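(* Let $N\in\mathbb N$ and let $(U_N^\times,S^{N-1}_\times)$ be any one of the $10$ pairs $$(O_N,S^{N-1}_{\mathbb R}),\ (O_N^*,S^{N-1}_{\mathbb R,*}),\ (O_N^+,S^{N-1}_{\mathbb R,+}),\ (\bar O_N^*,\bar S^{N-1}_{\mathbb R,*}),\ (\bar O_N,\bar S^{N-1}_{\mathbb R}),$$ $$(U_N,S^{N-1}_{\mathbb C}),\ (U_N^{**},S^{N-1}_{\mathbb C,**}),\ (U_N^+,S^{N-1}_{\mathbb C,+}),\ (\bar U_N^{**},\bar S^{N-1}_{\mathbb C,**}),\ (\bar U_N,\bar S^{N-1}_{\mathbb C}).$$ Denote by $z_1,\ldots,z_N$ the standard coordinates of $S^{N-1}_\times$ and by $u_{ij}$ those of $U_N^\times$. Then $U_N^\times$ is the biggest compact quantum group acting on $S^{N-1}_\times$ with the action leaving $\mathrm{span}(z_i)$ invariant. That is: $\Phi(z_i)=\sum_j u_{ij}\otimes z_j$ defines an action of $U_N^\times$ on $S^{N-1}_\times$; and whenever a compact quantum group $G$ acts on $S^{N-1}_\times$ with a coaction of the form $\Psi(z_i)=\sum_j w_{ij}\otimes z_j$, $w_{ij}\in C(G)$, there is a unital $*$-homomorphism $C(U_N^\times)\to C(G)$, compatible with the comultiplications, mapping $u_{ij}\mapsto w_{ij}$.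
   Context: Noncommutative compact spaces are the objects of the category of unital $C^*$-algebras with arrows reversed; $C(X)$ is the algebra of $X$. Spheres. All algebras are universal $C^*$-algebras. $C(S^{N-1}_{\mathbb R,+})$ is generated by $z_1,\ldots,z_N$ with $z_i=z_i^*$, $\sum_i z_i^2=1$. $C(S^{N-1}_{\mathbb C,+})$ is generated by $z_1,\ldots,z_N$ with $\sum_i z_iz_i^*=\sum_i z_i^*z_i=1$. The other spheres are given by quotients of $C(S^{N-1}_{\mathbb R,+})$ (real case) or $C(S^{N-1}_{\mathbb C,+})$ (complex case), by the following relations, where $\alpha\in\{a,a^*\},\beta\in\{b,b^*\},\gamma\in\{c,c^*\}$ and $a,b,c\in\{z_i\}$: - $S^{N-1}_{\mathbb R},S^{N-1}_{\mathbb C}$: $\alpha\beta=\beta\alpha$ for all $a,b$. - $\bar S^{N-1}_{\mathbb R},\bar S^{N-1}_{\mathbb C}$: $\alpha\beta=-\beta\alpha$ for $a,b$ distinct, $\alpha\beta=\beta\alpha$ otherwise. - $S^{N-1}_{\mathbb R,*},S^{N-1}_{\mathbb C,**}$: $\alpha\beta\gamma=\gamma\beta\alpha$ for all $a,b,c$. - $\bar S^{N-1}_{\mathbb R,*},\bar S^{N-1}_{\mathbb C,**}$: $\alpha\beta\gamma=-\gamma\beta\alpha$ for $a,b,c$ distinct, $\alpha\beta\gamma=\gamma\beta\alpha$ otherwise. Quantum groups. $C(O_N^+)$ is the universal $C^*$-algebra generated by $(u_{ij})_{i,j=1,\ldots,N}$ with $u_{ij}=u_{ij}^*$, $u^t=u^{-1}$;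 $C(U_N^+)$ is the one with $u^*=u^{-1}$, $u^t=\bar u^{-1}$. Both have $\Delta(u_{ij})=\sum_k u_{ik}\otimes u_{kj}$, $\varepsilon(u_{ij})=\delta_{ij}$, $S(u_{ij})=u_{ji}^*$. The others are quantum subgroups, given by quotients of $C(O_N^+)$ (real case) or $C(U_N^+)$ (complex case), by the following relations, where now $a,b,c\in\{u_{ij}\}$ and $\alpha\in\{a,a^*\},\beta\in\{b,b^*\},\gamma\in\{c,c^*\}$: - $O_N,U_N$: $\alpha\beta=\beta\alpha$. - $\bar O_N,\bar U_N$: $\alpha\beta=-\beta\alpha$ for $a,b$ distinct on the same row or the same column of $u$, $\alpha\beta=\beta\alpha$ otherwise. - $O_N^*,U_N^{**}$: $\alpha\beta\gamma=\gamma\beta\alpha$. - $\bar O_N^*,\bar U_N^{**}$: $\alpha\beta\gamma=-\gamma\beta\alpha$ if $\mathrm{span}(a,b,c)=(\le 2,3)$ or $(3,\le 2)$, $\alpha\beta\gamma=\gamma\beta\alpha$ otherwise, where $\mathrm{span}(a,b,c)=(r,s)$ with $r$ (resp. $s$) the number of distinct rows (resp. columns) of $u$ occupied by $a,b,c$. Actions. An action of a compact quantum group $G$ on $X$ is a morphism of $C^*$-algebras (coaction) $\Phi:C(X)\to C(G)\otimes C(X)$ with $(id\otimes\Phi)\Phi=(\Delta\otimes id)\Phi$, $(\varepsilon\otimes id)\Phi=id$, and $(\mathrm{Im}\,\Phi)(C(G)\otimes 1)$ dense in $C(G)\otimes C(X)$. The action leaves $\mathrm{span}(z_i)$ invariant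 when $\Phi(z_i)=\sum_j w_{ij}\otimes z_j$ for some $w_{ij}\in C(G)$. *)

(* Defs.v *)
From HB Require Import structures.
From mathcomp Require Import all_boot all_order all_algebra.
From mathcomp Require Import complex.
From mathcomp Require Import all_classical all_reals all_analysis.

Set Implicit Arguments.
Unset Strict Implicit.
Unset Printing Implicit Defensive.

Import Order.TTheory GRing.Theory Num.Theory.
Import numFieldNormedType.Exports.

Local Open Scope classical_set_scope.
Local Open Scope ring_scope.
Local Open Scope complex_scope.

(* The ring operations are part of the mixin, and the ring
   structure is derived from it below, because the hierarchy has no common
   extension of rings and normed modules besides number domains.  The zero
   algebra (the algebra of the empty space) is allowed. *)
HB.mixin Record isCStarAlgebra (R : realType) A
    of CompleteNormedModule R[i] A := {
  cstar_one : A;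
  cstar_mul : A -> A -> A;
  star : A -> A;
  cstar_mulA : associative cstar_mul;
  cstar_mul1r : left_id cstar_one cstar_mul;
  cstar_mulr1 : right_id cstar_one cstar_mul;
  cstar_mulDl : left_distributive cstar_mul +%R;
  cstar_mulDr : right_distributive cstar_mul +%R;
  cstar_scalerAl : forall (k : R[i]) x y,
    k *: cstar_mul x y = cstar_mul (k *: x) y;
  cstar_scalerAr : forall (k : R[i]) x y,
    k *: cstar_mul x y = cstar_mul x (k *: y);
  starK : involutive star;
  starD : {morph star : x y / x + y};
  starZ : forall (k : R[i]) x, star (k *: x) = k^* *: star x;
  starM : forall x y, star (cstar_mul x y) = cstar_mul (star y) (star x);
  cstar_normM : forall x y, `|cstar_mul x y| <= `|x| * `|y|;
  cstar_norm : forall x, `|cstar_mul (star x) x| = `|x| ^+ 2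
}.

#[short(type="cstarAlgType")]
HB.structure Definition CStarAlgebra (R : realType) :=
  {A of CompleteNormedModule R[i] A & isCStarAlgebra R A}.

HB.instance Definition _ (R : realType) (A : cstarAlgType R) :=
  GRing.Zmodule_isPzRing.Build (CStarAlgebra.sort A)
    (@cstar_mulA R A) (@cstar_mul1r R A) (@cstar_mulr1 R A)
    (@cstar_mulDl R A) (@cstar_mulDr R A).

Definition is_starhom (R : realType) (A B : cstarAlgType R) (f : A -> B) :=
  [/\ linear f, monoid_morphism f & {morph f : x / star x}].

Definition is_character (R : realType) (A : cstarAlgType R) (f : A -> R[i]) :=
  [/\ scalar f, monoid_morphism f & forall x, f (star x) = (f x)^*].

Record hilbertSpace (R : realType) := HilbertSpace {
  hilbert_sort :> completeNormedModType R[i];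
  hdot : {dot hilbert_sort for Num.conj};
  hdotE : forall x, hdot x x = `|x| ^+ 2
}.

Record representation (R : realType) (A : cstarAlgType R) := Representation {
  rep_space : hilbertSpace R;
  rep_act :> A -> rep_space -> rep_space;
  rep_linear : forall a, linear (rep_act a);
  rep_linearl : forall x, linear (rep_act^~ x);
  rep1 : forall x, rep_act 1 x = x;
  repM : forall a b x, rep_act (a * b) x = rep_act a (rep_act b x);
  rep_star : forall a x y,
    hdot rep_space (rep_act a x) y = hdot rep_space x (rep_act (star a) y)
}.

(* Sequences of pairs stand for the elements \sum_p p.1 (x) p.2 of an algebraic
   tensor product.  This is the squared norm of such an element of H (x) K. *)
Definition tensor_sqnorm (R : realType) (H K : hilbertSpace R)
    (s : seq (H * K)) : R[i] :=
  \sum_(p <- s) \sum_(q <- s) hdot H p.1 q.1 * hdot K p.2 q.2.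

(* The action of the operator (pi (x) rho)(t) on the vector s. *)
Definition tensor_act (R : realType) (A B : cstarAlgType R)
    (pi : representation A) (rho : representation B)
    (t : seq (A * B)) (s : seq (rep_space pi * rep_space rho)) :=
  [seq (pi x.1 p.1, rho x.2 p.2) | x <- t, p <- s].

Definition span2 (R : realType) (S S' : Type) (T : cstarAlgType R)
    (m : S -> S' -> T) : set T :=
  [set y | exists s : seq (S * S'), y = \sum_(p <- s) m p.1 p.2].

(* T is the completion of the algebraic tensor product of A and B for the
   spatial C*-norm sup_(pi, rho) |(pi (x) rho)(t)|, with a (x) b = l a * r b.
   The injectivity clause says that T contains the algebraic tensor product:
   an element of the latter is 0 as soon as all bilinear forms vanish on it. *)
Record is_spatial_tensor (R : realType) (A B T : cstarAlgType R)
    (l : A -> T) (r : B -> T) : Prop := IsSpatialTensor {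
  spatial_l : is_starhom l;
  spatial_r : is_starhom r;
  spatial_comm : forall a b, l a * r b = r b * l a;
  spatial_dense : dense (span2 (fun a b => l a * r b));
  spatial_inj : forall t : seq (A * B), \sum_(p <- t) l p.1 * r p.2 = 0 ->
    forall beta : {bilinear A -> B -> R[i] | *%R & *%R},
      \sum_(p <- t) beta p.1 p.2 = 0;
  spatial_norm : forall (t : seq (A * B)) (c : R[i]), 0 <= c ->
    (`|\sum_(p <- t) l p.1 * r p.2| <= c <->
     forall (pi : representation A) (rho : representation B)
            (s : seq (rep_space pi * rep_space rho)),
       tensor_sqnorm (tensor_act t s) <= c ^+ 2 * tensor_sqnorm s)
}.

(* A choice, for all A and B, of a model of their spatial tensor product. *)
Record spatialTensor (R : realType) := SpatialTensor {
  tens :> cstarAlgType R -> cstarAlgType R -> cstarAlgType R;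
  tinl : forall A B : cstarAlgType R, A -> tens A B;
  tinr : forall A B : cstarAlgType R, B -> tens A B;
  tensP : forall A B, is_spatial_tensor (@tinl A B) (@tinr A B)
}.

Section Tensor.
Variables (R : realType) (ten : spatialTensor R).
Implicit Types A B D X : cstarAlgType R.

Definition tprod A B (a : A) (b : B) : ten A B := tinl ten B a * tinr ten A b.

(* The unital *-homomorphism a (x) b |-> f a * g b (it is unique if it exists;
   the value is unspecified otherwise). *)
Definition tlift A B D (f : A -> D) (g : B -> D) : ten A B -> D :=
  get [set h : ten A B -> D |
        is_starhom h /\ forall a b, h (tprod a b) = f a * g b].

Definition tmap A A' B B' (f : A -> A') (g : B -> B') : ten A B -> ten A' B' :=
  tlift (fun a => tinl ten B' (f a)) (fun b => tinr ten A' (g b)).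

Definition tassoc A B D : ten (ten A B) D -> ten A (ten B D) :=
  tlift (tmap id (tinl ten D)) (fun d => tinr ten A (tinr ten B d)).

Definition scalar_map A D (f : A -> R[i]) : A -> D := fun a => f a *: (1 : D).

(* In Woronowicz's sense, with a counit which is bounded on C(G). *)
Record is_cqg A (Delta : A -> ten A A) (eps : A -> R[i]) : Prop := IsCQG {
  cqg_hom : is_starhom Delta;
  cqg_coassoc : forall a,
    tmap id Delta (Delta a) = tassoc (tmap Delta id (Delta a));
  cqg_eps : is_character eps;
  cqg_counitl : forall a, tlift (scalar_map A eps) id (Delta a) = a;
  cqg_counitr : forall a, tlift id (scalar_map A eps) (Delta a) = a;
  cqg_cancell : dense (span2 (fun x a : A => Delta x * tprod a 1));
  cqg_cancelr : dense (span2 (fun x a : A => Delta x * tprod 1 a))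
}.

Record is_action A (Delta : A -> ten A A) (eps : A -> R[i])
    X (Phi : X -> ten A X) : Prop := IsAction {
  action_hom : is_starhom Phi;
  action_coassoc : forall x,
    tmap id Phi (Phi x) = tassoc (tmap Delta id (Phi x));
  action_counit : forall x, tlift (scalar_map X eps) id (Phi x) = x;
  action_dense : dense (span2 (fun (x : X) (a : A) => Phi x * tprod a 1))
}.

End Tensor.

Definition is_universal (R : realType) (I : Type)
    (rel : forall A : cstarAlgType R, (I -> A) -> Prop)
    (A : cstarAlgType R) (v : I -> A) : Prop :=
  rel A v /\ forall (B : cstarAlgType R) (w : I -> B), rel B w ->
    exists! f : A -> B, is_starhom f /\ forall i, f (v i) = w i.

Variant scalars := RealCase | ComplexCase.

Variant liberation :=
  | Classical | HalfLiberated | Free | TwistedHalfLiberated | Twisted.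

Section Relations.
Variables (R : realType) (A : cstarAlgType R).

Definition adj (s : bool) (x : A) : A := if s then star x else x.

(* al * be = (-1)^e(a,b) be * al, for al in {a, a^*} and be in {b, b^*}. *)
Definition comm2 (I : Type) (v : I -> A) (e : I -> I -> bool) :=
  forall i j s t, adj s (v i) * adj t (v j) =
    (-1) ^+ e i j * (adj t (v j) * adj s (v i)).

Definition comm3 (I : Type) (v : I -> A) (e : I -> I -> I -> bool) :=
  forall i j k s t r, adj s (v i) * adj t (v j) * adj r (v k) =
    (-1) ^+ e i j k * (adj r (v k) * adj t (v j) * adj s (v i)).

Variable N : nat.

Definition sphere_rel (K : scalars) (L : liberation) (z : 'I_N -> A) : Prop :=
  match K with
  | RealCase => (forall i, z i = star (z i)) /\ \sum_i z i ^+ 2 = 1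
  | ComplexCase =>
      \sum_i z i * star (z i) = 1 /\ \sum_i star (z i) * z i = 1
  end /\
  match L with
  | Classical => comm2 z (fun _ _ => false)
  | HalfLiberated => comm3 z (fun _ _ _ => false)
  | Free => True
  | TwistedHalfLiberated => comm3 z (fun i j k => uniq [:: i; j; k])
  | Twisted => comm2 z (fun i j => i != j)
  end.

Definition same_line (a b : 'I_N * 'I_N) : bool :=
  (a != b) && ((a.1 == b.1) || (a.2 == b.2)).

(* span(a, b, c) is of the form (<= 2, 3) or (3, <= 2). *)
Definition mixed_span (a b c : 'I_N * 'I_N) : bool :=
  let r := size (undup [:: a.1; b.1; c.1]) in
  let s := size (undup [:: a.2; b.2; c.2]) in
  ((r <= 2) && (s == 3) || (r == 3) && (s <= 2))%N.

Definition qgroup_rel (K : scalars) (L : liberation)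
    (v : 'I_N * 'I_N -> A) : Prop :=
  let u : 'M[A]_N := \matrix_(i, j) v (i, j) in
  let ubar : 'M[A]_N := map_mx star u in
  match K with
  | RealCase =>
      [/\ forall a, v a = star (v a), u^T *m u = 1%:M & u *m u^T = 1%:M]
  | ComplexCase =>
      [/\ ubar^T *m u = 1%:M, u *m ubar^T = 1%:M,
          u^T *m ubar = 1%:M & ubar *m u^T = 1%:M]
  end /\
  match L with
  | Classical => comm2 v (fun _ _ => false)
  | HalfLiberated => comm3 v (fun _ _ _ => false)
  | Free => True
  | TwistedHalfLiberated => comm3 v mixed_span
  | Twisted => comm2 v same_line
  end.

End Relations.

(* Main.v *)
(** Comparing coefficients in the images under [Psi] of the sphere relations is
    possible because the monomials of degree at most 3 in the coordinates satisfy no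
    linear relation beyond the evident ones; this is tested on Clifford-type matrix models,
    after polarization over the unit sphere.  The outcome is that the commutation defect
    [Y_(I, L) = X_(I, L) - s_I s_L X_(rev I, rev L)] of the monomials [X_(I, L)] in the
    [w_ij] is antisymmetric in [L]; if [w] and its transpose are unitary then
    [\sum Y Y^* = 0], so [Y = 0].

    It remains to see that [w] is biunitary.  Outside the real (twisted) classical case
    the monomials [z_i^* z_j] are independent up to [\sum z_i^* z_i = 1], which gives
    [w^* w = 1]; then [q = 1 - w w^*] is a projection with zero trace, hence [q = 0].
    In the real (twisted) classical case only the symmetrization of this relation is
    available.  There is no antipode on [C(G)]; instead the Haar state [h] provides scalar
    matrices [P = h(w w^t)] and [Q = h(w^t w)] with [w P w^t = P], [w^t Q w = Q], whence
    [Q P w^t = w^t Q P].  In the untwisted case this and the symmetrization give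
    [w w^t = 1].  In the twisted case one must first exclude that some diagonal entry
    of [P] vanishes, which is where the density condition in the definition of an
    action is needed: reflecting the generators of a Clifford model would not be
    detected by [(A (x) 1) Psi(C(S))].

    Morphisms out of spatial tensor products ([Delta], [Phi], the compatibility of [f] with
    the comultiplications) exist because product functionals separate points: the
    closure of the graph on elementary tensors is again a graph, over which the first
    projection is an injective, hence isometric, *-homomorphism. *)

Require Import Defs.
From HB Require Import structures.
From mathcomp Require Import all_boot all_order all_algebra.
From mathcomp Require Import complex.
From mathcomp Require Import all_classical all_reals all_analysis.
From mathcomp Require Import ring lra zify.

Set Implicit Arguments.
Unset Strict Implicit.
Unset Printing Implicit Defensive.

Import Order.TTheory GRing.Theory Num.Theory.
Import numFieldNormedType.Exports.

Local Open Scope complex_scope.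
Local Open Scope ring_scope.

(** * Complex scalars, norms and limits *)

(** Two obstacles shape the proof. First, positivity is never read off spectra: for self-adjoint
    [h], the bound [|h| <= 1] amounts to a commuting self-adjoint [k] with [h^2 + k^2 = 1], an
    algebraic condition that unital *-homomorphisms preserve, and square roots come from a
    convergent iteration. Nor are representations constructed: [A] embeds in [ten A A], whose norm
    is by definition a supremum over representations, and this already provides norming ones.

    Second, the Haar state need not be faithful, so a row [i] of [w] with [P_ii = 0] is a priori
    null only for [h]. In the twisted case [P + P^t = 2 D] with [D] diagonal and [Q] is symmetric,
    so [w] commutes with [D Q]; null rows are exactly what keeps [D Q] from being invertible. They
    would give a left ideal, stable under right multiplication by the coefficients, on which [h]
    vanishes and modulo which a reflection of the sphere is invisible. Once they are excluded, [D]
    and its inverse both have trace [N], which forces [D = 1]. *)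

Section ComplexNumbers.
Variable R : realType.
Local Notation C := R[i].
Implicit Types (z w : C) (r s : R).

Lemma ge0_complexE z : 0 <= z -> z = (complex.Re z)%:C.
Proof. by case: z => a b; rewrite lecE /= => /andP[/eqP -> _]. Qed.

Lemma Re_ge0 z : 0 <= z -> 0 <= complex.Re z.
Proof. by case: z => a b; rewrite lecE /= => /andP[_]. Qed.

Lemma real_complexD r s : (r + s)%:C = r%:C + s%:C :> C.
Proof. exact: rmorphD. Qed.

Lemma real_complexM r s : (r * s)%:C = r%:C * s%:C :> C.
Proof. exact: rmorphM. Qed.

Lemma real_complexX r n : (r ^+ n)%:C = r%:C ^+ n :> C.
Proof. exact: rmorphXn. Qed.

Lemma real_complex_inj : injective (fun r => r%:C : C).
Proof. by move=> r s []. Qed.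

Lemma ReD z w : complex.Re (z + w) = complex.Re z + complex.Re w.
Proof. by case: z w => [a b] [c d]. Qed.

Lemma ler0c r : (0 <= r%:C :> C) = (0 <= r).
Proof. by rewrite -[0 : C]/((0 : R)%:C) lecR. Qed.

Lemma ltr0c r : (0 < r%:C :> C) = (0 < r).
Proof. by rewrite !lt_def ler0c -[0 : C]/((0 : R)%:C) (inj_eq real_complex_inj). Qed.

Lemma conjcM z w : (z * w)^* = z^* * w^*.
Proof. exact: rmorphM. Qed.

Lemma conjcD z w : (z + w)^* = z^* + w^*.
Proof. exact: rmorphD. Qed.

Lemma conjcN z : (- z)^* = - z^*.
Proof. exact: rmorphN. Qed.

Lemma conjc_sum (I : Type) (r : seq I) (P : pred I) (F : I -> C) :
  (\sum_(i <- r | P i) F i)^* = \sum_(i <- r | P i) (F i)^*.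
Proof. exact: rmorph_sum. Qed.

Lemma mulcJ_ge0 z : 0 <= z * z^*.
Proof. exact: mul_conjC_ge0. Qed.

Lemma mulcJ z : z * z^* = `|z| ^+ 2.
Proof. by rewrite normCK. Qed.

Lemma conjr (r : R) : (r%:C)^* = r%:C :> C.
Proof. exact: conjc_real. Qed.

Lemma iK : 'i%C * 'i%C = -1 :> C.
Proof. by rewrite -expr2 sqr_i. Qed.

Lemma conj_i : ('i%C)^* = - 'i%C :> C.
Proof. by apply/eqP; rewrite eq_complex /= oppr0 !eqxx. Qed.

Section Norm.
Variable V : normedModType C.
Implicit Types x y : V.

Definition nm x : R := complex.Re `|x|.

Lemma nmE x : `|x| = (nm x)%:C.
Proof. by apply: ge0_complexE; rewrite normr_ge0. Qed.

Lemma nm_le x r : (`|x| <= r%:C) = (nm x <= r).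
Proof. by rewrite nmE lecR. Qed.

Lemma nm_ge0 x : 0 <= nm x.
Proof. exact: Re_ge0. Qed.

Lemma nm0 : nm 0 = 0.
Proof. by rewrite /nm normr0. Qed.

Lemma nm_eq0 x : nm x = 0 -> x = 0.
Proof. by move=> x0; apply/eqP; rewrite -normr_eq0 nmE x0. Qed.

Lemma nm_le0 x : nm x <= 0 -> x = 0.
Proof. by move=> x0; apply: nm_eq0; apply/eqP; rewrite eq_le x0 nm_ge0. Qed.

Lemma nmN x : nm (- x) = nm x.
Proof. by rewrite /nm normrN. Qed.

Lemma nmB x y : nm (x - y) = nm (y - x).
Proof. by rewrite /nm distrC. Qed.

Lemma nmD x y : nm (x + y) <= nm x + nm y.
Proof. by rewrite -nm_le real_complexD -!nmE ler_normD. Qed.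

Lemma nm_tri (v x y : V) : nm (x - y) <= nm (x - v) + nm (v - y).
Proof. by rewrite -[x - y](subrKA v) nmD. Qed.

End Norm.

Definition cabs z : R := complex.Re `|z|.

Lemma cabsE z : `|z| = (cabs z)%:C.
Proof. by apply: ge0_complexE; rewrite normr_ge0. Qed.

Lemma cabs_ge0 z : 0 <= cabs z. Proof. exact: Re_ge0. Qed.

Lemma cabs0 : cabs 0 = 0. Proof. by rewrite /cabs normr0. Qed.

Lemma cabs1 : cabs 1 = 1. Proof. by rewrite /cabs normr1. Qed.

Lemma cabs_le0 z : cabs z <= 0 -> z = 0.
Proof.
move=> z0; apply/eqP; rewrite -normr_eq0 cabsE.
by have/eqP -> : cabs z == 0 by rewrite eq_le z0 cabs_ge0.
Qed.

Lemma cabsM z w : cabs (z * w) = cabs z * cabs w.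
Proof. by apply: real_complex_inj; rewrite real_complexM -!cabsE normrM. Qed.

Lemma cabsD z w : cabs (z + w) <= cabs z + cabs w.
Proof. by rewrite -lecR real_complexD -!cabsE ler_normD. Qed.

Lemma cabsN z : cabs (- z) = cabs z.
Proof. by rewrite /cabs normrN. Qed.

Lemma cabsJ z : cabs (z^*) = cabs z.
Proof. by rewrite /cabs norm_conjC. Qed.

Lemma cabs_real r : cabs (r%:C) = `|r|.
Proof. by rewrite /cabs normc_def /= expr0n addr0 sqrtr_sqr. Qed.

Lemma cabs_i : cabs 'i%C = 1.
Proof. by rewrite /cabs normc_def /= expr0n add0r expr1n sqrtr1. Qed.

Lemma cabs_sum (I : Type) (r : seq I) (P : pred I) (F : I -> C) :
  cabs (\sum_(i <- r | P i) F i) <= \sum_(i <- r | P i) cabs (F i).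
Proof.
elim/big_ind2: _ => [|x r1 y r2 h1 h2|//]; first by rewrite cabs0.
by apply: (le_trans (cabsD _ _)); rewrite lerD.
Qed.

Lemma mulcJ_cabs z : z * z^* = (cabs z ^+ 2)%:C.
Proof. by rewrite mulcJ cabsE real_complexX. Qed.

Lemma cabs_Re z : `|complex.Re z| <= cabs z.
Proof.
by rewrite /cabs normc_def /= -[X in X <= _]sqrtr_sqr ler_wsqrtr // lerDl sqr_ge0.
Qed.

Lemma cabs_Im z : `|complex.Im z| <= cabs z.
Proof.
by rewrite /cabs normc_def /= -[X in X <= _]sqrtr_sqr ler_wsqrtr // lerDr sqr_ge0.
Qed.

Lemma cabs_ReIm z : cabs z <= `|complex.Re z| + `|complex.Im z|.
Proof.
have {1}-> : z = (complex.Re z)%:C + 'i%C * (complex.Im z)%:C.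
  by case: z => a b /=; apply/eqP; rewrite eq_complex /= !(mul0r, mulr0, mul1r, subr0, addr0, add0r) !eqxx.
by apply: (le_trans (cabsD _ _)); rewrite cabsM cabs_i mul1r !cabs_real.
Qed.

Lemma nmZ (V : normedModType C) (k : C) (x : V) : nm (k *: x) = cabs k * nm x.
Proof. by apply: real_complex_inj; rewrite real_complexM -nmE -cabsE -nmE normrZ. Qed.

End ComplexNumbers.

(** * Sequential limits, completeness and density in normed modules *)

Section Limits.
Variable R : realType.
Local Notation C := R[i].

Definition seq_lim (V : normedModType C) (u : nat -> V) (l : V) :=
  forall e : R, 0 < e -> exists n0, forall n, (n0 <= n)%N -> nm (u n - l) < e.

Definition seq_cauchy (V : normedModType C) (u : nat -> V) :=
  forall e : R, 0 < e -> exists n0, forall m n, (n0 <= m)%N -> (n0 <= n)%N ->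
    nm (u m - u n) < e.

Lemma le_eps (a b : R) : (forall e, 0 < e -> a <= b + e) -> a <= b.
Proof. by move=> h; apply/ler_addgt0Pr. Qed.

Lemma pos_complex (e : C) : 0 < e -> 0 < complex.Re e /\ e = (complex.Re e)%:C.
Proof.
move=> e0; have eE := ge0_complexE (ltW e0); split=> //.
by rewrite -ltr0c -eE.
Qed.

Lemma nm_lt (V : normedModType C) (x : V) (r : R) : (`|x| < r%:C) = (nm x < r).
Proof. by rewrite nmE ltcR. Qed.

(** Choose [x n] whose ball of radius [1/(n+1)] belongs to the filter; two such balls meet, so the
    centres form a Cauchy sequence, and its limit is the limit of the filter. Completeness of the
    algebras built below is checked on sequences in this way. *)
Lemma complete_of_seq (V : normedModType C) :
  (forall u : nat -> V, seq_cauchy u -> exists l, seq_lim u l) ->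
  forall F : set_system V, ProperFilter F -> cauchy F -> cvg F.
Proof.
move=> hV F FF /cauchyP Fc.
have hn (n : nat) : exists x : V, F (ball x ((n.+1%:R^-1 : R)%:C)).
  by apply: Fc; rewrite ltr0c invr_gt0 ltr0n.
have [x hx] := choice hn.
have hxB (m n : nat) : nm (x m - x n) < m.+1%:R^-1 + n.+1%:R^-1.
  have [y [h1 h2]] := filter_ex (filterI (hx m) (hx n)).
  move: h1 h2; rewrite -!ball_normE /ball_ /= !nm_lt => h1 h2.
  by apply: (le_lt_trans (nm_tri y _ _)); rewrite ltrD // nmB.
have inv_lt (e : R) : 0 < e -> exists n0, forall n : nat, (n0 <= n)%N -> n.+1%:R^-1 < e.
  move=> e0; exists (Num.truncn e^-1).+1 => n le_n.
  rewrite -[ltRHS]invrK ltf_pV2 ?posrE ?invr_gt0 ?ltr0n //.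
  apply: (lt_le_trans (truncnS_gt _)); rewrite ler_nat.
  by apply: leq_trans le_n _.
have [l hl] : exists l, seq_lim x l.
  apply: hV => e e0; have [n0 hn0] := inv_lt (e / 2) (divr_gt0 e0 (ltr0Sn _ _)).
  exists n0 => m n le_m le_n; apply: (lt_trans (hxB m n)).
  by rewrite [e]splitr ltrD ?hn0.
apply/cvg_ex; exists l; apply/cvgrPdist_lt => e /pos_complex[e0 ->].
have e20 : 0 < complex.Re e / 2 by rewrite divr_gt0.
have [n0 hn0] := inv_lt _ e20; have [n1 hn1] := hl _ e20.
pose n := maxn n0 n1.
apply: filterS (hx n) => y; rewrite -ball_normE /ball_ /= !nm_lt => hy.
apply: (le_lt_trans (nm_tri (x n) _ _)); rewrite [ltRHS]splitr ltrD //.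
  by rewrite nmB hn1 // leq_maxr.
by apply: (lt_trans hy); rewrite hn0 // leq_maxl.
Qed.

Lemma seq_complete (V : completeNormedModType C) (u : nat -> V) :
  seq_cauchy u -> exists l, seq_lim u l.
Proof.
move=> uc; have cu : cauchy (u @ \oo)%classic.
  apply/cauchyP => e /pos_complex[e0 ->]; have [n0 hn0] := uc _ e0.
  exists (u n0); exists n0 => // n /= hn.
  by rewrite -ball_normE /ball_ /= nm_lt hn0.
have /cvg_ex[l /cvgrPdist_lt hl] : cvg (u @ \oo)%classic by exact: cauchy_cvg.
exists l => e e0; have [|n0 _ hn0] := hl (e%:C); first by rewrite ltr0c.
by exists n0 => n hn; have := hn0 n hn; rewrite /= nm_lt nmB.
Qed.

Section Basic.
Variable V : normedModType C.
Implicit Types (u v : nat -> V) (l m : V).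

Lemma seq_lim_unique u l m : seq_lim u l -> seq_lim u m -> l = m.
Proof.
move=> ul um; apply/eqP; rewrite -subr_eq0; apply/eqP/nm_le0/le_eps => e e0.
have e20 : 0 < e / 2 by rewrite divr_gt0.
have [n0 h0] := ul _ e20; have [n1 h1] := um _ e20; rewrite add0r.
pose n := maxn n0 n1.
apply: (le_trans (nm_tri (u n) _ _)); rewrite [leRHS]splitr lerD //.
  by rewrite nmB ltW // h0 // leq_maxl.
by rewrite ltW // h1 // leq_maxr.
Qed.

Lemma seq_lim_cst l : seq_lim (fun=> l) l.
Proof. by move=> e e0; exists 0%N => n _; rewrite subrr nm0. Qed.

Lemma seq_lim_bound (W : normedModType C) (u : nat -> V) (l : V)
    (v : nat -> W) (m : W) (k : R) :
  (forall n, nm (v n - m) <= k * nm (u n - l)) -> seq_lim u l -> seq_lim v m.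
Proof.
move=> h ul e e0; have k0 : 0 < `|k| + 1 by rewrite ltr_wpDl.
have [n0 hn0] := ul (e / (`|k| + 1)) (divr_gt0 e0 k0).
exists n0 => n hn; apply: (le_lt_trans (h n)).
apply: (@le_lt_trans _ _ ((`|k| + 1) * nm (u n - l))).
  by rewrite ler_wpM2r ?nm_ge0 // (le_trans (ler_norm k)) // lerDl.
by rewrite mulrC -ltr_pdivlMr // hn0.
Qed.

Lemma seq_limD u v l m : seq_lim u l -> seq_lim v m ->
  seq_lim (fun n => u n + v n) (l + m).
Proof.
move=> ul vm e e0; have e20 : 0 < e / 2 by rewrite divr_gt0.
have [n0 h0] := ul _ e20; have [n1 h1] := vm _ e20.
exists (maxn n0 n1) => n; rewrite geq_max => /andP[a b].
rewrite opprD addrACA (le_lt_trans (nmD _ _)) // [ltRHS]splitr ltrD ?h0 ?h1 //.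
Qed.

Lemma seq_limZ u l (k : C) : seq_lim u l -> seq_lim (fun n => k *: u n) (k *: l).
Proof.
by apply: (@seq_lim_bound _ _ _ _ _ (cabs k)) => n; rewrite -scalerBr nmZ.
Qed.

Lemma seq_lim_shift u l : seq_lim u l -> seq_lim (fun n => u n.+1) l.
Proof.
by move=> ul e e0; have [n0 h] := ul e e0; exists n0 => n hn; apply/h/leqW.
Qed.

Lemma seq_lim_le u l (r : R) : seq_lim u l -> (forall n, nm (u n) <= r) -> nm l <= r.
Proof.
move=> ul ur; apply: le_eps => e e0; have [n0 h] := ul e e0.
rewrite -[l](subrK (u n0)) (le_trans (nmD _ _)) // addrC lerD //.
by rewrite nmB ltW // h.
Qed.

Lemma dense_nm (S : set V) : dense S <->
  forall x (e : R), 0 < e -> exists2 y, S y & nm (x - y) < e.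
Proof.
split=> [dS x e e0|h O [x Ox] oO].
  have [||y [yb Sy]] := dS (ball x (e%:C)).
  - by exists x; apply: ballxx; rewrite ltr0c.
  - exact: ball_open.
  by exists y => //; move: yb; rewrite -ball_normE /ball_ /= nm_lt.
have /nbhs_ballP[e /= /pos_complex[e0 eE] eO] : nbhs x O by apply: open_nbhs_nbhs.
have [y Sy ye] := h x _ e0; exists y; split=> //; apply: eO.
by rewrite eE -ball_normE /ball_ /= nm_lt.
Qed.

Lemma dense_seq (S : set V) : dense S -> forall x, exists u : nat -> V,
  (forall n, S (u n)) /\ seq_lim u x.
Proof.
move=> /dense_nm dS x.
have /choice[u hu] (n : nat) : exists y, S y /\ nm (x - y) < n.+1%:R^-1.
  have [|y] := dS x (n.+1%:R^-1); first by rewrite invr_gt0 ltr0n.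
  by exists y.
exists u; split=> [n|e e0]; first by case: (hu n).
exists (Num.truncn e^-1).+1 => n hn; rewrite nmB.
apply: (lt_trans (hu n).2).
rewrite -[ltRHS]invrK ltf_pV2 ?posrE ?invr_gt0 ?ltr0n //.
apply: (lt_le_trans (truncnS_gt _)); rewrite ler_nat.
by apply: leq_trans hn _.
Qed.

End Basic.
End Limits.

(** * Elementary C*-algebra theory *)

Section CStar.
Variable R : realType.
Local Notation C := R[i].

Section Elementary.
Variable A : cstarAlgType R.
Implicit Types (x y a b h k : A) (c d : C).

Lemma scaleAl c x y : c *: (x * y) = (c *: x) * y.
Proof. exact: cstar_scalerAl. Qed.

Lemma scaleAr c x y : c *: (x * y) = x * (c *: y).
Proof. exact: cstar_scalerAr. Qed.

Lemma starZc c x : star (c *: x) = (c^*) *: star x.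
Proof. exact: starZ. Qed.

Lemma starMr x y : star (x * y) = star y * star x.
Proof. exact: starM. Qed.

Lemma star0 : star (0 : A) = 0.
Proof. by apply: (addrI (star 0)); rewrite -starD !addr0. Qed.

Lemma starN x : star (- x) = - star x.
Proof. by apply/eqP; rewrite -addr_eq0 -starD addNr star0. Qed.

Lemma starB x y : star (x - y) = star x - star y.
Proof. by rewrite starD starN. Qed.

Lemma star_sum (I : Type) (r : seq I) (P : pred I) (F : I -> A) :
  star (\sum_(i <- r | P i) F i) = \sum_(i <- r | P i) star (F i).
Proof. exact: (big_morph _ (@starD R A) star0). Qed.

Lemma star1 : star (1 : A) = 1.
Proof. by rewrite -[LHS]mul1r -{1}[1]starK -starMr mul1r starK. Qed.

Lemma nmM x y : nm (x * y) <= nm x * nm y.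
Proof. by rewrite -lecR real_complexM -!nmE; exact: cstar_normM. Qed.

Lemma nm_starM x : nm (star x * x) = nm x ^+ 2.
Proof. by apply: real_complex_inj; rewrite real_complexX -!nmE; exact: cstar_norm. Qed.

Lemma nm_star x : nm (star x) = nm x.
Proof.
have le y : nm y <= nm (star y).
  have [/nm_le0-> |y0] := leP (nm y) 0; first by rewrite star0.
  by rewrite -(ler_pM2r y0) -expr2 -nm_starM nmM.
by apply/eqP; rewrite eq_le le -{2}[x]starK le.
Qed.

Lemma nm1_le : nm (1 : A) <= 1.
Proof.
have := nm_starM 1; rewrite star1 mul1r expr2 => e.
have [|n0] := leP (nm (1 : A)) 0; first by move=> h; apply: le_trans h ler01.
by have /eqP := e; rewrite -{1}[nm (1 : A)]mul1r (inj_eq (mulIf (lt0r_neq0 n0))) => /eqP <-.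
Qed.

Lemma nm_sa2 h : star h = h -> nm (h * h) = nm h ^+ 2.
Proof. by move=> sh; rewrite -{1}sh nm_starM. Qed.

Lemma seq_limM (u v : nat -> A) x y : seq_lim u x -> seq_lim v y ->
  seq_lim (fun n => u n * v n) (x * y).
Proof.
move=> ux vy.
have hxv : seq_lim (fun n => x * v n) (x * y).
  by apply: (seq_lim_bound (k := nm x) _ vy) => n; rewrite -mulrBr nmM.
have huv : seq_lim (fun n => (u n - x) * v n) 0.
  have [n1 hn1] := vy 1 ltr01; have K0 : 0 < nm y + 1 by rewrite ltr_wpDl ?nm_ge0.
  move=> e e0; have [n0 hn0] := ux (e / (nm y + 1)) (divr_gt0 e0 K0).
  exists (maxn n0 n1) => n; rewrite geq_max => /andP[le0 le1]; rewrite subr0.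
  apply: (le_lt_trans (nmM _ _)).
  apply: (@le_lt_trans _ _ (nm (u n - x) * (nm y + 1))).
    rewrite ler_wpM2l ?nm_ge0 // -[v n](subrK y) (le_trans (nmD _ _)) //.
    by rewrite addrC lerD // ltW // hn1.
  by rewrite -ltr_pdivlMr // hn0.
have := seq_limD huv hxv; rewrite add0r.
by have -> : (fun n => (u n - x) * v n + x * v n) = fun n => u n * v n
  by apply/funext => n; rewrite -mulrDl subrK.
Qed.

Lemma seq_lim_star (u : nat -> A) x : seq_lim u x -> seq_lim (star \o u) (star x).
Proof. by apply: (seq_lim_bound (k := 1)) => n /=; rewrite -starB nm_star mul1r. Qed.

Definition halfc : C := 2^-1.

Lemma half2 x : halfc *: x + halfc *: x = x.
Proof. by rewrite -scalerDl /halfc -mulr2n -[_ *+ 2]mulr_natr mulVf ?pnatr_eq0 // scale1r. Qed.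

Lemma cabs_half : cabs halfc = 2^-1 :> R.
Proof.
have -> : halfc = (2^-1 : R)%:C by rewrite /halfc fmorphV rmorph_nat.
by rewrite cabs_real ger0_norm // invr_ge0.
Qed.

Lemma half_conj : halfc^* = halfc.
Proof.
have -> : halfc = (2^-1 : R)%:C by rewrite /halfc fmorphV rmorph_nat.
by rewrite conjr.
Qed.

(* Real and scalar-valued model of the Riesz-Nagy iteration for 1 - sqrt(1 - x). *)
Fixpoint sigma_it (n : nat) : R :=
  if n is n'.+1 then (1 + sigma_it n' ^+ 2) / 2 else 0.

Fixpoint sqrt_it (x : A) (n : nat) : A :=
  if n is n'.+1 then halfc *: (x + sqrt_it x n' * sqrt_it x n') else 0.

Lemma sigma_bound n : 0 <= sigma_it n <= 1.
Proof. by elim: n => [|n /andP[h1 h2]] /=; [rewrite lexx ler01|apply/andP; split; nra]. Qed.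

Lemma sigma_cauchy (e : R) : 0 < e ->
  exists n0, forall n, (n0 <= n)%N -> sigma_it n - sigma_it n0 < e.
Proof.
move=> e0; pose S := [set sigma_it n | n in @setT nat]%classic.
have hs : has_sup S.
  split; first by exists (sigma_it 0), 0%N.
  by exists 1 => _ [n _ <-]; case/andP: (sigma_bound n).
have [_ [n0 _ <-] hn0] := sup_adherent e0 hs.
exists n0 => n _; rewrite ltrBlDr -ltrBlDl (le_lt_trans _ hn0) // lerD2r.
by apply: (ub_le_sup hs.2); exists n.
Qed.

Section SqrtIteration.
Variable x : A.
Hypotheses (sx : star x = x) (x1 : nm x <= 1).
Local Notation s := (sqrt_it x).

Lemma sqrt_it_comm b : b * x = x * b -> forall n, b * s n = s n * b.
Proof.
move=> bx; elim=> [|n ih] /=; first by rewrite mulr0 mul0r.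
by rewrite -scaleAr -scaleAl mulrDr mulrDl bx mulrA ih -mulrA ih mulrA.
Qed.

Lemma sqrt_it_sa n : star (s n) = s n.
Proof. by elim: n => [|n ih] /=; rewrite ?star0 // starZc starD starMr ih sx half_conj. Qed.

Lemma sqrt_it_le n : nm (s n) <= sigma_it n.
Proof.
elim: n => [|n ih] /=; first by rewrite nm0.
rewrite nmZ cabs_half mulrC ler_wpM2r ?invr_ge0 // (le_trans (nmD _ _)) // lerD //.
by rewrite (le_trans (nmM _ _)) // expr2 ler_pM ?nm_ge0.
Qed.

(** [sigma_it] is the same iteration at the scalar [1]. The iterates commute, so each increment is
    half the product of the previous increment with the sum of two iterates; the scalar increments
    obey the same identity and therefore majorize. *)
Lemma sqrt_it_step n : nm (s n.+1 - s n) <= sigma_it n.+1 - sigma_it n.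
Proof.
elim: n => [|n ih].
  by rewrite subr0 subr0; exact: (sqrt_it_le 1).
have cm : s n * s n.+1 = s n.+1 * s n.
  apply: sqrt_it_comm; apply/esym; exact: sqrt_it_comm.
have e : s n.+2 - s n.+1 = halfc *: ((s n.+1 - s n) * (s n.+1 + s n)).
  rewrite [s n.+2]/= [X in _ - X]/= -scalerBr opprD addrACA subrr add0r.
  by rewrite mulrDr !mulrBl cm addrA subrK.
rewrite e nmZ cabs_half.
have es : sigma_it n.+2 - sigma_it n.+1 =
    2^-1 * ((sigma_it n.+1 - sigma_it n) * (sigma_it n.+1 + sigma_it n)).
  have -> : sigma_it n.+2 = (1 + sigma_it n.+1 ^+ 2) / 2 by [].
  have -> : sigma_it n.+1 = (1 + sigma_it n ^+ 2) / 2 by [].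
  by rewrite -[X in _ - X]/((1 + sigma_it n ^+ 2) / 2); field.
rewrite es ler_wpM2l ?invr_ge0 // (le_trans (nmM _ _)) // ler_pM ?nm_ge0 //.
by rewrite (le_trans (nmD _ _)) // lerD // sqrt_it_le.
Qed.

Lemma sqrt_it_dist m n : (m <= n)%N -> nm (s n - s m) <= sigma_it n - sigma_it m.
Proof.
move=> /subnK <-; elim: (n - m)%N => [|k ih]; first by rewrite !subrr nm0.
rewrite addSn -[sigma_it _ - _](subrKA (sigma_it (k + m))).
by apply: (le_trans (nm_tri (s (k + m)%N) _ _)); rewrite lerD // sqrt_it_step.
Qed.

Lemma sqrt_it_lim : exists l, seq_lim s l.
Proof.
apply: seq_complete => e e0; have [n0 h] := sigma_cauchy (divr_gt0 e0 (ltr0Sn R 1)).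
exists n0 => m n hm hn; apply: (le_lt_trans (nm_tri (s n0) _ _)).
rewrite [ltRHS]splitr ltrD //.
  exact: (le_lt_trans (sqrt_it_dist hm) (h m hm)).
by rewrite nmB; exact: (le_lt_trans (sqrt_it_dist hn) (h n hn)).
Qed.

End SqrtIteration.

(** The limit [l] of the iteration at [1 - a] satisfies [2 l = 1 - a + l^2], so [g = 1 - l] has
    square [a]. The bound on [1 - a] stands in for positivity of [a], and the commutation clause for
    membership of [g] in the algebra generated by [a]. *)
Lemma sqrt_exists a : star a = a -> nm (1 - a) <= 1 -> exists g, [/\ star g = g,
  g * g = a, nm (1 - g) <= 1 & forall b, b * a = a * b -> b * g = g * b].
Proof.
move=> sa a1; pose x := 1 - a.
have sx : star x = x by rewrite starB star1 sa.
have [l hl] := sqrt_it_lim a1.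
exists (1 - l); split.
- rewrite starB star1; congr (_ - _); have h1 := seq_lim_star hl.
  apply: seq_lim_unique hl; move: h1; congr seq_lim; apply/funext => n /=.
  exact: sqrt_it_sa.
- have e : halfc *: (x + l * l) = l.
    apply: (@seq_lim_unique _ _ (fun n => sqrt_it x n.+1)); last exact: seq_lim_shift.
    exact: seq_limZ (seq_limD (seq_lim_cst _) (seq_limM hl hl)).
  have {e} e : x + l * l = l + l by rewrite -{3 4}e half2.
  have {e}-> : a = 1 - (l + l) + l * l by rewrite -e opprD addrA subrK subKr.
  rewrite mulrBr mulr1 mulrBl mul1r opprB addrA addrAC; congr (_ + _).
  by rewrite -addrA -opprD.
- rewrite opprB addrC subrK; apply: seq_lim_le hl _ => n.
  apply: (le_trans (sqrt_it_le a1 n)); by case/andP: (sigma_bound n).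
- move=> b ba; have bx : b * x = x * b by rewrite mulrBr mulrBl ba mul1r mulr1.
  rewrite mulrBr mulrBl mul1r mulr1; congr (_ - _).
  apply: (seq_lim_unique (u := fun n => b * sqrt_it x n)).
    exact: seq_limM (seq_lim_cst _) hl.
  have := seq_limM hl (seq_lim_cst b); congr seq_lim; apply/funext => n /=.
  by rewrite sqrt_it_comm.
Qed.

(** [h] is the real part of the unitary [h + i k]. *)
Lemma circ_le1 h k : star h = h -> star k = k -> h * k = k * h ->
  h * h + k * k = 1 -> nm h <= 1.
Proof.
move=> sh sk hk e; pose w := h + 'i%C *: k.
have sw : star w = h - 'i%C *: k by rewrite starD starZc sh sk conj_i scaleNr.
have w1 : nm w <= 1.
  rewrite -(@ler_pXn2r _ 2) ?nnegrE ?nm_ge0 // expr1n -nm_starM sw.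
  have -> : (h - 'i%C *: k) * w = 1; last exact: nm1_le.
  rewrite /w mulrDr !mulrBl -!scaleAl -!scaleAr hk -e.
  by rewrite scalerA iK scaleN1r opprK addrA subrK.
have -> : h = halfc *: (w + star w).
  rewrite sw /w addrACA subrr addr0 -{1}[h]half2 scalerDr //.
rewrite nmZ cabs_half (le_trans (ler_wpM2l _ (nmD _ _))) ?invr_ge0 // nm_star; lra.
Qed.

Lemma circ_exists h : star h = h -> nm h <= 1 -> exists k, [/\ star k = k,
  h * h + k * k = 1, nm k <= 1 & forall b, b * h = h * b -> b * k = k * b].
Proof.
move=> sh h1.
have [||k [sk kk _ ck]] := @sqrt_exists (1 - h * h).
- by rewrite starB star1 starMr sh.
- by rewrite opprB addrC subrK nm_sa2 // expr_le1 ?nm_ge0.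
have hk b : b * h = h * b -> b * k = k * b.
  by move=> bh; apply: ck; rewrite mulrBr mulrBl mulr1 mul1r mulrA bh -mulrA bh mulrA.
exists k; split=> //; first by rewrite kk addrC subrK.
by apply: (@circ_le1 k h) => //; [rewrite -hk|rewrite kk subrK].
Qed.

Lemma nm_1Bsq h : star h = h -> nm h <= 1 -> nm (1 - h * h) <= 1.
Proof.
move=> sh h1; have [k [sk <- k1 _]] := circ_exists sh h1.
by rewrite addrAC subrr add0r nm_sa2 // expr_le1 ?nm_ge0.
Qed.

(** With [w = a + i b], the product [star w * w] is [a^2 + b^2 = 0], so [w] and its adjoint
    [a - i b] both vanish. *)
Lemma sum_sq_eq0 a b : star a = a -> star b = b -> a * b = b * a ->
  a * a + b * b = 0 -> b = 0.
Proof.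
move=> sa sb ab e; pose w := a + 'i%C *: b.
have sw : star w = a - 'i%C *: b by rewrite starD starZc sa sb conj_i scaleNr.
have w0 : w = 0.
  apply: nm_eq0; apply/eqP; rewrite -sqrf_eq0 -nm_starM sw.
  have -> : (a - 'i%C *: b) * w = 0; last by rewrite nm0.
  rewrite /w mulrDr !mulrBl -!scaleAl -!scaleAr ab -e.
  by rewrite scalerA iK scaleN1r opprK addrA subrK.
have a1 : a = - ('i%C *: b) by apply/eqP; rewrite -addr_eq0 -/w w0.
have a2 : a = 'i%C *: b by apply/eqP; rewrite -subr_eq0 -sw w0 star0.
have : 'i%C *: b + 'i%C *: b = 0 by rewrite -{1}a2 a1 addNr.
rewrite -scalerDr -mulr2n -scaler_nat scalerA => /eqP; rewrite scaler_eq0 mulf_eq0.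
rewrite pnatr_eq0 orbF -(inj_eq (mulIf (_ : 'i%C != 0))) ?mul0r ?iK ?oppr_eq0 ?oner_eq0 /=.
  by move/eqP.
by rewrite -sqrf_eq0 expr2 iK oppr_eq0 oner_eq0.
Qed.

End Elementary.

(** * Contractivity of *-homomorphisms and isometry of the injective ones *)

Section Homs.
Variables (A B : cstarAlgType R) (f : A -> B).
Hypothesis hf : is_starhom f.

Lemma starhomD x y : f (x + y) = f x + f y.
Proof. by case: hf => lf _ _; have := lf 1 x y; rewrite !scale1r. Qed.

Lemma starhom0 : f 0 = 0.
Proof. by apply: (addrI (f 0)); rewrite -starhomD !addr0. Qed.

Lemma starhomZ c x : f (c *: x) = c *: f x.
Proof. by case: hf => lf _ _; have := lf c x 0; rewrite !addr0 starhom0 addr0. Qed.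

Lemma starhomN x : f (- x) = - f x.
Proof. by apply/eqP; rewrite -addr_eq0 -starhomD addNr starhom0. Qed.

Lemma starhomB x y : f (x - y) = f x - f y.
Proof. by rewrite starhomD starhomN. Qed.

Lemma starhomM x y : f (x * y) = f x * f y.
Proof. by case: hf => _ [_ fM] _; exact: fM. Qed.

Lemma starhom1 : f 1 = 1.
Proof. by case: hf => _ [f1 _] _. Qed.

Lemma starhom_star x : f (star x) = star (f x).
Proof. by case: hf => _ _ fs; exact: fs. Qed.

Lemma starhom_sum (I : Type) (r : seq I) (P : pred I) (F : I -> A) :
  f (\sum_(i <- r | P i) F i) = \sum_(i <- r | P i) f (F i).
Proof. exact: (big_morph _ starhomD starhom0). Qed.

Lemma starhom_sa h : star h = h -> star (f h) = f h.
Proof. by rewrite -starhom_star => ->. Qed.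

Lemma sa_scale (D : cstarAlgType R) (r : R) (h : D) :
  star h = h -> star (r%:C *: h) = r%:C *: h.
Proof. by move=> sh; rewrite starZc sh conjr. Qed.

Lemma starhom_le_sa h : star h = h -> nm h <= 1 -> nm (f h) <= 1.
Proof.
move=> sh h1; have [k [sk e _ ck]] := circ_exists sh h1.
apply: (@circ_le1 _ (f h) (f k)); rewrite ?starhom_sa -?starhomM ?ck //.
by rewrite -starhomD e starhom1.
Qed.

(** Homogeneity; scaling by the inverse of [nm h + e] rather than of [nm h] avoids a division by
    zero. *)
Lemma sa_le (D E : cstarAlgType R) (g : D -> E) (hg : forall c x, g (c *: x) = c *: g x) :
  (forall h, star h = h -> nm h <= 1 -> nm (g h) <= 1) ->
  forall h, star h = h -> nm (g h) <= nm h.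
Proof.
move=> g1 h sh; apply: le_eps => e e0; pose r := nm h + e.
have r0 : 0 < r by rewrite ltr_wpDl ?nm_ge0.
have := g1 (r^-1%:C *: h) (sa_scale _ sh); rewrite hg !nmZ cabs_real ger0_norm ?invr_ge0 ?(ltW r0) //.
by rewrite ![r^-1 * _]mulrC !ler_pdivrMr // !mul1r; apply; rewrite lerDl ltW.
Qed.

Lemma starhom_le x : nm (f x) <= nm x.
Proof.
rewrite -(@ler_pXn2r _ 2) ?nnegrE ?nm_ge0 // -!nm_starM -starhom_star -starhomM.
apply: sa_le => [||]; [exact: starhomZ|exact: starhom_le_sa|].
by rewrite starMr starK.
Qed.

Lemma starhom_lim (u : nat -> A) l : seq_lim u l -> seq_lim (f \o u) (f l).
Proof. by apply: (seq_lim_bound (k := 1)) => n /=; rewrite -starhomB mul1r starhom_le. Qed.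

Section Injective.
Hypothesis f_inj : forall x, f x = 0 -> x = 0.

(* y_ is the negative part of y = l(1 - h^2); f y is a square, so f kills y_. *)
Lemma inj_le_sa h : star h = h -> nm (f h) <= 1 -> nm h <= 1.
Proof.
move=> sh fh1; pose l : R := (1 + nm h ^+ 2)^-1.
have l0 : 0 < l by rewrite invr_gt0 ltr_wpDr ?sqr_ge0.
pose y := l%:C *: (1 - h * h).
have sy : star y = y by apply: sa_scale; rewrite starB star1 starMr sh.
have y1 : nm y <= 1.
  rewrite nmZ cabs_real ger0_norm ?(ltW l0) // mulrC ler_pdivrMr ?mul1r; last first.
    by rewrite ltr_wpDr ?sqr_ge0.
  by rewrite (le_trans (nmD _ _)) // nmN lerD ?nm1_le // nm_sa2.
have cy b : b * h = h * b -> b * y = y * b.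
  by move=> bh; rewrite -scaleAr -scaleAl mulrBr mulrBl mulr1 mul1r mulrA bh -mulrA bh mulrA.
have [||m [sm mm m1 cm]] := @sqrt_exists _ (y * y); [by rewrite starMr sy|exact: nm_1Bsq|].
have {}cm b : b * h = h * b -> b * m = m * b.
  by move=> /cy by_; apply: cm; rewrite mulrA by_ -mulrA by_ mulrA.
have [q [sq qq _ cq]] := sqrt_exists sm m1.
have {}cq b : b * h = h * b -> b * q = q * b by move=> /cm /cq.
have hq : h * q = q * h by rewrite cq.
have hm : h * m = m * h by rewrite cm.
have hy : h * y = y * h by rewrite cy.
have my : m * y = y * m by rewrite cy // hm.
pose z := m - y.
have hz : h * z = z * h by rewrite mulrBr mulrBl hm hy.
have sz : star z = z by rewrite starB sm sy.
have qz : q * z = z * q by rewrite -cq // hz.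
have yz : y * z = - (m * z) by rewrite !mulrBr mm opprB my.
have zz : z * z = m * z + m * z.
  by rewrite {1}/z mulrBl yz opprK.
have [k [sk kk _ ck]] := circ_exists (starhom_sa sh) fh1.
have fk b : b * h = h * b -> k * f b = f b * k.
  by move=> bh; rewrite ck // -!starhomM bh.
(* [f y] is [l k^2], and [y z = - m z] with [m = q^2]. Hence the commuting self-adjoint elements
   [sqrt l k f(z)] and [f(q z)] have squares with sum [f(y z^2) + f(m z^2) = 0]. *)
have fqz0 : f (q * z) = 0.
  have sl : (Num.sqrt l)%:C * (Num.sqrt l)%:C = l%:C :> C.
    by rewrite -real_complexM -expr2 sqr_sqrtr ?(ltW l0).
  have fy : f y = l%:C *: (k * k).
    by rewrite starhomZ starhomB starhomM starhom1 -kk addrAC subrr add0r.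
  apply: (@sum_sq_eq0 _ ((Num.sqrt l)%:C *: (k * f z))).
  - by rewrite sa_scale // starMr sk starhom_sa // fk.
  - by rewrite starhom_sa // starMr sz sq qz.
  - rewrite -scaleAl -scaleAr; congr (_ *: _).
    have kq : k * f (q * z) = f (q * z) * k by apply: fk; rewrite -mulrA -hz mulrA -hq mulrA.
    have zqz : z * (q * z) = q * z * z by rewrite mulrA -qz.
    by rewrite -[LHS]mulrA -starhomM zqz starhomM mulrA kq -mulrA.
  - rewrite -scaleAl -scaleAr scalerA sl -mulrA [f z * (k * _)]mulrA -fk; last by rewrite -hz.
    rewrite mulrA mulrA scaleAl [l%:C *: (k * k * f z)]scaleAl -fy -!starhomM -starhomD.
    have -> : q * z * (q * z) = m * z * z by rewrite -mulrA [z * (q * z)]mulrA -qz !mulrA qq.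
    by rewrite yz mulNr addNr starhom0.
have qz0 := f_inj fqz0.
have mz0 : m * z = 0 by rewrite -qq -mulrA qz0 mulr0.
have z0 : z = 0.
  by apply: nm_eq0; apply/eqP; rewrite -sqrf_eq0 -nm_starM sz zz mz0 addr0 nm0.
have ym : y = m by apply/esym/eqP; rewrite -subr_eq0 -/z z0.
have sl : (Num.sqrt l)^-1%:C * (Num.sqrt l)^-1%:C = l^-1%:C :> C.
  by rewrite -real_complexM -invfM -expr2 sqr_sqrtr ?(ltW l0).
apply: (@circ_le1 _ h ((Num.sqrt l)^-1%:C *: q)) => //.
- exact: sa_scale.
- by rewrite -scaleAr -scaleAl hq.
- rewrite -scaleAl -scaleAr scalerA sl qq -ym scalerA -real_complexM mulVf ?gt_eqF //.
  by rewrite scale1r addrC subrK.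
Qed.

Lemma starhom_inj_le x : nm x <= nm (f x).
Proof.
rewrite -(@ler_pXn2r _ 2) ?nnegrE ?nm_ge0 // -!nm_starM -starhom_star -starhomM.
have : star (star x * x) = star x * x by rewrite starMr starK.
move: (star x * x) => h sh.
apply: le_eps => e e0; pose r := nm (f h) + e.
have r0 : 0 < r by rewrite ltr_wpDl ?nm_ge0.
have := inj_le_sa (sa_scale r^-1 sh); rewrite starhomZ !nmZ cabs_real ger0_norm ?invr_ge0 ?(ltW r0) //.
by rewrite ![r^-1 * _]mulrC !ler_pdivrMr // !mul1r; apply; rewrite lerDl ltW.
Qed.

End Injective.
End Homs.
End CStar.

(** * Positive sesquilinear forms *)

(** Discriminant argument along [c = - t L] with [t] real: take [t = 1 / G] or, when [G = 0], a [t]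
    at which the affine function of [t] that remains would equal [-1]. *)
Lemma quad_CS (R : realType) (S G : R) (L : R[i]) : 0 <= G ->
  (forall c : R[i], 0 <= S%:C + c^* * L + c * L^* + c * c^* * G%:C) ->
  cabs L ^+ 2 <= S * G.
Proof.
move=> G0 key0.
have key (t : R) : 0 <= S - 2 * t * cabs L ^+ 2 + t ^+ 2 * cabs L ^+ 2 * G.
  have := key0 (- t%:C * L); rewrite !conjcM conjcN conjr.
  have -> : S%:C + - t%:C * L^* * L + - t%:C * L * L^* + - t%:C * L * (- t%:C * L^*) * G%:C
    = S%:C - 2%:C * t%:C * (L * L^*) + t%:C ^+ 2 * (L * L^*) * G%:C by rewrite rmorph_nat; ring.
  by rewrite mulcJ_cabs -real_complexX -!real_complexM -rmorphB -rmorphD /= ler0c.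
have [G00|Gp] := leP G 0.
  have {G00}G00 : G = 0 by apply/eqP; rewrite eq_le G00 G0.
  rewrite G00 mulr0 leNgt; apply/negP => z0.
  have := key ((S + 1) / (2 * cabs L ^+ 2)); rewrite G00 mulr0 addr0.
  have -> : S - 2 * ((S + 1) / (2 * cabs L ^+ 2)) * cabs L ^+ 2 = -1.
    have zn : cabs L != 0 by rewrite -sqrf_eq0 gt_eqF.
    by field.
  lra.
have := key G^-1.
have -> : S - 2 / G * cabs L ^+ 2 + G^-1 ^+ 2 * cabs L ^+ 2 * G = S - cabs L ^+ 2 / G.
  by field; rewrite gt_eqF.
by rewrite subr_ge0 ler_pdivrMr.
Qed.

Section SemiInner.
Variable R : realType.
Local Notation C := R[i].
Variables (V : lmodType C) (f : V -> V -> C).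

Definition semidot := [/\ forall w, scalar (f^~ w),
  forall u v, f v u = (f u v)^* & forall v, 0 <= f v v].

Hypothesis hf : semidot.

Lemma sdDl u v w : f (u + v) w = f u w + f v w.
Proof. by case: hf => l _ _; have := l w 1 u v; rewrite scale1r mul1r. Qed.

Lemma sd0l w : f 0 w = 0.
Proof. by apply: (addrI (f 0 w)); rewrite -sdDl !addr0. Qed.

Lemma sdZl c u w : f (c *: u) w = c * f u w.
Proof. by case: hf => l _ _; have := l w c u 0; rewrite !addr0 sd0l addr0. Qed.

Lemma sdC u v : f v u = (f u v)^*.
Proof. by case: hf. Qed.

Lemma sd_ge0 v : 0 <= f v v.
Proof. by case: hf. Qed.

Lemma sdDr u v w : f w (u + v) = f w u + f w v.
Proof. by rewrite sdC sdDl conjcD -!sdC. Qed.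

Lemma sdZr c u w : f w (c *: u) = c^* * f w u.
Proof. by rewrite sdC sdZl conjcM -sdC. Qed.

Lemma sd0r w : f w 0 = 0.
Proof. by rewrite sdC sd0l rmorph0. Qed.

Lemma sdNl u w : f (- u) w = - f u w.
Proof. by rewrite -scaleN1r sdZl mulN1r. Qed.

Lemma sdNr u w : f w (- u) = - f w u.
Proof. by rewrite sdC sdNl conjcN -sdC. Qed.

Lemma sd_suml (I : Type) (r : seq I) (P : pred I) (F : I -> V) w :
  f (\sum_(i <- r | P i) F i) w = \sum_(i <- r | P i) f (F i) w.
Proof.
by apply: (big_morph (f^~ w)); [move=> u v; exact: sdDl|exact: sd0l].
Qed.

Lemma sd_sumr (I : Type) (r : seq I) (P : pred I) (F : I -> V) w :
  f w (\sum_(i <- r | P i) F i) = \sum_(i <- r | P i) f w (F i).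
Proof.
by apply: (big_morph (f w)); [move=> u v; exact: sdDr|exact: sd0r].
Qed.

Definition sq v : R := complex.Re (f v v).

Lemma sqE v : f v v = (sq v)%:C.
Proof. by apply: ge0_complexE; exact: sd_ge0. Qed.

Lemma sq_ge0 v : 0 <= sq v.
Proof. exact/Re_ge0/sd_ge0. Qed.

Lemma sd_cauchy_schwarz u v : cabs (f u v) ^+ 2 <= sq u * sq v.
Proof.
apply: quad_CS => [|c]; first exact: sq_ge0.
have := sd_ge0 (u + c *: v); rewrite sdDl !sdDr !sdZl !sdZr [f v u]sdC -!sqE.
by congr (0 <= _); ring.
Qed.

Lemma sd_null u v : f v v = 0 -> f u v = 0.
Proof.
move=> v0; apply/cabs_le0; have := sd_cauchy_schwarz u v.
by rewrite /sq v0 mulr0 => h; rewrite -(@ler_pXn2r _ 2) ?nnegrE ?cabs_ge0 // expr0n.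
Qed.

Definition snorm v : R := Num.sqrt (sq v).

Lemma snorm_ge0 v : 0 <= snorm v. Proof. exact: sqrtr_ge0. Qed.

Lemma snorm2 v : snorm v ^+ 2 = sq v. Proof. by rewrite sqr_sqrtr ?sq_ge0. Qed.

Lemma sd_CS u v : cabs (f u v) <= snorm u * snorm v.
Proof.
rewrite -(@ler_pXn2r _ 2) ?nnegrE ?cabs_ge0 ?mulr_ge0 ?snorm_ge0 //.
by rewrite exprMn !snorm2 sd_cauchy_schwarz.
Qed.

Lemma snormD u v : snorm (u + v) <= snorm u + snorm v.
Proof.
rewrite -(@ler_pXn2r _ 2) ?nnegrE ?addr_ge0 ?snorm_ge0 // sqrrD !snorm2.
rewrite /sq sdDl !sdDr !ReD [f v u]sdC.
have := sd_CS u v; have := cabs_Re (f u v); rewrite ler_norml => /andP[_ h1] h2.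
have : complex.Re (f u v)^* = complex.Re (f u v) by case: (f u v).
by move: (snorm u * snorm v) h2 h1 => K; rewrite -mulr_natr; lra.
Qed.

Lemma snormZ c u : snorm (c *: u) = cabs c * snorm u.
Proof.
have e : sq (c *: u) = cabs c ^+ 2 * sq u.
  rewrite /sq sdZl sdZr mulrA mulcJ_cabs sqE -real_complexM //.
by rewrite /snorm e sqrtrM ?sqr_ge0 // sqrtr_sqr ger0_norm // cabs_ge0.
Qed.

Lemma snorm_sum (I : Type) (r : seq I) (P : pred I) (F : I -> V) :
  snorm (\sum_(i <- r | P i) F i) <= \sum_(i <- r | P i) snorm (F i).
Proof.
elim/big_ind2: _ => [|x r1 y r2 h1 h2|//].
  by rewrite /snorm /sq sd0l sqrtr0.
by apply: (le_trans (snormD _ _)); rewrite lerD.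
Qed.

End SemiInner.

Lemma schur_cons (R : realType) (V W : lmodType R[i]) (f : V -> V -> R[i])
    (g : W -> W -> R[i]) (t : seq (V * W)) h k :
  \sum_(p <- (h, k) :: t) \sum_(q <- (h, k) :: t) f p.1 q.1 * g p.2 q.2 =
  f h h * g k k + \sum_(q <- t) f h q.1 * g k q.2
  + \sum_(p <- t) f p.1 h * g p.2 k
  + \sum_(p <- t) \sum_(q <- t) f p.1 q.1 * g p.2 q.2.
Proof.
rewrite big_cons big_cons /= -!addrA; congr (_ + (_ + _)).
by under eq_bigr do rewrite big_cons; rewrite big_split.
Qed.

(* Positive semidefiniteness of a Schur product: split off the component of
   the second legs along the first one. *)
Lemma schur_ge0 (R : realType) (V W : lmodType R[i]) (f : V -> V -> R[i])
    (g : W -> W -> R[i]) (s : seq (V * W)) : semidot f -> semidot g ->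
  0 <= \sum_(p <- s) \sum_(q <- s) f p.1 q.1 * g p.2 q.2.
Proof.
move=> hf hg; have [n] := ubnP (size s); elim: n s => // n ih [|[h k] s] /=.
  by rewrite big_nil.
rewrite ltnS => sn.
rewrite schur_cons.
(* A vector [k] of zero length is orthogonal to everything, so the pair [(h, k)] contributes
   nothing. *)
have [k0|k0] := eqVneq (g k k) 0.
  have e1 : \sum_(q <- s) f h q.1 * g k q.2 = 0.
    by rewrite big1 // => q _; rewrite (sdC hg) (sd_null hg q.2 k0) rmorph0 mulr0.
  have e2 : \sum_(p <- s) f p.1 h * g p.2 k = 0.
    by rewrite big1 // => q _; rewrite (sd_null hg q.2 k0) mulr0.
  by rewrite k0 e1 e2 mulr0 !add0r ih.
(* [al p] is the coefficient along [k] of the second leg of [p]. The first legs attached to [k] add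
   up to [H]; the remainders [s'] have second legs orthogonal to [k] and form a list with one term
   fewer. *)
pose al (p : V * W) := g p.2 k / g k k.
pose s' := [seq (p.1, p.2 - al p *: k) | p <- s].
pose H := h + \sum_(p <- s) al p *: p.1.
have gk : (g k k)^* = g k k by rewrite -sdC.
have alJ p : (al p)^* = g k p.2 / g k k by rewrite /al rmorphM fmorphV /= gk -sdC.
suff -> : f h h * g k k + \sum_(q <- s) f h q.1 * g k q.2
    + \sum_(p <- s) f p.1 h * g p.2 k
    + \sum_(p <- s) \sum_(q <- s) f p.1 q.1 * g p.2 q.2 =
    f H H * g k k + \sum_(p <- s') \sum_(q <- s') f p.1 q.1 * g p.2 q.2.
  by rewrite addr_ge0 ?mulr_ge0 ?sd_ge0 // ih // size_map.
have -> : \sum_(p <- s') \sum_(q <- s') f p.1 q.1 * g p.2 q.2 =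
    \sum_(p <- s) \sum_(q <- s) f p.1 q.1 * g p.2 q.2 -
    \sum_(p <- s) \sum_(q <- s) f p.1 q.1 * (al p * (al q)^* * g k k).
  rewrite big_map -sumrB; apply: eq_bigr => p _; rewrite big_map -sumrB.
  apply: eq_bigr => q _ /=; rewrite -mulrBr; congr (_ * _).
  rewrite (sdDl hg) !(sdDr hg) (sdNl hg) !(sdNr hg) !(sdZl hg) !(sdZr hg) (sdNl hg) (sdZl hg) alJ /al.
  by field.
have -> : f H H = f h h + \sum_(q <- s) (al q)^* * f h q.1 +
    \sum_(p <- s) al p * f p.1 h +
    \sum_(p <- s) \sum_(q <- s) al p * ((al q)^* * f p.1 q.1).
  rewrite /H (sdDl hf) !(sdDr hf) -!addrA; congr (_ + _).
  rewrite (sd_sumr hf); under eq_bigr do rewrite (sdZr hf); congr (_ + _).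
  rewrite !(sd_suml hf); under eq_bigr do rewrite (sdZl hf); congr (_ + _).
  apply: eq_bigr => p _; rewrite (sdZl hf) (sd_sumr hf) mulr_sumr.
  by apply: eq_bigr => q _; rewrite (sdZr hf).
rewrite !mulrDl -!addrA; congr (_ + _); rewrite !addrA.
have -> : (\sum_(q <- s) (al q)^* * f h q.1) * g k k = \sum_(q <- s) f h q.1 * g k q.2.
  by rewrite mulr_suml; apply: eq_bigr => q _; rewrite alJ; field.
have -> : (\sum_(p <- s) al p * f p.1 h) * g k k = \sum_(p <- s) f p.1 h * g p.2 k.
  by rewrite mulr_suml; apply: eq_bigr => q _; rewrite /al; field.
rewrite -!addrA; congr (_ + (_ + _)); rewrite addrCA -[LHS]addr0; congr (_ + _).
apply/esym/eqP; rewrite subr_eq0 mulr_suml; apply/eqP/eq_bigr => p _.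
rewrite mulr_suml; apply: eq_bigr => q _; ring.
Qed.

Definition tform (R : realType) (V W : lmodType R[i]) (f : V -> V -> R[i])
    (g : W -> W -> R[i]) (s t : seq (V * W)) : R[i] :=
  \sum_(p <- s) \sum_(q <- t) f p.1 q.1 * g p.2 q.2.

(** Positivity on the concatenation of [s] and [c t] is the quadratic inequality that [quad_CS] asks
    for. *)
Lemma tform_CS (R : realType) (V W : lmodType R[i]) (f : V -> V -> R[i])
    (g : W -> W -> R[i]) (s t : seq (V * W)) : semidot f -> semidot g ->
  cabs (tform f g s t) ^+ 2 <= complex.Re (tform f g s s) * complex.Re (tform f g t t).
Proof.
move=> hf hg.
have S0 s' : 0 <= tform f g s' s' by exact: schur_ge0.
apply: quad_CS => [|c]; first exact/Re_ge0.
rewrite -!ge0_complexE //.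
have := S0 (s ++ [seq (c *: p.1, p.2) | p <- t]).
rewrite {1}/tform big_cat /= big_map.
under eq_bigr do rewrite big_cat /= big_map.
under [X in _ + X]eq_bigr do rewrite big_cat /= big_map.
rewrite !big_split /= -![\sum_(p <- _) _]/(tform f g _ _); congr (0 <= _).
rewrite !addrA; congr (_ + _ + _ + _).
- rewrite mulr_sumr; apply: eq_bigr => p _; rewrite mulr_sumr; apply: eq_bigr => q _.
  by rewrite (sdZr hf) mulrA.
- rewrite /tform exchange_big conjc_sum mulr_sumr; apply: eq_bigr => p _.
  rewrite conjc_sum mulr_sumr; apply: eq_bigr => q _.
  by rewrite (sdZl hf) conjcM -(sdC hf) -(sdC hg) mulrA.
- rewrite mulr_sumr; apply: eq_bigr => p _; rewrite mulr_sumr; apply: eq_bigr => q _.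
  by rewrite (sdZl hf) (sdZr hf) !mulrA.
Qed.

Lemma hdot_semidot (R : realType) (H : hilbertSpace R) : semidot (hdot H).
Proof.
split=> [w c u v|u v|v].
- exact: linearPl.
- have := hermC (hdot H) v u; rewrite expr0 mul1r => ->. by [].
- by rewrite hdotE exprn_ge0.
Qed.

Lemma sq_hdot (R : realType) (H : hilbertSpace R) (x : H) : sq (hdot H) x = nm x ^+ 2.
Proof. by rewrite /sq hdotE nmE -real_complexX. Qed.

Section Scalars.
Variable R : realType.
Local Notation C := R[i].

Lemma real_seq_complete (u : nat -> R) :
  (forall e, 0 < e -> exists n0, forall m n, (n0 <= m)%N -> (n0 <= n)%N -> `|u m - u n| < e) ->
  exists l, forall e, 0 < e -> exists n0, forall n, (n0 <= n)%N -> `|u n - l| < e.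
Proof.
move=> uc; have cu : cauchy (u @ \oo)%classic.
  apply/cauchyP => e e0; have [n0 hn0] := uc _ e0.
  exists (u n0); exists n0 => // n /= hn.
  by rewrite -ball_normE /ball_ /= hn0.
have /cvg_ex[l /cvgrPdist_lt hl] : cvg (u @ \oo)%classic by exact: cauchy_cvg.
exists l => e e0; have [n0 _ hn0] := hl _ e0.
by exists n0 => n hn; have := hn0 n hn; rewrite /= distrC.
Qed.

Lemma complex_seq_complete (u : nat -> C) :
  (forall e, 0 < e -> exists n0, forall m n, (n0 <= m)%N -> (n0 <= n)%N ->
     cabs (u m - u n) < e) ->
  exists l, forall e, 0 < e -> exists n0, forall n, (n0 <= n)%N -> cabs (u n - l) < e.
Proof.
move=> uc.
have ReB (z w : C) : complex.Re (z - w) = complex.Re z - complex.Re w by case: z w => [a b] [c d].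
have ImB (z w : C) : complex.Im (z - w) = complex.Im z - complex.Im w by case: z w => [a b] [c d].
have [|a ha] := real_seq_complete (u := fun n => complex.Re (u n)).
  move=> e /uc[n0 h]; exists n0 => m n hm hn; rewrite -ReB.
  exact: le_lt_trans (cabs_Re _) (h m n hm hn).
have [|b hb] := real_seq_complete (u := fun n => complex.Im (u n)).
  move=> e /uc[n0 h]; exists n0 => m n hm hn; rewrite -ImB.
  exact: le_lt_trans (cabs_Im _) (h m n hm hn).
exists (a +i* b) => e e0; have e20 : 0 < e / 2 by rewrite divr_gt0.
have [n0 h0] := ha _ e20; have [n1 h1] := hb _ e20.
exists (maxn n0 n1) => n; rewrite geq_max => /andP[le0 le1].
apply: (le_lt_trans (cabs_ReIm _)); rewrite ReB ImB [ltRHS]splitr.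
by rewrite ltrD ?h0 ?h1.
Qed.

End Scalars.

(** * Closed *-subalgebras of a product *)

Section PairAlgebra.
Variable R : realType.
Local Notation C := R[i].

(** A norm-closed unital *-subalgebra of the product, kept as a relation. Two instances matter: the
    closure of a graph given on elementary tensors, and the pairs [(a, a)] with [P a], which turn an
    inductive predicate [P] into an algebra to which a universal property applies. *)
Record pairalg (A B : cstarAlgType R) := PairAlg {
  pa_rel : A -> B -> Prop;
  pa_1 : pa_rel 1 1;
  pa_lin : forall (c : C) a b a' b', pa_rel a b -> pa_rel a' b' ->
    pa_rel (c *: a + a') (c *: b + b');
  pa_mul : forall a b a' b', pa_rel a b -> pa_rel a' b' -> pa_rel (a * a') (b * b');
  pa_star : forall a b, pa_rel a b -> pa_rel (star a) (star b);
  pa_lim : forall (u : nat -> A) (v : nat -> B) a b, (forall n, pa_rel (u n) (v n)) ->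
    seq_lim u a -> seq_lim v b -> pa_rel a b
}.

Section Type_.
Variables (A B : cstarAlgType R) (G : pairalg A B).

Definition pa_pred : {pred A * B} := [pred p : A * B | `[< pa_rel G p.1 p.2 >]].

Lemma pa_predE p : reflect (pa_rel G p.1 p.2) (p \in pa_pred).
Proof. exact: asboolP. Qed.

Lemma pa_0 : pa_rel G 0 0.
Proof. by have := pa_lin (-1) (pa_1 G) (pa_1 G); rewrite !scaleN1r !addNr. Qed.

Lemma pa_submod : GRing.submod_closed pa_pred.
Proof.
split=> [|c p q /pa_predE hp /pa_predE hq]; apply/pa_predE; first exact: pa_0.
exact: pa_lin.
Qed.

Record paT := PaT { pa_val :> A * B; pa_valP : pa_val \in pa_pred }.

HB.instance Definition _ := [isSub for pa_val].
HB.instance Definition _ := [Choice of paT by <:].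
HB.instance Definition _ := GRing.SubChoice_isSubLmodule.Build C (A * B)%type pa_pred paT pa_submod.

Definition pa_n (p : A * B) : R := Num.max (nm p.1) (nm p.2).

Lemma pa_n_lt p e : (pa_n p < e) = (nm p.1 < e) && (nm p.2 < e).
Proof. exact: gt_max. Qed.

Lemma pa_nD p q : pa_n (p + q) <= pa_n p + pa_n q.
Proof.
rewrite ge_max !(le_trans (nmD _ _)) ?lerD //=; by rewrite /pa_n le_max lexx ?orbT.
Qed.

Lemma pa_valD (p q : paT) : pa_val (p + q) = pa_val p + pa_val q.
Proof. exact: (raddfD (val : paT -> A * B)). Qed.

Lemma pa_valZ (c : C) (p : paT) : pa_val (c *: p) = c *: pa_val p.
Proof. by first [exact: (linearZZ (pa_val)) | exact: linearZ_LR | reflexivity]. Qed.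

Lemma pa_valN (p : paT) : pa_val (- p) = - pa_val p.
Proof. exact: (raddfN (val : paT -> A * B)). Qed.

Lemma pa_inj (p q : paT) : pa_val p = pa_val q -> p = q.
Proof. exact: val_inj. Qed.

Let norm (p : paT) : C := (pa_n (pa_val p))%:C.

Let normD p q : norm (p + q) <= norm p + norm q.
Proof. by rewrite /norm -real_complexD lecR pa_valD pa_nD. Qed.

Let normZ (c : C) p : norm (c *: p) = `|c| * norm p.
Proof.
rewrite /norm pa_valZ cabsE -real_complexM; congr (_%:C).
by rewrite /pa_n /= !nmZ maxr_pMr ?cabs_ge0.
Qed.

Let norm0 p : norm p = 0 -> p = 0.
Proof.
move=> /real_complex_inj n0; apply: pa_inj.
have /andP[h1 h2] : (nm (pa_val p).1 <= 0) && (nm (pa_val p).2 <= 0) by rewrite -ge_max -/(pa_n _) n0.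
by rewrite -[LHS]/(pa_val p); case: (pa_val p) h1 h2 => a b /= /nm_le0 -> /nm_le0 ->.
Qed.

HB.instance Definition _ := Lmodule_isNormed.Build C paT normD normZ norm0.

Lemma nm_pa (p : paT) : nm p = pa_n (pa_val p).
Proof. by []. Qed.

Let complete : forall F : set_system paT, ProperFilter F -> cauchy F -> cvg F.
Proof.
apply: complete_of_seq => u uc.
have uc1 : seq_cauchy (fun n => (pa_val (u n)).1).
  move=> e /uc[n0 h]; exists n0 => m n hm hn; have := h m n hm hn.
  by rewrite nm_pa pa_n_lt pa_valD pa_valN => /andP[].
have uc2 : seq_cauchy (fun n => (pa_val (u n)).2).
  move=> e /uc[n0 h]; exists n0 => m n hm hn; have := h m n hm hn.
  by rewrite nm_pa pa_n_lt pa_valD pa_valN => /andP[].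
have [a ha] := seq_complete uc1; have [b hb] := seq_complete uc2.
have Gab : (a, b) \in pa_pred.
  by apply/pa_predE; apply: pa_lim ha hb => n; apply/(pa_predE (pa_val (u n)))/pa_valP.
exists (PaT Gab) => e e0; have [n0 h0] := ha e e0; have [n1 h1] := hb e e0.
exists (maxn n0 n1) => n; rewrite geq_max => /andP[le0 le1].
by rewrite nm_pa pa_n_lt pa_valD pa_valN /= h0 ?h1.
Qed.

HB.instance Definition _ := Uniform_isComplete.Build paT complete.

Let one_subproof : ((1 : A), (1 : B)) \in pa_pred.
Proof. by apply/pa_predE; exact: pa_1. Qed.
Let mul_subproof (p q : paT) :
  ((pa_val p).1 * (pa_val q).1, (pa_val p).2 * (pa_val q).2) \in pa_pred.
Proof. by apply/pa_predE; apply: pa_mul; apply/pa_predE/pa_valP. Qed.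
Let star_subproof (p : paT) : (star (pa_val p).1, star (pa_val p).2) \in pa_pred.
Proof. by apply/pa_predE; apply: pa_star; apply/pa_predE/pa_valP. Qed.

Let pone := PaT one_subproof.
Let pmul p q := PaT (mul_subproof p q).
Let pstar p := PaT (star_subproof p).

Let pa_mulA : associative pmul.
Proof. by move=> p q r; apply: pa_inj; rewrite /= !mulrA. Qed.
Let pa_mul1r : left_id pone pmul.
Proof. by move=> [[a b] h]; apply: pa_inj; rewrite /= !mul1r. Qed.
Let pa_mulr1 : right_id pone pmul.
Proof. by move=> [[a b] h]; apply: pa_inj; rewrite /= !mulr1. Qed.
Let pa_mulDl : left_distributive pmul +%R.
Proof. by move=> p q r; apply: pa_inj; rewrite [RHS]pa_valD -[LHS]/((pa_val (p + q)).1 * (pa_val r).1, (pa_val (p + q)).2 * (pa_val r).2) pa_valD !mulrDl. Qed.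
Let pa_mulDr : right_distributive pmul +%R.
Proof. by move=> p q r; apply: pa_inj; rewrite [RHS]pa_valD -[LHS]/((pa_val p).1 * (pa_val (q + r)).1, (pa_val p).2 * (pa_val (q + r)).2) pa_valD !mulrDr. Qed.
Let pa_scalerAl (k : C) x y : k *: pmul x y = pmul (k *: x) y.
Proof. by apply: pa_inj; rewrite [LHS]pa_valZ -[RHS]/((pa_val (k *: x)).1 * (pa_val y).1, (pa_val (k *: x)).2 * (pa_val y).2) pa_valZ -!scaleAl. Qed.
Let pa_scalerAr (k : C) x y : k *: pmul x y = pmul x (k *: y).
Proof. by apply: pa_inj; rewrite [LHS]pa_valZ -[RHS]/((pa_val x).1 * (pa_val (k *: y)).1, (pa_val x).2 * (pa_val (k *: y)).2) pa_valZ -!scaleAr. Qed.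
Let pa_starK : involutive pstar.
Proof. by move=> [[a b] h]; apply: pa_inj; rewrite /= !starK. Qed.
Let pa_starD : {morph pstar : x y / x + y}.
Proof. by move=> p q; apply: pa_inj; rewrite [RHS]pa_valD -[LHS]/(star (pa_val (p + q)).1, star (pa_val (p + q)).2) pa_valD !starD. Qed.
Let pa_starZ (k : C) x : pstar (k *: x) = k^* *: pstar x.
Proof. by apply: pa_inj; rewrite [RHS]pa_valZ -[LHS]/(star (pa_val (k *: x)).1, star (pa_val (k *: x)).2) pa_valZ !starZc. Qed.
Let pa_starM x y : pstar (pmul x y) = pmul (pstar y) (pstar x).
Proof. by apply: pa_inj; rewrite /= !starMr. Qed.
Let pa_normM (x y : paT) : `|pmul x y| <= `|x| * `|y|.
Proof.
rewrite !nmE -real_complexM lecR !nm_pa /pa_n /= ge_max.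
by rewrite !(le_trans (nmM _ _)) // ler_pM ?nm_ge0 // le_max lexx ?orbT.
Qed.
Let pa_norm (x : paT) : `|pmul (pstar x) x| = `|x| ^+ 2.
Proof.
rewrite !nmE -real_complexX !nm_pa /pa_n /= !nm_starM; congr (_%:C).
case: (leP (nm (pa_val x).1) (nm (pa_val x).2)) => h.
  by rewrite max_r // ler_pXn2r // nnegrE nm_ge0.
by rewrite max_l // ler_pXn2r ?nnegrE ?nm_ge0 // ltW.
Qed.

HB.instance Definition _ := isCStarAlgebra.Build R paT pa_mulA pa_mul1r pa_mulr1 pa_mulDl
  pa_mulDr pa_scalerAl pa_scalerAr pa_starK pa_starD pa_starZ pa_starM pa_normM pa_norm.

Definition pa_fst (p : paT) : A := (pa_val p).1.
Definition pa_snd (p : paT) : B := (pa_val p).2.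

Lemma pa_fst_hom : is_starhom pa_fst.
Proof.
split=> [c p q|//|//]; by rewrite /pa_fst pa_valD pa_valZ.
Qed.

Definition pa_mk a b (h : pa_rel G a b) : paT := PaT (introT (pa_predE (a, b)) h).

Lemma pa_rel_val (p : paT) : pa_rel G (pa_fst p) (pa_snd p).
Proof. exact/(pa_predE (pa_val p))/pa_valP. Qed.

End Type_.

(* A closed *-subalgebra of A x B that is a graph over a dense subset of A
   is the graph of a *-homomorphism, since injective *-homomorphisms are isometric. *)
Lemma graph_hom (A B : cstarAlgType R) (G : pairalg A B) :
  (forall b, pa_rel G 0 b -> b = 0) ->
  (forall a (e : R), 0 < e -> exists a' b', pa_rel G a' b' /\ nm (a - a') < e) ->
  exists f : A -> B, is_starhom f /\ forall a, pa_rel G a (f a).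
Proof.
move=> G0 Gd.
have inj (p : paT G) : pa_fst p = 0 -> p = 0.
  move=> p0; apply: pa_inj; have := pa_rel_val p; rewrite p0 => /G0.
  by move: p0; rewrite /pa_fst /pa_snd; case: (pa_val p) => a b /= -> ->.
(* The norm of a pair is the maximum of the two norms, and the first projection is isometric. *)
have le a b : pa_rel G a b -> nm b <= nm a.
  move=> h; have := starhom_inj_le (pa_fst_hom G) inj (pa_mk h).
  by apply: le_trans; rewrite nm_pa le_max lexx orbT.
have tot a : exists b, pa_rel G a b.
  have /choice[u hu] (n : nat) : exists p : A * B, pa_rel G p.1 p.2 /\ nm (a - p.1) < n.+1%:R^-1.
    have [|a' [b' h]] := Gd a (n.+1%:R^-1); first by rewrite invr_gt0 ltr0n.
    by exists (a', b').
  have ua : seq_lim (fun n => (u n).1) a.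
    have /dense_seq : dense [set a' | exists b', pa_rel G a' b']%classic.
      by apply/dense_nm => x e /(Gd x)[a' [b' [h1 h2]]]; exists a' => //; exists b'.
    move=> _ e e0; exists (Num.truncn e^-1).+1 => n hn; rewrite nmB.
    apply: (lt_trans (hu n).2); rewrite -[ltRHS]invrK ltf_pV2 ?posrE ?invr_gt0 ?ltr0n //.
    by apply: (lt_le_trans (truncnS_gt _)); rewrite ler_nat; apply: leq_trans hn _.
  have vc : seq_cauchy (fun n => (u n).2).
    move=> e e0; have [n0 h0] := ua (e / 2) (divr_gt0 e0 (ltr0Sn _ _)).
    exists n0 => m n hm hn.
    have hG : pa_rel G ((u m).1 - (u n).1) ((u m).2 - (u n).2).
      have := pa_lin (-1) (hu n).1 (hu m).1; by rewrite !scaleN1r ![- _ + _]addrC.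
    apply: (le_lt_trans (le _ _ hG)); apply: (le_lt_trans (nm_tri a _ _)).
    by rewrite [ltRHS]splitr ltrD ?h0 // nmB h0.
  have [b hb] := seq_complete vc; exists b.
  by apply: pa_lim ua hb => n; case: (hu n).
have [f hf] := choice tot; exists f; split=> //.
have uniq a b : pa_rel G a b -> b = f a.
  move=> h; apply/eqP; rewrite -subr_eq0; apply/eqP/G0.
  by have := pa_lin (-1) (hf a) h; rewrite !scaleN1r ![- _ + _]addrC subrr.
split.
- by move=> c x y; apply/esym/uniq/pa_lin.
- by split=> [|x y]; apply/esym/uniq; [exact: pa_1|exact: pa_mul].
- by move=> x; apply/esym/uniq/pa_star.
Qed.

Section Closure.
Variables (A B : cstarAlgType R) (S : A -> B -> Prop).
Hypotheses (S1 : S 1 1)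
  (Slin : forall (c : C) a b a' b', S a b -> S a' b' -> S (c *: a + a') (c *: b + b'))
  (Smul : forall a b a' b', S a b -> S a' b' -> S (a * a') (b * b'))
  (Sstar : forall a b, S a b -> S (star a) (star b)).

Definition pclosure a b := exists (u : nat -> A) (v : nat -> B),
  [/\ forall n, S (u n) (v n), seq_lim u a & seq_lim v b].

Lemma pclosure_eps a b : (forall e, 0 < e -> exists a' b',
  [/\ S a' b', nm (a' - a) < e & nm (b' - b) < e]) -> pclosure a b.
Proof.
move=> h; have /choice[u hu] (n : nat) : exists p : A * B,
    [/\ S p.1 p.2, nm (p.1 - a) < n.+1%:R^-1 & nm (p.2 - b) < n.+1%:R^-1].
  have [|a' [b' h']] := h (n.+1%:R^-1); first by rewrite invr_gt0 ltr0n.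
  by exists (a', b').
exists (fun n => (u n).1), (fun n => (u n).2).
have inv_lt (e : R) : 0 < e -> exists n0, forall n : nat, (n0 <= n)%N -> n.+1%:R^-1 < e.
  move=> e0; exists (Num.truncn e^-1).+1 => n le_n.
  rewrite -[ltRHS]invrK ltf_pV2 ?posrE ?invr_gt0 ?ltr0n //.
  apply: (lt_le_trans (truncnS_gt _)); rewrite ler_nat.
  by apply: leq_trans le_n _.
split=> [n|e /inv_lt[n0 h0]|e /inv_lt[n0 h0]]; first by case: (hu n).
  by exists n0 => n hn; case: (hu n) => _ /lt_trans -> //; exact: h0.
by exists n0 => n hn; case: (hu n) => _ _ /lt_trans -> //; exact: h0.
Qed.

Lemma pclosureW a b : S a b -> pclosure a b.
Proof. by move=> h; exists (fun=> a), (fun=> b); split=> //; exact: seq_lim_cst. Qed.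

Lemma pclosure_lin (c : C) a b a' b' :
  pclosure a b -> pclosure a' b' -> pclosure (c *: a + a') (c *: b + b').
Proof.
move=> [u [v [h1 h2 h3]]] [u' [v' [h1' h2' h3']]].
exists (fun n => c *: u n + u' n), (fun n => c *: v n + v' n); split.
- by move=> n; exact: Slin.
- exact: seq_limD (seq_limZ c h2) h2'.
- exact: seq_limD (seq_limZ c h3) h3'.
Qed.

Lemma pclosure_mul a b a' b' :
  pclosure a b -> pclosure a' b' -> pclosure (a * a') (b * b').
Proof.
move=> [u [v [h1 h2 h3]]] [u' [v' [h1' h2' h3']]].
exists (fun n => u n * u' n), (fun n => v n * v' n); split.
- by move=> n; exact: Smul.
- exact: seq_limM h2 h2'.
- exact: seq_limM h3 h3'.
Qed.

Lemma pclosure_star a b : pclosure a b -> pclosure (star a) (star b).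
Proof.
move=> [u [v [h1 h2 h3]]].
exists (star \o u), (star \o v); split.
- by move=> n; exact: Sstar.
- exact: seq_lim_star.
- exact: seq_lim_star.
Qed.

Lemma pclosure_lim (u : nat -> A) (v : nat -> B) a b :
  (forall n, pclosure (u n) (v n)) -> seq_lim u a -> seq_lim v b -> pclosure a b.
Proof.
move=> h ua vb; apply: pclosure_eps => e e0; have e20 : 0 < e / 2 by rewrite divr_gt0.
have [n0 h0] := ua _ e20; have [n1 h1] := vb _ e20; pose n := maxn n0 n1.
have [u' [v' [hS hu hv]]] := h n.
have [m0 k0] := hu _ e20; have [m1 k1] := hv _ e20; pose m := maxn m0 m1.
exists (u' m), (v' m); split=> //.
  apply: (le_lt_trans (nm_tri (u n) _ _)); rewrite [ltRHS]splitr ltrD ?h0 ?leq_maxl //.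
  by rewrite k0 ?leq_maxl.
apply: (le_lt_trans (nm_tri (v n) _ _)); rewrite [ltRHS]splitr ltrD ?h1 ?leq_maxr //.
by rewrite k1 ?leq_maxr.
Qed.

Definition pclosure_alg := PairAlg (pclosureW S1) pclosure_lin pclosure_mul
  pclosure_star pclosure_lim.

End Closure.

Section Generation.
Variables (I : Type) (rel : forall A : cstarAlgType R, (I -> A) -> Prop).
Variables (A : cstarAlgType R) (v : I -> A).
Hypothesis univ : is_universal rel v.
Hypothesis rel_sub : forall (G : pairalg A A) (w : I -> paT G),
  rel (fun i => pa_fst (w i)) -> (forall i, pa_fst (w i) = pa_snd (w i)) -> 
  (forall p : paT G, pa_fst p = pa_snd p) -> rel w.

(* Universality applied to the algebra of the pairs [(a, a)] with [P a] factors the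
   identity through it. *)
Lemma universal_gen (P : A -> Prop) : P 1 ->
  (forall (c : C) a b, P a -> P b -> P (c *: a + b)) ->
  (forall a b, P a -> P b -> P (a * b)) ->
  (forall a, P a -> P (star a)) ->
  (forall (u : nat -> A) a, (forall n, P (u n)) -> seq_lim u a -> P a) ->
  (forall i, P (v i)) -> forall a, P a.
Proof.
move=> P1 Plin Pmul Pstar Plim Pv.
pose rl (a b : A) := P a /\ a = b.
have r1 : rl 1 1 by [].
have r2 (c : C) a b a' b' : rl a b -> rl a' b' -> rl (c *: a + a') (c *: b + b').
  by move=> [p1 <-] [p2 <-]; split=> //; exact: Plin.
have r3 a b a' b' : rl a b -> rl a' b' -> rl (a * a') (b * b').
  by move=> [p1 <-] [p2 <-]; split=> //; exact: Pmul.
have r4 a b : rl a b -> rl (star a) (star b).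
  by move=> [p1 <-]; split=> //; exact: Pstar.
have r5 (u w : nat -> A) a b : (forall n, rl (u n) (w n)) -> seq_lim u a -> seq_lim w b -> rl a b.
  move=> h ua wb; split; first by apply: Plim ua => n; case: (h n).
  by apply: seq_lim_unique ua _; move: wb; congr seq_lim; apply/funext => n; case: (h n).
pose G := PairAlg r1 r2 r3 r4 r5.
pose w i : paT G := @pa_mk _ _ G (v i) (v i) (conj (Pv i) erefl).
have [rv ext] := univ.
have [|f [[hf fv] _]] := ext _ w.
  by apply: rel_sub => // p; case: (pa_rel_val p).
have [g [_ ug]] := ext A v rv.
have e1 : g = id by apply: ug; split.
have hfs : is_starhom (@pa_fst A A G \o f).
  have [l1 [m1 m2] s1] := hf; have [l2 [n1 n2] s2] := pa_fst_hom G.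
  split=> [c x y|//|x] /=; first by rewrite l1 l2.
    by split=> [|x y] /=; rewrite ?m1 ?n1 ?m2 ?n2.
  by rewrite s1 s2.
have e2 : g = @pa_fst A A G \o f by apply: ug; split=> // i /=; rewrite fv.
move=> a; have [h _] := pa_rel_val (f a).
by move: h; rewrite -[pa_fst (f a)]/((@pa_fst A A G \o f) a) -e2 e1.
Qed.

End Generation.
End PairAlgebra.

(** * Matrix algebras *)

Section Matrices.
Variable R : realType.
Local Notation C := R[i].
Variable T : finType.

Definition vec := {ffun T -> C^o}.

Definition vdot (x y : vec) : C := \sum_i x i * (y i)^*.

Lemma vdot_semidot : semidot vdot.
Proof.
split=> [w c u v|u v|v].
- rewrite /vdot mulr_sumr -big_split; apply: eq_bigr => i _ /=.
  by rewrite !ffunE mulrDl mulrA.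
- by rewrite /vdot conjc_sum; apply: eq_bigr => i _; rewrite conjcM conjCK mulrC.
- by apply: sumr_ge0 => i _; exact: mulcJ_ge0.
Qed.

Local Notation vn := (snorm vdot).

Lemma vn0_eq0 (x : vec) : vn x = 0 -> x = 0.
Proof.
move=> x0; have : vdot x x = 0 by rewrite (sqE vdot_semidot) -(snorm2 vdot_semidot) x0 expr0n.
move=> /eqP; rewrite psumr_eq0 => [|i _]; last exact: mulcJ_ge0.
move=> /allP h; apply/ffunP => i; rewrite ffunE; have := h i (mem_index_enum _).
by rewrite mulcJ sqrf_eq0 normr_eq0 => /eqP.
Qed.

Lemma vn_entry (x : vec) i : cabs (x i) <= vn x.
Proof.
rewrite -(@ler_pXn2r _ 2) ?nnegrE ?cabs_ge0 ?snorm_ge0 //.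
rewrite (snorm2 vdot_semidot) -lecR -(sqE vdot_semidot) -mulcJ_cabs /vdot (bigD1 i) //=.
by rewrite lerDl sumr_ge0 // => j _; exact: mulcJ_ge0.
Qed.

Lemma vn_sum (x : vec) : vn x <= \sum_i cabs (x i).
Proof.
have {1}-> : x = \sum_i x i *: ([ffun j => (i == j)%:R] : vec).
  apply/ffunP => j; rewrite sum_ffunE (bigD1 j) //= big1 => [|i ij].
    by rewrite !ffunE eqxx addr0 -[_ *: _]/(_ * _) mulr1.
  by rewrite !ffunE (negbTE ij) scaler0.
apply: (le_trans (snorm_sum vdot_semidot _ _ _)); apply: ler_sum => i _.
rewrite (snormZ vdot_semidot) -[leRHS]mulr1 ler_wpM2l ?cabs_ge0 //.
rewrite -(@ler_pXn2r _ 2) ?nnegrE ?snorm_ge0 // (snorm2 vdot_semidot) expr1n.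
rewrite -lecR -(sqE vdot_semidot) /vdot (bigD1 i) //= big1 => [|j ij].
  by rewrite !ffunE eqxx conjC1 mulr1 addr0.
by rewrite !ffunE eq_sym (negbTE ij) mul0r.
Qed.

(** Functions on pairs instead of matrices with ordinal indices, so that the models can be indexed
    by any finite type. *)
Definition opmx := {ffun T * T -> C^o}.
HB.instance Definition _ := GRing.Lmodule.on opmx.

Implicit Types M N : opmx.

Definition mapply M (x : vec) : vec := [ffun i => \sum_j M (i, j) * x j].
Definition mmul M N : opmx := [ffun p => \sum_k M (p.1, k) * N (k, p.2)].
Definition mstar M : opmx := [ffun p => (M (p.2, p.1))^*].
Definition mone : opmx := [ffun p => (p.1 == p.2)%:R].

Lemma mapplyD M N x : mapply (M + N) x = mapply M x + mapply N x.
Proof.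
apply/ffunP => i; rewrite !ffunE -big_split; apply: eq_bigr => j _ /=.
by rewrite ffunE mulrDl.
Qed.

Lemma mapplyZ c M x : mapply (c *: M) x = c *: mapply M x.
Proof.
apply/ffunP => i; rewrite !ffunE [RHS]mulr_sumr; apply: eq_bigr => j _ /=.
by rewrite ffunE mulrA.
Qed.

Lemma mapplyM M N x : mapply (mmul M N) x = mapply M (mapply N x).
Proof.
apply/ffunP => i; rewrite !ffunE.
under eq_bigr do rewrite ffunE mulr_suml.
rewrite exchange_big; apply: eq_bigr => k _ /=; rewrite ffunE mulr_sumr.
by apply: eq_bigr => j _; rewrite mulrA.
Qed.

Lemma mapply_star M x y : vdot (mapply M x) y = vdot x (mapply (mstar M) y).
Proof.
rewrite /vdot; under eq_bigr do rewrite ffunE mulr_suml.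
rewrite exchange_big; apply: eq_bigr => j _ /=; rewrite ffunE conjc_sum mulr_sumr.
by apply: eq_bigr => i _; rewrite ffunE conjcM conjCK mulrCA mulrA mulrC mulrA.
Qed.

Lemma mapply_zero M : (forall x, mapply M x = 0) -> M = 0.
Proof.
move=> h; apply/ffunP => -[i j]; rewrite ffunE.
have := h [ffun k => (j == k)%:R] => /ffunP/(_ i); rewrite !ffunE (bigD1 j) //= big1 => [|k jk].
  by rewrite ffunE eqxx mulr1 addr0.
by rewrite ffunE eq_sym (negbTE jk) mulr0.
Qed.

Definition opbound M (r : R) := 0 <= r /\ forall x, vn (mapply M x) <= r * vn x.

Lemma opbound_entries M : opbound M (\sum_p cabs (M p)).
Proof.
split=> [|x]; first by apply: sumr_ge0 => p _; exact: cabs_ge0.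
apply: (le_trans (vn_sum _)).
rewrite (eq_bigr (fun p => cabs (M (p.1, p.2)))); last by case.
rewrite -(pair_bigA _ (fun i j => cabs (M (i, j)))) /= mulr_suml.
apply: ler_sum => i _; rewrite ffunE mulr_suml; apply: (le_trans (cabs_sum _ _ _)).
by apply: ler_sum => j _; rewrite cabsM ler_wpM2l ?cabs_ge0 ?vn_entry.
Qed.

Definition opset M := [set r | opbound M r]%classic.

Lemma opset_inf M : has_inf (opset M).
Proof. by split; [exists (\sum_p cabs (M p)); exact: opbound_entries|exists 0 => r []]. Qed.

(** The operator norm for the Hilbert space of functions on [T]; the set of bounds contains the sum
    of the moduli of the entries, and its infimum is itself a bound by [opnP]. *)
Definition opn M : R := inf (opset M).

Lemma opn_ge0 M : 0 <= opn M.
Proof. by apply: lb_le_inf; [case: (opset_inf M)|move=> r []]. Qed.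

Lemma opn_le M r : opbound M r -> opn M <= r.
Proof. by move=> h; apply: ge_inf => //; case: (opset_inf M). Qed.

Lemma opnP M x : vn (mapply M x) <= opn M * vn x.
Proof.
have [x0|x0] := leP (vn x) 0.
  have {}x0 : vn x = 0 by apply/eqP; rewrite eq_le x0 snorm_ge0.
  by have [_ /(_ x)] := opbound_entries M; rewrite x0 !mulr0.
rewrite -ler_pdivrMr //; apply: lb_le_inf; first by case: (opset_inf M).
by move=> r [_ /(_ x)]; rewrite ler_pdivrMr.
Qed.

Let norm M : C := (opn M)%:C.

Let normD M N : norm (M + N) <= norm M + norm N.
Proof.
rewrite /norm -real_complexD lecR; apply: opn_le; split; first by rewrite addr_ge0 ?opn_ge0.
move=> x; rewrite mapplyD (le_trans (snormD vdot_semidot _ _)) // mulrDl.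
by rewrite lerD ?opnP.
Qed.

Let opnZ_le c M : opn (c *: M) <= cabs c * opn M.
Proof.
apply: opn_le; split; first by rewrite mulr_ge0 ?opn_ge0 ?cabs_ge0.
by move=> x; rewrite mapplyZ (snormZ vdot_semidot) -mulrA ler_wpM2l ?cabs_ge0 ?opnP.
Qed.

Let norm0 M : norm M = 0 -> M = 0.
Proof.
move=> /real_complex_inj n0; apply: mapply_zero => x; apply: vn0_eq0.
by apply/eqP; rewrite eq_le snorm_ge0 andbT; have := opnP M x; rewrite n0 mul0r.
Qed.

Let normZ (c : C) M : norm (c *: M) = `|c| * norm M.
Proof.
rewrite /norm cabsE -real_complexM; congr (_%:C).
have [->|c0] := eqVneq c 0.
  rewrite scale0r cabs0 mul0r; apply/eqP; rewrite eq_le opn_ge0 andbT.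
  by have := opnZ_le 0 0; rewrite scaler0 cabs0 mul0r.
apply/eqP; rewrite eq_le opnZ_le /=.
have := opnZ_le c^-1 (c *: M); rewrite scalerA mulVf // scale1r => h.
rewrite (le_trans (ler_wpM2l (cabs_ge0 c) h)) // mulrA -cabsM divff // cabs1 mul1r //.
Qed.

HB.instance Definition _ := Lmodule_isNormed.Build C opmx normD normZ norm0.

Lemma nm_opmx M : nm M = opn M. Proof. by []. Qed.

Lemma opn_entry M p : cabs (M p) <= opn M.
Proof.
case: p => i j; pose e : vec := [ffun k => (j == k)%:R].
have e1 : mapply M e i = M (i, j).
  rewrite ffunE (bigD1 j) //= big1 => [|k jk]; first by rewrite ffunE eqxx mulr1 addr0.
  by rewrite ffunE eq_sym (negbTE jk) mulr0.
rewrite -e1 (le_trans (vn_entry _ _)) // (le_trans (opnP _ _)) //.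
rewrite -[leRHS]mulr1 ler_wpM2l ?opn_ge0 // (le_trans (vn_sum _)) //.
rewrite (bigD1 j) //= big1 => [|k jk]; first by rewrite ffunE eqxx cabs1 addr0.
by rewrite ffunE eq_sym (negbTE jk) cabs0.
Qed.

Let complete : forall F : set_system opmx, ProperFilter F -> cauchy F -> cvg F.
Proof.
apply: complete_of_seq => u uc.
have /choice[l hl] p : exists l, forall e, 0 < e -> exists n0, forall n, (n0 <= n)%N ->
    cabs (u n p - l) < e.
  apply: complex_seq_complete => e /uc[n0 h]; exists n0 => m n hm hn.
  apply: le_lt_trans (h m n hm hn); rewrite nm_opmx.
  by have := opn_entry (u m - u n) p; rewrite !ffunE.
exists [ffun p => l p] => e e0; pose K : R := #|{: T * T}|%:R + 1.
have K0 : 0 < K by rewrite ltr_wpDl ?ler0n.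
have /choice[n0 hn0] p := hl p (e / K) (divr_gt0 e0 K0).
exists (\max_p n0 p) => n hn; rewrite nm_opmx.
apply: (le_lt_trans (opn_le (opbound_entries _))).
apply: (@le_lt_trans _ _ (\sum_(p : T * T) e / K)).
  apply: ler_sum => p _; rewrite !ffunE ltW // hn0 // (leq_trans _ hn) //.
  exact: leq_bigmax.
rewrite sumr_const -mulr_natl mulrA ltr_pdivrMr // [ltRHS]mulrC ltr_pM2r //.
by rewrite /K ltrDl.
Qed.

HB.instance Definition _ := Uniform_isComplete.Build opmx complete.

Let mmulA : associative mmul.
Proof.
move=> L M N; apply/ffunP => -[i j]; rewrite !ffunE /=.
under eq_bigr do rewrite ffunE mulr_sumr.
rewrite exchange_big; apply: eq_bigr => k _ /=; rewrite ffunE mulr_suml.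
by apply: eq_bigr => l _; rewrite mulrA.
Qed.

Let mmul1r : left_id mone mmul.
Proof.
move=> M; apply/ffunP => -[i j]; rewrite ffunE (bigD1 i) //= big1 => [|k ik].
  by rewrite ffunE eqxx mul1r addr0.
by rewrite ffunE /= eq_sym (negbTE ik) mul0r.
Qed.

Let mmulr1 : right_id mone mmul.
Proof.
move=> M; apply/ffunP => -[i j]; rewrite ffunE (bigD1 j) //= big1 => [|k ik].
  by rewrite ffunE eqxx mulr1 addr0.
by rewrite ffunE /= (negbTE ik) mulr0.
Qed.

Let mmulDl : left_distributive mmul +%R.
Proof.
move=> L M N; apply/ffunP => p; rewrite !ffunE -big_split; apply: eq_bigr => k _.
by rewrite ffunE mulrDl.
Qed.

Let mmulDr : right_distributive mmul +%R.
Proof.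
move=> L M N; apply/ffunP => p; rewrite !ffunE -big_split; apply: eq_bigr => k _.
by rewrite ffunE mulrDr.
Qed.

Let mscalerAl (k : C) M N : k *: mmul M N = mmul (k *: M) N.
Proof.
apply/ffunP => p; rewrite !ffunE [LHS]mulr_sumr; apply: eq_bigr => j _.
by rewrite ffunE mulrA.
Qed.

Let mscalerAr (k : C) M N : k *: mmul M N = mmul M (k *: N).
Proof.
apply/ffunP => p; rewrite !ffunE [LHS]mulr_sumr; apply: eq_bigr => j _.
by rewrite ffunE mulrCA.
Qed.

Let mstarK : involutive mstar.
Proof. by move=> M; apply/ffunP => -[i j]; rewrite !ffunE /= conjCK. Qed.

Let mstarD : {morph mstar : x y / x + y}.
Proof. by move=> M N; apply/ffunP => p; rewrite !ffunE conjcD. Qed.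

Let mstarZ (k : C) M : mstar (k *: M) = k^* *: mstar M.
Proof. by apply/ffunP => p; rewrite !ffunE conjcM. Qed.

Let mstarM M N : mstar (mmul M N) = mmul (mstar N) (mstar M).
Proof.
apply/ffunP => p; rewrite !ffunE conjc_sum; apply: eq_bigr => j _.
by rewrite !ffunE conjcM mulrC.
Qed.

Let mnormM M N : `|mmul M N| <= `|M| * `|N|.
Proof.
rewrite !nmE -real_complexM lecR !nm_opmx; apply: opn_le.
split=> [|x]; first by rewrite mulr_ge0 ?opn_ge0.
by rewrite mapplyM (le_trans (opnP _ _)) // -mulrA ler_wpM2l ?opn_ge0 ?opnP.
Qed.

Let opn_star_mul M : opn M ^+ 2 <= opn (mmul (mstar M) M).
Proof.
set c := opn (mmul _ _); have c0 : 0 <= c by exact: opn_ge0.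
rewrite -[c](sqr_sqrtr c0) (@ler_pXn2r _ 2) ?nnegrE ?opn_ge0 ?sqrtr_ge0 //.
apply: opn_le; split=> [|x]; first exact: sqrtr_ge0.
rewrite -(@ler_pXn2r _ 2) ?nnegrE ?mulr_ge0 ?snorm_ge0 ?sqrtr_ge0 //.
rewrite exprMn [Num.sqrt c ^+ 2]sqr_sqrtr // !(snorm2 vdot_semidot) -[sq _ _]ger0_norm ?sq_ge0 //; last exact: vdot_semidot.
rewrite -cabs_real -(sqE vdot_semidot) mapply_star -mapplyM.
rewrite (le_trans (sd_CS vdot_semidot _ _)) //.
rewrite -[in leRHS](snorm2 vdot_semidot) expr2 mulrCA.
by rewrite ler_wpM2l ?snorm_ge0 // opnP.
Qed.

Let mnorm M : `|mmul (mstar M) M| = `|M| ^+ 2.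
Proof.
have le N : opn N <= opn (mstar N).
  have [h|n0] := leP (opn N) 0; first by rewrite (le_trans h) ?opn_ge0.
  rewrite -(ler_pM2r n0) -expr2 (le_trans (opn_star_mul N)) //.
  by have := mnormM (mstar N) N; rewrite !nmE -real_complexM lecR !nm_opmx.
have st : opn (mstar M) = opn M.
  by apply/eqP; rewrite eq_le le -{2}[M]mstarK le.
rewrite !nmE -real_complexX !nm_opmx; congr (_%:C); apply/eqP.
rewrite eq_le opn_star_mul andbT.
by have := mnormM (mstar M) M; rewrite !nmE -real_complexM lecR !nm_opmx st -expr2.
Qed.

HB.instance Definition _ := isCStarAlgebra.Build R opmx mmulA mmul1r mmulr1 mmulDl
  mmulDr mscalerAl mscalerAr mstarK mstarD mstarZ mstarM mnormM mnorm.

Definition mat : cstarAlgType R := opmx.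
Definition entry (M : mat) (i j : T) : C := (M : opmx) (i, j).
Definition mat_of (F : T -> T -> C) : mat := [ffun p => F p.1 p.2] : opmx.

Lemma entry_mat_of F i j : entry (mat_of F) i j = F i j.
Proof. exact: ffunE. Qed.

Lemma matP (M N : mat) : (forall i j, entry M i j = entry N i j) -> M = N.
Proof. by move=> h; apply/(@ffunP _ (fun=> C^o)) => -[i j]; exact: h. Qed.

Lemma entryM (M N : mat) i j : entry (M * N) i j = \sum_k entry M i k * entry N k j.
Proof. exact: ffunE. Qed.

Lemma entry_star (M : mat) i j : entry (star M) i j = (entry M j i)^*.
Proof. exact: ffunE. Qed.

Lemma entry1 i j : entry 1 i j = (i == j)%:R.
Proof. exact: ffunE. Qed.

Lemma entry_scalar i j : scalar (fun M => entry M i j).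
Proof. by move=> c M N; rewrite /entry !ffunE. Qed.

Lemma cabs_entry (M : mat) i j : cabs (entry M i j) <= nm M.
Proof. exact: opn_entry. Qed.

End Matrices.

(** * Functionals, representations and elementary tensors *)

Section Functionals.
Variable R : realType.
Local Notation C := R[i].

(** A subspace maximal among those avoiding [a] is a hyperplane complementary to the line of [a].
    The functional need not be continuous, which is harmless: injectivity of the algebraic tensor
    product is tested by arbitrary bilinear forms. *)
Lemma separating_functional (V : lmodType C) (a : V) : a <> 0 ->
  exists g : V -> C, scalar g /\ g a = 1.
Proof.
move=> a0.
pose P (M : set V) := (forall (c : C) x y, M x -> M y -> M (c *: x + y)) /\ ~ M a.
have [|M [[Mlin Ma] Mmax]] := @Zorn_bigcup V P.
  move=> F FP Ftot; split; last by case=> X FX Xa; case: (FP _ FX).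
  move=> c x y [X FX Xx] [Y FY Yy].
  have [XY|YX] := Ftot X Y FX FY.
    by exists Y => //; apply: (FP _ FY).1 => //; exact: XY.
  by exists X => //; apply: (FP _ FX).1 => //; exact: YX.
(* The empty set satisfies [P] too, so a maximal [M] must be compared with [{0}] to see that it is
   nonempty. *)
have M0 : M 0.
  apply: contrapT => nM0.
  have Me x : M x -> False.
    by move=> Mx; apply: nM0; have := Mlin (-1) x x Mx Mx; rewrite scaleN1r addNr.
  apply: (Mmax [set 0]%classic).
    by split=> [x /Me//|h]; exact: nM0 (h 0 erefl).
  by split=> [c x y -> ->|/= /esym e]; [rewrite /= scaler0 addr0|exact: a0 (esym e)].
have MZ c x : M x -> M (c *: x) by move=> Mx; rewrite -[_ *: _]addr0; exact: Mlin.
(* Otherwise the span of [M] and [x] would be strictly larger than [M] and still avoid [a]. *)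
have tot x : exists l : C, M (x - l *: a).
  apply: contrapT => nx.
  pose B : set V := [set y | exists m (mu : C), M m /\ y = m + mu *: x]%classic.
  apply: (Mmax B).
    split=> [y My|h]; first by exists y, 0; rewrite scale0r addr0.
    apply: nx; exists 0; rewrite scale0r subr0; apply: h.
    by exists 0, 1; rewrite scale1r add0r.
  split=> [c y z [m [mu [h ->]]] [m' [mu' [h' ->]]]|[m [mu [h e]]]].
    exists (c *: m + m'), (c * mu + mu'); split; first exact: Mlin.
    by rewrite scalerDr scalerDl scalerA addrACA.
  have mu0 : mu != 0.
    by apply/eqP => mu0; apply: Ma; rewrite e mu0 scale0r addr0.
  apply: nx; exists mu^-1; rewrite e scalerDr scalerA mulVf // scale1r opprD addrCA.
  by rewrite subrr addr0 -scaleNr; exact: MZ.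
have uniq x l m : M (x - l *: a) -> M (x - m *: a) -> l = m.
  move=> h1 h2; have [//|] := eqVneq l m; rewrite -subr_eq0 => lm.
  case: Ma; have := Mlin (-1) _ _ h1 h2.
  rewrite scaleN1r opprB subrKA -scalerBl => /(MZ (l - m)^-1).
  by rewrite scalerA mulVf // scale1r.
have [g hg] := choice tot; exists g; split.
  move=> c x y; apply: (uniq (c *: x + y)) => //.
  have := Mlin c _ _ (hg x) (hg y).
  by rewrite scalerBr scalerA addrACA -opprD -scalerDl.
by apply: (uniq a) => //; rewrite scale1r subrr.
Qed.

Definition bdfun (A : cstarAlgType R) (phi : A -> C) :=
  scalar phi /\ exists M : R, 0 <= M /\ forall a, cabs (phi a) <= M * nm a.

Section Scalar.
Variables (V : lmodType C) (phi : V -> C).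
Hypothesis h : scalar phi.

Lemma scfD x y : phi (x + y) = phi x + phi y.
Proof. by have := h 1 x y; rewrite scale1r mul1r. Qed.

Lemma scf0 : phi 0 = 0.
Proof. by apply: (addrI (phi 0)); rewrite -scfD !addr0. Qed.

Lemma scfZ c x : phi (c *: x) = c * phi x.
Proof. by have := h c x 0; rewrite !addr0 scf0 addr0. Qed.

Lemma scfN x : phi (- x) = - phi x.
Proof. by rewrite -scaleN1r scfZ mulN1r. Qed.

Lemma scfB x y : phi (x - y) = phi x - phi y.
Proof. by rewrite scfD scfN. Qed.

Lemma scf_sum (I : Type) (r : seq I) (P : pred I) (F : I -> V) :
  phi (\sum_(i <- r | P i) F i) = \sum_(i <- r | P i) phi (F i).
Proof. exact: (big_morph _ scfD scf0). Qed.
End Scalar.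

Section Linear.
Variables (V W : lmodType C) (f : V -> W).
Hypothesis h : linear f.

Lemma lfD x y : f (x + y) = f x + f y.
Proof. by have := h 1 x y; rewrite !scale1r. Qed.

Lemma lf0 : f 0 = 0.
Proof. by apply: (addrI (f 0)); rewrite -lfD !addr0. Qed.

Lemma lfZ c x : f (c *: x) = c *: f x.
Proof. by have := h c x 0; rewrite !addr0 lf0 addr0. Qed.

Lemma lfN x : f (- x) = - f x.
Proof. by rewrite -scaleN1r lfZ scaleN1r. Qed.

Lemma lfB x y : f (x - y) = f x - f y.
Proof. by rewrite lfD lfN. Qed.

Lemma lf_sum (I : Type) (r : seq I) (P : pred I) (F : I -> V) :
  f (\sum_(i <- r | P i) F i) = \sum_(i <- r | P i) f (F i).
Proof. exact: (big_morph _ lfD lf0). Qed.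
End Linear.

Definition bounded_map (V W : normedModType C) (f : V -> W) :=
  linear f /\ exists M : R, 0 <= M /\ forall a, nm (f a) <= M * nm a.

Lemma bounded_map_lim (V W : normedModType C) (f : V -> W) u l :
  bounded_map f -> seq_lim u l -> seq_lim (f \o u) (f l).
Proof.
move=> [fl [M [M0 hM]]]; apply: (seq_lim_bound (k := M)) => n /=.
by rewrite -(lfB fl).
Qed.

Lemma bdfun_lim (A : cstarAlgType R) (phi : A -> C) (u : nat -> A) l :
  bdfun phi -> seq_lim u l -> forall e : R, 0 < e ->
  exists n0, forall n, (n0 <= n)%N -> cabs (phi (u n) - phi l) < e.
Proof.
move=> [pl [M [M0 hM]]] ul e e0; have k0 : 0 < M + 1 by rewrite ltr_wpDl.
have [n0 h0] := ul (e / (M + 1)) (divr_gt0 e0 k0).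
exists n0 => n hn; rewrite -(scfB pl); apply: (le_lt_trans (hM _)).
apply: (@le_lt_trans _ _ ((M + 1) * nm (u n - l))).
  by rewrite ler_wpM2r ?nm_ge0 // lerDl.
by rewrite mulrC -ltr_pdivlMr // h0.
Qed.

Lemma bdfun_lim0 (A : cstarAlgType R) (phi : A -> C) (u : nat -> A) l :
  bdfun phi -> seq_lim u l -> (forall n, phi (u n) = 0) -> phi l = 0.
Proof.
move=> hp ul u0; apply: cabs_le0; apply: le_eps => e e0; rewrite add0r.
have [n0 h0] := bdfun_lim hp ul e0.
by have := h0 n0 (leqnn _); rewrite u0 sub0r cabsN => /ltW.
Qed.

(** The bound makes the linear relation [S] single-valued and carries Cauchy sequences of the domain
    to Cauchy sequences of values. A relation is convenient because finite sums of elementary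
    tensors have many presentations. *)
Lemma extend_linear (V : normedModType C) (W : completeNormedModType C)
    (S : V -> W -> Prop) (M : R) : 0 <= M ->
  (forall (c : C) a b a' b', S a b -> S a' b' -> S (c *: a + a') (c *: b + b')) ->
  (forall a b, S a b -> nm b <= M * nm a) ->
  (forall a (e : R), 0 < e -> exists a' b', S a' b' /\ nm (a - a') < e) ->
  exists f : V -> W, [/\ linear f, forall a, nm (f a) <= M * nm a &
    forall a b, S a b -> f a = b].
Proof.
move=> M0 Slin SM Sd.
have SB a b a' b' : S a b -> S a' b' -> S (a - a') (b - b').
  by move=> h h'; have := Slin (-1) _ _ _ _ h' h; rewrite !scaleN1r ![- _ + _]addrC.
have appr a : exists u : nat -> V * W, (forall n, S (u n).1 (u n).2) /\
    seq_lim (fun n => (u n).1) a.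
  have /choice[u hu] (n : nat) : exists p : V * W, S p.1 p.2 /\ nm (a - p.1) < n.+1%:R^-1.
    have [|a' [b' h]] := Sd a (n.+1%:R^-1); first by rewrite invr_gt0 ltr0n.
    by exists (a', b').
  exists u; split=> [n|e e0]; first by case: (hu n).
  exists (Num.truncn e^-1).+1 => n hn; rewrite nmB.
  apply: (lt_trans (hu n).2); rewrite -[ltRHS]invrK ltf_pV2 ?posrE ?invr_gt0 ?ltr0n //.
  by apply: (lt_le_trans (truncnS_gt _)); rewrite ler_nat; apply: leq_trans hn _.
pose G a b := exists u : nat -> V * W, [/\ forall n, S (u n).1 (u n).2,
    seq_lim (fun n => (u n).1) a & seq_lim (fun n => (u n).2) b].
have GM a b : G a b -> nm b <= M * nm a.
  move=> [u [h1 h2 h3]]; apply: le_eps => e e0; have k0 : 0 < M + 1 by rewrite ltr_wpDl.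
  have e20 : 0 < e / 2 by rewrite divr_gt0.
  have [n0 h0] := h2 _ (divr_gt0 e20 k0).
  have [n1 h1'] := h3 _ e20; pose n := maxn n0 n1.
  have {}h0 := h0 n (leq_maxl _ _); have {}h1' := h1' n (leq_maxr _ _).
  have {}h1 := SM _ _ (h1 n).
  have a2 := nmD (b - (u n).2) (u n).2; rewrite subrK in a2.
  have a3 := nmD ((u n).1 - a) a; rewrite subrK in a3.
  rewrite nmB in h1'.
  have a4 : (M + 1) * nm ((u n).1 - a) <= e / 2 by rewrite mulrC -ler_pdivlMr // ltW.
  have a5 := ler_wpM2l M0 a3; have a6 := nm_ge0 ((u n).1 - a).
  rewrite mulrDr in a5; rewrite mulrDl mul1r in a4; lra.
have Gtot a : exists b, G a b.
  have [u [h1 h2]] := appr a.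
  have [|b hb] := seq_complete (u := fun n => (u n).2).
    move=> e e0; have k0 : 0 < M + 1 by rewrite ltr_wpDl.
    have [n0 h0] := h2 (e / 2 / (M + 1)) (divr_gt0 (divr_gt0 e0 (ltr0Sn _ _)) k0).
    exists n0 => m n hm hn; apply: (le_lt_trans (SM _ _ (SB _ _ _ _ (h1 m) (h1 n)))).
    have := h0 m hm; have := h0 n hn; rewrite !ltr_pdivlMr //.
    have := nm_tri a (u m).1 (u n).1; rewrite [nm (a - _)]nmB.
    have := nm_ge0 ((u m).1 - a); have := nm_ge0 ((u n).1 - a).
    by move: (nm _) (nm ((u m).1 - a)) (nm ((u m).1 - (u n).1)) => x y z x0 y0 hz hx hy; nra.
  by exists b, u.
have Glin (c : C) a b a' b' : G a b -> G a' b' -> G (c *: a + a') (c *: b + b').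
  move=> [u [h1 h2 h3]] [u' [h1' h2' h3']].
  exists (fun n => (c *: (u n).1 + (u' n).1, c *: (u n).2 + (u' n).2)); split.
  - by move=> n; exact: Slin.
  - exact: seq_limD (seq_limZ c h2) h2'.
  - exact: seq_limD (seq_limZ c h3) h3'.
have [f hf] := choice Gtot.
have uniq a b : G a b -> f a = b.
  move=> h; apply/eqP; rewrite -subr_eq0; apply/eqP/nm_le0.
  have := GM _ _ (Glin (-1) _ _ _ _ h (hf a)).
  by rewrite !scaleN1r addNr nm0 mulr0 addrC.
exists f; split=> [c x y|a|a b h]; [exact/uniq/Glin|exact/GM/hf|].
by apply: uniq; exists (fun=> (a, b)); split=> // ; exact: seq_lim_cst.
Qed.

End Functionals.

Section Representations.
Variable R : realType.
Local Notation C := R[i].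

Section One.
Variables (A : cstarAlgType R) (pi : representation A).
Local Notation H := (rep_space pi).
Local Notation dot := (hdot H).

Lemma repD a b x : pi (a + b) x = pi a x + pi b x.
Proof. exact: (lfD (rep_linearl (r := pi) x)). Qed.

Lemma repZ c a x : pi (c *: a) x = c *: pi a x.
Proof. exact: (lfZ (rep_linearl (r := pi) x)). Qed.

Lemma repB a b x : pi (a - b) x = pi a x - pi b x.
Proof. exact: (lfB (rep_linearl (r := pi) x)). Qed.

Lemma rep_sum (I : Type) (r : seq I) (P : pred I) (F : I -> A) x :
  pi (\sum_(i <- r | P i) F i) x = \sum_(i <- r | P i) pi (F i) x.
Proof. exact: (lf_sum (rep_linearl (r := pi) x)). Qed.

(** Boundedness is not a field of [representation]: it follows from a square root [k] of
    [1 - a^* a / |a|^2], since [<k^2 x, x> = |k x|^2] is nonnegative. *)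
Lemma rep_le a x : nm (pi a x) <= nm a * nm x.
Proof.
apply: le_eps => e e0; rewrite -(@ler_pXn2r _ 2) ?nnegrE ?nm_ge0 ?addr_ge0 ?mulr_ge0 ?nm_ge0 ?(ltW e0) //.
apply: (@le_trans _ _ ((nm a * nm x) ^+ 2)); last first.
  by rewrite ler_pXn2r ?nnegrE ?addr_ge0 ?mulr_ge0 ?nm_ge0 ?(ltW e0) // lerDl ltW.
have [a0|a0] := leP (nm a) 0.
  rewrite (nm_le0 a0); have -> : pi 0 x = 0 by exact: (lf0 (rep_linearl (r := pi) x)).
  by rewrite !nm0 mul0r.
pose r : R := (nm a ^+ 2)^-1.
have r0 : 0 < r by rewrite invr_gt0 exprn_gt0.
pose h : A := r%:C *: (star a * a).
have sh : star h = h by apply: sa_scale; rewrite starMr starK.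
have h1 : nm h <= 1.
  by rewrite nmZ cabs_real gtr0_norm // nm_starM mulVf // gt_eqF // exprn_gt0.
have [||k [sk kk _ _]] := @sqrt_exists _ _ (1 - h).
- by rewrite starB star1 sh.
- by rewrite subKr.
have : 0 <= dot (pi (k * k) x) x by rewrite repM rep_star sk hdotE exprn_ge0.
rewrite kk repB rep1 repZ repM.
have hd := hdot_semidot H.
rewrite (sdDl hd) (sdNl hd) (sdZl hd) rep_star starK !hdotE !nmE -!real_complexX -real_complexM.
rewrite -rmorphB /= ler0c subr_ge0 /r ler_pdivrMl ?exprn_gt0 // exprMn.
done.
Qed.

Lemma rep_fun x y : bdfun (fun a => dot (pi a x) y).
Proof.
have hd := hdot_semidot H; split.
  by move=> c a b; rewrite repD repZ (sdDl hd) (sdZl hd).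
exists (nm x * nm y); split=> [|a]; first by rewrite mulr_ge0 ?nm_ge0.
apply: (le_trans (sd_CS hd _ _)).
rewrite /snorm !sq_hdot !sqrtr_sqr !ger0_norm ?nm_ge0 //.
by rewrite mulrAC ler_wpM2r ?nm_ge0 // mulrC rep_le.
Qed.

End One.

Variable ten : spatialTensor R.

(** * Elementary tensors and finite sums of them *)

Section Two.
Variables A B : cstarAlgType R.
Local Notation l := (@tinl R ten A B).
Local Notation r := (@tinr R ten A B).
Local Notation tp := (@tprod R ten A B).

Lemma tinl_hom : is_starhom l. Proof. exact: (spatial_l (tensP ten A B)). Qed.
Lemma tinr_hom : is_starhom r. Proof. exact: (spatial_r (tensP ten A B)). Qed.

Lemma tprodM a b a' b' : tp a b * tp a' b' = tp (a * a') (b * b').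
Proof.
rewrite /tprod (starhomM tinl_hom) (starhomM tinr_hom) -!mulrA; congr (_ * _).
by rewrite !mulrA -(spatial_comm (tensP ten A B)).
Qed.

Lemma tprod_star a b : star (tp a b) = tp (star a) (star b).
Proof.
rewrite /tprod starMr -(starhom_star tinl_hom) -(starhom_star tinr_hom).
by rewrite (spatial_comm (tensP ten A B)).
Qed.

Lemma tprodDl a a' b : tp (a + a') b = tp a b + tp a' b.
Proof. by rewrite /tprod (starhomD tinl_hom) mulrDl. Qed.

Lemma tprodDr a b b' : tp a (b + b') = tp a b + tp a b'.
Proof. by rewrite /tprod (starhomD tinr_hom) mulrDr. Qed.

Lemma tprodZl c a b : tp (c *: a) b = c *: tp a b.
Proof. by rewrite /tprod (starhomZ tinl_hom) -scaleAl. Qed.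

Lemma tprodZr c a b : tp a (c *: b) = c *: tp a b.
Proof. by rewrite /tprod (starhomZ tinr_hom) -scaleAr. Qed.

Lemma tprod0l b : tp 0 b = 0.
Proof. by rewrite /tprod (starhom0 tinl_hom) mul0r. Qed.

Lemma tprod0r a : tp a 0 = 0.
Proof. by rewrite /tprod (starhom0 tinr_hom) mulr0. Qed.

Lemma tprodNl a b : tp (- a) b = - tp a b.
Proof. by rewrite -scaleN1r tprodZl scaleN1r. Qed.

Lemma tprodBl a a' b : tp (a - a') b = tp a b - tp a' b.
Proof. by rewrite tprodDl tprodNl. Qed.

Lemma tprod_suml (I : Type) (s : seq I) (P : pred I) (F : I -> A) b :
  tp (\sum_(i <- s | P i) F i) b = \sum_(i <- s | P i) tp (F i) b.
Proof. by apply: (big_morph (tp^~ b)); [move=> x y; exact: tprodDl|exact: tprod0l]. Qed.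

Lemma tprod_sumr (I : Type) (s : seq I) (P : pred I) (F : I -> B) a :
  tp a (\sum_(i <- s | P i) F i) = \sum_(i <- s | P i) tp a (F i).
Proof. by apply: (big_morph (tp a)); [move=> x y; exact: tprodDr|exact: tprod0r]. Qed.

Lemma tprod1l a : tp a 1 = l a.
Proof. by rewrite /tprod (starhom1 tinr_hom) mulr1. Qed.

Lemma tprod1r b : tp 1 b = r b.
Proof. by rewrite /tprod (starhom1 tinl_hom) mul1r. Qed.

Lemma tprod11 : tp 1 1 = 1.
Proof. by rewrite tprod1l (starhom1 tinl_hom). Qed.

Definition tsum (t : seq (A * B)) : ten A B := \sum_(p <- t) tp p.1 p.2.

Lemma tsum_dense x (e : R) : 0 < e -> exists t, nm (x - tsum t) < e.
Proof.
move=> e0; have /dense_nm/(_ x e e0)[_ [t ->] h] := spatial_dense (tensP ten A B).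
by exists t.
Qed.

Lemma tsum_lin c s t : exists t', c *: tsum s + tsum t = tsum t' /\
  forall (W : lmodType C) (f : A -> B -> W), (forall a b, f (c *: a) b = c *: f a b) ->
    c *: (\sum_(p <- s) f p.1 p.2) + \sum_(p <- t) f p.1 p.2 = \sum_(p <- t') f p.1 p.2.
Proof.
exists ([seq (c *: p.1, p.2) | p <- s] ++ t).
have h (W : lmodType C) (f : A -> B -> W) : (forall a b, f (c *: a) b = c *: f a b) ->
    c *: (\sum_(p <- s) f p.1 p.2) + \sum_(p <- t) f p.1 p.2 =
    \sum_(p <- [seq (c *: p.1, p.2) | p <- s] ++ t) f p.1 p.2.
  move=> fZ; rewrite big_cat big_map scaler_sumr; congr (_ + _).
  by apply: eq_bigr => p _; rewrite fZ.
by split=> //; apply: h => a b; exact: tprodZl.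
Qed.

Lemma tens_ext (W : normedModType C) (f g : ten A B -> W) :
  bounded_map f -> bounded_map g -> (forall a b, f (tp a b) = g (tp a b)) -> f =1 g.
Proof.
move=> bf bg fg x; have [u [hS ux]] := dense_seq (spatial_dense (tensP ten A B)) x.
apply: (seq_lim_unique (u := f \o u)); first exact: bounded_map_lim.
have -> : f \o u = g \o u; last exact: bounded_map_lim.
apply/funext => n /=; have [t ->] := hS n.
by rewrite (lf_sum bf.1) (lf_sum bg.1); apply: eq_bigr => p _; exact: fg.
Qed.

Lemma tens_fun_ext (f g : ten A B -> C) : bdfun f -> bdfun g ->
  (forall a b, f (tp a b) = g (tp a b)) -> f =1 g.
Proof.
move=> [fl [M [M0 fM]]] [gl [M' [M'0 gM]]] fg x.
have [u [hS ux]] := dense_seq (spatial_dense (tensP ten A B)) x.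
have b : bdfun (fun y => f y - g y).
  split; first by move=> c y z; rewrite fl gl mulrBr opprD addrACA.
  exists (M + M'); split=> [|y]; first exact: addr_ge0.
  by rewrite (le_trans (cabsD _ _)) // cabsN mulrDl lerD.
apply/eqP; rewrite -subr_eq0; apply/eqP; apply: (bdfun_lim0 b ux) => n.
have [t ->] := hS n; rewrite (scf_sum fl) (scf_sum gl) -sumrB big1 // => p _.
by apply/eqP; rewrite subr_eq0; apply/eqP; exact: fg.
Qed.

Lemma tens_algebraic_inj (t : seq (A * B)) : tsum t = 0 ->
  forall (g : A -> C) (g' : B -> C), scalar g -> scalar g' ->
    \sum_(p <- t) g p.1 * g' p.2 = 0.
Proof.
move=> t0 g g' hg hg'; pose h := fun x y => g x * g' y.
have bl : bilinear_for *%R *%R h.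
  by split=> [u' c x y|u c x y]; rewrite /h ?hg ?hg' /=; ring.
pose Bh : {bilinear A -> B -> C | *%R & *%R} :=
  HB.pack h (bilinear_isBilinear.Build C A B C *%R *%R h bl).
exact: (spatial_inj (tensP ten A B) t0 Bh).
Qed.

(** For nonzero [a], functionals equal to [1] at [a] and at the unit of [B] multiply to a bilinear
    form that detects [a (x) 1]. *)
Lemma tinl_inj a : (1 : B) <> 0 -> l a = 0 -> a = 0.
Proof.
move=> b0 la; apply: contrapT => a0.
have [g [hg ga]] := separating_functional a0; have [g' [hg' gb]] := separating_functional b0.
have := @tens_algebraic_inj [:: (a, 1)] _ g g' hg hg'.
rewrite !big_seq1 ga gb mulr1 => /(_ _)/eqP; rewrite oner_eq0.
by move=> h; have /h : tsum [:: (a, 1)] = 0 by rewrite /tsum big_seq1 tprod1l.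
Qed.

Lemma tsum_rep_le t (pi : representation A) (rho : representation B)
    (s : seq (rep_space pi * rep_space rho)) :
  complex.Re (tensor_sqnorm (tensor_act t s)) <=
  nm (tsum t) ^+ 2 * complex.Re (tensor_sqnorm s).
Proof.
have hs (s' : seq (rep_space pi * rep_space rho)) : 0 <= tensor_sqnorm s'.
  exact: (schur_ge0 s' (hdot_semidot _) (hdot_semidot _)).
have n0 : 0 <= (nm (tsum t))%:C :> C by rewrite ler0c nm_ge0.
have [/(_ _) h _] := spatial_norm (tensP ten A B) t n0.
have := h _ pi rho s; rewrite -nmE => /(_ (lexx _)).
by rewrite (ge0_complexE (hs s)) (ge0_complexE (hs (tensor_act t s))) nmE -real_complexX -real_complexM lecR.
Qed.

Lemma tsum_le t (c : R) : 0 <= c ->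
  (forall (pi : representation A) (rho : representation B)
    (s : seq (rep_space pi * rep_space rho)),
    complex.Re (tensor_sqnorm (tensor_act t s)) <= c ^+ 2 * complex.Re (tensor_sqnorm s)) ->
  nm (tsum t) <= c.
Proof.
move=> c0 h.
have hs (pi : representation A) (rho : representation B)
    (s' : seq (rep_space pi * rep_space rho)) : 0 <= tensor_sqnorm s'.
  exact: (schur_ge0 s' (hdot_semidot _) (hdot_semidot _)).
have n0 : 0 <= c%:C :> C by rewrite ler0c.
rewrite -nm_le; apply: (spatial_norm (tensP ten A B) t n0).2 => pi rho s.
by rewrite (ge0_complexE (hs pi rho s)) (ge0_complexE (hs pi rho (tensor_act t s))) -real_complexX -real_complexM lecR.
Qed.

End Two.
End Representations.

(** * Slice maps and morphisms of tensor products *)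

Lemma starhom_comp (R : realType) (V W Z : cstarAlgType R) (p : V -> W) (q : W -> Z) :
  is_starhom p -> is_starhom q -> is_starhom (q \o p).
Proof.
move=> [l1 [m1 m2] s1] [l2 [n1 n2] s2]; split=> [c x y|//|x] /=; first by rewrite l1 l2.
  by split=> [|x y] /=; rewrite ?m1 ?n1 ?m2 ?n2.
by rewrite s1 s2.
Qed.

Section Slices.
Variable R : realType.
Local Notation C := R[i].
Variable ten : spatialTensor R.

(** As [tinl] is injective, hence isometric, the norm of [a] is that of [a (x) 1] in [ten A A],
    which is a supremum over pairs of representations. *)
Lemma rep_norming (A : cstarAlgType R) (a : A) (c : R) : 0 <= c ->
  (forall (pi : representation A) x, nm (pi a x) <= c * nm x) -> nm a <= c.
Proof.
move=> c0 h; have [e|n1] := pselect ((1 : A) = 0).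
  by rewrite -[a]mulr1 e mulr0 nm0.
apply: (le_trans (starhom_inj_le (tinl_hom ten A A) (fun x => tinl_inj n1 (a := x)) a)).
rewrite -tprod1l; have -> : tprod ten a (1 : A) = tsum ten [:: (a, 1)] by rewrite /tsum big_seq1.
apply: tsum_le => // pi rho s.
have hd := hdot_semidot (rep_space pi); have hk := hdot_semidot (rep_space rho).
(* The bound [c] says that this form is positive; its Schur product with the inner product of the
   second factor carries the bound over to [pi (x) rho]. *)
pose f (x y : rep_space pi) : C := (c ^+ 2)%:C * hdot _ x y - hdot _ (pi a x) (pi a y).
have sf : semidot f.
  have piD x y k : pi a (k *: x + y) = k *: pi a x + pi a y by exact: rep_linear.
  split=> [w k u v|u v|v]; rewrite /f.
  - by rewrite piD (sdDl hd) (sdZl hd) (sdDl hd) (sdZl hd); ring.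
  - by rewrite conjcD conjcN conjcM conjr -!(sdC hd).
  - rewrite !hdotE !nmE -!real_complexX -real_complexM -rmorphB /= ler0c subr_ge0 -exprMn.
    by rewrite ler_pXn2r ?nnegrE ?mulr_ge0 ?nm_ge0.
have := schur_ge0 s sf hk.
have -> : \sum_(p <- s) \sum_(q <- s) f p.1 q.1 * hdot _ p.2 q.2 =
  (c ^+ 2)%:C * tensor_sqnorm s - tensor_sqnorm (tensor_act [:: (a, 1)] s).
  rewrite /tensor_sqnorm /tensor_act /= cats0 big_map mulr_sumr -sumrB.
  apply: eq_bigr => p _; rewrite big_map mulr_sumr -sumrB; apply: eq_bigr => q _ /=.
  by rewrite /f !rep1; ring.
have h1 := schur_ge0 s hd hk; rewrite -/(tensor_sqnorm s) in h1.
have h2 := schur_ge0 (tensor_act [:: (a, 1)] s) hd hk.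
rewrite -/(tensor_sqnorm _) in h2.
rewrite (ge0_complexE h1) (ge0_complexE h2) -real_complexM -rmorphB /= ler0c subr_ge0.
done.
Qed.

Lemma hdot_norm_le (H : hilbertSpace R) (x : H) (c : R) : 0 <= c ->
  (forall y, cabs (hdot H x y) <= c * nm y) -> nm x <= c.
Proof.
move=> c0 /(_ x); rewrite hdotE nmE -real_complexX cabs_real ger0_norm ?sqr_ge0 // expr2.
by have [|x0] := leP (nm x) 0; [move=> h _; apply: le_trans h c0|rewrite ler_pM2r].
Qed.

Lemma rep_norming_form (A : cstarAlgType R) (a : A) (c : R) : 0 <= c ->
  (forall (pi : representation A) x y, cabs (hdot _ (pi a x) y) <= c * nm x * nm y) ->
  nm a <= c.
Proof.
move=> c0 h; apply: rep_norming => // pi x; apply: hdot_norm_le => // .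
by rewrite mulr_ge0 ?nm_ge0.
Qed.

Lemma rep_sep (A : cstarAlgType R) (a : A) :
  (forall (pi : representation A) x y, hdot _ (pi a x) y = 0) -> a = 0.
Proof.
by move=> h; apply: nm_le0; apply: rep_norming_form => // pi x y; rewrite h cabs0 !mul0r.
Qed.

Lemma bdfun_sep (A : cstarAlgType R) (a : A) :
  (forall phi : A -> C, bdfun phi -> phi a = 0) -> a = 0.
Proof. by move=> h; apply: rep_sep => pi x y; exact: (h _ (rep_fun _ _)). Qed.

(** In a representation, the term of index [i] contributes [|pi(star F_i) x|^2] to the diagonal
    coefficient at [x], so all of these vanish. Trace computations over [A] are concluded in this
    way below. *)
Lemma sum_mul_star_eq0 (A : cstarAlgType R) (I : finType) (P : pred I) (F : I -> A) :
  \sum_(i | P i) F i * star (F i) = 0 -> forall i, P i -> F i = 0.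
Proof.
move=> s0 i Pi; rewrite -[F i]starK -[RHS]star0; congr star.
apply: rep_sep => pi x y.
have hd := hdot_semidot (rep_space pi).
have e : \sum_(j | P j) hdot _ (pi (star (F j)) x) (pi (star (F j)) x) = 0.
  have e0 : hdot _ (pi 0 x) x = 0 by rewrite (lf0 (rep_linearl (r := pi) x)) (sd0l hd).
  rewrite -[RHS]e0 -s0 rep_sum (sd_suml hd).
  by apply: eq_bigr => j _; rewrite repM [RHS]rep_star.
have := e => /eqP; rewrite psumr_eq0 => [|j _]; last exact: (sd_ge0 hd).
move=> /allP/(_ i (mem_index_enum _)); rewrite Pi /= => /eqP h.
by rewrite (sdC hd) (sd_null hd y h) rmorph0.
Qed.

Section Two.
Variables A B : cstarAlgType R.
Local Notation tp := (@tprod R ten A B).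
Local Notation T := (tsum ten (A := A) (B := B)).

(** Cauchy-Schwarz between the image of [h (x) k] and the vector [h' (x) k']. *)
Lemma tsum_form t (pi : representation A) (rho : representation B) h h' k k' :
  cabs (\sum_(p <- t) hdot _ (pi p.1 h) h' * hdot _ (rho p.2 k) k') <=
  nm (T t) * nm h * nm h' * nm k * nm k'.
Proof.
have hd := hdot_semidot (rep_space pi); have hk := hdot_semidot (rep_space rho).
pose s := [:: (h, k)].
have := tform_CS (tensor_act t s) [:: (h', k')] hd hk.
rewrite {1}/tform; under eq_bigr do rewrite big_seq1.
rewrite /tensor_act /s /= (_ : [seq _ | x <- t, p <- [:: (h, k)]] = [seq (pi p.1 h, rho p.2 k) | p <- t]); last first.
  by elim: t {s} => //= p t ->.
rewrite big_map /=.
have := tsum_rep_le ten t s; rewrite /s /tensor_act /= (_ : [seq _ | x <- t, p <- [:: (h, k)]] = [seq (pi p.1 h, rho p.2 k) | p <- t]); last first.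
  by elim: t {s} => //= p t ->.
rewrite /tensor_sqnorm big_seq1 big_seq1 /= /tform [X in _ -> _ <= _ * complex.Re X -> _]big_seq1 big_seq1 /=.
rewrite !hdotE !nmE -!real_complexX -!real_complexM /= -!exprMn => h1 h2.
rewrite -(@ler_pXn2r _ 2) ?nnegrE ?cabs_ge0 ?mulr_ge0 ?nm_ge0 //.
apply: (le_trans h2); apply: le_trans (ler_wpM2r (sqr_ge0 _) h1) _.
by rewrite -!exprMn le_eqVlt; apply/orP; left; apply/eqP; congr (_ ^+ 2); ring.
Qed.

Definition sliceR_spec (psi : B -> C) (f : ten A B -> A) :=
  bounded_map f /\ forall a b, f (tp a b) = psi b *: a.
Definition sliceL_spec (phi : A -> C) (f : ten A B -> B) :=
  bounded_map f /\ forall a b, f (tp a b) = phi a *: b.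

(** The slice map [id (x) psi]. Its defining property is meaningful once [psi] is bounded; the
    choice is then unique by density. *)
Definition sliceR psi : ten A B -> A := get (sliceR_spec psi).
Definition sliceL phi : ten A B -> B := get (sliceL_spec phi).

(** The norm bound uses matrix coefficients twice: a coefficient of the slice is [psi] applied to a
    slice on the other side, whose norm is again tested on coefficients, and [tsum_form] bounds the
    outcome. *)
Lemma sliceRP psi : bdfun psi -> sliceR_spec psi (sliceR psi).
Proof.
move=> [pl [M [M0 hM]]]; rewrite /sliceR; apply: (@getPex _ (sliceR_spec psi)).
pose S x y := exists t, x = T t /\ y = \sum_(p <- t) psi p.2 *: p.1.
have [|||f [fl fM fS]] := @extend_linear R (ten A B) A S M M0.
- move=> c _ _ _ _ [s [-> ->]] [t [-> ->]]; have [t' [e h]] := tsum_lin ten c s t.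
  exists t'; split=> //; apply: (h A (fun a b => psi b *: a)) => a b.
  by rewrite !scalerA mulrC.
- move=> _ _ [t [-> ->]]; apply: rep_norming_form => [|pi x y]; first by rewrite mulr_ge0 ?nm_ge0.
  have hd := hdot_semidot (rep_space pi).
  have -> : hdot _ (pi (\sum_(p <- t) psi p.2 *: p.1) x) y =
      psi (\sum_(p <- t) hdot _ (pi p.1 x) y *: p.2).
    rewrite rep_sum (sd_suml hd) (scf_sum pl); apply: eq_bigr => p _.
    by rewrite repZ (sdZl hd) (scfZ pl) mulrC.
  apply: (le_trans (hM _)); rewrite -!mulrA ler_wpM2l //.
  apply: rep_norming_form => [|rho k k']; first by rewrite !mulr_ge0 ?nm_ge0.
  rewrite rep_sum (sd_suml (hdot_semidot _)).
  under eq_bigr do rewrite repZ (sdZl (hdot_semidot _)).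
  by rewrite !mulrA; exact: tsum_form.
- move=> x e e0; have [t ht] := tsum_dense (ten := ten) x e0.
  by exists (T t), (\sum_(p <- t) psi p.2 *: p.1); split=> //; exists t.
exists f; split; first by split=> //; exists M.
by move=> a b; apply: fS; exists [:: (a, b)]; rewrite /tsum !big_seq1.
Qed.

Lemma sliceLP phi : bdfun phi -> sliceL_spec phi (sliceL phi).
Proof.
move=> [pl [M [M0 hM]]]; rewrite /sliceL; apply: (@getPex _ (sliceL_spec phi)).
pose S x y := exists t, x = T t /\ y = \sum_(p <- t) phi p.1 *: p.2.
have [|||f [fl fM fS]] := @extend_linear R (ten A B) B S M M0.
- move=> c _ _ _ _ [s [-> ->]] [t [-> ->]]; have [t' [e h]] := tsum_lin ten c s t.
  exists t'; split=> //; apply: (h B (fun a b => phi a *: b)) => a b.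
  by rewrite !scalerA (scfZ pl).
- move=> _ _ [t [-> ->]]; apply: rep_norming_form => [|rho x y]; first by rewrite mulr_ge0 ?nm_ge0.
  have hd := hdot_semidot (rep_space rho).
  have -> : hdot _ (rho (\sum_(p <- t) phi p.1 *: p.2) x) y =
      phi (\sum_(p <- t) hdot _ (rho p.2 x) y *: p.1).
    rewrite rep_sum (sd_suml hd) (scf_sum pl); apply: eq_bigr => p _.
    by rewrite repZ (sdZl hd) (scfZ pl) mulrC.
  apply: (le_trans (hM _)); rewrite -!mulrA ler_wpM2l //.
  apply: rep_norming_form => [|pi k k']; first by rewrite !mulr_ge0 ?nm_ge0.
  rewrite rep_sum (sd_suml (hdot_semidot _)).
  under eq_bigr do rewrite repZ (sdZl (hdot_semidot _)) mulrC.
  apply: (le_trans (tsum_form t k k' x y)); rewrite le_eqVlt; apply/orP; left.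
  by apply/eqP; ring.
- move=> x e e0; have [t ht] := tsum_dense (ten := ten) x e0.
  by exists (T t), (\sum_(p <- t) phi p.1 *: p.2); split=> //; exists t.
exists f; split; first by split=> //; exists M.
by move=> a b; apply: fS; exists [:: (a, b)]; rewrite /tsum !big_seq1.
Qed.

End Two.

Lemma bdfun_comp (V W : cstarAlgType R) (f : V -> W) (phi : W -> C) :
  bdfun phi -> bounded_map f -> bdfun (phi \o f).
Proof.
move=> [pl [M [M0 hM]]] [fl [K [K0 hK]]]; split.
  by move=> c x y /=; rewrite fl pl.
exists (M * K); split=> [|a /=]; first exact: mulr_ge0.
by rewrite (le_trans (hM _)) // -mulrA ler_wpM2l.
Qed.

Lemma starhom_bounded (V W : cstarAlgType R) (f : V -> W) : is_starhom f -> bounded_map f.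
Proof.
move=> hf; split; first by case: hf.
by exists 1; split=> // a; rewrite mul1r starhom_le.
Qed.

Lemma bdfun_sum (I : Type) (r : seq I) (V : cstarAlgType R) (F : I -> V -> C) :
  (forall i, bdfun (F i)) -> bdfun (fun x => \sum_(i <- r) F i x).
Proof.
move=> h; elim: r => [|i r [il [M [M0 hM]]]].
  split=> [c x y|]; first by rewrite !big_nil mulr0 addr0.
  by exists 0; split=> // a; rewrite big_nil cabs0 mul0r.
have [jl [K [K0 hK]]] := h i; split=> [c x y|].
  by rewrite !big_cons il jl mulrDr addrACA.
exists (K + M); split=> [|a]; first exact: addr_ge0.
by rewrite big_cons (le_trans (cabsD _ _)) // mulrDl lerD.
Qed.

(** The product functional [phi (x) psi]. *)
Definition pfun (A B : cstarAlgType R) (phi : A -> C) (psi : B -> C) (x : ten A B) : C :=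
  phi (sliceR psi x).

Section Product.
Variables (A B : cstarAlgType R) (phi : A -> C) (psi : B -> C).
Hypotheses (bphi : bdfun phi) (bpsi : bdfun psi).

Lemma pfun_bounded : bdfun (pfun phi psi).
Proof. by have [b _] := sliceRP A bpsi; exact: (bdfun_comp bphi b). Qed.

Lemma pfunE a b : pfun phi psi (tprod ten a b) = phi a * psi b.
Proof. by rewrite /pfun (sliceRP A bpsi).2 (scfZ bphi.1) mulrC. Qed.

Lemma pfun_sliceL x : pfun phi psi x = psi (sliceL phi x).
Proof.
move: x; apply: (@tens_fun_ext R ten A B); first exact: pfun_bounded.
  by have [b _] := sliceLP B bphi; exact: (bdfun_comp bpsi b).
by move=> a b; rewrite pfunE (sliceLP B bphi).2 (scfZ bpsi.1).
Qed.

End Product.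

Lemma bdfun_le (A B : cstarAlgType R) (F : ten A B -> C) (K : R) : bdfun F ->
  (forall t, cabs (F (tsum ten t)) <= K * nm (tsum ten t)) -> 0 <= K ->
  forall x, cabs (F x) <= K * nm x.
Proof.
move=> bF h K0 x; apply: le_eps => e e0.
have [u [hS ux]] := dense_seq (spatial_dense (tensP ten A B)) x.
have e20 : 0 < e / 2 by rewrite divr_gt0.
have [n0 h0] := bdfun_lim bF ux e20.
have K1 : 0 < K + 1 by rewrite ltr_wpDl.
have [n1 h1] := ux _ (divr_gt0 e20 K1); pose n := maxn n0 n1.
have {}h0 := h0 n (leq_maxl _ _); have {}h1 := h1 n (leq_maxr _ _).
have [t et] := hS n; rewrite -/(tsum ten t) in et; rewrite et in h0 h1; have ht := h t.
have a1 := cabsD (F x - F (tsum ten t)) (F (tsum ten t)); rewrite subrK in a1.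
rewrite -cabsN opprB in h0.
have a2 := nmD (tsum ten t - x) x; rewrite subrK in a2.
have a3 := ler_wpM2l K0 a2; rewrite mulrDr in a3.
have a4 : (K + 1) * nm (tsum ten t - x) <= e / 2 by rewrite mulrC -ler_pdivlMr // ltW.
have a5 := nm_ge0 (tsum ten t - x); rewrite mulrDl mul1r in a4; lra.
Qed.

(** Approximate [y] by a finite sum [t] and put [N = (pi (x) rho)(t) s] for a vector [s]. The
    functional [Om], which pairs the image of [s] with [N], is a sum of product functionals, so it
    vanishes at [y], and [|N|^2 = Om(t) = Om(t - y) <= |s| |N| e / 2]. Thus the spatial norm of [t]
    is at most [e / 2]. *)
Lemma tens_sep (A B : cstarAlgType R) (y : ten A B) :
  (forall phi psi, bdfun phi -> bdfun psi -> pfun phi psi y = 0) -> y = 0.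
Proof.
move=> hy; apply: nm_le0; apply: le_eps => e e0; rewrite add0r.
have e20 : 0 < e / 2 by rewrite divr_gt0.
have [t ht] := tsum_dense (ten := ten) y e20.
suff h : nm (tsum ten t) <= e / 2.
  by rewrite -[y](subrK (tsum ten t)) (le_trans (nmD _ _)) // [leRHS]splitr lerD // ltW.
apply: tsum_le => [|pi rho s]; first exact: ltW.
have hd := hdot_semidot (rep_space pi); have hk := hdot_semidot (rep_space rho).
set N := tensor_act t s.
pose Om x := \sum_(p <- s) \sum_(q <- N)
  pfun (fun a => hdot _ (pi a p.1) q.1) (fun b => hdot _ (rho b p.2) q.2) x.
have bOm : bdfun Om.
  apply: bdfun_sum => p; apply: bdfun_sum => q.
  exact: (pfun_bounded (rep_fun _ _) (rep_fun _ _)).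
have OmE t' : Om (tsum ten t') = tform (hdot _) (hdot _) (tensor_act t' s) N.
  rewrite (scf_sum bOm.1) /tform /tensor_act big_allpairs_dep.
  apply: eq_bigr => x _; apply: eq_bigr => p _ /=; apply: eq_bigr => q _.
  by rewrite pfunE //; exact: rep_fun.
have S0 s' : 0 <= complex.Re (@tensor_sqnorm R (rep_space pi) (rep_space rho) s').
  exact: (Re_ge0 (schur_ge0 s' hd hk)).
pose ns := Num.sqrt (complex.Re (tensor_sqnorm s)).
pose nN := Num.sqrt (complex.Re (tensor_sqnorm N)).
have key x : cabs (Om x) <= ns * nN * nm x.
  apply: bdfun_le => [//|t'|]; last by rewrite mulr_ge0 ?sqrtr_ge0.
  rewrite OmE -(@ler_pXn2r _ 2) ?nnegrE ?cabs_ge0 ?mulr_ge0 ?sqrtr_ge0 ?nm_ge0 //.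
  apply: (le_trans (tform_CS _ _ hd hk)); rewrite !exprMn !sqr_sqrtr //.
  by rewrite mulrAC ler_wpM2r ?(S0 N) // mulrC; exact: tsum_rep_le.
have Omy : Om y = 0.
  rewrite /Om big1 // => p _; rewrite big1 // => q _; by apply: hy; exact: rep_fun.
have := key (tsum ten t - y); rewrite (scfB bOm.1) Omy subr0 OmE.
have h1 := schur_ge0 N hd hk; rewrite -/(tform _ _ N N) in h1.
rewrite -/N (ge0_complexE h1) cabs_real ger0_norm; last exact: Re_ge0.
rewrite -[complex.Re _](sqr_sqrtr (Re_ge0 h1)) -/nN nmB => h2.
have h3 : nN <= ns * (e / 2).
  have [n0|n0] := leP nN 0; first by rewrite (le_trans n0) // mulr_ge0 ?sqrtr_ge0 // ltW.
  rewrite -(ler_pM2l n0) -expr2 (le_trans h2) // mulrCA mulrA ler_wpM2l ?ltW //.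
  by rewrite mulr_gt0 // lt_neqAle sqrtr_ge0 andbT; apply/negP => /eqP n1; move: h2; rewrite -n1 !mul0r; rewrite leNgt exprn_gt0.
have : nN ^+ 2 <= (e / 2) ^+ 2 * ns ^+ 2.
  have nN0 : 0 <= nN by exact: sqrtr_ge0.
  by rewrite -exprMn [_ * ns]mulrC !expr2; apply: ler_pM.
rewrite (sqr_sqrtr (S0 N)) (sqr_sqrtr (S0 s)); exact.
Qed.

Section Lift.
Variables (A B D : cstarAlgType R) (f : A -> D) (g : B -> D).
Hypotheses (hf : is_starhom f) (hg : is_starhom g).
Hypothesis fg : forall a b, f a * g b = g b * f a.

(* Points of [D] are separated by the functionals whose pullback along [f (x) g] is
   continuous for the spatial norm. *)
Hypothesis sep : forall d : D, (forall F : D -> C, bdfun F ->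
  (exists F' : ten A B -> C, bdfun F' /\
    forall a b, F' (tprod ten a b) = F (f a * g b)) -> F d = 0) -> d = 0.

Lemma lift_exists : exists h : ten A B -> D,
  is_starhom h /\ forall a b, h (tprod ten a b) = f a * g b.
Proof.
pose S x d := exists t, x = tsum ten t /\ d = \sum_(p <- t) f p.1 * g p.2.
have S1 a b : S (tprod ten a b) (f a * g b).
  by exists [:: (a, b)]; rewrite /tsum !big_seq1.
have S11 : S 1 1 by have := S1 1 1; rewrite tprod11 (starhom1 hf) (starhom1 hg) mulr1.
have Slin (c : C) a b a' b' : S a b -> S a' b' -> S (c *: a + a') (c *: b + b').
  move=> [s [-> ->]] [t [-> ->]]; have [t' [e h]] := tsum_lin ten c s t.
  exists t'; split=> //; apply: (h D (fun a b => f a * g b)) => x y.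
  by rewrite (starhomZ hf) scaleAl.
have Smul a b a' b' : S a b -> S a' b' -> S (a * a') (b * b').
  move=> [s [-> ->]] [t [-> ->]].
  exists [seq (p.1 * q.1, p.2 * q.2) | p <- s, q <- t].
  rewrite /tsum !big_allpairs_dep !mulr_suml; split; apply: eq_bigr => p _;
    rewrite mulr_sumr; apply: eq_bigr => q _ /=; first exact: tprodM.
  by rewrite (starhomM hf) (starhomM hg) -!mulrA; congr (_ * _); rewrite !mulrA fg.
have Sstar a b : S a b -> S (star a) (star b).
  move=> [s [-> ->]]; exists [seq (star p.1, star p.2) | p <- s].
  rewrite /tsum !big_map !star_sum; split; apply: eq_bigr => p _ /=; first exact: tprod_star.
  by rewrite starMr -(starhom_star hf) -(starhom_star hg) fg.
have [||h [hh hS]] := @graph_hom R (ten A B) D (pclosure_alg S11 Slin Smul Sstar).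
- move=> d [u [v [uv u0 vd]]]; apply: sep => F bF [F' [bF' F'E]].
  have e n : F' (u n) = F (v n).
    have [t [-> ->]] := uv n; rewrite (scf_sum bF'.1) (scf_sum bF.1).
    by apply: eq_bigr => p _; exact: F'E.
  apply: cabs_le0; apply: le_eps => e' e0; rewrite add0r.
  have e20 : 0 < e' / 2 by rewrite divr_gt0.
  have [n0 h0] := bdfun_lim bF' u0 e20; have [n1 h1] := bdfun_lim bF vd e20.
  pose n := maxn n0 n1; have {}h0 := h0 n (leq_maxl _ _); have {}h1 := h1 n (leq_maxr _ _).
  rewrite (scf0 bF'.1) subr0 e in h0.
  have a1 := cabsD (F d - F (v n)) (F (v n)); rewrite subrK in a1.
  rewrite -cabsN opprB in h1; lra.
- move=> x e e0; have [t ht] := tsum_dense (ten := ten) x e0.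
  exists (tsum ten t), (\sum_(p <- t) f p.1 * g p.2); split=> //.
  by apply: pclosureW; exists t.
exists h; split=> // a b.
have bh := starhom_bounded hh.
have := hS (tprod ten a b) => -[u [v [uv ux vy]]].
(* The closed graph contains both candidate values over [a (x) b]; their difference lies over
   [0]. *)
have G0 : pclosure S 0 (h (tprod ten a b) - f a * g b).
  have := pclosure_lin Slin (-1) (pclosureW (S1 a b)) (hS (tprod ten a b)).
  by rewrite !scaleN1r addNr addrC.
apply/eqP; rewrite -subr_eq0; apply/eqP/sep => F bF [F' [bF' F'E]].
have [u' [v' [uv' u0 vd]]] := G0.
have e n : F' (u' n) = F (v' n).
  have [t [-> ->]] := uv' n; rewrite (scf_sum bF'.1) (scf_sum bF.1).
  by apply: eq_bigr => p _; exact: F'E.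
apply: cabs_le0; apply: le_eps => e' e0; rewrite add0r.
have e20 : 0 < e' / 2 by rewrite divr_gt0.
have [n0 h0] := bdfun_lim bF' u0 e20; have [n1 h1] := bdfun_lim bF vd e20.
pose n := maxn n0 n1; have {}h0 := h0 n (leq_maxl _ _); have {}h1 := h1 n (leq_maxr _ _).
rewrite (scf0 bF'.1) subr0 e in h0.
have a1 := cabsD (F (h (tprod ten a b) - f a * g b) - F (v' n)) (F (v' n)); rewrite subrK in a1.
rewrite -cabsN opprB in h1; lra.
Qed.

Lemma tliftP : is_starhom (tlift (ten := ten) f g) /\
  forall a b, tlift (ten := ten) f g (tprod ten a b) = f a * g b.
Proof. by have := lift_exists; exact: getPex. Qed.

End Lift.

Lemma tmapP (A A' B B' : cstarAlgType R) (f : A -> A') (g : B -> B') :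
  is_starhom f -> is_starhom g -> is_starhom (tmap (ten := ten) f g) /\
  forall a b, tmap (ten := ten) f g (tprod ten a b) = tprod ten (f a) (g b).
Proof.
move=> hf hg.
apply: tliftP; try exact: starhom_comp (tinl_hom _ _ _); try exact: starhom_comp (tinr_hom _ _ _).
- by move=> a b; exact: (spatial_comm (tensP ten A' B')).
- move=> d h; apply: tens_sep => phi psi bphi bpsi; apply: h; first exact: pfun_bounded.
  have b1 := bdfun_comp bphi (starhom_bounded hf).
  have b2 := bdfun_comp bpsi (starhom_bounded hg).
  exists (pfun (phi \o f) (psi \o g)); split; first exact: pfun_bounded.
  by move=> a b; rewrite pfunE // -[tinl _ _ _ * _]/(tprod ten (f a) (g b)) pfunE.
Qed.

Lemma starhom_id (A : cstarAlgType R) : is_starhom (@id A).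
Proof. by split. Qed.

(** The target is separated by the functionals [phi (x) (psi (x) chi)], because slicing off the
    first leg reduces the matter to [ten B D]; these pull back to [(phi (x) psi) (x) chi]. *)
Lemma tassocP (A B D : cstarAlgType R) : is_starhom (@tassoc R ten A B D) /\
  forall a b d, @tassoc R ten A B D (tprod ten (tprod ten a b) d) = tprod ten a (tprod ten b d).
Proof.
have [h1 e1] := tmapP (starhom_id A) (tinl_hom ten B D).
have h2 := starhom_comp (tinr_hom ten B D) (tinr_hom ten A (ten B D)).
have bl (d : D) : bounded_map (fun x => tmap id (tinl ten D) x * tinr ten A (tinr ten B d) : ten A (ten B D)).
  split; first by move=> c x y; rewrite (starhomD h1) (starhomZ h1) mulrDl -scaleAl.
  exists (nm (tinr ten A (tinr ten B d))); split=> [|x]; first exact: nm_ge0.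
  by rewrite (le_trans (nmM _ _)) // mulrC ler_wpM2l ?nm_ge0 // starhom_le.
have br (d : D) : bounded_map (fun x => tinr ten A (tinr ten B d) * tmap id (tinl ten D) x : ten A (ten B D)).
  split; first by move=> c x y; rewrite (starhomD h1) (starhomZ h1) mulrDr -scaleAr.
  exists (nm (tinr ten A (tinr ten B d))); split=> [|x]; first exact: nm_ge0.
  by rewrite (le_trans (nmM _ _)) // ler_wpM2l ?nm_ge0 // starhom_le.
have e3 a b d : tmap id (tinl ten D) (tprod ten a b) * tinr ten A (tinr ten B d) =
    tprod ten a (tprod ten b d) :> ten A (ten B D).
  by rewrite e1 -tprod1r tprodM mulr1.
have [] := @tliftP (ten A B) D (ten A (ten B D)) _ _ h1 h2.
- move=> x d; apply: (tens_ext (bl d) (br d)) => a b.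
  by rewrite e1 -tprod1r !tprodM mulr1 mul1r (spatial_comm (tensP ten B D)).
- move=> y hy; apply: tens_sep => phi om bphi bom.
  rewrite pfun_sliceL //; suff -> : sliceL phi y = 0 by rewrite (scf0 bom.1).
  apply: tens_sep => psi chi bpsi bchi.
  have bpc := pfun_bounded bpsi bchi.
  rewrite -pfun_sliceL //; apply: hy; first exact: pfun_bounded.
  have bpp := pfun_bounded bphi bpsi.
  exists (pfun (pfun phi psi) chi); split; first exact: pfun_bounded.
  move=> x d; rewrite pfunE //.
  have bF : bdfun (fun x => pfun phi (pfun psi chi) (tmap id (tinl ten D) x * tinr ten A (tinr ten B d))).
    exact: (bdfun_comp (pfun_bounded bphi bpc) (bl d)).
  have bF' : bdfun (fun x => pfun phi psi x * chi d).
    split=> [c x1 x2|]; first by rewrite bpp.1 mulrDl mulrA.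
    have [_ [M [M0 hM]]] := bpp; exists (M * cabs (chi d)); split.
      by rewrite mulr_ge0 ?cabs_ge0.
    by move=> a; rewrite cabsM mulrAC ler_wpM2r ?cabs_ge0.
  apply: (tens_fun_ext bF' bF) => a b.
  by rewrite e3 !pfunE // mulrA.
move=> h3 e4; split=> // a b d; by rewrite /tassoc e4 e3.
Qed.

Section Characters.
Variables (A B : cstarAlgType R) (eps : A -> C).
Hypothesis he : is_character eps.

Lemma character_hom (D : cstarAlgType R) : is_starhom (scalar_map D eps).
Proof.
have [l [m1 m2] s] := he; split=> [c x y|//|x]; rewrite /scalar_map.
- by rewrite l scalerDl scalerA.
- split=> [|x y]; first by rewrite m1 scale1r.
  by rewrite m2 -scaleAl mul1r scalerA.
- by rewrite s starZc star1.
Qed.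

Lemma scalar_eq1 (D : cstarAlgType R) (c d : C) : (1 : D) <> 0 ->
  c *: (1 : D) = d *: (1 : D) -> c = d.
Proof.
move=> D1 /eqP; rewrite -subr_eq0 -scalerBl scaler_eq0 subr_eq0 => /orP[/eqP//|/eqP//].
Qed.

(** Viewed as a unital *-homomorphism from [A] to itself, [eps] is contractive; [A] is nonzero
    because [eps 1 = 1]. *)
Lemma character_bounded : bdfun eps.
Proof.
have [l [m1 m2] s] := he; split=> //; exists 1; split=> // a.
have A1 : (1 : A) <> 0.
  by move=> e; have := m1; rewrite e (scf0 l) => /eqP; rewrite eq_sym oner_eq0.
have n1 : nm (1 : A) = 1.
  have := nm_starM (1 : A); rewrite star1 mul1r expr2 => e.
  have n0 : nm (1 : A) != 0 by apply/eqP => /nm_eq0.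
  by apply: (mulIf n0); rewrite mul1r.
have := starhom_le (character_hom A) a; rewrite nmZ n1 mulr1 mul1r.
exact.
Qed.

Lemma tlift_epsl : is_starhom (tlift (ten := ten) (scalar_map B eps) id) /\
  forall a b, tlift (ten := ten) (scalar_map B eps) id (tprod ten a b) = eps a *: b.
Proof.
have [||h e] := @tliftP A B B _ _ (character_hom B) (starhom_id B).
- by move=> a b; rewrite /scalar_map -scaleAl -scaleAr mul1r mulr1.
- move=> d h; apply: bdfun_sep => psi bpsi; apply: h => //.
  exists (pfun eps psi); split; first exact: pfun_bounded character_bounded bpsi.
  move=> a b; rewrite pfunE //; last exact: character_bounded.
  by rewrite /scalar_map -scaleAl mul1r (scfZ bpsi.1).
by split=> // a b; rewrite e /scalar_map -scaleAl mul1r.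
Qed.

Lemma tlift_epsr : is_starhom (tlift (ten := ten) id (scalar_map B eps)) /\
  forall b a, tlift (ten := ten) id (scalar_map B eps) (tprod ten b a) = eps a *: b.
Proof.
have [||h e] := @tliftP B A B _ _ (starhom_id B) (character_hom B).
- by move=> a b; rewrite /scalar_map -scaleAl -scaleAr mul1r mulr1.
- move=> d h; apply: bdfun_sep => psi bpsi; apply: h => //.
  exists (pfun psi eps); split; first exact: pfun_bounded bpsi character_bounded.
  move=> b a; rewrite pfunE //; last exact: character_bounded.
  by rewrite /scalar_map -scaleAr mulr1 (scfZ bpsi.1) mulrC.
by split=> // b a; rewrite e /scalar_map -scaleAr mulr1.
Qed.

End Characters.
End Slices.

(** * Ultralimits and states *)

Lemma approx_ge0 (R : realType) (l : R[i]) :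
  (forall e : R, 0 < e -> exists z : R[i], 0 <= z /\ cabs (z - l) < e) -> 0 <= l.
Proof.
move=> h.
have hI : complex.Im l = 0.
  apply/eqP; rewrite -normr_eq0 eq_le normr_ge0 andbT; apply: le_eps => e e0; rewrite add0r.
  have [z [z0 a]] := h e e0.
  have -> : complex.Im l = - complex.Im (z - l).
    by rewrite (ge0_complexE z0); case: (l) => x y /=; rewrite sub0r opprK.
  by rewrite normrN (le_trans (cabs_Im _)) // ltW.
have hR : 0 <= complex.Re l.
  rewrite -oppr_le0; apply: le_eps => e e0; rewrite add0r.
  have [z [z0 a]] := h e e0; have := cabs_Re (z - l).
  have := Re_ge0 z0; case: l a {h hI} => x y; case: z {z0} => x' y' /= a a1.
  by rewrite ler_norml => /andP[]; lra.
by case: l hI hR {h} => x y /= -> h; rewrite lecE /= eqxx.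
Qed.

Section UltraLimit.
Variables (R : realType) (T : Type) (U : set_system T).
Hypothesis hU : UltraFilter U.
Local Notation C := R[i].

Definition ucvg (u : T -> C) (l : C) :=
  forall e : R, 0 < e -> U [set n | cabs (u n - l) < e]%classic.

Let fU : ProperFilter U. Proof. exact: ultra_proper. Qed.
Let fF : Filter U. Proof. exact: _. Qed.

Lemma ultra_ex (P : set T) : U P -> exists n, P n.
Proof. by move=> /(@filter_ex _ U fU). Qed.

(** The limit is the supremum of the [x] for which [x <= u n] holds on a set of the ultrafilter. *)
Lemma ucvg_real (u : T -> R) (M : R) : (forall n, `|u n| <= M) ->
  exists l : R, forall e : R, 0 < e -> U [set n | `|u n - l| < e]%classic.
Proof.
move=> hM; pose S := [set x : R | U [set n | x <= u n]%classic]%classic.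
have hs : has_sup S.
  split; first by exists (- M); apply: filterE => n /=; have := hM n; rewrite ler_norml => /andP[].
  exists M => x /ultra_ex[n /= xn]; apply: (le_trans xn).
  by have := hM n; rewrite ler_norml => /andP[].
exists (sup S) => e e0; have e20 : 0 < e / 2 by rewrite divr_gt0.
have [x Sx hx] := sup_adherent e20 hs.
have Sn : ~ S (sup S + e / 2).
  by move=> /(ub_le_sup hs.2); rewrite leNgt ltrDl e20.
have [//|h2] := in_ultra_setVsetC [set n | sup S + e / 2 <= u n]%classic hU.
have Ux : U [set n | x <= u n]%classic by exact: Sx.
have h3 := @filterI _ U fF _ _ Ux h2.
apply: (@filterS _ U fF _ _ _ h3) => n /= [a1 /negP]; rewrite -ltNge => a2.
by rewrite ltr_norml; apply/andP; split; lra.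
Qed.

Lemma ucvg_ex (u : T -> C) (M : R) : (forall n, cabs (u n) <= M) -> exists l, ucvg u l.
Proof.
move=> hM.
have [n|a ha] := @ucvg_real (fun n => complex.Re (u n)) M.
  exact: le_trans (cabs_Re _) (hM n).
have [n|b hb] := @ucvg_real (fun n => complex.Im (u n)) M.
  exact: le_trans (cabs_Im _) (hM n).
exists (a +i* b) => e e0; have e20 : 0 < e / 2 by rewrite divr_gt0.
apply: filterS (@filterI _ U _ _ _ (ha _ e20) (hb _ e20)) => n /= [h1 h2].
apply: (le_lt_trans (cabs_ReIm _)); move: h1 h2; case: (u n) => x y /= h1 h2.
lra.
Qed.

Lemma ucvg_unique u l m : ucvg u l -> ucvg u m -> l = m.
Proof.
move=> h1 h2; apply/eqP; rewrite -subr_eq0; apply/eqP/cabs_le0.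
apply: le_eps => e e0; rewrite add0r; have e20 : 0 < e / 2 by rewrite divr_gt0.
have [n /= [a b]] := ultra_ex (@filterI _ U _ _ _ (h1 _ e20) (h2 _ e20)).
have := cabsD (l - u n) (u n - m); rewrite subrKA -(cabsN (l - u n)) opprB; lra.
Qed.

Lemma ucvg_near u l v m : ucvg u l -> (forall e : R, 0 < e ->
  U [set n | cabs (u n - l) < e -> cabs (v n - m) < 2 * e]%classic) -> ucvg v m.
Proof.
move=> h hv e e0; have e20 : 0 < e / 2 by rewrite divr_gt0.
apply: filterS (@filterI _ U _ _ _ (h _ e20) (hv _ e20)) => n /= [a /(_ a)].
by rewrite mulrC divfK.
Qed.

Lemma ucvg_lin c u l v m : ucvg u l -> ucvg v m -> ucvg (fun n => c * u n + v n) (c * l + m).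
Proof.
move=> h1 h2 e e0; have k0 : 0 < cabs c + 1 by rewrite ltr_wpDl ?cabs_ge0.
have e20 : 0 < e / 2 by rewrite divr_gt0.
apply: filterS (@filterI _ U _ _ _ (h1 _ (divr_gt0 e20 k0)) (h2 _ e20)) => n /= [a b].
have := cabsD (c * (u n - l)) (v n - m); rewrite mulrBr addrACA -opprD.
rewrite -mulrBr cabsM; move: a; rewrite ltr_pdivlMr // => a a'.
apply: (le_lt_trans a'); have := cabs_ge0 (u n - l); have := cabs_ge0 c.
move: (cabs c) (cabs (u n - l)) (cabs (v n - m)) a b => x y z; nra.
Qed.

Lemma ucvg_cst c : ucvg (fun=> c) c.
Proof. by move=> e e0; apply: filterE => n /=; rewrite subrr cabs0. Qed.

Lemma ucvg_ge0 u l : (forall n, 0 <= u n) -> ucvg u l -> 0 <= l.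
Proof.
move=> u0 h; apply: approx_ge0 => e e0; have [n hn] := ultra_ex (h e e0).
by exists (u n).
Qed.

Lemma ucvg_eq_near u v l : ucvg u l -> U [set n | u n = v n]%classic -> ucvg v l.
Proof.
move=> h hn e e0; apply: filterS (@filterI _ U _ _ _ (h _ e0) hn) => n /= [a b].
by rewrite -b.
Qed.

End UltraLimit.

Section States.
Variables (R : realType) (A : cstarAlgType R).
Local Notation C := R[i].
Implicit Types phi psi : A -> C.

Definition positive phi := scalar phi /\ forall x, 0 <= phi (star x * x).
Definition state phi := positive phi /\ phi 1 = 1.

(** For self-adjoint [x], [2 x = (x + 1)^2 - x^2 - 1] is a combination of squares, on which [phi] is
    real. *)
Lemma positive_real phi x : positive phi -> star x = x -> (phi x)^* = phi x.
Proof.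
move=> [l p] sx.
have r y : (phi (star y * y))^* = phi (star y * y) by rewrite (ge0_complexE (p y)) conjr.
have e : 2%:R * phi x = phi (star (x + 1) * (x + 1)) - phi (star x * x) - phi (star 1 * 1).
  rewrite starD star1 sx -!(scfB l) -(scfZ l); congr phi.
  apply/eqP; rewrite mulrDl !mulrDr !mul1r !mulr1 scaler_nat mulr2n eq_sym !subr_eq.
  by rewrite -[x * x + x + _]addrA [x * x + _]addrC !addrA.
have h2 : 2%:R != 0 :> C by rewrite pnatr_eq0.
apply: (mulfI h2); rewrite -[in LHS](rmorph_nat Num.conj) -conjcM e.
by rewrite !conjcD !conjcN !r.
Qed.

Lemma cartesian x : exists a b : A, [/\ star a = a, star b = b & x = a + 'i%C *: b].
Proof.
exists ((halfc R) *: (x + star x)), ((halfc R) *: ('i%C *: (star x - x))); split.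
- by rewrite starZc half_conj starD starK addrC.
- rewrite !starZc half_conj conj_i starB starK scaleNr -scalerN opprB //.
- rewrite !scalerA mulrAC iK mulN1r scaleNr -scalerBr opprB.
  by rewrite addrACA subrr addr0 scalerDr half2.
Qed.

Lemma positive_star phi x : positive phi -> phi (star x) = (phi x)^*.
Proof.
move=> hp; have [a [b [sa sb ->]]] := cartesian x; have l := hp.1.
rewrite starD starZc sa sb conj_i !(scfD l) !(scfZ l) conjcD conjcM conj_i.
by rewrite (positive_real hp sa) (positive_real hp sb).
Qed.

Definition gns phi (x y : A) : C := phi (star y * x).

Lemma gns_semidot phi : positive phi -> semidot (gns phi).
Proof.
move=> hp; split=> [w c u v|u v|v]; last exact: hp.2.
  by rewrite /gns mulrDr -scaleAr hp.1.
by rewrite /gns -(positive_star _ hp) starMr starK.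
Qed.

Lemma positive_le phi a : positive phi ->
  complex.Re (phi (star a * a)) <= nm a ^+ 2 * complex.Re (phi 1).
Proof.
move=> hp; have l := hp.1; have [a0|a0] := leP (nm a) 0.
  by rewrite (nm_le0 a0) mulr0 (scf0 l) nm0 expr0n mul0r.
pose h : A := ((nm a ^+ 2)^-1)%:C *: (star a * a).
have r0 : 0 < (nm a ^+ 2)^-1 by rewrite invr_gt0 exprn_gt0.
have sh : star h = h by apply: sa_scale; rewrite starMr starK.
have h1 : nm h <= 1.
  by rewrite nmZ cabs_real gtr0_norm // nm_starM mulVf // gt_eqF // exprn_gt0.
have [||k [sk kk _ _]] := @sqrt_exists _ _ (1 - h).
- by rewrite starB star1 sh.
- by rewrite subKr.
have := hp.2 k; rewrite sk kk (scfB l) (scfZ l) (ge0_complexE (hp.2 a)).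
have : 0 <= phi 1 by have := hp.2 1; rewrite star1 mulr1.
move=> /ge0_complexE ->; rewrite -real_complexM -rmorphB /= ler0c subr_ge0.
by rewrite ler_pdivrMl ?exprn_gt0.
Qed.

Lemma positive_bounded phi : positive phi -> bdfun phi.
Proof.
move=> hp; split; first exact: hp.1.
have p1 : 0 <= complex.Re (phi 1).
  by apply: Re_ge0; have := hp.2 1; rewrite star1 mulr1.
exists (complex.Re (phi 1)); split=> // a.
have := sd_cauchy_schwarz (gns_semidot hp) a 1.
rewrite /gns /sq star1 mul1r mulr1 => h.
rewrite -(@ler_pXn2r _ 2) ?nnegrE ?cabs_ge0 ?mulr_ge0 ?nm_ge0 //.
apply: (le_trans h); apply: le_trans (ler_wpM2r p1 (positive_le a hp)) _.
by rewrite le_eqVlt; apply/orP; left; apply/eqP; ring.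
Qed.

Lemma state_le phi a : state phi -> cabs (phi a) <= nm a.
Proof.
move=> [hp h1]; have := sd_cauchy_schwarz (gns_semidot hp) a 1.
rewrite /gns /sq star1 mul1r mulr1 h1 mulr1 => h.
rewrite -(@ler_pXn2r _ 2) ?nnegrE ?cabs_ge0 ?nm_ge0 //.
by apply: (le_trans h); have := positive_le a hp; rewrite h1 mulr1.
Qed.

(** Cauchy-Schwarz for [gns]: the null vectors form a left ideal killed by [phi]. Since [phi] may
    fail to be faithful, this is the form in which vanishing is exploited. *)
Lemma positive_null phi a b : positive phi -> phi (star a * a) = 0 -> phi (b * a) = 0.
Proof.
move=> hp h; have hs := gns_semidot hp.
have := sd_null hs (star b) h; rewrite /gns => e.
by rewrite -[b * a]starK starMr (positive_star _ hp) e rmorph0.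
Qed.

(** Weak compactness of the state space, expressed by pointwise limits along an ultrafilter. *)
Lemma ultra_state (T : Type) (U : set_system T) (s : T -> A -> C) :
  UltraFilter U -> (forall n, state (s n)) ->
  exists h, state h /\ forall a, ucvg U (fun n => s n a) (h a).
Proof.
move=> hU hs.
have [h hh] := choice (fun a => @ucvg_ex R T U hU _ _ (fun n => state_le a (hs n))).
exists h; split=> //; split; first split.
- move=> c x y; apply: (ucvg_unique hU (hh _)).
  have := ucvg_lin hU c (hh x) (hh y).
  by congr ucvg; apply/funext => n; rewrite (hs n).1.1.
- by move=> x; apply: (ucvg_ge0 hU _ (hh _)) => n; exact: (hs n).1.2.
- apply: (ucvg_unique hU (hh _)); have := ucvg_cst hU (1 : C).
  by rewrite (_ : (fun=> 1) = (fun n => s n 1)) //; apply/funext => n; rewrite (hs n).2.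
Qed.

End States.

(** * The Haar state *)

Section Basics.
Variable R : realType.
Local Notation C := R[i].

Lemma bounded_map_comp (V W Z : normedModType C) (f : V -> W) (g : W -> Z) :
  bounded_map f -> bounded_map g -> bounded_map (g \o f).
Proof.
move=> [fl [M [M0 hM]]] [gl [K [K0 hK]]]; split=> [c x y /=|]; first by rewrite fl gl.
exists (K * M); split=> [|a /=]; first exact: mulr_ge0.
by rewrite (le_trans (hK _)) // -mulrA ler_wpM2l.
Qed.

Lemma bounded_mull (A : cstarAlgType R) (b : A) : bounded_map (fun y : A => b * y).
Proof.
split; first by move=> c x y; rewrite mulrDr -scaleAr.
by exists (nm b); split=> [|x]; [exact: nm_ge0|exact: nmM].
Qed.

Lemma bounded_mulr (A : cstarAlgType R) (b : A) : bounded_map (fun y : A => y * b).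
Proof.
split; first by move=> c x y; rewrite mulrDl -scaleAl.
by exists (nm b); split=> [|x]; [exact: nm_ge0|rewrite mulrC nmM].
Qed.

End Basics.

Section SliceAlgebra.
Variables (R : realType) (ten : spatialTensor R) (A B : cstarAlgType R).
Local Notation C := R[i].
Implicit Types (phi : A -> C) (psi : B -> C) (y : ten A B).

Lemma sliceR_mull psi b y : bdfun psi ->
  sliceR psi (tprod ten b 1 * y) = b * sliceR psi y.
Proof.
move=> hp; have [bs e] := sliceRP ten A hp.
apply: (tens_ext (f := fun y => sliceR psi (tprod ten b 1 * y)) (g := fun y => b * sliceR psi y)).
- exact: (bounded_map_comp (bounded_mull _) bs).
- exact: (bounded_map_comp bs (bounded_mull _)).
- by move=> a a'; rewrite tprodM mul1r !e scaleAr.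
Qed.

Lemma sliceL_mull phi b y : bdfun phi ->
  sliceL phi (tprod ten 1 b * y) = b * sliceL phi y.
Proof.
move=> hp; have [bs e] := sliceLP ten B hp.
apply: (tens_ext (f := fun y => sliceL phi (tprod ten 1 b * y)) (g := fun y => b * sliceL phi y)).
- exact: (bounded_map_comp (bounded_mull _) bs).
- exact: (bounded_map_comp bs (bounded_mull _)).
- by move=> a a'; rewrite tprodM mul1r !e scaleAr.
Qed.

Lemma tsum_sq (t : seq (A * B)) :
  star (tsum ten t) * tsum ten t =
  \sum_(p <- t) \sum_(q <- t) tprod ten (star p.1 * q.1) (star p.2 * q.2).
Proof.
rewrite /tsum star_sum mulr_suml; apply: eq_bigr => p _.
by rewrite mulr_sumr; apply: eq_bigr => q _; rewrite tprod_star tprodM.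
Qed.

Lemma pfun_positive phi psi : positive phi -> positive psi ->
  positive (pfun (ten := ten) phi psi).
Proof.
move=> hp hs; have bp := positive_bounded hp; have bs := positive_bounded hs.
have bb := pfun_bounded ten bp bs; split=> [|x]; first exact: bb.1.
have [u [hS ux]] := dense_seq (spatial_dense (tensP ten A B)) x.
apply: approx_ge0 => e e0.
have [n hn] := bdfun_lim bb (seq_limM (seq_lim_star ux) ux) e0.
exists (pfun phi psi (star (u n) * u n)); split; last exact: hn n (leqnn n).
have [t ->] := hS n; rewrite -/(tsum ten t) tsum_sq (scf_sum bb.1).
under eq_bigr do rewrite (scf_sum bb.1).
under eq_bigr do under eq_bigr do rewrite pfunE //.
have := schur_ge0 t (gns_semidot hp) (gns_semidot hs).
by rewrite exchange_big.
Qed.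

Lemma pfun_state phi psi : state phi -> state psi -> state (pfun (ten := ten) phi psi).
Proof.
move=> [hp p1] [hs s1]; split; first exact: pfun_positive.
by rewrite -tprod11 pfunE ?p1 ?s1 ?mulr1 //; exact: positive_bounded.
Qed.

Lemma pfunBr phi psi psi' y c : bdfun phi -> bdfun psi -> bdfun psi' ->
  bdfun (fun b => c * psi b - psi' b) ->
  pfun phi (fun b => c * psi b - psi' b) y = c * pfun phi psi y - pfun phi psi' y.
Proof.
move=> h1 h2 h3 h4; rewrite !pfun_sliceL // .
Qed.

End SliceAlgebra.

(* If [omega * h = h = h * omega], then [x |-> (h (x) omega)(|Delta c - c (x) 1|^2)]
   vanishes at [c = (id (x) h)(Delta a)]; the sides of the tensor product are
   abstracted in order to cover both one-sided statements. *)
Section Dominated.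
Variables (R : realType) (A T : cstarAlgType R) (Delta l r : A -> T).
Local Notation C := R[i].
Variables (P : (A -> C) -> (A -> C) -> T -> C) (S : (A -> C) -> T -> A).
Hypotheses (hD : is_starhom Delta) (hl : is_starhom l).
Hypothesis Ppos : forall phi psi, positive phi -> positive psi -> positive (P phi psi).
Hypothesis Pl : forall phi psi b y, bdfun phi -> bdfun psi ->
  P phi psi (l b * y) = phi (b * S psi y).
Hypothesis Pr : forall phi psi a, bdfun phi -> bdfun psi ->
  P phi psi (r a) = phi 1 * psi a.
Hypothesis S1 : forall psi, bdfun psi -> S psi 1 = psi 1 *: (1 : A).
Hypothesis PB : forall phi psi psi' y c, bdfun phi -> bdfun psi -> bdfun psi' ->
  bdfun (fun b => c * psi b - psi' b) ->
  P phi (fun b => c * psi b - psi' b) y = c * P phi psi y - P phi psi' y.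
Hypothesis coassoc : forall psi chi a, bdfun psi -> bdfun chi ->
  S psi (Delta (S chi (Delta a))) = S (P psi chi \o Delta) (Delta a).
Hypothesis dens : forall F F' : T -> C, bdfun F -> bdfun F' ->
  (forall a b, F (l b * Delta a) = F' (l b * Delta a)) -> F =1 F'.

Lemma dominated_invariant (h om rho : A -> C) (m : C) :
  state h -> state om -> state rho -> positive (fun x => m * om x - rho x) ->
  (forall a, P om h (Delta a) = h a) -> (forall a, P h om (Delta a) = h a) ->
  forall a, P rho h (Delta a) = h a.
Proof.
move=> [ph h1] [po o1] [pr r1] dom oh ho.
have bh := positive_bounded ph; have bo := positive_bounded po; have br := positive_bounded pr.
have cont (phi : A -> C) : positive phi -> bdfun (P phi h \o Delta).
  by move=> p; exact: bdfun_comp (positive_bounded (Ppos p ph)) (starhom_bounded hD).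
have inv a b : P h (P rho h \o Delta) (l b * Delta a) = P h h (l b * Delta a).
  have bc := cont _ pr.
  pose c := S h (Delta a); pose y := Delta c - l c.
  have Sc : S om (Delta c) = c.
    rewrite coassoc //; congr S; apply/funext => x /=; exact: oh.
  have E om' : positive om' -> P h om' (star y * y) = P h om' (Delta (star c * c)) -
      h (star (S om' (Delta c)) * c) - h (star c * S om' (Delta c)) + om' 1 * h (star c * c).
    move=> po'; have bo' := positive_bounded po'; have [sP _] := Ppos ph po'.
    have e1 : P h om' (l (star c) * Delta c) = h (star c * S om' (Delta c)) by rewrite Pl.
    have e2 : P h om' (star (Delta c) * l c) = h (star (S om' (Delta c)) * c).
      rewrite -[_ * l c]starK starMr starK -(starhom_star hl) (positive_star _ (Ppos ph po')).
      by rewrite e1 -(positive_star _ ph) starMr starK.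
    have e3 : P h om' (star (l c) * l c) = om' 1 * h (star c * c).
      by rewrite -(starhom_star hl) -(starhomM hl) -[l _]mulr1 Pl // S1 // -scaleAr mulr1 (scfZ bh.1).
    rewrite /y starB mulrBr !mulrBl !(scfB sP) e2 e3 -(starhom_star hl) e1.
    by rewrite -(starhom_star hD) -(starhomM hD); ring.
  have E0 : P h om (star y * y) = 0 by rewrite E // Sc ho o1; ring.
  (* Positivity of [m om - rho] bounds this value by [m] times the one for [om], which is zero. *)
  have Er : P h rho (star y * y) = 0.
    have h4 := (Ppos ph dom).2 y; have h5 := (Ppos ph pr).2 y.
    move: h4; rewrite PB //; last exact: positive_bounded.
    by rewrite E0 mulr0 sub0r oppr_ge0 => h4; apply/eqP; rewrite eq_le h4 h5.
  have := positive_null (l b) (Ppos ph pr) Er.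
  have Sr : S rho (Delta c) = S (P rho h \o Delta) (Delta a) by exact: coassoc.
  rewrite /y mulrBr (scfB (Ppos ph pr).1) [P h rho (l b * Delta c)]Pl // Sr.
  have -> : P h rho (l b * l c) = h (b * c).
    by rewrite -(starhomM hl) -[l (b * c)]mulr1 Pl // S1 // r1 scale1r mulr1.
  move=> /eqP.
  by rewrite subr_eq0 => /eqP e; rewrite !Pl // e.
move=> a; have bc := cont _ pr.
have pc : positive (P rho h \o Delta).
  split=> [|x]; first exact: bc.1.
  by rewrite /= (starhomM hD) (starhom_star hD); exact: (Ppos pr ph).2.
(* The two functionals agree on a dense span; on the leg [r a] alone they reduce to the two sides of
   the claim. *)
have := dens (positive_bounded (Ppos ph pc)) (positive_bounded (Ppos ph ph)) inv (r a).
by rewrite !Pr // h1 !mul1r.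
Qed.

End Dominated.

Section Cesaro.
Variables (R : realType) (U : set_system nat).
Local Notation C := R[i].
Hypothesis hU : UltraFilter U.
Hypothesis hN : forall k, U [set n | (k <= n)%N]%classic.

Definition cesaro (s : nat -> C) (n : nat) : C := (n.+1%:R)^-1 * \sum_(k < n.+1) s k.

(** The two averages differ by [(s_(n+1) - s_0) / (n + 1)], which tends to [0] as [s] is bounded. *)
Lemma cesaro_shift (s : nat -> C) (M : R) l : (forall n, cabs (s n) <= M) ->
  ucvg U (cesaro s) l -> ucvg U (cesaro (fun n => s n.+1)) l.
Proof.
move=> hM h; apply: (ucvg_near hU h) => e e0.
have fP : ProperFilter U by exact: ultra_proper.
have fF : Filter U by exact: _.
apply: (@filterS _ U fF _ _ _ (hN (Num.truncn (2 * M / e)).+1)) => n /= hn hs.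
have -> : cesaro (fun n => s n.+1) n = cesaro s n + n.+1%:R^-1 * (s n.+1 - s 0).
  rewrite /cesaro -mulrDr; congr (_ * _).
  rewrite [in LHS]big_ord_recr [in RHS]big_ord_recl /=.
  by rewrite [s 0 + _]addrC -addrA [s 0 + _]addrC subrK.
have n0 : 0 < n.+1%:R :> R by rewrite ltr0n.
have k : cabs (n.+1%:R^-1 * (s n.+1 - s 0)) < e.
  rewrite cabsM (_ : n.+1%:R^-1 = (n.+1%:R^-1)%:C :> C); last first.
    by rewrite fmorphV rmorph_nat.
  rewrite cabs_real ger0_norm ?invr_ge0 ?(ltW n0) // mulrC ltr_pdivrMr //.
  apply: (@le_lt_trans _ _ (2 * M)).
    rewrite (le_trans (cabsD _ _)) // cabsN; have := hM n.+1; have := hM 0; lra.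
  rewrite -ltr_pdivrMl // mulrC; apply: (lt_trans (truncnS_gt _)); rewrite ltr_nat.
  by rewrite ltnS.
have := cabsD (cesaro s n - l) (n.+1%:R^-1 * (s n.+1 - s 0)); rewrite addrAC; lra.
Qed.

End Cesaro.

Lemma dense_functionals_eq (R : realType) (T : cstarAlgType R) (S : set T)
    (F F' : T -> R[i]) : dense S ->
  bdfun F -> bdfun F' -> (forall y, S y -> F y = F' y) -> F =1 F'.
Proof.
move=> dS bF bF' e y; have [u [hu uy]] := dense_seq dS y.
apply/eqP; rewrite -subr_eq0; apply/eqP/cabs_le0/le_eps => e' e0; rewrite add0r.
have e20 : 0 < e' / 2 by rewrite divr_gt0.
have [n0 h0] := bdfun_lim bF uy e20; have [n1 h1] := bdfun_lim bF' uy e20.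
pose n := maxn n0 n1; have {}h0 := h0 n (leq_maxl _ _); have {}h1 := h1 n (leq_maxr _ _).
have eu := e _ (hu n).
have := cabsD (F y - F (u n)) (F (u n) - F' y); rewrite subrKA.
rewrite -eu in h1; rewrite -cabsN opprB in h0; lra.
Qed.

Lemma bdfun_star (R : realType) (B : cstarAlgType R) (F : B -> R[i]) : bdfun F ->
  bdfun (fun x => (F (star x))^*).
Proof.
move=> [l [M [M0 hM]]]; split.
  by move=> c x y; rewrite starD starZ l conjcD conjcM conjCK.
by exists M; split=> // a; rewrite cabsJ -[nm a]nm_star.
Qed.

(** Adjoints turn the products [Phi x * r a] of the density conditions into the products
    [r b * Phi a] that the invariance arguments control. *)
Lemma cancel_ext (R : realType) (A X T : cstarAlgType R) (Phi : X -> T) (r : A -> T)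
    (F F' : T -> R[i]) : is_starhom Phi -> is_starhom r ->
  dense (span2 (fun (x : X) (a : A) => Phi x * r a)) -> bdfun F -> bdfun F' ->
  (forall b a, F (r b * Phi a) = F' (r b * Phi a)) -> F =1 F'.
Proof.
move=> hPhi hr dS bF bF' e y.
rewrite -[F y]conjCK -[F' y]conjCK; congr (_^*); rewrite -[y]starK.
apply: (dense_functionals_eq dS (bdfun_star bF) (bdfun_star bF')) => _ [s ->].
rewrite star_sum (scf_sum bF.1) (scf_sum bF'.1); congr (_^*); apply: eq_bigr => p _.
by rewrite starMr -(starhom_star hPhi) -(starhom_star hr).
Qed.

Section Haar.
Variables (R : realType) (ten : spatialTensor R) (A : cstarAlgType R).
Local Notation C := R[i].
Variables (Delta : A -> ten A A) (eps : A -> C).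
Hypothesis hG : is_cqg Delta eps.

Definition convol (phi psi : A -> C) (a : A) : C := pfun phi psi (Delta a).

Let hD := cqg_hom hG.

Lemma convol_state phi psi : state phi -> state psi -> state (convol phi psi).
Proof.
move=> h1 h2; have [[l p] e] := pfun_state ten h1 h2; split; first split.
- by move=> c x y; rewrite /convol (starhomD hD) (starhomZ hD) l.
- by move=> x; rewrite /convol (starhomM hD) (starhom_star hD).
- by rewrite /convol (starhom1 hD).
Qed.

Lemma convol_bounded phi psi : bdfun phi -> bdfun psi -> bdfun (convol phi psi).
Proof.
by move=> h1 h2; exact: (bdfun_comp (pfun_bounded ten h1 h2) (starhom_bounded hD)).
Qed.

Lemma sliceR_assoc psi chi (w : ten (ten A A) A) : bdfun psi -> bdfun chi ->
  sliceR psi (sliceR chi w) = sliceR (pfun psi chi) (tassoc w).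
Proof.
move=> h1 h2; have h12 := pfun_bounded ten h1 h2.
have [b1 e1] := sliceRP ten A h1; have [b2 e2] := sliceRP ten (ten A A) h2.
have [b3 e3] := sliceRP ten A h12; have [ha ea] := tassocP ten A A A.
have ba := starhom_bounded ha.
apply: (tens_ext (f := sliceR psi \o sliceR chi) (g := sliceR (pfun psi chi) \o @tassoc R ten A A A)).
- exact: bounded_map_comp.
- exact: bounded_map_comp.
- move=> x d /=; rewrite e2 (lfZ b1.1).
  have bt : bounded_map (fun x => @tprod R ten (ten A A) A x d).
    by apply: (bounded_map_comp (starhom_bounded (tinl_hom ten _ _)) (bounded_mulr _)).
  apply: (tens_ext (f := fun x => chi d *: sliceR psi x)
    (g := fun x => sliceR (pfun psi chi) (tassoc (tprod ten x d)))).
  + split; first by move=> c u v; rewrite b1.1 scalerDr !scalerA mulrC.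
    have [_ [M [M0 hM]]] := b1; exists (cabs (chi d) * M); split.
      by rewrite mulr_ge0 ?cabs_ge0.
    by move=> u; rewrite nmZ -mulrA ler_wpM2l ?cabs_ge0.
  + exact: (bounded_map_comp bt (bounded_map_comp ba b3)).
  + by move=> a b; rewrite ea e3 pfunE // e1 scalerA mulrC.
Qed.

Lemma sliceL_assoc phi psi (w : ten (ten A A) A) : bdfun phi -> bdfun psi ->
  sliceL psi (sliceL phi (tassoc w)) = sliceL (pfun phi psi) w.
Proof.
move=> h1 h2; have h12 := pfun_bounded ten h1 h2.
have [b1 e1] := sliceLP ten (ten A A) h1; have [b2 e2] := sliceLP ten A h2.
have [b3 e3] := sliceLP ten A h12; have [ha ea] := tassocP ten A A A.
have ba := starhom_bounded ha.
apply: (tens_ext (f := sliceL psi \o (sliceL phi \o @tassoc R ten A A A)) (g := sliceL (pfun phi psi))).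
- by apply: bounded_map_comp => //; exact: bounded_map_comp.
- exact: b3.
- move=> x d /=; rewrite e3.
  have bt : bounded_map (fun x => @tprod R ten (ten A A) A x d).
    by apply: (bounded_map_comp (starhom_bounded (tinl_hom ten _ _)) (bounded_mulr _)).
  apply: (tens_ext (f := fun x => sliceL psi (sliceL phi (tassoc (tprod ten x d))))
    (g := fun x => pfun phi psi x *: d)).
  + exact: (bounded_map_comp bt (bounded_map_comp ba (bounded_map_comp b1 b2))).
  + split; first by move=> c u v; rewrite h12.1 scalerDl !scalerA.
    have [_ [M [M0 hM]]] := h12; exists (M * nm d); split.
      by rewrite mulr_ge0 ?nm_ge0.
    by move=> u; rewrite nmZ mulrAC ler_wpM2r ?nm_ge0.
  + by move=> a b; rewrite ea e1 pfunE // (lfZ b2.1) e2 scalerA.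
Qed.

Lemma sliceR_coassoc psi chi a : bdfun psi -> bdfun chi ->
  sliceR psi (Delta (sliceR chi (Delta a))) = sliceR (convol psi chi) (Delta a).
Proof.
move=> h1 h2; have h12 := convol_bounded h1 h2; have h12' := pfun_bounded ten h1 h2.
have [hm1 em1] := tmapP ten hD (starhom_id A); have [hm2 em2] := tmapP ten (starhom_id A) hD.
have [b2 e2] := sliceRP ten (ten A A) h2; have [b2' e2'] := sliceRP ten A h2.
have [b3 e3] := sliceRP ten A h12'; have [b4 e4] := sliceRP ten A h12.
have -> : Delta (sliceR chi (Delta a)) = sliceR chi (tmap Delta id (Delta a)).
  apply: (tens_ext (f := Delta \o sliceR chi) (g := sliceR chi \o tmap Delta id)).
  - exact: bounded_map_comp b2' (starhom_bounded hD).
  - exact: bounded_map_comp (starhom_bounded hm1) b2.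
  - by move=> x y; rewrite /= em1 e2 e2' (starhomZ hD).
rewrite sliceR_assoc // -(cqg_coassoc hG).
apply: (tens_ext (f := sliceR (pfun psi chi) \o tmap id Delta) (g := sliceR (convol psi chi))) => //.
- exact: bounded_map_comp (starhom_bounded hm2) b3.
- by move=> x y; rewrite /= em2 e3 e4.
Qed.

Lemma sliceL_coassoc phi psi a : bdfun phi -> bdfun psi ->
  sliceL psi (Delta (sliceL phi (Delta a))) = sliceL (convol phi psi) (Delta a).
Proof.
move=> h1 h2; have h12 := convol_bounded h1 h2; have h12' := pfun_bounded ten h1 h2.
have [hm1 em1] := tmapP ten hD (starhom_id A); have [hm2 em2] := tmapP ten (starhom_id A) hD.
have [b2 e2] := sliceLP ten (ten A A) h1; have [b2' e2'] := sliceLP ten A h1.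
have [b3 e3] := sliceLP ten A h12'; have [b4 e4] := sliceLP ten A h12.
have -> : Delta (sliceL phi (Delta a)) = sliceL phi (tmap id Delta (Delta a)).
  apply: (tens_ext (f := Delta \o sliceL phi) (g := sliceL phi \o tmap id Delta)).
  - exact: bounded_map_comp b2' (starhom_bounded hD).
  - exact: bounded_map_comp (starhom_bounded hm2) b2.
  - by move=> x y; rewrite /= em2 e2 e2' (starhomZ hD).
rewrite (cqg_coassoc hG) sliceL_assoc //.
apply: (tens_ext (f := sliceL (pfun phi psi) \o tmap Delta id) (g := sliceL (convol phi psi))) => //.
- exact: bounded_map_comp (starhom_bounded hm1) b3.
- by move=> x y; rewrite /= em1 e3 e4.
Qed.

Lemma convol_sliceL phi psi a : bdfun phi -> bdfun psi ->
  convol phi psi a = psi (sliceL phi (Delta a)).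
Proof. by move=> h1 h2; rewrite /convol pfun_sliceL. Qed.

Lemma convolA phi psi chi : bdfun phi -> bdfun psi -> bdfun chi ->
  convol phi (convol psi chi) = convol (convol phi psi) chi.
Proof.
by move=> h1 h2 h3; apply/funext => a; rewrite /convol /pfun -[RHS]/(convol phi psi _) /convol /pfun -sliceR_coassoc.
Qed.

Fixpoint cpow (om : A -> C) (n : nat) := if n is n'.+1 then convol om (cpow om n') else om.

Lemma cpow_state om n : state om -> state (cpow om n).
Proof. by move=> h; elim: n => //= n ih; exact: convol_state. Qed.

Lemma cpow_r om n : state om -> convol (cpow om n) om = cpow om n.+1.
Proof.
move=> h; have b k := positive_bounded (cpow_state k h).1.
have bo := positive_bounded h.1.
by elim: n => //= n ih; rewrite -convolA // ih.
Qed.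

Lemma cesaro_state (s : nat -> A -> C) n : (forall n, state (s n)) ->
  state (fun a => cesaro (fun k => s k a) n).
Proof.
move=> hs; split; first split.
- move=> c x y; rewrite /cesaro [c * (_ * _)]mulrCA -mulrDr; congr (_ * _).
  by rewrite mulr_sumr -big_split /=; apply: eq_bigr => k _; rewrite (hs k).1.1.
- move=> x; rewrite /cesaro mulr_ge0 ?invr_ge0 ?ler0n // sumr_ge0 // => k _.
  exact: (hs k).1.2.
- rewrite /cesaro (eq_bigr (fun=> 1)) => [|k _]; last exact: (hs k).2.
  by rewrite sumr_const card_ord mulVf // pnatr_eq0.
Qed.

(** An ultralimit of Cesaro means of the convolution powers of [om]. Convolving with [om] on either
    side shifts the powers by one, and it commutes with the limit because it amounts to evaluation
    at a fixed slice of [Delta a]. *)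
Lemma idempotent_state om : state om ->
  exists h, [/\ state h, convol om h = h & convol h om = h].
Proof.
move=> ho; have [U [hU sU]] := ultraFilterLemma (F := (\oo)%classic) _.
have hN k : U [set n | (k <= n)%N]%classic by apply: sU; exact: nbhs_infty_ge.
pose s k := cpow om k; have hs k : state (s k) by exact: cpow_state.
have bs k := positive_bounded (hs k).1; have bo := positive_bounded ho.1.
have [h [sh hh]] := ultra_state hU (fun n => cesaro_state n hs).
have bh := positive_bounded sh.1.
have sft a : ucvg U (cesaro (fun n => s n.+1 a)) (h a).
  by apply: (@cesaro_shift R U hU hN (fun n => s n a) (nm a)); [move=> n; exact: state_le|exact: hh].
exists h; split=> //; apply/funext => a; apply: (ucvg_unique hU _ (sft a)).
- have := hh (sliceL om (Delta a)); rewrite -convol_sliceL //; congr ucvg.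
  apply/funext => n; rewrite /cesaro; congr (_ * _); apply: eq_bigr => k _.
  by rewrite -convol_sliceL.
- have := hh (sliceR om (Delta a)); congr ucvg.
  apply/funext => n; rewrite /cesaro; congr (_ * _); apply: eq_bigr => k _.
  by rewrite -[LHS]/(convol (s k) om a) cpow_r.
Qed.

Lemma dominated_left h om rho (m : C) :
  state h -> state om -> state rho -> positive (fun x => m * om x - rho x) ->
  convol om h = h -> convol h om = h -> convol rho h = h.
Proof.
move=> sh so sr dom e1 e2; apply/funext => a.
apply: (@dominated_invariant R A (ten A A) Delta (@tinl R ten A A) (@tinr R ten A A)
  (@pfun R ten A A) (@sliceR R ten A A) _ _ _ _ _ _ _ _ _ h om rho m) => //.
- exact: tinl_hom.
- exact: pfun_positive.
- by move=> phi psi b y hp hs; rewrite /pfun -tprod1l sliceR_mull.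
- by move=> phi psi b hp hs; rewrite -tprod1r pfunE.
- by move=> psi hp; rewrite -tprod11 (sliceRP ten A hp).2.
- by move=> *; rewrite pfunBr.
- by move=> *; rewrite sliceR_coassoc.
- move=> F F' bF bF' e; apply: (cancel_ext hD (tinl_hom ten A A)) => //.
  by have := cqg_cancell hG; congr dense; congr span2; apply/funext => x; apply/funext => b; rewrite tprod1l.
- by move=> b; rewrite -[LHS]/(convol om h b) e1.
- by move=> b; rewrite -[LHS]/(convol h om b) e2.
Qed.

Lemma dominated_right h om rho (m : C) :
  state h -> state om -> state rho -> positive (fun x => m * om x - rho x) ->
  convol om h = h -> convol h om = h -> convol h rho = h.
Proof.
move=> sh so sr dom e1 e2; apply/funext => a.
apply: (@dominated_invariant R A (ten A A) Delta (@tinr R ten A A) (@tinl R ten A A)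
  (fun phi psi => @pfun R ten A A psi phi) (@sliceL R ten A A) _ _ _ _ _ _ _ _ _ h om rho m) => //.
- exact: tinr_hom.
- by move=> phi psi h1 h2; exact: pfun_positive.
- by move=> phi psi b y hp hs; rewrite pfun_sliceL // -tprod1r sliceL_mull.
- by move=> phi psi b hp hs; rewrite -tprod1l pfunE // mulrC.
- by move=> psi hp; rewrite -tprod11 (sliceLP ten A hp).2.
- by move=> psi chi b hp hs; rewrite sliceL_coassoc.
- move=> F F' bF bF' e; apply: (cancel_ext hD (tinr_hom ten A A)) => //.
  by have := cqg_cancelr hG; congr dense; congr span2; apply/funext => x; apply/funext => b; rewrite tprod1r.
- by move=> b; rewrite -[LHS]/(convol h om b) e2.
- by move=> b; rewrite -[LHS]/(convol om h b) e1.
Qed.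

Definition avg (s : seq (A -> C)) (a : A) : C := (size s)%:R^-1 * \sum_(f <- s) f a.

Lemma eps_state : state eps.
Proof.
have [l [m1 m2] s] := cqg_eps hG; split=> //; split=> // x.
by rewrite m2 s mulrC mulcJ_ge0.
Qed.

(** The invariance obtained from a state [om] extends to the states dominated by a multiple of [om],
    and in a non-separable algebra no single [om] need suffice for all. Each finite list of states
    therefore contributes the invariant state of its average, which dominates every member up to a
    factor, and an ultralimit over lists is taken. *)
Theorem haar_state : exists h, [/\ state h,
  forall rho, state rho -> convol rho h = h & forall rho, state rho -> convol h rho = h].
Proof.
pose St := {phi : A -> C | state phi}; pose S := seq St.
(* Prepending the counit keeps the list nonempty, so that its average is a state. *)
pose ev (s : S) := eps :: map (@proj1_sig _ _) s.
have evs (s : S) n : (n < size (ev s))%N -> state (nth eps (ev s) n).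
  case: n => [|n] /=; first by move=> _; exact: eps_state.
  rewrite ltnS size_map => hn; elim: s n hn => [|x s ih] [|n] //=; last exact: ih.
  by move=> _; exact: (proj2_sig x).
have avs s : state (avg (ev s)).
  have sz : (size (ev s))%:R != 0 :> C by rewrite pnatr_eq0.
  split; first split.
  - move=> c x y; rewrite /avg [c * (_ * _)]mulrCA -mulrDr; congr (_ * _).
    by rewrite mulr_sumr -big_split /= !(big_nth eps) !big_mkord; apply: eq_bigr => k _; rewrite (evs s k _).1.1.
  - move=> x; rewrite /avg mulr_ge0 ?invr_ge0 ?ler0n // (big_nth eps) big_mkord sumr_ge0 // => k _.
    exact: (evs s k _).1.2.
  - rewrite /avg (big_nth eps) big_mkord (eq_bigr (fun=> 1)) => [|k _]; last exact: (evs s k _).2.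
    by rewrite sumr_const card_ord mulVf.
have dom s n : (n < size (ev s))%N ->
    positive (fun x => (size (ev s))%:R * avg (ev s) x - nth eps (ev s) n x).
  move=> hn; have sz : (size (ev s))%:R != 0 :> C by rewrite pnatr_eq0.
  have e x : (size (ev s))%:R * avg (ev s) x - nth eps (ev s) n x =
      \sum_(k < size (ev s) | k != Ordinal hn) nth eps (ev s) k x.
    rewrite /avg mulrA divff // mul1r (big_nth eps) big_mkord (bigD1 (Ordinal hn)) //=.
    by rewrite addrAC subrr add0r.
  split=> [c x y|x].
    by rewrite !e mulr_sumr -big_split; apply: eq_bigr => k _; rewrite (evs s k _).1.1.
  by rewrite e sumr_ge0 // => k _; exact: (evs s k _).1.2.
have [hs hh] := choice (fun s => idempotent_state (avs s)).
pose base (l : S) := [set s : S | exists t, s = t ++ l]%classic.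
pose base' (x : St) := [set s : S | exists n, (n < size (ev s))%N /\ nth eps (ev s) n = proj1_sig x]%classic.
(* Lists are directed by inclusion of their members, so that any given state eventually belongs to
   the list. *)
pose F : set_system S := filter_from setT (fun l : S => [set s : S | forall x : St,
  (exists n, (n < size (ev l))%N /\ nth eps (ev l) n = proj1_sig x) ->
  exists n, (n < size (ev s))%N /\ nth eps (ev s) n = proj1_sig x]%classic).
have evin (l : S) (x : St) : (exists n, (n < size (ev l))%N /\ nth eps (ev l) n = proj1_sig x) <->
    proj1_sig x = eps \/ exists t1 t2, map (@proj1_sig _ _) l = t1 ++ proj1_sig x :: t2.
  split=> [[[|n] [/=]]|[e|[t1 [t2 e]]]]; first by left.
  - move=> hn e; right; rewrite ltnS in hn.
    exists (take n (map (@proj1_sig _ _) l)), (drop n.+1 (map (@proj1_sig _ _) l)).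
    by rewrite -e -drop_nth // cat_take_drop.
  - by exists 0.
  - exists (size t1).+1; rewrite /ev e /= size_cat /= nth_cat ltnn subnn /=.
    by split=> //; rewrite ltnS -addn1 leq_add2l.
have FF : ProperFilter F.
  apply: filter_from_proper; last by move=> l _; exists l.
  apply: filter_from_filter; first by exists [::].
  move=> l1 l2 _ _; exists (l1 ++ l2) => // s hs'; split=> x /evin hx; apply: hs'; apply/evin.
    case: hx => [|[t1 [t2 e]]]; first by left.
    by right; exists t1, (t2 ++ map (@proj1_sig _ _) l2); rewrite map_cat e -catA.
  case: hx => [|[t1 [t2 e]]]; first by left.
  by right; exists (map (@proj1_sig _ _) l1 ++ t1), t2; rewrite map_cat e catA.
have [U [hU sU]] := ultraFilterLemma FF.
have hx (x : St) : U (base' x).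
  apply: sU; exists [:: x] => // s; apply.
  by exists 1%N.
have sts s : state (hs s) by case: (hh s).
have [h [sh hcv]] := ultra_state hU sts; have bh := positive_bounded sh.1.
exists h; split=> // rho sr; apply/funext => a; have br := positive_bounded sr.1.
- rewrite convol_sliceL //; apply: (ucvg_unique hU (hcv _)); apply: (ucvg_eq_near hU (hcv a)).
  have fF : ProperFilter U by exact: ultra_proper.
  apply: filterS (hx (exist _ rho sr)) => s [n [hn /= e]].
  have [s1 s2 s3] := hh s; have bs := positive_bounded s1.1.
  have d := dom s n hn; rewrite e in d.
  by rewrite -convol_sliceL // (dominated_left s1 (avs s) sr d).
- apply: (ucvg_unique hU (hcv _)); apply: (ucvg_eq_near hU (hcv a)).
  have fF : ProperFilter U by exact: ultra_proper.
  apply: filterS (hx (exist _ rho sr)) => s [n [hn /= e]].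
  have [s1 s2 s3] := hh s; have d := dom s n hn; rewrite e in d.
  by rewrite -[RHS]/(convol _ rho a) (dominated_right s1 (avs s) sr d).
Qed.

(** Vector states give [<pi(b) z, z> = 0] for all [z]; polarization at [x + y] and [x + i y] yields
    all coefficients. *)
Lemma state_sep (B : cstarAlgType R) (b : B) : (forall phi, state phi -> phi b = 0) -> b = 0.
Proof.
move=> hb; apply: (rep_sep ten) => pi x y.
have hd := hdot_semidot (rep_space pi); pose q z := hdot _ (pi b z) z.
have q0 z : q z = 0.
  have [n0|n0] := leP (nm z) 0.
    by rewrite (nm_le0 n0) /q (sd0r hd).
  pose c : R := (nm z ^+ 2)^-1.
  pose phi (a : B) : C := c%:C * hdot _ (pi a z) z.
  have sp : state phi.
    split; first split.
    - by move=> k u v; rewrite /phi repD repZ (sdDl hd) (sdZl hd); ring.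
    - move=> u; rewrite /phi repM rep_star starK mulr_ge0 ?(sd_ge0 hd) // ler0c.
      by rewrite invr_ge0 exprn_ge0 // nm_ge0.
    - by rewrite /phi rep1 hdotE nmE -real_complexX -real_complexM mulVf // gt_eqF // exprn_gt0.
  have := hb phi sp; rewrite /phi => /eqP; rewrite mulf_eq0 => /orP[|/eqP //].
  rewrite -(rmorph0 (real_complex R)) => /eqP/real_complex_inj/eqP.
  by rewrite invr_eq0 gt_eqF // exprn_gt0.
have piD u v k : pi b (u + k *: v) = pi b u + k *: pi b v.
  by rewrite addrC rep_linear addrC.
have e1 := q0 (x + 1 *: y); have e2 := q0 (x + 'i%C *: y).
rewrite /q !piD !(sdDl hd) !(sdDr hd) !(sdZl hd) !(sdZr hd) -!/(q _) !q0 in e1 e2.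
rewrite conj_i rmorph1 in e1 e2; move: e1 e2.
move: (hdot _ (pi b x) y) (hdot _ (pi b y) x) => u v.
rewrite !mulr0 !mul1r !add0r !addr0 => e1 e2.
have i0 : 'i%C != 0 :> C by apply/eqP => i0; have := iK R; rewrite i0 mul0r => /eqP; rewrite eq_sym oppr_eq0 oner_eq0.
have e3 : u - v = 0.
  by apply: (mulfI i0); rewrite mulr0; move: e2 => /(congr1 -%R); rewrite oppr0 => <-; ring.
have e4 : 2%:R * u = 0 by rewrite -[RHS]addr0 -{1}e1 -e3; ring.
by move/eqP: e4; rewrite mulf_eq0 pnatr_eq0 => /eqP.
Qed.

End Haar.

(** * Polarization *)

Section Polarization.
Variables (R : realType) (N : nat).
Local Notation C := R[i].
Implicit Types (a b u v : 'I_N -> C).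

Let i0 : 'i%C != 0 :> C.
Proof.
apply/eqP => e; have := iK R; rewrite e mul0r => /eqP.
by rewrite eq_sym oppr_eq0 oner_eq0.
Qed.

Let n2 : 2%:R != 0 :> C. Proof. by rewrite pnatr_eq0. Qed.
Definition vdelta k : 'I_N -> C := fun i => (i == k)%:R.

Definition bil (c : 'I_N -> 'I_N -> C) a b : C := \sum_k \sum_l c k l * a k * b l.
Definition tri (c : 'I_N -> 'I_N -> 'I_N -> C) a b d : C :=
  \sum_k \sum_l \sum_m c k l m * a k * b l * d m.

Lemma sum_vdelta (f : 'I_N -> C) k : \sum_i f i * vdelta k i = f k.
Proof.
rewrite (bigD1 k) //= {1}/vdelta eqxx mulr1 big1 ?addr0 // => i /negPf ik.
by rewrite /vdelta ik mulr0.
Qed.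

Lemma bil_delta (c : 'I_N -> 'I_N -> C) k l : bil c (vdelta k) (vdelta l) = c k l.
Proof.
rewrite /bil -[RHS](sum_vdelta (fun k => c k l)); apply: eq_bigr => k' _.
by rewrite -[in RHS](sum_vdelta (fun l => c k' l)) mulr_suml; apply: eq_bigr => l' _; ring.
Qed.

Lemma bilDl c t a a' b : bil c (fun i => a i + t * a' i) b = bil c a b + t * bil c a' b.
Proof.
rewrite /bil mulr_sumr -big_split; apply: eq_bigr => k _.
by rewrite mulr_sumr -big_split; apply: eq_bigr => l _ /=; ring.
Qed.

Lemma bilDr c t a b b' : bil c a (fun i => b i + t * b' i) = bil c a b + t * bil c a b'.
Proof.
rewrite /bil mulr_sumr -big_split; apply: eq_bigr => k _.
by rewrite mulr_sumr -big_split; apply: eq_bigr => l _ /=; ring.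
Qed.

(* The coefficient of [t^*] is extracted by testing on the fourth roots of unity. *)
Lemma conj_coef0 (a b x d e g : C) :
  (forall t : C, a + t * b + t^* * x + t * t * d + t * t^* * e + t * t * t^* * g = 0) -> x = 0.
Proof.
move=> h; have i2 := iK R.
have := h 1; have := h (-1); have := h 'i%C; have := h (- 'i%C).
rewrite !conjcN conj_i !rmorph1 opprK => e1 e2 e3 e4.
have f1 : b + x + g = 0.
  apply: (mulfI n2); rewrite mulr0 -[RHS](subrr 0) -[X in _ = X - _]e4 -[X in _ = _ - X]e3; ring.
have f2 : 'i%C * (b - x - ('i%C * 'i%C) * g) = 0.
  apply: (mulfI n2); rewrite mulr0 -[RHS](subrr 0) -[X in _ = X - _]e2 -[X in _ = _ - X]e1; ring.
move/eqP: f2; rewrite mulf_eq0 (negPf i0) /= i2 mulN1r opprK => /eqP f2.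
apply: (mulfI n2); rewrite mulr0 -[RHS](subrr 0) -[X in _ = X - _]f1 -[X in _ = _ - X]f2; ring.
Qed.

(** Replace [a] by [a + t d] with [d] conjugate to [b]: the coefficient of the conjugate of [t] is
    [bil c a b]. A complex vector and its conjugate thus behave as independent variables. *)
Lemma bil_sesq0 c : (forall a, bil c a (fun i => (a i)^*) = 0) -> forall a b, bil c a b = 0.
Proof.
move=> h a b; pose d i := (b i)^*.
apply: (@conj_coef0 0 (bil c d (fun i => (a i)^*)) _ 0 (bil c d b) 0) => t.
have := h (fun i => a i + t * d i); rewrite bilDl.
have -> : (fun i => (a i + t * d i)^*) = (fun i => (a i)^* + t^* * b i).
  by apply/funext => i; rewrite conjcD conjcM conjCK.
by rewrite !bilDr h => e0; rewrite -[RHS]e0; ring.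
Qed.

Lemma bil_sym0 c : (forall k, bil c (vdelta k) (vdelta k) = 0) ->
  (forall k l, bil c (fun i => vdelta k i + 1 * vdelta l i) (fun i => vdelta k i + 1 * vdelta l i) = 0) ->
  forall k l, c k l + c l k = 0.
Proof.
move=> h1 h2 k l; have := h2 k l; rewrite bilDl !bilDr !h1 !bil_delta => <-; ring.
Qed.

Lemma tri_delta c k l m : tri c (vdelta k) (vdelta l) (vdelta m) = c k l m.
Proof.
rewrite /tri -[RHS](sum_vdelta (fun k => c k l m)); apply: eq_bigr => k' _.
rewrite -[in RHS](sum_vdelta (fun l => c k' l m)) mulr_suml; apply: eq_bigr => l' _.
rewrite -[in RHS](sum_vdelta (fun m => c k' l' m)) !mulr_suml; apply: eq_bigr => m' _; ring.
Qed.

Lemma triD1 c t a a' b d :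
  tri c (fun i => a i + t * a' i) b d = tri c a b d + t * tri c a' b d.
Proof.
do 3 (rewrite /tri mulr_sumr -big_split; apply: eq_bigr => ? _ /=); ring.
Qed.

Lemma triD2 c t a b b' d :
  tri c a (fun i => b i + t * b' i) d = tri c a b d + t * tri c a b' d.
Proof.
do 3 (rewrite /tri mulr_sumr -big_split; apply: eq_bigr => ? _ /=); ring.
Qed.

Lemma triD3 c t a b d d' :
  tri c a b (fun i => d i + t * d' i) = tri c a b d + t * tri c a b d'.
Proof.
do 3 (rewrite /tri mulr_sumr -big_split; apply: eq_bigr => ? _ /=); ring.
Qed.

Lemma tri_outer0 c : (forall a b, tri c a b a = 0) -> forall k l m, c k l m + c m l k = 0.
Proof.
move=> h k l m; have := h (fun i => vdelta k i + 1 * vdelta m i) (vdelta l).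
by rewrite triD1 !triD3 !h !tri_delta => <-; ring.
Qed.

(** The same substitution frees the middle argument, while the outer two stay equal; this is why
    only a symmetrized identity follows from [tri_outer0]. *)
Lemma tri_sesq0 c : (forall a, tri c a (fun i => (a i)^*) a = 0) -> forall a b, tri c a b a = 0.
Proof.
move=> h a b; pose d i := (b i)^*; pose ac i := (a i)^*.
apply: (@conj_coef0 0 (tri c d ac a + tri c a ac d) _ (tri c d ac d)
  (tri c d b a + tri c a b d) (tri c d b d)) => t.
have := h (fun i => a i + t * d i); rewrite triD1 !triD3.
have -> : (fun i => (a i + t * d i)^*) = (fun i => (a i)^* + t^* * b i).
  by apply/funext => i; rewrite conjcD conjcM conjCK.
by rewrite !triD2 h => e0; rewrite -[RHS]e0 /ac; ring.
Qed.

Lemma tri_r0 c : (forall a b, tri c a b (fun i => (b i)^*) = 0) -> forall k l m, c k l m = 0.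
Proof.
move=> h k l m; rewrite -tri_delta.
pose c' l m := \sum_i c i l m * vdelta k i.
have e b d : tri c (vdelta k) b d = bil c' b d.
  rewrite /tri /bil exchange_big; apply: eq_bigr => l' _; rewrite exchange_big.
  by apply: eq_bigr => m' _ /=; rewrite /c' !mulr_suml.
by rewrite e; apply: bil_sesq0 => b; rewrite -e.
Qed.

Lemma tri_l0 c : (forall a d, tri c a (fun i => (a i)^*) d = 0) -> forall k l m, c k l m = 0.
Proof.
move=> h k l m; rewrite -tri_delta.
pose c' k l := \sum_i c k l i * vdelta m i.
have e a b : tri c a b (vdelta m) = bil c' a b.
  rewrite /tri /bil; apply: eq_bigr => k' _; apply: eq_bigr => l' _.
  by rewrite /c' !mulr_suml; apply: eq_bigr => m' _; ring.
by rewrite e; apply: bil_sesq0 => b; rewrite -e.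
Qed.

End Polarization.

Section Monomial.
Variables (R : realType) (T : finType).
Local Notation C := R[i].
Implicit Types (g : T -> C) (f : T -> T).

(** Row [p] carries the single entry [g p], in column [f p]. Products compose the maps and multiply
    the weights, so that words in the models can be computed explicitly. *)
Definition mono g f : mat R T := mat_of (fun p q => g p * (q == f p)%:R).

Lemma entry_mono g f p q : entry (mono g f) p q = g p * (q == f p)%:R.
Proof. exact: entry_mat_of. Qed.

Lemma monoM g f g' f' : mono g f * mono g' f' = mono (fun p => g p * g' (f p)) (f' \o f).
Proof.
apply: matP => p q; rewrite entryM (bigD1 (f p)) //= !entry_mono eqxx mulr1 big1 ?addr0 ?mulrA //.
by move=> k /negPf kf; rewrite entry_mono kf mulr0 mul0r.
Qed.

Lemma mono_star g f : involutive f -> star (mono g f) = mono (fun p => (g (f p))^*) f.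
Proof.
move=> fK; apply: matP => p q; rewrite entry_star !entry_mono conjcM rmorph_nat.
have -> : (p == f q) = (q == f p) by apply/eqP/eqP => ->; rewrite fK.
by case: eqP => [->|_]; rewrite ?mulr0.
Qed.

Lemma mono_eq g f g' f' : (forall p, g p = g' p) -> (forall p, f p = f' p) ->
  mono g f = mono g' f'.
Proof. by move=> hg hf; apply: matP => p q; rewrite !entry_mono hg hf. Qed.

Lemma mono1 : mono (fun=> 1) id = 1.
Proof. by apply: matP => p q; rewrite entry_mono entry1 mul1r eq_sym. Qed.

(** On [mono g f] it returns [g p] whatever [f] is, so one functional sees monomials with different
    underlying maps. *)
Definition rowsum p (M : mat R T) : C := \sum_q entry M p q.

Lemma rowsum_scalar p : scalar (rowsum p).
Proof.
move=> c M M'; rewrite /rowsum mulr_sumr -big_split; apply: eq_bigr => q _.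
exact: entry_scalar.
Qed.

Lemma rowsum_mono p g f : rowsum p (mono g f) = g p.
Proof.
rewrite /rowsum (bigD1 (f p)) //= entry_mono eqxx mulr1 big1 ?addr0 // => q /negPf h.
by rewrite entry_mono h mulr0.
Qed.


End Monomial.

(** * Matrix models of the spheres *)

Section Homogeneity.
Variables (R : realType) (N : nat).
Local Notation C := R[i].
Implicit Types a b d : 'I_N -> C.

Definition unit_vec a : Prop := \sum_i a i * (a i)^* = 1.

(** The models exist for unit vectors only, whereas polarization needs all vectors; homogeneity of
    the forms bridges the gap. *)
Lemma unit_scale a : a = (fun=> 0) \/
  exists r : R, 0 < r /\ unit_vec (fun i => r%:C * a i).
Proof.
have [e|ne] := pselect (forall i, a i = 0); first by left; apply/funext.
right; pose s : R := \sum_i cabs (a i) ^+ 2.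
have s0 : 0 < s.
  have [i ai] : exists i, a i <> 0 by apply: contrapT => h; apply: ne => i; apply: contrapT => h'; apply: h; exists i.
  rewrite /s (bigD1 i) //= ltr_pwDl ?sumr_ge0 // => [|j _]; last exact: sqr_ge0.
  rewrite exprn_gt0 // lt_neqAle cabs_ge0 andbT; apply/eqP => e.
  by apply: ai; apply: cabs_le0; rewrite -e.
exists (Num.sqrt s)^-1; split; first by rewrite invr_gt0 sqrtr_gt0.
rewrite /unit_vec (eq_bigr (fun i => ((Num.sqrt s)^-1 ^+ 2 * cabs (a i) ^+ 2)%:C)) => [|i _].
  rewrite -(raddf_sum (real_complex R)) /= -mulr_sumr -/s exprVn sqr_sqrtr ?(ltW s0) // mulVf //.
  by rewrite gt_eqF.
rewrite conjcM conjr real_complexM -mulcJ_cabs real_complexX; ring.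
Qed.

Lemma bilZ1 (c : 'I_N -> 'I_N -> C) t a b : bil c (fun i => t * a i) b = t * bil c a b.
Proof. by do 2 (rewrite /bil mulr_sumr; apply: eq_bigr => ? _ /=); ring. Qed.

Lemma bilZ2 (c : 'I_N -> 'I_N -> C) t a b : bil c a (fun i => t * b i) = t * bil c a b.
Proof. by do 2 (rewrite /bil mulr_sumr; apply: eq_bigr => ? _ /=); ring. Qed.

Lemma triZ1 (c : 'I_N -> 'I_N -> 'I_N -> C) t a b d :
  tri c (fun i => t * a i) b d = t * tri c a b d.
Proof. by do 3 (rewrite /tri mulr_sumr; apply: eq_bigr => ? _ /=); ring. Qed.

Lemma triZ2 (c : 'I_N -> 'I_N -> 'I_N -> C) t a b d :
  tri c a (fun i => t * b i) d = t * tri c a b d.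
Proof. by do 3 (rewrite /tri mulr_sumr; apply: eq_bigr => ? _ /=); ring. Qed.

Lemma triZ3 (c : 'I_N -> 'I_N -> 'I_N -> C) t a b d :
  tri c a b (fun i => t * d i) = t * tri c a b d.
Proof. by do 3 (rewrite /tri mulr_sumr; apply: eq_bigr => ? _ /=); ring. Qed.

Let cancel (r : R) (z : C) : 0 < r -> r%:C * z = 0 -> z = 0.
Proof.
move=> r0 /eqP; rewrite mulf_eq0 => /orP[/eqP/real_complex_inj e|/eqP //].
by move: r0; rewrite e ltxx.
Qed.

Let conjZ (r : R) a : (fun i => (r%:C * a i)^*) = (fun i => r%:C * (a i)^*).
Proof. by apply/funext => i; rewrite conjcM conjr. Qed.

Let bil0 (c : 'I_N -> 'I_N -> C) b : bil c (fun=> 0) b = 0.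
Proof. by rewrite /bil big1 // => k _; rewrite big1 // => l _; rewrite mulr0 mul0r. Qed.

Let tri0 (c : 'I_N -> 'I_N -> 'I_N -> C) b d : tri c (fun=> 0) b d = 0.
Proof.
by rewrite /tri big1 // => k _; rewrite big1 // => l _; rewrite big1 // => m _; rewrite mulr0 !mul0r.
Qed.

Let tri0' (c : 'I_N -> 'I_N -> 'I_N -> C) a d : tri c a (fun=> 0) d = 0.
Proof.
by rewrite /tri big1 // => k _; rewrite big1 // => l _; rewrite big1 // => m _; rewrite mulr0 !mul0r.
Qed.

Let tri0'' (c : 'I_N -> 'I_N -> 'I_N -> C) a b : tri c a b (fun=> 0) = 0.
Proof.
by rewrite /tri big1 // => k _; rewrite big1 // => l _; rewrite big1 // => m _; rewrite mulr0.
Qed.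

Lemma unit_bil_sesq0 c : (forall a, unit_vec a -> bil c a (fun i => (a i)^*) = 0) ->
  forall k l, c k l = 0.
Proof.
move=> h k l; rewrite -bil_delta; apply: bil_sesq0 => a.
have [->|[r [r0 ua]]] := unit_scale a; first exact: bil0.
apply: (cancel r0); apply: (cancel r0).
by rewrite -(h _ ua) conjZ bilZ1 bilZ2.
Qed.

Lemma unit_tri_outer0 c : (forall a, unit_vec a -> tri c a (fun i => (a i)^*) a = 0) ->
  forall k l m, c k l m + c m l k = 0.
Proof.
move=> h; apply: tri_outer0; apply: tri_sesq0 => a.
have [->|[r [r0 ua]]] := unit_scale a; first exact: tri0.
do 3 apply: (cancel r0).
by rewrite -(h _ ua) conjZ triZ1 triZ2 triZ3.
Qed.

Lemma unit_tri_r0 c :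
  (forall a b, unit_vec a -> unit_vec b -> tri c a b (fun i => (b i)^*) = 0) ->
  forall k l m, c k l m = 0.
Proof.
move=> h; apply: tri_r0 => a b.
have [->|[r [r0 ua]]] := unit_scale a; first exact: tri0.
have [->|[t [t0 ub]]] := unit_scale b; first exact: tri0'.
apply: (cancel r0); do 2 apply: (cancel t0).
by rewrite -(h _ _ ua ub) conjZ triZ1 triZ2 triZ3; ring.
Qed.

Lemma unit_tri_l0 c :
  (forall a d, unit_vec a -> unit_vec d -> tri c a (fun i => (a i)^*) d = 0) ->
  forall k l m, c k l m = 0.
Proof.
move=> h; apply: tri_l0 => a d.
have [->|[r [r0 ua]]] := unit_scale a; first exact: tri0.
have [->|[t [t0 ud]]] := unit_scale d; first exact: tri0''.
do 2 apply: (cancel r0); apply: (cancel t0).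
by rewrite -(h _ _ ua ud) conjZ triZ1 triZ2 triZ3; ring.
Qed.

Lemma unit_bil_sym0 c :
  (forall a, unit_vec a -> (forall i, (a i)^* = a i) -> bil c a a = 0) ->
  forall k l, c k l + c l k = 0.
Proof.
move=> h.
have h' a : (forall i, (a i)^* = a i) -> bil c a a = 0.
  move=> sa; have [->|[r [r0 ua]]] := unit_scale a; first exact: bil0.
  apply: (cancel r0); apply: (cancel r0).
  rewrite -[RHS](h _ ua) ?bilZ1 ?bilZ2 // => i; by rewrite conjcM conjr sa.
apply: bil_sym0 => k; first by apply: h' => i; rewrite rmorph_nat.
by move=> l; apply: h' => i; rewrite mul1r conjcD !rmorph_nat.
Qed.

Lemma unit_vdelta k : unit_vec (vdelta R k).
Proof.
rewrite /unit_vec (eq_bigr (fun i => vdelta R k i * vdelta R k i)) => [|i _].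
  by rewrite sum_vdelta /vdelta eqxx.
by rewrite rmorph_nat.
Qed.

End Homogeneity.

Section Model.
Variables (R : realType) (N : nat) (tw : bool).
Local Notation C := R[i].
Local Notation T := (bool * {set 'I_N})%type.
Implicit Types (i j k : 'I_N) (S : {set 'I_N}) (p q x y : 'I_N -> C).

(** Jordan-Wigner form of the Clifford generators on subsets: generator [j] toggles [j], with the
    sign [csgn j S] counting the elements of [S] below [j]. Without twist both are trivial. *)
Definition flip i S := if tw then [set k | (k \in S) (+) (k == i)] else S.
Definition csgn j S : C := if tw then \prod_(k < N | (k < j)%N) (-1) ^+ (k \in S) else 1.

Lemma flipK i : involutive (flip i).
Proof.
move=> S; rewrite /flip; case: (tw) => //; apply/setP => k.
by rewrite !inE -addbA addbb addbF.
Qed.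

Lemma flipC i j S : flip i (flip j S) = flip j (flip i S).
Proof.
by rewrite /flip; case: (tw) => //; apply/setP => k; rewrite !inE -!addbA [(k == j) (+) _]addbC.
Qed.

Lemma csgn0 j : csgn j finset.set0 = 1.
Proof. by rewrite /csgn; case: (tw) => //; rewrite big1 // => k _; rewrite inE. Qed.

Lemma csgn2 j S : csgn j S * csgn j S = 1.
Proof.
rewrite /csgn; case: (tw); last by rewrite mulr1.
by rewrite -big_split big1 // => k _; rewrite /= -signr_addb addbb.
Qed.

Lemma csgn_flip i j S : csgn j (flip i S) = (-1) ^+ (tw && (i < j)%N) * csgn j S.
Proof.
rewrite /csgn /flip; case: (tw) => /=; last by rewrite mul1r.
rewrite (eq_bigr (fun k : 'I_N => (-1) ^+ (k == i) * (-1) ^+ (k \in S))) => [|k _]; last first.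
  by rewrite inE signr_addb mulrC.
rewrite big_split; congr (_ * _) => /=.
have [ij|ij] := boolP (i < j)%N.
  by rewrite (bigD1 i) //= eqxx big1 ?mulr1 // => k /andP[_ /negPf ->].
by rewrite big1 // => k kj; case: eqP kj ij => // -> ->.
Qed.

Lemma csgn_conj j S : (csgn j S)^* = csgn j S.
Proof.
rewrite /csgn; case: (tw); last exact: rmorph1.
by rewrite rmorph_prod; apply: eq_bigr => k _; rewrite rmorph_sign.
Qed.

(** The antidiagonal 2 by 2 block with entries [p_j] and [q_j], tensored with the Clifford generator
    [j]. Along a word the two vectors alternate, as in [p_i q_j p_k], whence half-commutation up to
    the Clifford sign. *)
Definition letter p q j : mat R T :=
  mono (fun s => csgn j s.2 * (if s.1 then p j else q j)) (fun s => (~~ s.1, flip j s.2)).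

Lemma letter_star p q j : star (letter p q j) = letter (fun i => (q i)^*) (fun i => (p i)^*) j.
Proof.
rewrite mono_star; last by case=> b S; rewrite /= negbK flipK.
apply: mono_eq => -[b S] //=; rewrite conjcM csgn_conj csgn_flip ltnn andbF mul1r.
by case: b.
Qed.

Lemma mono_sign (b : bool) (g : T -> C) (f : T -> T) :
  (-1) ^+ b * mono g f = mono (fun s => (-1) ^+ b * g s) f.
Proof.
case: b; last by rewrite mul1r; apply: mono_eq => p; rewrite ?mul1r.
rewrite !expr1 mulN1r; apply: matP => p q.
have e := scfN (entry_scalar p q (T := T)); rewrite e !entry_mono; ring.
Qed.

Lemma letterM p q p' q' i j : letter p q i * letter p' q' j =
  mono (fun s => (-1) ^+ (tw && (i < j)%N) * (csgn i s.2 * csgn j s.2) *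
          (if s.1 then p i * q' j else q i * p' j))
       (fun s => (s.1, flip j (flip i s.2))).
Proof.
rewrite monoM; apply: mono_eq => -[b S] /=; last by rewrite negbK.
by rewrite csgn_flip; case: b => /=; ring.
Qed.

Lemma letterM3 p q p' q' p'' q'' i j k :
  letter p q i * letter p' q' j * letter p'' q'' k =
  mono (fun s => (-1) ^+ (tw && (i < j)%N) * (-1) ^+ (tw && (i < k)%N) *
          (-1) ^+ (tw && (j < k)%N) * (csgn i s.2 * csgn j s.2 * csgn k s.2) *
          (if s.1 then p i * q' j * p'' k else q i * p' j * q'' k))
       (fun s => (~~ s.1, flip k (flip j (flip i s.2)))).
Proof.
rewrite letterM monoM; apply: mono_eq => -[b S] //=.
by rewrite !csgn_flip; case: b => /=; ring.
Qed.

Lemma mono_sum (I : finType) (g : I -> T -> C) (f : T -> T) :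
  \sum_i mono (g i) f = mono (fun s => \sum_i g i s) f.
Proof.
apply: matP => p q; rewrite (scf_sum (entry_scalar p q (T := T))) entry_mono mulr_suml.
by apply: eq_bigr => i _; rewrite entry_mono.
Qed.

Lemma letter_sum p q p' q' : (\sum_i p i * q' i = 1) -> (\sum_i q i * p' i = 1) ->
  \sum_i letter p q i * letter p' q' i = 1.
Proof.
move=> h1 h2; under eq_bigr => i _ do rewrite letterM.
rewrite (eq_bigr (fun i => mono (fun s : T => if s.1 then p i * q' i else q i * p' i) id)).
  rewrite mono_sum -mono1; apply: mono_eq => // -[[] S] /=; [exact: h1|exact: h2].
move=> i _; apply: mono_eq => -[b S] /=; last by rewrite flipK.
by rewrite ltnn andbF mul1r csgn2 mul1r.
Qed.

Definition vec_of x y (b s : bool) i : C :=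
  if b then (if s then (y i)^* else x i) else (if s then (x i)^* else y i).

Lemma adj_letter x y s i :
  adj s (letter x y i) = letter (vec_of x y true s) (vec_of x y false s) i.
Proof. by case: s => //=; rewrite letter_star. Qed.

Lemma rowsum_letter x y b s i :
  rowsum (b, finset.set0) (adj s (letter x y i)) = vec_of x y b s i.
Proof. by rewrite adj_letter rowsum_mono /= csgn0 mul1r; case: b. Qed.

Lemma rowsum_letter2 x y b s t i j :
  rowsum (b, finset.set0) (adj s (letter x y i) * adj t (letter x y j)) =
  (-1) ^+ (tw && (i < j)%N) * vec_of x y b s i * vec_of x y (~~ b) t j.
Proof. by rewrite !adj_letter letterM rowsum_mono /= !csgn0 !mulr1 -mulrA; case: b. Qed.

Lemma rowsum_letter3 x y b s t r i j k :
  rowsum (b, finset.set0) (adj s (letter x y i) * adj t (letter x y j) * adj r (letter x y k)) =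
  (-1) ^+ (tw && (i < j)%N) * (-1) ^+ (tw && (i < k)%N) * (-1) ^+ (tw && (j < k)%N) *
  (vec_of x y b s i * vec_of x y (~~ b) t j * vec_of x y b r k).
Proof. by rewrite !adj_letter letterM3 rowsum_mono /= !csgn0 !mulr1; case: b. Qed.

End Model.

(** * Independence of monomials *)

(* With [X] a unitary matrix and [Y_(I, L) = X_(I, L) - s_I s_L X_(rev I, rev L)],
   the antisymmetry of [Y] forces [\sum Y Y^* = 0]. *)
Lemma antisym_unitary_eq0 (R : realType) (ten : spatialTensor R) (A : cstarAlgType R)
    (I : finType) (rev : I -> I) (s : I -> bool) (X : I -> I -> A) :
  involutive rev -> (forall i, s (rev i) = s i) ->
  (forall i j, \sum_l X i l * star (X j l) = (i == j)%:R) ->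
  (forall l k, \sum_i X i l * star (X i k) = (l == k)%:R) ->
  (forall i l, X i (rev l) - (-1) ^+ (s i (+) s l) * X (rev i) l =
     - ((-1) ^+ s l * (X i l - (-1) ^+ (s i (+) s l) * X (rev i) (rev l)))) ->
  forall i l, X i l = (-1) ^+ (s i (+) s l) * X (rev i) (rev l).
Proof.
move=> revK srev hA hB hY.
have sgM (b : bool) (x y : A) : x * ((-1) ^+ b * y) = (-1) ^+ b * (x * y).
  by case: b; rewrite ?mul1r // expr1 !mulN1r mulrN.
have sgS (b : bool) (x : A) : star ((-1) ^+ b * x) = (-1) ^+ b * star x.
  by case: b; rewrite ?mul1r // expr1 !mulN1r starN.
have sgK (b : bool) (x : A) : (-1) ^+ b * ((-1) ^+ b * x) = x.
  by case: b; rewrite ?mul1r // expr1 !mulN1r opprK.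
have sgA (b c : bool) (x : A) : (-1) ^+ b * ((-1) ^+ c * x) = (-1) ^+ (b (+) c) * x.
  by rewrite mulrA -signr_addb.
pose t : A := \sum_(i | rev i == i) (-1) ^+ s i.
pose n : A := \sum_(i : I) 1.
pose Sg : A := \sum_i \sum_l (-1) ^+ (s i (+) s l) * (X (rev i) (rev l) * star (X i l)).
have nE : \sum_i \sum_l X i l * star (X i l) = n.
  by apply: eq_bigr => i _; rewrite hA eqxx.
have nE' : \sum_i \sum_l X (rev i) (rev l) * star (X (rev i) (rev l)) = n.
  rewrite -nE [RHS](reindex_inj (inv_inj revK)); apply: eq_bigr => i _.
  by rewrite [RHS](reindex_inj (inv_inj revK)).
have t1 : \sum_l \sum_i (-1) ^+ s l * (X i (rev l) * star (X i l)) = t.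
  rewrite /t [RHS]big_mkcond; apply: eq_bigr => l _; rewrite -mulr_sumr hB.
  by case: eqP => _; rewrite ?mulr1 ?mulr0.
have t2 : \sum_i \sum_l (-1) ^+ s i * (X (rev i) l * star (X i l)) = t.
  rewrite /t [RHS]big_mkcond; apply: eq_bigr => i _; rewrite -mulr_sumr hA.
  by case: eqP => _; rewrite ?mulr1 ?mulr0.
(* Multiply [hY] by [(-1)^(s l)] and, on the right, by the adjoint of [X i l], then sum. The left
   side is [t - t], one term computed by columns and the other by rows; the right side is
   [Sg - n]. *)
have SgE : Sg = n.
  have e : \sum_i \sum_l ((-1) ^+ s l * (X i (rev l) * star (X i l)) -
      (-1) ^+ s i * (X (rev i) l * star (X i l))) = Sg - n.
    rewrite /Sg -nE -sumrB; apply: eq_bigr => i _; rewrite -sumrB; apply: eq_bigr => l _.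
    have := congr1 (fun x => (-1) ^+ s l * (x * star (X i l))) (hY i l).
    rewrite !mulrBl mulrBr mulNr -!mulrA mulrN sgK mulrBl -mulrA !sgA => e.
    by rewrite -[RHS]opprB -e addbCA addbb addbF.
  move/eqP: e; under eq_bigr do rewrite sumrB; rewrite sumrB t2 exchange_big /= t1 subrr.
  by rewrite eq_sym subr_eq0 => /eqP.
have SgE' : \sum_i \sum_l (-1) ^+ (s i (+) s l) * (X i l * star (X (rev i) (rev l))) = n.
  rewrite -SgE /Sg [RHS](reindex_inj (inv_inj revK)); apply: eq_bigr => i _.
  rewrite [RHS](reindex_inj (inv_inj revK)); apply: eq_bigr => l _.
  by rewrite !srev !revK.
have Y0 : \sum_(p : I * I) (X p.1 p.2 - (-1) ^+ (s p.1 (+) s p.2) * X (rev p.1) (rev p.2)) *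
    star (X p.1 p.2 - (-1) ^+ (s p.1 (+) s p.2) * X (rev p.1) (rev p.2)) = 0.
  rewrite -(pair_big xpredT xpredT (fun i l => (X i l - (-1) ^+ (s i (+) s l) * X (rev i) (rev l)) *
    star (X i l - (-1) ^+ (s i (+) s l) * X (rev i) (rev l)))) /=.
  (* Each of the four terms of the expanded square sums to [n]. *)
  transitivity (n - n - (n - n)); last by rewrite !subrr.
  rewrite -{1}nE -{1}SgE -{1}SgE' -{1}nE' /Sg -!sumrB; apply: eq_bigr => i _.
  rewrite -!sumrB; apply: eq_bigr => l _.
  by rewrite starB sgS mulrBr !mulrBl !sgM -!mulrA sgK.
move=> i l; have := sum_mul_star_eq0 ten Y0 (i := (i, l)) isT.
by move=> /eqP; rewrite subr_eq0 => /eqP.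
Qed.

Lemma tens_fin (R : realType) (ten : spatialTensor R) (A B : cstarAlgType R) (I : finType)
    (a : I -> A) (b : I -> B) : \sum_i tprod ten (a i) (b i) = 0 ->
  forall (g : A -> R[i]) (g' : B -> R[i]), scalar g -> scalar g' -> \sum_i g (a i) * g' (b i) = 0.
Proof.
move=> h g g' hg hg'.
have := @tens_algebraic_inj R ten A B [seq (a i, b i) | i <- index_enum I] _ g g' hg hg'.
by rewrite big_map; apply; rewrite /tsum big_map.
Qed.

Definition twisted (L : liberation) : bool :=
  match L with Twisted | TwistedHalfLiberated => true | _ => false end.

Definition quadratic (L : liberation) : bool :=
  match L with Classical | Twisted => true | _ => false end.

Definition cubic (L : liberation) : bool :=
  match L with HalfLiberated | TwistedHalfLiberated => true | _ => false end.

Lemma unit_vecJ (R : realType) (N : nat) (x : 'I_N -> R[i]) :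
  unit_vec x -> unit_vec (fun i => (x i)^*).
Proof. by rewrite /unit_vec => <-; apply: eq_bigr => i _; rewrite conjCK mulrC. Qed.

Section Sphere.
Variables (R : realType) (N : nat) (K : scalars) (L : liberation).
Local Notation C := R[i].
Implicit Types (x y : 'I_N -> C) (i j k : 'I_N).

Lemma sign_swap2 (tw : bool) i j :
  (-1) ^+ (tw && (i < j)%N) = (-1) ^+ (tw && (i != j)) * (-1) ^+ (tw && (j < i)%N) :> C.
Proof.
case: tw => /=; last by rewrite mulr1.
by rewrite -(inj_eq val_inj) /=; case: ltngtP => _ /=; rewrite ?mulr1 ?mulrNN ?mul1r ?expr1 ?mulrNN ?mulr1.
Qed.

Lemma sign_swap3 (tw : bool) i j k :
  (-1) ^+ (tw && (i < j)%N) * (-1) ^+ (tw && (i < k)%N) * (-1) ^+ (tw && (j < k)%N) =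
  (-1) ^+ (tw && uniq [:: i; j; k]) * ((-1) ^+ (tw && (k < j)%N) *
  (-1) ^+ (tw && (k < i)%N) * (-1) ^+ (tw && (j < i)%N)) :> C.
Proof.
case: tw => /=; last by rewrite !mulr1.
rewrite !inE -!(inj_eq val_inj) /= -!signr_addb; congr ((-1) ^+ (nat_of_bool _)).
by case: (ltngtP i j) => h1; case: (ltngtP i k) => h2; case: (ltngtP j k) => h3 //=; lia.
Qed.

(** Self-adjointness forces [y] to be conjugate to [x], and commutation or anticommutation of the
    generators forces [y = x]. The free spheres are tested on the half-commuting model, which is
    already large enough. *)
Lemma sphere_model x y : unit_vec x -> unit_vec y ->
  (K = RealCase -> forall i, y i = (x i)^*) ->
  (quadratic L -> forall i, y i = x i) ->
  sphere_rel K L (letter (twisted L) x y).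
Proof.
move=> ux uy hK hL; split.
  case: K hK => [h|_]; last first.
    have ux' : \sum_i (x i)^* * x i = 1 by rewrite -[RHS]ux; apply: eq_bigr => i _; rewrite mulrC.
    have uy' : \sum_i (y i)^* * y i = 1 by rewrite -[RHS]uy; apply: eq_bigr => i _; rewrite mulrC.
    by split; under eq_bigr => i _ do rewrite letter_star; apply: letter_sum.
  have h' : (fun i => (y i)^*) = x by apply/funext => i; rewrite h ?conjCK.
  have h'' : (fun i => (x i)^*) = y by apply/funext => i; rewrite h.
  split=> [i|]; first by rewrite letter_star h' h''.
  under eq_bigr do rewrite expr2; apply: letter_sum.
    by rewrite -ux; apply: eq_bigr => i _; rewrite h.
  by rewrite -ux; apply: eq_bigr => i _; rewrite h // mulrC.
have q : quadratic L -> comm2 (letter (twisted L) x y) (fun i j => twisted L && (i != j)).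
  move=> qL i j s t; have xy : x = y by apply/funext => i'; rewrite hL.
  rewrite !adj_letter [LHS]letterM [X in _ = _ * X]letterM mono_sign xy; apply: mono_eq => -[b S] /=; last by rewrite flipC.
  by rewrite sign_swap2; case: b; case: s; case: t; rewrite /vec_of; ring.
have c : comm3 (letter (twisted L) x y) (fun i j k => twisted L && uniq [:: i; j; k]).
  move=> i j k s t r.
  rewrite !adj_letter [LHS]letterM3 [X in _ = _ * X]letterM3 mono_sign; apply: mono_eq => -[b S]; last first.
    by congr pair; rewrite /= (flipC _ k j) (flipC _ k i) (flipC _ j i).
  by rewrite sign_swap3; case: b; cbn [fst snd]; ring.
by case: L hL q c => //= _ q c; [exact: q isT|exact: q isT].
Qed.

Variables (X : cstarAlgType R) (z : 'I_N -> X).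
Hypothesis univ : is_universal (fun A => @sphere_rel R A N K L) z.

Definition sgn2 i j : C := (-1) ^+ (twisted L && (i < j)%N).
Definition sgn3 i j k : C := (-1) ^+ (twisted L && (i < j)%N) *
  (-1) ^+ (twisted L && (i < k)%N) * (-1) ^+ (twisted L && (j < k)%N).

(** The row sum at the empty set, where [csgn] is trivial, turns a word into the product of its
    scalar coordinates, up to a sign that depends only on the order of the indices. *)
Lemma sphere_functional x y (b : bool) : unit_vec x -> unit_vec y ->
  (K = RealCase -> forall i, y i = (x i)^*) ->
  (quadratic L -> forall i, y i = x i) ->
  exists F : X -> C, [/\ scalar F, forall s i, F (adj s (z i)) = vec_of x y b s i,
    forall s t i j, F (adj s (z i) * adj t (z j)) =
      sgn2 i j * vec_of x y b s i * vec_of x y (~~ b) t j &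
    forall s t r i j k, F (adj s (z i) * adj t (z j) * adj r (z k)) =
      sgn3 i j k * (vec_of x y b s i * vec_of x y (~~ b) t j * vec_of x y b r k)].
Proof.
move=> ux uy hK hL; have [_ /(_ _ _ (sphere_model ux uy hK hL))[f [[hf fz] _]]] := univ.
have fa s i : f (adj s (z i)) = adj s (letter (twisted L) x y i).
  by case: s => /=; rewrite ?(starhom_star hf) fz.
exists (fun a => rowsum (b, finset.set0) (f a)); split.
- by move=> c u v; rewrite (starhomD hf) (starhomZ hf) rowsum_scalar.
- by move=> s i; rewrite fa rowsum_letter.
- by move=> s t i j; rewrite (starhomM hf) !fa rowsum_letter2.
- by move=> s t r i j k; rewrite !(starhomM hf) !fa rowsum_letter3.
Qed.

Variables (ten : spatialTensor R) (A : cstarAlgType R).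

Lemma scalar_sep (a : A) : (forall g : A -> C, scalar g -> g a = 0) -> a = 0.
Proof.
move=> h; apply: contrapT => a0; have [g [hg ga]] := separating_functional a0.
by have := h g hg; rewrite ga => /eqP; rewrite oner_eq0.
Qed.

Lemma sphere_indep1 (a : 'I_N -> A) : \sum_i tprod ten (a i) (z i) = 0 -> forall i, a i = 0.
Proof.
move=> h k; apply: scalar_sep => g hg.
have [||F [hF F1 _ _]] := @sphere_functional (vdelta R k) (vdelta R k) true (unit_vdelta R k) (unit_vdelta R k).
- by move=> _ i; rewrite rmorph_nat.
- by [].
rewrite -(sum_vdelta (fun i => g (a i)) k) -[RHS](tens_fin h hg hF).
by apply: eq_bigr => i _; have -> : F (z i) = vdelta R k i := F1 false i.
Qed.

Let tens_fin2 (a : 'I_N -> 'I_N -> A) (b : 'I_N -> 'I_N -> X) :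
  \sum_k \sum_l tprod ten (a k l) (b k l) = 0 ->
  forall (g : A -> C) (F : X -> C), scalar g -> scalar F ->
    \sum_k \sum_l g (a k l) * F (b k l) = 0.
Proof.
rewrite pair_big => h g F hg hF; rewrite pair_big.
exact: (@tens_fin R ten A X _ (fun p => a p.1 p.2) (fun p => b p.1 p.2)).
Qed.

Let tens_fin3 (a : 'I_N -> 'I_N -> 'I_N -> A) (b : 'I_N -> 'I_N -> 'I_N -> X) :
  \sum_k \sum_l \sum_m tprod ten (a k l m) (b k l m) = 0 ->
  forall (g : A -> C) (F : X -> C), scalar g -> scalar F ->
    \sum_k \sum_l \sum_m g (a k l m) * F (b k l m) = 0.
Proof.
have e (V : nmodType) (f : 'I_N -> 'I_N -> 'I_N -> V) :
    \sum_k \sum_l \sum_m f k l m = \sum_(p : 'I_N * ('I_N * 'I_N)) f p.1 p.2.1 p.2.2.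
  under eq_bigr do rewrite pair_big; by rewrite pair_big.
rewrite e => h g F hg hF; rewrite e.
exact: (@tens_fin R ten A X _ (fun p => a p.1 p.2.1 p.2.2) (fun p => b p.1 p.2.1 p.2.2)).
Qed.

Let sgn2_neq0 i j : sgn2 i j != 0. Proof. by rewrite signr_eq0. Qed.
Let sgn3_neq0 i j k : sgn3 i j k != 0. Proof. by rewrite /sgn3 !mulf_neq0 ?signr_eq0. Qed.

Let scalar_sg (g : A -> C) (b : bool) (a : A) : scalar g -> g ((-1) ^+ b * a) = (-1) ^+ b * g a.
Proof. by move=> hg; case: b; rewrite ?mul1r // expr1 !mulN1r (scfN hg). Qed.

(** Real points [x = y] are available for all ten spheres, and on them a bilinear form shows just
    its symmetric part; the sign records the reordering of the two letters. *)
Lemma sphere_indep2_sym s (a : 'I_N -> 'I_N -> A) :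
  \sum_k \sum_l tprod ten (a k l) (adj s (z k) * adj s (z l)) = 0 ->
  forall k l, a k l + (-1) ^+ (twisted L && (k != l)) * a l k = 0.
Proof.
move=> h k l; apply: scalar_sep => g hg; rewrite (scfD hg) scalar_sg //.
have sym : g (a k l) * sgn2 k l + g (a l k) * sgn2 l k = 0.
  apply: (unit_bil_sym0 (c := fun k l => g (a k l) * sgn2 k l)) => x ux sx.
  have [||F [hF _ F2 _]] := @sphere_functional x x true ux ux; [by move=> _ i; rewrite sx|by []|].
  rewrite -[RHS](tens_fin2 h hg hF) /bil; apply: eq_bigr => k' _; apply: eq_bigr => l' _.
  by rewrite F2 /vec_of !sx /= !if_same; ring.
apply: (mulIf (sgn2_neq0 k l)); rewrite mul0r -[RHS]sym mulrDl; congr (_ + _).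
rewrite mulrAC mulrC; congr (_ * _); rewrite /sgn2 [in RHS]sign_swap2 eq_sym //.
Qed.

(** A letter and an adjoint letter see a complex vector and its conjugate, which polarization
    separates. Taking [x = y] covers the quadratic spheres too. *)
Lemma sphere_indep2_mixed s (a : 'I_N -> 'I_N -> A) : K = ComplexCase ->
  \sum_k \sum_l tprod ten (a k l) (adj s (z k) * adj (~~ s) (z l)) = 0 -> forall k l, a k l = 0.
Proof.
move=> hK h k l; apply: scalar_sep => g hg; apply: (mulIf (sgn2_neq0 k l)); rewrite mul0r.
move: k l; apply: unit_bil_sesq0 => x ux.
pose w i := if s then (x i)^* else x i.
have uw : unit_vec w.
  by rewrite /w; case: (s) => //; exact: unit_vecJ.
have [||F [hF _ F2 _]] := @sphere_functional w w true uw uw; [by rewrite hK|by []|].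
rewrite -[RHS](tens_fin2 h hg hF) /bil; apply: eq_bigr => k _; apply: eq_bigr => l _.
by rewrite F2 /vec_of /w; case: (s); rewrite /= ?conjCK; ring.
Qed.

(** Here [y] may be taken conjugate to [x], so that even [z_k z_l] sees a vector and its
    conjugate. *)
Lemma sphere_indep2_real (a : 'I_N -> 'I_N -> A) : ~~ quadratic L ->
  \sum_k \sum_l tprod ten (a k l) (z k * z l) = 0 -> forall k l, a k l = 0.
Proof.
move=> hL h k l; apply: scalar_sep => g hg; apply: (mulIf (sgn2_neq0 k l)); rewrite mul0r.
move: k l; apply: unit_bil_sesq0 => x ux; pose y i := (x i)^*.
have uy : unit_vec y := unit_vecJ ux.
have [||F [hF _ F2 _]] := @sphere_functional x y true ux uy; [by []|by rewrite (negPf hL)|].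
rewrite -[RHS](tens_fin2 h hg hF) /bil; apply: eq_bigr => k _; apply: eq_bigr => l _.
have -> : F (z k * z l) = _ := F2 false false k l; rewrite /vec_of /y; ring.
Qed.

Lemma sphere_indep3_sym s t (a : 'I_N -> 'I_N -> 'I_N -> A) : ~~ quadratic L ->
  \sum_k \sum_l \sum_m tprod ten (a k l m) (adj s (z k) * adj t (z l) * adj s (z m)) = 0 ->
  forall k l m, a k l m + (-1) ^+ (twisted L && uniq [:: k; l; m]) * a m l k = 0.
Proof.
move=> hL h k l m; apply: scalar_sep => g hg; rewrite (scfD hg) scalar_sg //.
have sym : g (a k l m) * sgn3 k l m + g (a m l k) * sgn3 m l k = 0.
  apply: (unit_tri_outer0 (c := fun k l m => g (a k l m) * sgn3 k l m)) => x ux.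
  pose y i := (x i)^*.
  have uy : unit_vec y := unit_vecJ ux.
  have [||F [hF _ _ F3]] := @sphere_functional x y true ux uy; [by []|by rewrite (negPf hL)|].
  rewrite -[RHS](tens_fin3 h hg hF) /tri; apply: eq_bigr => k' _; apply: eq_bigr => l' _.
  apply: eq_bigr => m' _.
  by rewrite F3 /vec_of /y; case: (s); case: (t); rewrite /= ?conjCK; ring.
apply: (mulIf (sgn3_neq0 k l m)); rewrite mul0r -[RHS]sym mulrDl; congr (_ + _).
rewrite mulrAC mulrC; congr (_ * _); rewrite /sgn3 [in RHS]sign_swap3.
congr ((-1) ^+ (nat_of_bool _) * _); congr (_ && _).
by rewrite -[LHS](@rev_uniq _ [:: k; l; m]).
Qed.

(** With [x] and [y] independent the two outer letters see different vectors, and the middle one is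
    conjugate to exactly one of them: the stars decide between [tri_r0] and [tri_l0]. *)
Lemma sphere_indep3_mixed s t (a : 'I_N -> 'I_N -> 'I_N -> A) : K = ComplexCase -> ~~ quadratic L ->
  \sum_k \sum_l \sum_m tprod ten (a k l m) (adj s (z k) * adj t (z l) * adj (~~ s) (z m)) = 0 ->
  forall k l m, a k l m = 0.
Proof.
move=> hK hL h k l m; apply: scalar_sep => g hg; apply: (mulIf (sgn3_neq0 k l m)); rewrite mul0r.
have uJ x : unit_vec x -> unit_vec (fun i => (x i)^*) by exact: unit_vecJ.
have key x y : unit_vec x -> unit_vec y ->
    tri (fun k l m => g (a k l m) * sgn3 k l m) (vec_of x y true s) (vec_of x y false t)
      (vec_of x y true (~~ s)) = 0.
  move=> ux uy.
  have [||F [hF _ _ F3]] := @sphere_functional x y true ux uy; [by rewrite hK|by rewrite (negPf hL)|].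
  rewrite -[RHS](tens_fin3 h hg hF) /tri; apply: eq_bigr => k' _; apply: eq_bigr => l' _.
  by apply: eq_bigr => m' _; rewrite F3 /=; ring.
case: s t key {h} => -[] key; move: k l m.
- apply: unit_tri_r0 => u v uu uv; have := key _ _ (uJ _ uv) (uJ _ uu).
  by rewrite /vec_of /=; congr (tri _ _ _ _ = 0); apply/funext => i; rewrite ?conjCK.
- apply: unit_tri_l0 => u v uu uv; have := key _ _ uv (uJ _ uu).
  by rewrite /vec_of /=; congr (tri _ _ _ _ = 0); apply/funext => i; rewrite ?conjCK.
- apply: unit_tri_l0 => u v uu uv; have := key _ _ uu (uJ _ uv).
  by rewrite /vec_of /=; congr (tri _ _ _ _ = 0); apply/funext => i; rewrite ?conjCK.
- apply: unit_tri_r0 => u v uu uv; have := key _ _ uu uv.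
  by rewrite /vec_of /=; congr (tri _ _ _ _ = 0); apply/funext => i; rewrite ?conjCK.
Qed.

End Sphere.

(** * Relations between the coefficients of an action *)

Section Relations.
Variables (R : realType) (N : nat) (K : scalars) (L : liberation).
Implicit Types (A X : cstarAlgType R) (i j k l m n : 'I_N).

Lemma adj_star A s (x : A) : star (adj s x) = adj (~~ s) x.
Proof. by case: s => //=; rewrite starK. Qed.

Lemma adj_id A s (x : A) : x = star x -> adj s x = x.
Proof. by case: s. Qed.

Lemma starhom_adj A X (f : A -> X) s x : is_starhom f -> f (adj s x) = adj s (f x).
Proof. by move=> hf; case: s => //=; exact: starhom_star. Qed.

Definition e2 i j := twisted L && (i != j).
Definition e3 i j k := twisted L && uniq [:: i; j; k].

Lemma e2C i j : e2 i j = e2 j i. Proof. by rewrite /e2 eq_sym. Qed.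

Lemma e3C i j k : e3 i j k = e3 k j i.
Proof. by rewrite /e3 -[uniq [:: i; j; k]](@rev_uniq _ [:: i; j; k]). Qed.

(** The quantum group sign is the sphere sign of the rows times that of the columns. Signs of
    summation indices therefore cancel in the comultiplication and in the action. *)
Lemma same_lineE i j k l : twisted L && same_line (i, k) (j, l) = e2 i j (+) e2 k l.
Proof.
rewrite /e2 /same_line xpair_eqE; case: (twisted L) => //=.
by case: eqP; case: eqP.
Qed.

Lemma uniq3E (T : eqType) (a b c : T) : (size (undup [:: a; b; c]) == 3) = uniq [:: a; b; c].
Proof.
apply/idP/idP => [/eqP h|h]; last by rewrite undup_id.
by rewrite (uniq_size_uniq (undup_uniq _) (mem_undup [:: a; b; c])) h.
Qed.

(** A mixed span means that exactly one of the two triples, rows or columns, consists of distinct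
    indices. *)
Lemma mixed_spanE i j k l m n :
  twisted L && mixed_span (i, l) (j, m) (k, n) = e3 i j k (+) e3 l m n.
Proof.
rewrite /e3; case: (twisted L) => //; rewrite !andTb.
have le3 (a b c : 'I_N) : (size (undup [:: a; b; c]) <= 2)%N = ~~ uniq [:: a; b; c].
  have := size_undup [:: a; b; c]; rewrite -uniq3E leq_eqVlt ltnS => /orP[/eqP -> //|h].
  by rewrite h; case: eqP h => // ->.
rewrite /mixed_span [(_, _).1]/= -/(_ || _) !le3 !uniq3E.
by case: (uniq [:: i; j; k]); case: (uniq [:: l; m; n]).
Qed.

(** A presentation uniform in [K] and [L]: the two complex sums are indexed by [s], and they
    coincide when the generators are self-adjoint. *)
Lemma sphere_relP A (z : 'I_N -> A) : sphere_rel K L z <->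
  [/\ K = RealCase -> forall i, z i = star (z i),
      forall s, \sum_i adj s (z i) * adj (~~ s) (z i) = 1,
      quadratic L -> comm2 z e2 & cubic L -> comm3 z e3].
Proof.
rewrite /sphere_rel /e2 /e3; split.
  move=> [hK hL]; split.
  - by move: hK => /[swap] -> [].
  - case: (K) hK => [[sa h1] s|[h1 h2] [] //].
    rewrite -[RHS]h1; apply: eq_bigr => i _.
    by rewrite !adj_id ?expr2.
  - by case: (L) hL.
  - by case: (L) hL.
move=> [h1 h2 h3 h4]; split.
  case: (K) h1 => h1; last by split; [have := h2 false|have := h2 true].
  split; first by apply: h1.
  by rewrite -[RHS](h2 false); apply: eq_bigr => i _ /=; rewrite expr2 -h1.
by case: (L) h3 h4 => //= h3 h4; [exact: h3|exact: h4|exact: h4|exact: h3].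
Qed.

(** Unitarity of [w] and of its entrywise adjoint, with [s] choosing between them. *)
Definition biunitary A (w : 'I_N -> 'I_N -> A) :=
  (forall s k l, \sum_i adj s (w i k) * adj (~~ s) (w i l) = (k == l)%:R) /\
  (forall s i j, \sum_l adj s (w i l) * adj (~~ s) (w j l) = (i == j)%:R).

Lemma qgroup_relP A (v : 'I_N * 'I_N -> A) : qgroup_rel K L v <->
  [/\ K = RealCase -> forall a, v a = star (v a),
      biunitary (fun i j => v (i, j)),
      quadratic L -> comm2 v (fun a b => twisted L && same_line a b) &
      cubic L -> comm3 v (fun a b c => twisted L && mixed_span a b c)].
Proof.
have mxP (M M' : 'M[A]_N) : M = M' <-> (forall i j, M i j = M' i j).
  by split=> [-> //|h]; apply/matrixP.
rewrite /qgroup_rel; split.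
  move=> [hK hL]; split.
  - by move: hK => /[swap] -> [].
  - case: (K) hK => [[sa /mxP h1 /mxP h2]|[/mxP h1 /mxP h2 /mxP h3 /mxP h4]].
      split=> s k l.
        have := h1 k l; rewrite !mxE => <-; apply: eq_bigr => i _.
        by rewrite !mxE !adj_id.
      have := h2 k l; rewrite !mxE => <-; apply: eq_bigr => i _.
      by rewrite !mxE !adj_id.
    split=> -[] k l; [have := h1 k l|have := h3 k l|have := h4 k l|have := h2 k l];
      by rewrite !mxE => <-; apply: eq_bigr => i _; rewrite !mxE.
  - by case: (L) hL.
  - by case: (L) hL.
move=> [h1 [h2 h2'] h3 h4]; split.
  case: (K) h1 => h1.
    split; first exact: h1.
      apply/mxP => k l; rewrite !mxE -(h2 false); apply: eq_bigr => i _.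
      by rewrite !mxE /= -h1.
    apply/mxP => k l; rewrite !mxE -(h2' false); apply: eq_bigr => i _.
    by rewrite !mxE /= -h1.
  split; apply/mxP => k l; rewrite !mxE; [rewrite -(h2 true)|rewrite -(h2' false)|
    rewrite -(h2 false)|rewrite -(h2' true)]; by apply: eq_bigr => i _; rewrite !mxE.
by case: (L) h3 h4 => //= h3 h4; [exact: h3|exact: h4|exact: h4|exact: h3].
Qed.

End Relations.

(** The second hypothesis makes [q = 1 - v v^*] a projection. The trace is not cyclic over [A];
    instead the diagonal of [v v^*] is rearranged into the column sums of the first hypothesis. *)
Lemma unitary_rows (R : realType) (ten : spatialTensor R) (A : cstarAlgType R) (N : nat)
    (v : 'I_N -> 'I_N -> A) :
  (forall k l, \sum_i v i k * star (v i l) = (k == l)%:R) ->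
  (forall k l, \sum_i star (v i k) * v i l = (k == l)%:R) ->
  forall i j, \sum_l v i l * star (v j l) = (i == j)%:R.
Proof.
move=> h1 h2; pose q i j := (i == j)%:R - \sum_l v i l * star (v j l).
have star_nat (b : bool) : star (b%:R : A) = b%:R by case: b; rewrite ?star1 ?star0.
have qs i j : star (q i j) = q j i.
  rewrite /q starB star_nat eq_sym star_sum; congr (_ - _); apply: eq_bigr => l _.
  by rewrite starMr starK.
have qv i k : \sum_j q i j * v j k = 0.
  rewrite /q; under eq_bigr do rewrite mulrBl mulr_suml.
  rewrite sumrB exchange_big /= (bigD1 i) //= eqxx mul1r big1 ?addr0; last first.
    by move=> j; rewrite eq_sym => /negPf ->; rewrite mul0r.
  apply/eqP; rewrite subr_eq0; apply/eqP.
  under eq_bigr => l _.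
    under eq_bigr do rewrite -mulrA.
    rewrite -mulr_sumr h2; over.
  rewrite (bigD1 k) //= eqxx mulr1 big1 ?addr0 // => l /negPf ->; by rewrite mulr0.
have qq i : \sum_j q i j * star (q i j) = q i i.
  under eq_bigr do rewrite qs {2}/q mulrBr mulr_sumr.
  rewrite sumrB (bigD1 i) //= eqxx mulr1 big1 ?addr0; last first.
    by move=> j /negPf ->; rewrite mulr0.
  rewrite exchange_big /= [X in _ - X]big1 ?subr0 // => l _.
  by under eq_bigr do rewrite mulrA; rewrite -mulr_suml qv mul0r.
have q0 : \sum_(p : 'I_N * 'I_N) q p.1 p.2 * star (q p.1 p.2) = 0.
  rewrite -(pair_big xpredT xpredT (fun i j => q i j * star (q i j))) /=.
  under eq_bigr do rewrite qq; rewrite /q sumrB exchange_big /=.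
  by apply/eqP; rewrite subr_eq0; apply/eqP/eq_bigr => i _; rewrite h1 !eqxx.
move=> i j; have /eqP := sum_mul_star_eq0 ten q0 (i := (i, j)) isT.
by rewrite subr_eq0 eq_sym => /eqP.
Qed.

Lemma starhom_sgn (R : realType) (A X : cstarAlgType R) (f : A -> X) (b : bool) x :
  is_starhom f -> f ((-1) ^+ b * x) = (-1) ^+ b * f x.
Proof. by move=> hf; case: b; rewrite ?mul1r // expr1 !mulN1r (starhomN hf). Qed.

Section Action.
Variables (R : realType) (ten : spatialTensor R) (N : nat) (K : scalars) (L : liberation).
Variables (X : cstarAlgType R) (z : 'I_N -> X).
Hypothesis univ : is_universal (fun A => @sphere_rel R A N K L) z.
Variables (A : cstarAlgType R) (Psi : X -> ten A X) (w : 'I_N -> 'I_N -> A).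
Hypotheses (hPsi : is_starhom Psi) (Psiz : forall i, Psi (z i) = \sum_j tprod ten (w i j) (z j)).
Implicit Types i j k l m n : 'I_N.

Let zrel := (sphere_relP K L z).1 univ.1.

Lemma Psi_adj s i : Psi (adj s (z i)) = \sum_j tprod ten (adj s (w i j)) (adj s (z j)).
Proof.
rewrite (starhom_adj _ _ hPsi) Psiz; case: s => //=.
by rewrite star_sum; apply: eq_bigr => j _; rewrite tprod_star.
Qed.

Lemma Psi_adj2 s t i j : Psi (adj s (z i) * adj t (z j)) =
  \sum_k \sum_l tprod ten (adj s (w i k) * adj t (w j l)) (adj s (z k) * adj t (z l)).
Proof.
rewrite (starhomM hPsi) !Psi_adj mulr_suml; apply: eq_bigr => k _.
by rewrite mulr_sumr; apply: eq_bigr => l _; rewrite tprodM.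
Qed.

Lemma Psi_adj3 s t r i j k : Psi (adj s (z i) * adj t (z j) * adj r (z k)) =
  \sum_l \sum_m \sum_n tprod ten (adj s (w i l) * adj t (w j m) * adj r (w k n))
    (adj s (z l) * adj t (z m) * adj r (z n)).
Proof.
rewrite (starhomM hPsi) Psi_adj2 Psi_adj mulr_suml; apply: eq_bigr => l _.
rewrite mulr_suml; apply: eq_bigr => m _.
by rewrite mulr_sumr; apply: eq_bigr => n _; rewrite tprodM.
Qed.

Lemma coef_sa : K = RealCase -> forall i j, w i j = star (w i j).
Proof.
move=> hK i j; have [sa _ _ _] := zrel; apply/eqP; rewrite -subr_eq0; apply/eqP.
move: j; apply: (sphere_indep1 univ (ten := ten)).
rewrite (eq_bigr (fun k => tprod ten (w i k) (z k) - tprod ten (star (w i k)) (z k))) => [|k _]; last exact: tprodBl.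
rewrite sumrB -Psiz.
rewrite {1}(sa hK i) -[star (z i)]/(adj true (z i)) Psi_adj.
by apply/eqP; rewrite subr_eq0; apply/eqP/eq_bigr => k _ /=; rewrite -sa.
Qed.

Lemma sphere_sum_coef s : \sum_k \sum_l tprod ten
  (\sum_i adj s (w i k) * adj (~~ s) (w i l) - (k == l)%:R) (adj s (z k) * adj (~~ s) (z l)) = 0.
Proof.
have [_ su _ _] := zrel.
have e1 : \sum_k \sum_l tprod ten (\sum_i adj s (w i k) * adj (~~ s) (w i l))
    (adj s (z k) * adj (~~ s) (z l)) = 1.
  rewrite -(starhom1 hPsi) -(su s) (starhom_sum hPsi); under [RHS]eq_bigr do rewrite Psi_adj2.
  rewrite [RHS]exchange_big; apply: eq_bigr => k _; rewrite [RHS]exchange_big.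
  by apply: eq_bigr => l _; rewrite tprod_suml.
under eq_bigr do under eq_bigr do rewrite tprodBl; under eq_bigr do rewrite sumrB.
rewrite sumrB e1 -[X in X - _](tprod11 ten A X) -{1}(su s) tprod_sumr.
apply/eqP; rewrite subr_eq0; apply/eqP/eq_bigr => k _.
rewrite [RHS](bigD1 k) //= eqxx big1 ?addr0 // => l; rewrite eq_sym => /negPf ->.
by rewrite tprod0l.
Qed.

Lemma coef_biunitary_of_cols :
  (forall s k l, \sum_i adj s (w i k) * adj (~~ s) (w i l) = (k == l)%:R) -> biunitary w.
Proof.
move=> h; split=> // s i j.
have := @unitary_rows R ten A N (fun i k => adj s (w i k)) _ _ i j.
rewrite -[RHS in (_ -> _ -> RHS)]/(_ = _); under eq_bigr do rewrite adj_star.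
apply=> k l; first by rewrite -(h s); apply: eq_bigr => i' _; rewrite adj_star.
by rewrite -(h (~~ s)); apply: eq_bigr => i' _; rewrite adj_star negbK.
Qed.

Lemma coef_biunitary : K = ComplexCase \/ ~~ quadratic L -> biunitary w.
Proof.
move=> hKL; apply: coef_biunitary_of_cols => s k l.
apply/eqP; rewrite -subr_eq0; apply/eqP; move: k l.
case: (K) hKL univ coef_sa zrel (sphere_sum_coef s) => [|_ u _ _]; last exact: (sphere_indep2_mixed u).
move=> [//|hL] u /(_ erefl) sa [/(_ erefl) sz _ _ _] h; apply: (sphere_indep2_real u (ten := ten)) => //.
rewrite -[RHS]h; apply: eq_bigr => k _; apply: eq_bigr => l _.
by congr tprod; rewrite !adj_id.
Qed.

Hypothesis bw : biunitary w.

Lemma sgn_tprod (b : bool) (a : A) (x : X) :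
  tprod ten ((-1) ^+ b * a) x = (-1) ^+ b * tprod ten a x.
Proof. by case: b; rewrite ?mul1r // expr1 !mulN1r tprodNl. Qed.

Lemma tprod_sgn (b : bool) (a : A) (x : X) :
  tprod ten a ((-1) ^+ b * x) = (-1) ^+ b * tprod ten a x.
Proof.
by case: b; rewrite ?mul1r // expr1 !mulN1r -scaleN1r tprodZr scaleN1r.
Qed.


(** Apply [Psi] to the relation between [z_i] and [z_j], then reorder the reversed monomials on the
    sphere side by the relation for [k] and [l]; the two signs combine into that of the quantum
    group. *)
Lemma coef_comm2_coef s t i j : quadratic L ->
  \sum_k \sum_l tprod ten (adj s (w i k) * adj t (w j l) -
    (-1) ^+ (e2 L i j (+) e2 L k l) * (adj t (w j l) * adj s (w i k)))
    (adj s (z k) * adj t (z l)) = 0.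
Proof.
move=> hL; have [_ _ /(_ hL) cz _] := zrel.
have := congr1 Psi (cz i j s t); rewrite (starhom_sgn _ _ hPsi) !Psi_adj2 => /eqP.
rewrite -subr_eq0 => /eqP e; rewrite -[RHS]e [in X in _ = _ - X]exchange_big mulr_sumr -sumrB.
apply: eq_bigr => k _; rewrite mulr_sumr -sumrB; apply: eq_bigr => l _.
rewrite tprodBl sgn_tprod; congr (_ - _).
by rewrite (cz l k t s) tprod_sgn (e2C _ l k) signr_addb mulrA.
Qed.

Lemma coef_comm3_coef s t r i j k : cubic L ->
  \sum_l \sum_m \sum_n tprod ten (adj s (w i l) * adj t (w j m) * adj r (w k n) -
    (-1) ^+ (e3 L i j k (+) e3 L l m n) * (adj r (w k n) * adj t (w j m) * adj s (w i l)))
    (adj s (z l) * adj t (z m) * adj r (z n)) = 0.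
Proof.
move=> hL; have [_ _ _ /(_ hL) cz] := zrel.
have := congr1 Psi (cz i j k s t r); rewrite (starhom_sgn _ _ hPsi) !Psi_adj3 => /eqP.
rewrite -subr_eq0 => /eqP e; rewrite -[RHS]e.
have rv (V : nmodType) (f : 'I_N -> 'I_N -> 'I_N -> V) :
    \sum_l \sum_m \sum_n f l m n = \sum_n \sum_m \sum_l f l m n.
  rewrite exchange_big; under eq_bigr do rewrite exchange_big; rewrite exchange_big.
  by apply: eq_bigr.
rewrite [in X in _ = _ - X]rv mulr_sumr -sumrB; apply: eq_bigr => l _.
rewrite mulr_sumr -sumrB; apply: eq_bigr => m _.
rewrite mulr_sumr -sumrB; apply: eq_bigr => n _.
rewrite tprodBl sgn_tprod; congr (_ - _).
by rewrite (cz n m l r t s) tprod_sgn (e3C _ n m l) signr_addb mulrA.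
Qed.

(** Opposite stars are settled by full independence of the monomials. Equal stars give only
    antisymmetry in the column pair; [antisym_unitary_eq0], for the unitary matrix of products
    [w_ik w_jl] indexed by pairs and with [rev] the swap, then concludes. *)
Lemma coef_comm2 : quadratic L -> comm2 (fun p => w p.1 p.2) (fun a b => twisted L && same_line a b).
Proof.
move=> hL.
have real s t : K = RealCase -> forall i j k l,
    adj s (w i k) * adj t (w j l) = adj false (w i k) * adj false (w j l).
  by move=> /coef_sa sa i j k l; rewrite !adj_id.
have mixed s : K = ComplexCase -> forall i j k l, adj s (w i k) * adj (~~ s) (w j l) =
    (-1) ^+ (e2 L i j (+) e2 L k l) * (adj (~~ s) (w j l) * adj s (w i k)).
  move=> hK i j k l; apply/eqP; rewrite -subr_eq0; apply/eqP; move: k l.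
  by apply: (sphere_indep2_mixed univ hK (coef_comm2_coef s (~~ s) i j hL)).
have same s i j k l : adj s (w i k) * adj s (w j l) =
    (-1) ^+ (e2 L i j (+) e2 L k l) * (adj s (w j l) * adj s (w i k)).
  pose X' (p q : 'I_N * 'I_N) := adj s (w p.1 q.1) * adj s (w p.2 q.2).
  have := @antisym_unitary_eq0 R ten A _ (fun p : 'I_N * 'I_N => (p.2, p.1)) (fun p => e2 L p.1 p.2) X'.
  move=> /(_ _ _ _ _ _ (i, j) (k, l)); apply.
  - by case.
  - by move=> p; exact: e2C.
  - move=> [p p'] [q q']; rewrite -(pair_big xpredT xpredT (fun a b =>
      X' (p, p') (a, b) * star (X' (q, q') (a, b)))) /= /X' /=.
    under eq_bigr => a _.
      under eq_bigr => b _ do rewrite starMr !adj_star -mulrA [X in _ * X]mulrA.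
      rewrite -mulr_sumr -mulr_suml bw.2; over.
    rewrite xpair_eqE; case: (p' == q') => /=; last first.
      by rewrite andbF big1 // => a _; rewrite mul0r mulr0.
    rewrite andbT -(bw.2 s p q); apply: eq_bigr => a _; by rewrite mul1r.
  - move=> [p p'] [q q']; rewrite -(pair_big xpredT xpredT (fun a b =>
      X' (a, b) (p, p') * star (X' (a, b) (q, q')))) /= /X' /=.
    under eq_bigr => a _.
      under eq_bigr => b _ do rewrite starMr !adj_star -mulrA [X in _ * X]mulrA.
      rewrite -mulr_sumr -mulr_suml bw.1; over.
    rewrite xpair_eqE; case: (p' == q') => /=; last first.
      by rewrite andbF big1 // => a _; rewrite mul0r mulr0.
    rewrite andbT -(bw.1 s p q); apply: eq_bigr => a _; by rewrite mul1r.
  - move=> [p p'] [q q']; rewrite /X' /=.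
    have := sphere_indep2_sym univ (coef_comm2_coef s s p p' hL) q q'.
    move=> /eqP; rewrite addrC addr_eq0 => /eqP; rewrite -/(e2 L q q') => e.
    have sgK (x : A) : (-1) ^+ e2 L q q' * ((-1) ^+ e2 L q q' * x) = x.
      by case: (e2 L q q'); rewrite ?mul1r // expr1 !mulN1r opprK.
    by rewrite -[RHS]mulrN -e sgK (e2C L q q').
move=> [i k] [j l] s t /=; rewrite same_lineE.
case eK: K real mixed => real mixed.
  by rewrite (real s t) // (real t s) // same.
case: (boolP (s == t)) => [/eqP <-|]; first exact: same.
by case: s t => -[] //= _; [exact: (mixed true)|exact: (mixed false)].
Qed.

(** As in degree two, with triples and the reversal fixing the middle index; only the two outer
    stars decide between the mixed and the equal case. *)
Lemma coef_comm3 : cubic L ->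
  comm3 (fun p => w p.1 p.2) (fun a b c => twisted L && mixed_span a b c).
Proof.
move=> hL; have qL : ~~ quadratic L by case: (L) hL.
have real s t r : K = RealCase -> forall i j k l m n,
    adj s (w i l) * adj t (w j m) * adj r (w k n) =
    adj false (w i l) * adj false (w j m) * adj false (w k n).
  by move=> /coef_sa sa i j k l m n; rewrite !adj_id.
have mixed s t : K = ComplexCase -> forall i j k l m n,
    adj s (w i l) * adj t (w j m) * adj (~~ s) (w k n) =
    (-1) ^+ (e3 L i j k (+) e3 L l m n) * (adj (~~ s) (w k n) * adj t (w j m) * adj s (w i l)).
  move=> hK i j k l m n; apply/eqP; rewrite -subr_eq0; apply/eqP; move: l m n.
  by apply: (sphere_indep3_mixed univ hK qL (coef_comm3_coef s t (~~ s) i j k hL)).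
have same s t i j k l m n : adj s (w i l) * adj t (w j m) * adj s (w k n) =
    (-1) ^+ (e3 L i j k (+) e3 L l m n) * (adj s (w k n) * adj t (w j m) * adj s (w i l)).
  pose I3 := ('I_N * ('I_N * 'I_N))%type.
  pose X' (p q : I3) := adj s (w p.1 q.1) * adj t (w p.2.1 q.2.1) * adj s (w p.2.2 q.2.2).
  have p3 (V : nmodType) (f : I3 -> V) : \sum_p f p = \sum_a \sum_b \sum_c f (a, (b, c)).
    rewrite (eq_bigr (fun a => \sum_p f (a, p))) => [|a _]; last by rewrite pair_big; apply: eq_bigr => -[].
    by rewrite pair_big; apply: eq_bigr => -[].
  have := @antisym_unitary_eq0 R ten A I3 (fun p => (p.2.2, (p.2.1, p.1)))
    (fun p => e3 L p.1 p.2.1 p.2.2) X'.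
  have X'X' p q p' q' : X' p q * star (X' p' q') = adj s (w p.1 q.1) * (adj t (w p.2.1 q.2.1) *
      (adj s (w p.2.2 q.2.2) * adj (~~ s) (w p'.2.2 q'.2.2)) * adj (~~ t) (w p'.2.1 q'.2.1)) *
      adj (~~ s) (w p'.1 q'.1).
    by rewrite /X' !starMr !adj_star -!mulrA.
  have nat3 (b c d : bool) (x y x' y' : 'I_N -> A) : \sum_a x a * y a = b%:R ->
      \sum_a x' a * y' a = c%:R ->
      \sum_a \sum_b x a * (x' b * d%:R * y' b) * y a = (b && (c && d))%:R :> A.
    move=> hb hc; case: d; last first.
      rewrite !andbF big1 // => a _; rewrite big1 // => a' _.
      by rewrite mulr0 mul0r mulr0 mul0r.
    under eq_bigr => a _.
      under eq_bigr => a' _ do rewrite mulr1.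
      rewrite -mulr_suml -mulr_sumr hc; over.
    case: c hc => _; last by rewrite andbF big1 // => a _; rewrite mulr0 mul0r.
    by rewrite !andbT -hb; apply: eq_bigr => a _; rewrite mulr1.
  move=> /(_ _ _ _ _ _ (i, (j, k)) (l, (m, n))); apply.
  - by case=> ? [].
  - by move=> p; exact: e3C.
  - move=> p q; rewrite p3; under eq_bigr do under eq_bigr do under eq_bigr do rewrite X'X' /=.
    under eq_bigr do under eq_bigr do rewrite -mulr_suml -mulr_sumr -mulr_suml -mulr_sumr /= bw.2.
    rewrite (nat3 _ _ _ _ _ _ _ (bw.2 s _ _) (bw.2 t _ _)).
    by case: p q => ? [? ?] [? [? ?]]; rewrite !xpair_eqE.
  - move=> p q; rewrite p3; under eq_bigr do under eq_bigr do under eq_bigr do rewrite X'X' /=.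
    under eq_bigr do under eq_bigr do rewrite -mulr_suml -mulr_sumr -mulr_suml -mulr_sumr /= bw.1.
    rewrite (nat3 _ _ _ _ _ _ _ (bw.1 s _ _) (bw.1 t _ _)).
    by case: p q => ? [? ?] [? [? ?]]; rewrite !xpair_eqE.
  - move=> [p [p' p'']] [q [q' q'']]; rewrite /X' /=.
    have := sphere_indep3_sym univ qL (coef_comm3_coef s t s p p' p'' hL) q q' q''.
    move=> /eqP; rewrite addrC addr_eq0 => /eqP; rewrite -/(e3 L q q' q'') => e.
    have sgK (x : A) : (-1) ^+ e3 L q q' q'' * ((-1) ^+ e3 L q q' q'' * x) = x.
      by case: (e3 L q q' q''); rewrite ?mul1r // expr1 !mulN1r opprK.
    by rewrite -[RHS]mulrN -e sgK (e3C L q q' q'').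
move=> [i l] [j m] [k n] s t r /=; rewrite mixed_spanE.
case eK: K real mixed => real mixed.
  by rewrite (real s t r) // (real r t s) // same.
case: (boolP (s == r)) => [/eqP <-|]; first exact: same.
by case: s r => -[] //= _; [exact: (mixed true)|exact: (mixed false)].
Qed.

Theorem coef_relations : qgroup_rel K L (fun p => w p.1 p.2).
Proof.
apply/qgroup_relP; split=> //; last exact: coef_comm3; last exact: coef_comm2.
by move=> hK a; exact: coef_sa.
Qed.

End Action.

(** * Haar matrices of a corepresentation *)

Section ScalarMatrices.
Variables (R : realType) (A : cstarAlgType R) (N : nat).
Local Notation C := R[i].
Implicit Types (S T : 'M[C]_N) (M P : 'M[A]_N).

Definition emb S : 'M[A]_N := \matrix_(i, j) (S i j *: (1 : A)).
Definition dag M : 'M[A]_N := (map_mx star M)^T.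

Lemma embE S i j : emb S i j = S i j *: (1 : A). Proof. exact: mxE. Qed.

Lemma emb_mull S M i j : (emb S *m M) i j = \sum_k S i k *: M k j.
Proof. by rewrite mxE; apply: eq_bigr => k _; rewrite embE -scaleAl mul1r. Qed.

Lemma emb_mulr S M i j : (M *m emb S) i j = \sum_k S k j *: M i k.
Proof. by rewrite mxE; apply: eq_bigr => k _; rewrite embE -scaleAr mulr1. Qed.

Lemma embM S T : emb (S *m T) = emb S *m emb T.
Proof.
apply/matrixP => i j; rewrite emb_mull embE mxE scaler_suml; apply: eq_bigr => k _.
by rewrite embE scalerA.
Qed.

Lemma embD S T : emb (S + T) = emb S + emb T.
Proof. by apply/matrixP => i j; rewrite !mxE scalerDl. Qed.

Lemma emb1 : emb 1%:M = 1%:M.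
Proof. by apply/matrixP => i j; rewrite !mxE; case: eqP; rewrite ?scale1r ?scale0r. Qed.

Lemma emb0 : emb 0 = 0.
Proof. by apply/matrixP => i j; rewrite !mxE scale0r. Qed.

Lemma tr_emb_mull S M : (emb S *m M)^T = M^T *m emb S^T.
Proof. by apply/matrixP => i j; rewrite mxE emb_mull emb_mulr; apply: eq_bigr => k _; rewrite !mxE. Qed.

Lemma tr_emb_mulr S M : (M *m emb S)^T = emb S^T *m M^T.
Proof. by apply/matrixP => i j; rewrite mxE emb_mull emb_mulr; apply: eq_bigr => k _; rewrite !mxE. Qed.

Lemma dagM M P : dag (M *m P) = dag P *m dag M.
Proof.
apply/matrixP => i j; rewrite !mxE star_sum; apply: eq_bigr => k _.
by rewrite starMr !mxE.
Qed.

Lemma dag_emb S : dag (emb S) = emb (map_mx Num.conj S^T).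
Proof. by apply/matrixP => i j; rewrite !mxE starZc star1. Qed.

Lemma dagK M : dag (dag M) = M.
Proof. by apply/matrixP => i j; rewrite !mxE starK. Qed.

Variable h : A -> C.
Hypothesis hh : scalar h.

Lemma map_emb_mull S M : map_mx h (emb S *m M) = S *m map_mx h M.
Proof.
apply/matrixP => i j; rewrite mxE emb_mull !mxE (scf_sum hh); apply: eq_bigr => k _.
by rewrite (scfZ hh) mxE.
Qed.

Lemma map_emb_mulr S M : map_mx h (M *m emb S) = map_mx h M *m S.
Proof.
apply/matrixP => i j; rewrite mxE emb_mulr !mxE (scf_sum hh); apply: eq_bigr => k _.
by rewrite (scfZ hh) mxE mulrC.
Qed.

End ScalarMatrices.

Section Corepresentation.
Variables (R : realType) (ten : spatialTensor R) (N : nat) (K : scalars) (L : liberation).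
Local Notation C := R[i].
Variables (X : cstarAlgType R) (z : 'I_N -> X).
Hypothesis univ : is_universal (fun A => @sphere_rel R A N K L) z.

Lemma rowsum_bounded (T : finType) (p : T) : bdfun (@rowsum R T p).
Proof.
split; first exact: rowsum_scalar.
exists (#|T|%:R); split=> [|M]; first exact: ler0n.
rewrite (le_trans (cabs_sum _ _ _)) // (le_trans (ler_sum _ (G := fun=> nm M) _)) //.
  by move=> q _; exact: cabs_entry.
by rewrite sumr_const mulr_natl.
Qed.

(** A bounded coordinate functional, since slicing the completed tensor product requires
    continuity. *)
Lemma sphere_coord k : exists F : X -> C, bdfun F /\ forall i, F (z i) = (i == k)%:R.
Proof.
have hm : sphere_rel K L (letter (twisted L) (vdelta R k) (vdelta R k)).
  by apply: sphere_model => //; try exact: unit_vdelta; move=> _ i; rewrite rmorph_nat.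
have [_ /(_ _ _ hm)[f [[hf fz] _]]] := univ.
exists (fun a => rowsum (true, finset.set0) (f a)); split.
  exact: (bdfun_comp (rowsum_bounded _) (starhom_bounded hf)).
by move=> i; rewrite fz; exact: (rowsum_letter _ _ _ true false i).
Qed.

Variables (A : cstarAlgType R) (Delta : A -> ten A A) (eps : A -> C).
Hypothesis hG : is_cqg Delta eps.
Variables (Psi : X -> ten A X) (w : 'I_N -> 'I_N -> A).
Hypothesis hPsi : is_action Delta eps Psi.
Hypothesis Psiz : forall i, Psi (z i) = \sum_j tprod ten (w i j) (z j).

Let hD := cqg_hom hG.

Lemma pfun_tassoc (B : cstarAlgType R) (F : B -> C) phi psi (x : ten A A) (b : B) :
  bdfun phi -> bdfun psi -> bdfun F ->
  pfun phi (pfun psi F) (tassoc (tprod ten x b)) = pfun phi psi x * F b.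
Proof.
move=> h1 h2 h3; have h12 := pfun_bounded ten h1 h2; have h23 := pfun_bounded ten h2 h3.
have [ha ea] := tassocP ten A A B.
have bt : bounded_map (fun x => @tprod R ten (ten A A) B x b).
  by apply: (bounded_map_comp (starhom_bounded (tinl_hom ten _ _)) (bounded_mulr _)).
apply: (tens_fun_ext (f := fun x => pfun phi (pfun psi F) (tassoc (tprod ten x b)))
  (g := fun x => pfun phi psi x * F b)).
- exact: (bdfun_comp (bdfun_comp (pfun_bounded ten h1 h23) (starhom_bounded ha)) bt).
- split; first by move=> c u v; rewrite h12.1 mulrDl mulrA.
  have [_ [M [M0 hM]]] := h12; exists (M * cabs (F b)); split.
    by rewrite mulr_ge0 ?cabs_ge0.
  by move=> u; rewrite cabsM mulrAC ler_wpM2r ?cabs_ge0.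
- by move=> a a'; rewrite ea !pfunE // mulrA.
Qed.

(** Only the values of [Psi] on generators are given; the comultiplication of the [w_ij] is read off
    from coassociativity of the action by applying coordinate functionals. *)
Lemma coef_comult i k : Delta (w i k) = \sum_j tprod ten (w i j) (w j k).
Proof.
have [hm1 em1] := tmapP ten hD (starhom_id X).
have [hm2 em2] := tmapP ten (starhom_id A) (action_hom hPsi).
have [ha ea] := tassocP ten A A X.
have := action_coassoc hPsi (z i).
rewrite !Psiz (starhom_sum hm1) (starhom_sum hm2).
rewrite (eq_bigr (fun j => \sum_k tassoc (tprod ten (tprod ten (w i j) (w j k)) (z k)))); last first.
  move=> j _; rewrite em2 Psiz tprod_sumr; apply: eq_bigr => l _; by rewrite ea.
rewrite exchange_big /= (starhom_sum ha) => e.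
apply/eqP; rewrite -subr_eq0; apply/eqP; apply: (@tens_sep R ten) => phi psi h1 h2.
have [F [bF Fz]] := sphere_coord k.
have h23 := pfun_bounded ten h2 bF; have h12 := pfun_bounded ten h1 h2.
have := congr1 (pfun phi (pfun psi F)) e.
rewrite !(scf_sum (pfun_bounded ten h1 h23).1).
rewrite (eq_bigr (fun l => (\sum_j pfun phi psi (tprod ten (w i j) (w j l))) * (l == k)%:R)); last first.
  move=> l _; rewrite -Fz (scf_sum (pfun_bounded ten h1 h23).1) mulr_suml; apply: eq_bigr => j _.
  by rewrite pfun_tassoc.
rewrite [X in _ = X -> _](eq_bigr (fun l => pfun phi psi (Delta (w i l)) * (l == k)%:R)); last first.
  by move=> l _; rewrite -Fz em1 pfun_tassoc.
have col (f : 'I_N -> C) : \sum_l f l * (l == k)%:R = f k := sum_vdelta f k.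
by rewrite !col => e'; rewrite (scfB h12.1) -e' (scf_sum h12.1) subrr.
Qed.

(** Invariance under every state becomes an identity in [A] because states separate points. *)
Lemma haar_left h x : state h -> (forall rho, state rho -> convol Delta rho h = h) ->
  sliceR h (Delta x) = h x *: (1 : A).
Proof.
move=> sh hi; apply/eqP; rewrite -subr_eq0; apply/eqP; apply: (state_sep ten) => rho sr.
rewrite (scfB sr.1.1) (scfZ sr.1.1) sr.2 mulr1 -[rho (sliceR _ _)]/(convol Delta rho h x).
by rewrite hi // subrr.
Qed.

Lemma haar_right h x : state h -> (forall rho, state rho -> convol Delta h rho = h) ->
  sliceL h (Delta x) = h x *: (1 : A).
Proof.
move=> sh hi; apply/eqP; rewrite -subr_eq0; apply/eqP; apply: (state_sep ten) => rho sr.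
have br := positive_bounded sr.1; have bh := positive_bounded sh.1.
rewrite (scfB sr.1.1) (scfZ sr.1.1) sr.2 mulr1 -convol_sliceL //.
by rewrite hi // subrr.
Qed.

Definition coefmx : 'M[A]_N := \matrix_(i, j) w i j.
Local Notation W := coefmx.

(** [Delta] sends [(W W^t)_ij] to the sum of the [w_ia w_jb (x) (W W^t)_ab], and slicing the right
    leg with [h] gives the first identity. For [W^t W] it is the left leg that becomes scalar,
    whence the need for invariance on both sides. *)
Lemma coefmx_haar : exists h, [/\ state h,
  W *m emb A (map_mx h (W *m W^T)) *m W^T = emb A (map_mx h (W *m W^T)) &
  W^T *m emb A (map_mx h (W^T *m W)) *m W = emb A (map_mx h (W^T *m W))].
Proof.
have [h [sh hl hr]] := haar_state hG; exists h; split=> //.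
- apply/matrixP => i j; have := haar_left ((W *m W^T) i j) sh hl.
  have [bR eR] := sliceRP ten A (positive_bounded sh.1).
  have sl (f : 'I_N -> ten A A) : sliceR h (\sum_i f i) = \sum_i sliceR h (f i).
    exact: (lf_sum bR.1).
  have -> : Delta ((W *m W^T) i j) =
      \sum_b \sum_a tprod ten (w i a * w j b) ((W *m W^T) a b).
    rewrite mxE (starhom_sum hD).
    rewrite (eq_bigr (fun k => \sum_b \sum_a tprod ten (w i a * w j b) (w a k * w b k))); last first.
      move=> k _; rewrite !mxE (starhomM hD) !coef_comult mulr_sumr; apply: eq_bigr => b _.
      by rewrite mulr_suml; apply: eq_bigr => a _; rewrite tprodM.
    rewrite exchange_big; apply: eq_bigr => b _; rewrite exchange_big; apply: eq_bigr => a _.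
    by rewrite mxE tprod_sumr; apply: eq_bigr => k _; rewrite !mxE.
  move=> e; rewrite embE [in RHS]mxE -e mxE; symmetry; apply: (etrans (sl _)).
  apply: eq_bigr => b _; apply: (etrans (sl _)); rewrite emb_mulr mulr_suml.
  by apply: eq_bigr => a _; rewrite eR !mxE scaleAl.
- apply/matrixP => i j; have := haar_right ((W^T *m W) i j) sh hr.
  have [bR eR] := sliceLP ten A (positive_bounded sh.1).
  have sl (f : 'I_N -> ten A A) : sliceL h (\sum_i f i) = \sum_i sliceL h (f i).
    exact: (lf_sum bR.1).
  have -> : Delta ((W^T *m W) i j) =
      \sum_b \sum_a tprod ten ((W^T *m W) a b) (w a i * w b j).
    rewrite mxE (starhom_sum hD).
    rewrite (eq_bigr (fun k => \sum_b \sum_a tprod ten (w k a * w k b) (w a i * w b j))); last first.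
      move=> k _; rewrite !mxE (starhomM hD) !coef_comult mulr_sumr; apply: eq_bigr => b _.
      by rewrite mulr_suml; apply: eq_bigr => a _; rewrite tprodM.
    rewrite exchange_big; apply: eq_bigr => b _; rewrite exchange_big; apply: eq_bigr => a _.
    by rewrite mxE tprod_suml; apply: eq_bigr => k _; rewrite !mxE.
  move=> e; rewrite embE [in RHS]mxE -e mxE; symmetry; apply: (etrans (sl _)).
  apply: eq_bigr => b _; apply: (etrans (sl _)); rewrite emb_mulr mulr_suml.
  by apply: eq_bigr => a _; rewrite eR !mxE scaleAl.
Qed.

End Corepresentation.

(* Both conclusions come from [Q P W^T = W^T Q P], by [dag] and by transposition. *)
Lemma haar_commute (R : realType) (A : cstarAlgType R) (N : nat) (W : 'M[A]_N)
    (P Q : 'M[R[i]]_N) : dag W = W^T -> map_mx Num.conj P^T = P -> map_mx Num.conj Q^T = Q ->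
  W *m emb A P *m W^T = emb A P -> W^T *m emb A Q *m W = emb A Q ->
  W *m emb A (P *m Q) = emb A (P *m Q) *m W /\ W *m emb A (P^T *m Q^T) = emb A (P^T *m Q^T) *m W.
Proof.
move=> dW hP hQ h1 h2.
have e : emb A (Q *m P) *m W^T = W^T *m emb A (Q *m P).
  by rewrite embM -{1}h2 -[in RHS]h1 !mulmxA.
split; last first.
  have := congr1 trmx e; rewrite tr_emb_mull tr_emb_mulr trmxK trmx_mul; exact.
have := congr1 (@dag R A N) e; rewrite !dagM dag_emb -dW dagK trmx_mul map_mxM /= hP hQ.
by [].
Qed.

(** * The real classical sphere *)

Lemma addxx_inj (R : realType) (V : lmodType R[i]) (x y : V) : x + x = y + y -> x = y.
Proof.
rewrite -(mulr2n x) -(mulr2n y) -(scaler_nat 2 x) -(scaler_nat 2 y).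
move=> /(congr1 (fun v => 2%:R^-1 *: v)); rewrite !scalerA mulVf ?pnatr_eq0 // !scale1r.
exact.
Qed.

(** The trace of [M = M M^*] is the sum of the squared moduli of the entries. *)
Lemma projection_tr0 (R : realType) (n : nat) (M : 'M[R[i]]_n) :
  map_mx Num.conj M^T = M -> M *m M = M -> \tr M = 0 -> M = 0.
Proof.
move=> hM MM; rewrite -{1}MM -{2}hM => /eqP.
rewrite /mxtrace (eq_bigr (fun i => \sum_j M i j * (M i j)^*)) => [|i _]; last first.
  by rewrite mxE; apply: eq_bigr => j _; rewrite !mxE.
rewrite psumr_eq0 => [/allP h|i _]; last by apply: sumr_ge0 => j _; exact: mulcJ_ge0.
apply/matrixP => i j; rewrite mxE; have := h i (mem_index_enum _).
rewrite /= psumr_eq0 => [/allP/(_ j (mem_index_enum _))/= |k _]; last exact: mulcJ_ge0.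
by rewrite mulf_eq0 conjC_eq0 orbb => /eqP.
Qed.

Section RealQuadratic.
Variables (R : realType) (ten : spatialTensor R) (N : nat) (L : liberation).
Local Notation C := R[i].
Variables (X : cstarAlgType R) (z : 'I_N -> X).
Hypothesis univ : is_universal (fun A => @sphere_rel R A N RealCase L) z.
Hypothesis qL : quadratic L.
Variables (A : cstarAlgType R) (Psi : X -> ten A X) (w : 'I_N -> 'I_N -> A).
Hypothesis hPsi : is_starhom Psi.
Hypothesis Psiz : forall i, Psi (z i) = \sum_j tprod ten (w i j) (z j).
Local Notation W := (coefmx w).

Lemma coef_real i j : star (w i j) = w i j.
Proof. by rewrite -(coef_sa univ hPsi Psiz erefl). Qed.

Lemma coefmx_dag : dag W = W^T.
Proof. by apply/matrixP => i j; rewrite !mxE coef_real. Qed.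

Lemma coef_exchange i j k l :
  (w i k * w j l - (-1) ^+ (e2 L i j (+) e2 L k l) * (w j l * w i k)) +
  (-1) ^+ e2 L k l * (w i l * w j k - (-1) ^+ (e2 L i j (+) e2 L l k) * (w j k * w i l)) = 0.
Proof.
exact: (sphere_indep2_sym univ (coef_comm2_coef univ hPsi Psiz false false i j qL) k l).
Qed.

Lemma coef_column i j k : w i k * w j k = (-1) ^+ e2 L i j * (w j k * w i k).
Proof.
have ek : e2 L k k = false by rewrite /e2 eqxx andbF.
have := coef_exchange i j k k; rewrite ek addbF mul1r -[RHS](addr0 0) => /addxx_inj/eqP.
by rewrite subr_eq0 => /eqP.
Qed.

Lemma rows_sym i j : (W *m W^T) i j = (-1) ^+ e2 L i j * (W *m W^T) j i.
Proof.
rewrite !mxE mulr_sumr; apply: eq_bigr => k _; rewrite !mxE; exact: coef_column.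
Qed.

Lemma cols_sym k l : ((W^T *m W) k l - (k == l)%:R) +
  (-1) ^+ e2 L k l * ((W^T *m W) l k - (l == k)%:R) = 0.
Proof.
have := sphere_indep2_sym univ (ten := ten) (a := fun k l => (W^T *m W) k l - (k == l)%:R) (s := false) _ k l.
apply; rewrite -[RHS](sphere_sum_coef univ hPsi Psiz false); apply: eq_bigr => k' _.
apply: eq_bigr => l' _ /=; congr tprod.
  by congr (_ - _); rewrite mxE; apply: eq_bigr => i _; rewrite !mxE coef_real.
by congr (_ * _); have [/(_ erefl) sa _ _ _] := (sphere_relP _ _ _).1 univ.1; rewrite -sa.
Qed.

Lemma cols_diag k : (W^T *m W) k k = 1.
Proof.
have ek : e2 L k k = false by rewrite /e2 eqxx andbF.
have := cols_sym k k; rewrite ek mul1r eqxx -[RHS](addr0 0) => /addxx_inj/eqP.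
by rewrite subr_eq0 => /eqP.
Qed.

Lemma rows_dag : dag (W *m W^T) = W *m W^T.
Proof. by rewrite dagM -{1}coefmx_dag dagK coefmx_dag. Qed.

Lemma cols_dag : dag (W^T *m W) = W^T *m W.
Proof. by rewrite dagM -{1}coefmx_dag dagK coefmx_dag. Qed.

(** [unitary_rows] for the transposed matrix, the entries being self-adjoint. *)
Lemma biunitary_of_rows : W *m W^T = 1%:M -> biunitary w.
Proof.
move=> h; apply: (coef_biunitary_of_cols ten) => s k l.
have e i j : \sum_k w i k * w j k = (i == j)%:R.
  by have /matrixP/(_ i j) := h; rewrite !mxE => <-; apply: eq_bigr => m _; rewrite !mxE.
rewrite -(@unitary_rows R ten A N (fun k i => w i k) _ _ k l) => [|i j|i j].
- by apply: eq_bigr => i _; case: s; rewrite /= !coef_real.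
- by rewrite -e; apply: eq_bigr => m _; rewrite coef_real.
- by rewrite -e; apply: eq_bigr => m _; rewrite coef_real.
Qed.

Variable h : A -> C.
Hypothesis sh : state h.

Lemma state_dag (M : 'M[A]_N) : dag M = M -> map_mx Num.conj (map_mx h M)^T = map_mx h M.
Proof.
move=> /matrixP dM; apply/matrixP => i j; rewrite !mxE -(positive_star _ sh.1).
by have := dM i j; rewrite !mxE => ->.
Qed.

(** The trace is [h] of the sum of all squares [w_ik^2], which can be summed along the columns by
    [cols_diag]. *)
Lemma state_tr : \tr (map_mx h (W *m W^T)) = N%:R.
Proof.
have l := sh.1.1.
transitivity (\sum_(k < N) h 1); last first.
  by rewrite sh.2 sumr_const card_ord.
under [RHS]eq_bigr => k _ do rewrite -(cols_diag k) mxE (scf_sum l).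
rewrite exchange_big; apply: eq_bigr => i _; rewrite !mxE (scf_sum l).
by apply: eq_bigr => k _; rewrite !mxE.
Qed.

Lemma state_emb (P : 'M[C]_N) : map_mx h (emb A P) = P.
Proof. by apply/matrixP => i j; rewrite !mxE (scfZ sh.1.1) sh.2 mulr1. Qed.

(** Entries in a common column commute, so [P] is symmetric, and [Q + Q^t = 2]. The two conclusions
    of [haar_commute] then add up to [W P = P W], so [P W W^t = P]. Applying [h] shows that [P] is a
    projection; its trace is [N], so [P = 1]. *)
Lemma classical_rows : L = Classical ->
  W *m emb A (map_mx h (W *m W^T)) *m W^T = emb A (map_mx h (W *m W^T)) ->
  W^T *m emb A (map_mx h (W^T *m W)) *m W = emb A (map_mx h (W^T *m W)) ->
  W *m W^T = 1%:M.
Proof.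
move=> hL; set P := map_mx h (W *m W^T); set Q := map_mx h (W^T *m W) => hP hQ.
have l := sh.1.1.
have e0 i j : e2 L i j = false by rewrite /e2 hL.
have dP := state_dag rows_dag; have dQ := state_dag cols_dag; rewrite -/P -/Q in dP dQ.
have PT : P^T = P by apply/matrixP => i j; rewrite [LHS]mxE /P [LHS]mxE [RHS]mxE rows_sym e0 mul1r.
have QT : Q + Q^T = 1%:M + 1%:M.
  apply/matrixP => k m; have := congr1 h (cols_sym k m).
  rewrite e0 mul1r addrACA -opprD (scfB l) (scf0 l) => /eqP; rewrite subr_eq0 => /eqP.
  rewrite !(scfD l) !mxE => ->.
  have hb (b : bool) : h b%:R = b%:R by case: b; rewrite ?sh.2 ?(scf0 l).
  by rewrite !hb eq_sym.
have [c1 c2] := haar_commute coefmx_dag dP dQ hP hQ.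
have cP : W *m emb A P = emb A P *m W.
  have e : W *m emb A P + W *m emb A P = emb A P *m W + emb A P *m W.
    rewrite -mulmxDr -mulmxDl -embD.
    have -> : P + P = P *m Q + P^T *m Q^T by rewrite PT -mulmxDr QT mulmxDr mulmx1.
    by rewrite embD mulmxDr mulmxDl c1 c2.
  apply/matrixP => i j; apply: (@addxx_inj R A).
  by have := congr1 (fun B : 'M[A]_N => B i j) e; rewrite [LHS]mxE [RHS]mxE.
have Pd : emb A P *m (W *m W^T) = emb A P by rewrite mulmxA -cP.
have PP : P *m P = P.
  by have := congr1 (map_mx h) Pd; rewrite (map_emb_mull l) state_emb.
have P1 : 1%:M - P = 0.
  apply: projection_tr0.
  - by rewrite raddfB /= map_mxB /= dP trmx1 map_mx1.
  - by rewrite mulmxBl mul1mx mulmxBr mulmx1 PP subrr subr0.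
  - by rewrite raddfB /= state_tr mxtrace1 subrr.
have e : P = 1%:M by apply/esym/eqP; rewrite -subr_eq0 P1.
by move: Pd; rewrite e emb1 mul1mx.
Qed.

End RealQuadratic.

(** * Induction on words *)

Section RelationsInjective.
Variables (R : realType) (N : nat) (K : scalars) (L : liberation).
Variables (A B : cstarAlgType R) (f : B -> A).
Hypotheses (hf : is_starhom f) (fI : injective f).

Let f_nat (b : bool) : f b%:R = b%:R.
Proof. by case: b; rewrite ?(starhom1 hf) ?(starhom0 hf). Qed.

Let comm2_inj (I : Type) (v : I -> B) e : comm2 (f \o v) e -> comm2 v e.
Proof.
move=> h i j s t; apply: fI; have := h i j s t.
by rewrite (starhom_sgn _ _ hf) !(starhomM hf) !(starhom_adj _ _ hf).
Qed.

Let comm3_inj (I : Type) (v : I -> B) e : comm3 (f \o v) e -> comm3 v e.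
Proof.
move=> h i j k s t r; apply: fI; have := h i j k s t r.
by rewrite (starhom_sgn _ _ hf) !(starhomM hf) !(starhom_adj _ _ hf).
Qed.

Lemma sphere_rel_inj (v : 'I_N -> B) : sphere_rel K L (f \o v) -> sphere_rel K L v.
Proof.
move=> /sphere_relP[h1 h2 h3 h4]; apply/sphere_relP; split.
- by move=> hK i; apply: fI; rewrite (starhom_star hf); exact: h1.
- move=> s; apply: fI; rewrite (starhom1 hf) -(h2 s) (starhom_sum hf).
  by apply: eq_bigr => i _; rewrite (starhomM hf) !(starhom_adj _ _ hf).
- by move=> /h3; exact: comm2_inj.
- by move=> /h4; exact: comm3_inj.
Qed.

Lemma qgroup_rel_inj (v : 'I_N * 'I_N -> B) : qgroup_rel K L (f \o v) -> qgroup_rel K L v.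
Proof.
move=> /qgroup_relP[h1 [h2 h2'] h3 h4]; apply/qgroup_relP; split.
- by move=> hK i; apply: fI; rewrite (starhom_star hf); exact: h1.
- split=> s k l; apply: fI; rewrite f_nat (starhom_sum hf); [rewrite -(h2 s)|rewrite -(h2' s)];
  by apply: eq_bigr => i _; rewrite (starhomM hf) !(starhom_adj _ _ hf).
- by move=> /h3; exact: comm2_inj.
- by move=> /h4; exact: comm3_inj.
Qed.

End RelationsInjective.

Section WordInduction.
Variables (R : realType) (I : Type) (rel : forall A : cstarAlgType R, (I -> A) -> Prop).
Local Notation C := R[i].
Variables (A : cstarAlgType R) (v : I -> A).
Hypothesis univ : is_universal rel v.
Hypothesis rel_inj : forall (B D : cstarAlgType R) (f : B -> D) (w : I -> B),
  is_starhom f -> injective f -> rel (f \o w) -> rel w.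

(** The pairs occurring in [universal_gen] are diagonal, so the first projection is injective and
    reflects the relations. *)
Lemma universal_gen_inj (P : A -> Prop) : P 1 ->
  (forall (c : C) a b, P a -> P b -> P (c *: a + b)) ->
  (forall a b, P a -> P b -> P (a * b)) ->
  (forall a, P a -> P (star a)) ->
  (forall (u : nat -> A) a, (forall n, P (u n)) -> seq_lim u a -> P a) ->
  (forall i, P (v i)) -> forall a, P a.
Proof.
apply: (universal_gen univ) => G w h1 h2 h3.
apply: (rel_inj (pa_fst_hom G) _ h1) => p q e.
apply: pa_inj; have := h3 p; have := h3 q; move: e; rewrite /pa_fst /pa_snd.
by case: (pa_val p) (pa_val q) => [a b] [a' b'] /= -> <- <-.
Qed.

(** The induction proves stability of [P] under right multiplication by [a] and by [star a], a
    property that products and adjoints inherit. *)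
Lemma right_word_ind (P : A -> Prop) : P 1 ->
  (forall (c : C) a b, P a -> P b -> P (c *: a + b)) ->
  (forall (u : nat -> A) a, (forall n, P (u n)) -> seq_lim u a -> P a) ->
  (forall a i s, P a -> P (a * adj s (v i))) -> forall a, P a.
Proof.
move=> P1 Plin Plim Pw a.
suff [h _] : (forall x, P x -> P (x * a)) /\ (forall x, P x -> P (x * star a)).
  by rewrite -[a]mul1r; exact: h.
move: a; apply: universal_gen_inj.
- by rewrite star1; split=> x; rewrite mulr1.
- move=> c a b [h1 h2] [h3 h4]; split=> x Px.
    by rewrite mulrDr -scaleAr; apply: Plin; [exact: h1|exact: h3].
  by rewrite starD starZc mulrDr -scaleAr; apply: Plin; [exact: h2|exact: h4].
- move=> a b [h1 h2] [h3 h4]; split=> x Px.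
    by rewrite mulrA; apply: h3; exact: h1.
  by rewrite starMr mulrA; apply: h2; exact: h4.
- by move=> a [h1 h2]; split=> //; rewrite starK.
- move=> u a hu ua; split=> x Px.
    apply: (Plim (fun n => x * u n)); last exact: seq_limM (seq_lim_cst _) ua.
    by move=> n; exact: (hu n).1.
  apply: (Plim (fun n => x * star (u n))); last exact: seq_limM (seq_lim_cst _) (seq_lim_star ua).
  by move=> n; exact: (hu n).2.
- by move=> i; split=> x Px; [exact: (Pw x i false)|exact: (Pw x i true)].
Qed.

Lemma left_word_ind (P : A -> Prop) : P 1 ->
  (forall (c : C) a b, P a -> P b -> P (c *: a + b)) ->
  (forall (u : nat -> A) a, (forall n, P (u n)) -> seq_lim u a -> P a) ->
  (forall a i s, P a -> P (adj s (v i) * a)) -> forall a, P a.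
Proof.
move=> P1 Plin Plim Pw a; rewrite -[a]starK; move: (star a).
apply: right_word_ind.
- by rewrite star1.
- by move=> c a' b ha hb; rewrite starD starZc; exact: Plin.
- move=> u a' hu ua; apply: (Plim (fun n => star (u n))) => //; exact: seq_lim_star.
- by move=> a' i s ha; rewrite starMr adj_star; exact: Pw.
Qed.

End WordInduction.

(** * The real twisted sphere *)

Section Anticommutator.
Variables (R : realType) (A : cstarAlgType R).
Implicit Types x y : A.

Definition acomm x y := x * y + y * x.

Lemma acommC x y : acomm x y = acomm y x. Proof. exact: addrC. Qed.

Lemma acommBl x y t : acomm (x - y) t = acomm x t - acomm y t.
Proof. by rewrite /acomm mulrBl mulrBr addrACA opprD. Qed.

Lemma acommZl c x y : acomm (c *: x) y = c *: acomm x y.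
Proof. by rewrite /acomm -scaleAl -scaleAr scalerDr. Qed.

Lemma acommBr x y t : acomm t (x - y) = acomm t x - acomm t y.
Proof. by rewrite !(acommC t) acommBl. Qed.

Lemma acommZr c x y : acomm x (c *: y) = c *: acomm x y.
Proof. by rewrite !(acommC x) acommZl. Qed.

Lemma acomm_suml (I : Type) (r : seq I) (F : I -> A) y :
  acomm (\sum_(i <- r) F i) y = \sum_(i <- r) acomm (F i) y.
Proof. by rewrite /acomm mulr_suml mulr_sumr -big_split. Qed.

End Anticommutator.

Section Clifford.
Variables (R : realType) (N : nat) (i0 : 'I_N).
Local Notation C := R[i].
Local Notation T := (bool * {set 'I_N})%type.

(** The letters at the constant unit vector, with coordinates [N^(-1/2)]. Their anticommutators are
    all scalar, which makes the model stable under orthogonal reflections. *)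
Lemma clifford_model : exists F : 'I_N -> mat R T,
  sphere_rel RealCase Twisted F /\ forall i j,
  acomm (F i) (F j) = (2%:R * (N%:R)^-1 * (i == j)%:R) *: (1 : mat R T).
Proof.
have N0 : N%:R != 0 :> C by rewrite pnatr_eq0 -lt0n; case: (N) i0 => [[]|].
pose xx : 'I_N -> C := fun=> ((Num.sqrt (N%:R : R))^-1)%:C.
have xx2 i j : xx i * xx j = (N%:R)^-1.
  rewrite /xx -real_complexM -expr2 exprVn sqr_sqrtr ?ler0n // fmorphV.
  by rewrite rmorph_nat.
have xs i : (xx i)^* = xx i by exact: conjr.
have ux : unit_vec xx.
  rewrite /unit_vec; under eq_bigr do rewrite xs xx2.
  by rewrite sumr_const card_ord -[_ *+ _]mulr_natl divff.
have rel : sphere_rel RealCase Twisted (letter true xx xx).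
  by apply: (@sphere_model R N RealCase Twisted xx xx ux ux).
have sq i : letter true xx xx i * letter true xx xx i = (N%:R)^-1 *: (1 : mat R T).
  rewrite letterM -mono1; apply: matP => p q.
  rewrite (scfZ (entry_scalar p q (T := T))) !entry_mono.
  by rewrite ltnn if_same xx2 csgn2 flipK !mul1r; case: (p).
exists (letter true xx xx); split=> //; move: rel sq.
move: (letter true xx xx) => F rel sq i j.
have [h1 _ /(_ isT) h2 _] := (sphere_relP _ _ _).1 rel.
have [<-|ij] := eqVneq i j; first by rewrite /acomm sq mulr1 -scalerDl -mulr2n mulr_natl.
rewrite /acomm; have := h2 i j false false; rewrite /e2 ij /= => ->.
by rewrite expr1 mulN1r addNr mulr0 scale0r.
Qed.

End Clifford.

Section HermitianKernel.
Variables (R : realType) (N : nat).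
Local Notation C := R[i].
Implicit Types (M U V : 'M[C]_N).

Definition adjmx M : 'M[C]_N := map_mx Num.conj M^T.

Lemma adjmxE M i j : adjmx M i j = (M j i)^*. Proof. by rewrite !mxE. Qed.

Lemma adjmxM M V : adjmx (M *m V) = adjmx V *m adjmx M.
Proof. by rewrite /adjmx trmx_mul map_mxM. Qed.

Lemma adjmxK M : adjmx (adjmx M) = M.
Proof. by apply/matrixP => i j; rewrite !adjmxE conjCK. Qed.

Lemma adjmx0 : adjmx 0 = 0.
Proof. by apply/matrixP => i j; rewrite adjmxE !mxE rmorph0. Qed.

Lemma mul_diag_adj0 (d : 'rV[C]_N) M : (forall i, 0 <= d 0 i) ->
  (forall i, (M *m diag_mx d *m adjmx M) i i = 0) -> forall i k, d 0 k * M i k = 0.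
Proof.
move=> d0 h i k; have := h i; rewrite mxE.
rewrite (eq_bigr (fun k => d 0 k * (M i k * (M i k)^*))) => [/eqP|j _]; last first.
  by rewrite mul_mx_diag !mxE; ring.
rewrite psumr_eq0 => [/allP/(_ k (mem_index_enum _))/=|j _]; last first.
  by rewrite mulr_ge0 ?mulcJ_ge0.
by rewrite !mulf_eq0 conjC_eq0 orbb -mulf_eq0 => /eqP.
Qed.

End HermitianKernel.

(** Spectral theorem: [B] is the diagonal of square roots of eigenvalues times the diagonalizing
    unitary. *)
Lemma psd_factor (R : realType) (N : nat) (M : 'M[R[i]]_N) : adjmx M = M ->
  (forall V i, 0 <= (adjmx V *m M *m V) i i) -> exists B, M = adjmx B *m B.
Proof.
move=> hM M0.
have nM : M \is normalmx by apply/normalmxP; have := hM; rewrite /adjmx => ->.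
have /orthomx_spectralP ME := nM.
have uS := spectral_unitarymx M; set S := spectralmx M in ME uS.
set d := spectral_diag M in ME.
have iS : invmx S = adjmx S by exact: invmx_unitary.
have d0 i : 0 <= d 0 i.
  have := M0 (adjmx S) i; rewrite adjmxK ME iS.
  have SS : S *m adjmx S = 1%:M by rewrite -iS mulmxV // spectral_unit.
  rewrite !mulmxA SS mul1mx -mulmxA SS mulmx1 mxE eqxx mulr1n; exact.
pose B := diag_mx (\row_i sqrtC (d 0 i)) *m S; exists B.
have aD : adjmx (diag_mx (\row_i sqrtC (d 0 i))) = diag_mx (\row_i sqrtC (d 0 i)).
  apply/matrixP => i j; rewrite adjmxE !mxE eq_sym; case: eqP => [->|_]; last by rewrite rmorph0.
  by rewrite !mulr1n; apply: geC0_conj; rewrite sqrtC_ge0.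
rewrite /B adjmxM aD {1}ME iS -!mulmxA; congr (_ *m _); rewrite mulmxA; congr (_ *m _).
apply/matrixP => i j; rewrite mul_diag_mx !mxE; case: eqP => [->|_]; last by rewrite !mulr0n mulr0.
by rewrite !mulr1n -expr2 sqrtCK.
Qed.

Lemma mxtrace_emb (R : realType) (A : cstarAlgType R) (N : nat) (S : 'M[R[i]]_N) (M : 'M[A]_N) :
  \tr (emb A S *m M) = \tr (M *m emb A S).
Proof.
rewrite /mxtrace; under eq_bigr do rewrite emb_mull.
by rewrite exchange_big; apply: eq_bigr => k _; rewrite emb_mulr.
Qed.

Section Twisted.
Variables (R : realType) (ten : spatialTensor R) (N : nat).
Local Notation C := R[i].
Variables (X : cstarAlgType R) (z : 'I_N -> X).
Hypothesis univ : is_universal (fun A => @sphere_rel R A N RealCase Twisted) z.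
Variables (A : cstarAlgType R) (Psi : X -> ten A X) (w : 'I_N -> 'I_N -> A).
Hypothesis hPsi : is_starhom Psi.
Hypothesis Psiz : forall i, Psi (z i) = \sum_j tprod ten (w i j) (z j).
Local Notation W := (coefmx w).
Variable h : A -> C.
Hypothesis sh : state h.
Local Notation P := (map_mx h (W *m W^T)).
Local Notation Q := (map_mx h (W^T *m W)).
Hypothesis hP : W *m emb A P *m W^T = emb A P.
Hypothesis hQ : W^T *m emb A Q *m W = emb A Q.

Let l := sh.1.1.
Let ph := sh.1.
Let wr := coef_real univ hPsi Psiz.
Let qT : quadratic Twisted := isT.
Let dW : dag W = W^T := coefmx_dag univ hPsi Psiz.

(** The off-diagonal part of [W W^t] is antisymmetric in the twisted case, so the diagonal matrix
    [D] is half of [P + P^t]. *)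
Definition dvec : 'rV[C]_N := \row_i P i i.
Local Notation D := (diag_mx dvec).
Local Notation null i := (P i i == 0).

Let dP : adjmx P = P. Proof. exact: (state_dag sh (rows_dag univ hPsi Psiz)). Qed.
Let dQ : adjmx Q = Q. Proof. exact: (state_dag sh (cols_dag univ hPsi Psiz)). Qed.

Let PE i : P i i = \sum_k h (star (w i k) * w i k).
Proof. by rewrite !mxE (scf_sum l); apply: eq_bigr => k _; rewrite !mxE wr. Qed.

Let P_ge0 i : 0 <= P i i.
Proof. by rewrite PE sumr_ge0 // => k _; exact: ph.2. Qed.

Let dvecE i : dvec 0 i = P i i. Proof. exact: mxE. Qed.

Let Preal i : (P i i)^* = P i i.
Proof. by rewrite (ge0_complexE (P_ge0 i)) conjr. Qed.

Let conjD : map_mx Num.conj D = D.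
Proof.
apply/matrixP => i j; rewrite [LHS]mxE [D i j]mxE dvecE; case: (i == j).
  by rewrite !mulr1n Preal.
by rewrite !mulr0n rmorph0.
Qed.

Let adjD : adjmx D = D.
Proof. by rewrite /adjmx tr_diag_mx conjD. Qed.

(** [P_ii] is the sum of the [h(w_ik^* w_ik)], so a null row generates a left ideal killed by
    [h]. *)
Lemma null_row i k a : null i -> h (a * w i k) = 0.
Proof.
move=> /eqP; rewrite PE => /eqP; rewrite psumr_eq0 => [/allP/(_ k (mem_index_enum _))/= /eqP e|j _].
  exact: (positive_null _ ph e).
exact: ph.2.
Qed.

Let QT : Q^T = Q.
Proof.
apply/matrixP => i j; rewrite [LHS]mxE [LHS]mxE [RHS]mxE.
have [->//|ij] := eqVneq i j; have := cols_sym univ hPsi Psiz i j.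
have ji : (j == i) = false by rewrite eq_sym (negPf ij).
rewrite /e2 (negPf ij) ji /= !subr0 expr1 mulN1r => /eqP.
by rewrite subr_eq0 => /eqP ->.
Qed.

Let Qreal i j : (Q i j)^* = Q i j.
Proof. by have /matrixP/(_ j i) := dQ; rewrite adjmxE => ->; rewrite -{1}QT mxE. Qed.

Let conjQ : map_mx Num.conj Q = Q.
Proof. by apply/matrixP => i j; rewrite [LHS]mxE Qreal. Qed.

Let PD : P + P^T = D + D.
Proof.
apply/matrixP => i j; rewrite [LHS]mxE [X in _ + X]mxE [RHS]mxE [in RHS]mxE dvecE.
have [->|ij] := eqVneq i j; first by rewrite mulr1n.
rewrite mulr0n addr0 [X in _ + X]mxE (rows_sym univ qT hPsi Psiz) /e2 eq_sym ij.
by rewrite expr1 mulN1r (scfN l) mxE subrr.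
Qed.

(** Since [Q] is symmetric, [P Q + P^t Q^t = 2 D Q]: the two conclusions of [haar_commute] add
    up. *)
Let WDQ : W *m emb A (D *m Q) = emb A (D *m Q) *m W.
Proof.
have [c1 c2] := haar_commute dW dP dQ hP hQ.
have e : W *m emb A (D *m Q) + W *m emb A (D *m Q) = emb A (D *m Q) *m W + emb A (D *m Q) *m W.
  have e0 : D *m Q + D *m Q = P *m Q + P^T *m Q^T by rewrite -mulmxDl -PD mulmxDl QT.
  by rewrite -mulmxDr -mulmxDl -embD e0 embD mulmxDr mulmxDl c1 c2.
apply/matrixP => i j; apply: (@addxx_inj R A).
by have := congr1 (fun B : 'M[A]_N => B i j) e; rewrite [LHS]mxE [RHS]mxE.
Qed.

Let Y (V : 'M[C]_N) := W *m emb A V.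

Let gramY (V : 'M[C]_N) : map_mx h (dag (Y V) *m Y V) = adjmx V *m Q *m V.
Proof.
rewrite /Y dagM dag_emb dW -!mulmxA (mulmxA W^T) (map_emb_mull l) mulmxA.
by rewrite -[adjmx V *m Q *m V]mulmxA -(map_emb_mulr l) -!mulmxA.
Qed.

Lemma gram_null (V : 'M[C]_N) k : (adjmx V *m Q *m V) k k = 0 -> forall i a, h (a * Y V i k) = 0.
Proof.
rewrite -gramY mxE mxE (scf_sum l) => /eqP.
rewrite psumr_eq0 => [/allP e i a|i _]; last by rewrite !mxE; exact: ph.2.
have := e i (mem_index_enum _); rewrite /= mxE [map_mx _ _ _ _]mxE => /eqP e'.
exact: (positive_null _ ph e').
Qed.

Lemma gram_ker (V : 'M[C]_N) : (forall k, (adjmx V *m Q *m V) k k = 0) -> Q *m V = 0.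
Proof.
move=> e; rewrite -(map_emb_mulr l) -mulmxA; apply/matrixP => j k; rewrite !mxE (scf_sum l).
by rewrite big1 // => i _; exact: gram_null.
Qed.

(** Put [Z = Q W V]. Then [D Z = W D Q V = 0], so [Z] is supported on the null rows. As
    [V^* Q V = (W V)^* Z] and [h] kills the contribution of null rows, the Gram matrix [V^* Q V] has
    zero diagonal. *)
Lemma ker_DQ (V : 'M[C]_N) : D *m Q *m V = 0 -> Q *m V = 0.
Proof.
move=> e; apply: gram_ker => k; set Zm := emb A Q *m Y V.
have DZ : emb A D *m Zm = 0.
  by rewrite /Zm mulmxA -embM /Y mulmxA -WDQ -mulmxA -embM e emb0 mulmx0.
have e1 : emb A (adjmx V *m Q *m V) = dag (Y V) *m Zm.
  by rewrite /Zm /Y dagM dag_emb dW !embM -{1}hQ !mulmxA.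
have := congr1 (fun M : 'M[A]_N => h (M k k)) e1.
rewrite embE (scfZ l) sh.2 mulr1 => ->; rewrite mxE (scf_sum l) big1 // => i _.
rewrite 2!mxE; have [ni|ni] := boolP (null i).
  rewrite -[X in _ * X]starK -starMr (positive_star _ ph).
  rewrite /Y emb_mulr mulr_sumr (scf_sum l) big1 ?rmorph0 // => j _.
  by rewrite [W _ _]mxE -scaleAr (scfZ l) null_row ?mulr0.
have := congr1 (fun M : 'M[A]_N => M i k) DZ.
rewrite emb_mull (bigD1 i) //= big1 ?addr0; last first.
  by move=> j ji; rewrite mxE eq_sym (negPf ji) mulr0n scale0r.
rewrite mxE eqxx mulr1n dvecE [RHS]mxE => /eqP; rewrite scaler_eq0 (negPf ni) /= => /eqP ->.
by rewrite mulr0 (scf0 l).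
Qed.

(** The scalar matrix [G] of values [h(a (U W)_ik)] satisfies [G D Q = 0] and vanishes on the kernel
    of [Q], so [G = U1 Q]; [ker_DQ] for the adjoint of [U1] gives [G = 0]. Hence [U P^t U^*]
    vanishes, and likewise [U P U^*] by passing to the conjugate of [U], as [D] and [Q] are real.
    Their sum is [2 U D U^*]. *)
Lemma coker_DQ (U : 'M[C]_N) : U *m D *m Q = 0 -> (forall a i, null i -> U a i = 0) -> U = 0.
Proof.
move=> UDQ U0.
have key (U' : 'M[C]_N) : U' *m D *m Q = 0 -> forall a i k, h (a * (emb A U' *m W) i k) = 0.
  move=> e a i k; pose G : 'M[C]_N := \matrix_(i, k) h (a * (emb A U' *m W) i k).
  have GV (V : 'M[C]_N) : map_mx h (\matrix_(i, k) (a * (emb A U' *m W *m emb A V) i k)) = G *m V.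
    apply/matrixP => i' k'; rewrite !mxE mulr_sumr (scf_sum l); apply: eq_bigr => j _.
    by rewrite embE -!scaleAr mulr1 (scfZ l) mulrC !mxE.
  have GDQ : G *m D *m Q = 0.
    rewrite -mulmxA -GV -(mulmxA (emb A U')) WDQ mulmxA -embM mulmxA e emb0 mul0mx.
    by apply/matrixP => i' k'; rewrite !mxE mulr0 (scf0 l).
  have Gker (V : 'M[C]_N) : Q *m V = 0 -> G *m V = 0.
    move=> QV; rewrite -GV; apply/matrixP => i' k'; rewrite mxE mxE [RHS]mxE -mulmxA -/(Y V) emb_mull.
    rewrite mulr_sumr (scf_sum l) big1 // => j _; rewrite -scaleAr (scfZ l) gram_null ?mulr0 //.
    by rewrite -mulmxA QV mulmx0 mxE.
  have /submxP[U1 GE] : (G <= Q)%MS by rewrite submxE Gker ?mulmx_coker.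
  have aG : adjmx G = Q *m adjmx U1 by rewrite GE adjmxM dQ.
  have G0 : G = 0.
    rewrite -[G]adjmxK aG ker_DQ ?adjmx0 // -mulmxA -aG; apply/matrixP => j i'.
    have h' := @mul_diag_adj0 R N dvec G _ _ i' j.
    rewrite mul_diag_mx mxE [RHS]mxE adjmxE dvecE.
    have -> : P j j * (G i' j)^* = (P j j * G i' j)^*.
      by rewrite conjcM (ge0_complexE (P_ge0 j)) conjr.
    rewrite -dvecE h' ?rmorph0 // => [i2|i2]; first by rewrite dvecE.
    by rewrite aG mulmxA GDQ mul0mx mxE.
  by have /matrixP/(_ i k) := G0; rewrite !mxE.
have cU : map_mx Num.conj U *m D *m Q = 0.
  have := congr1 (map_mx Num.conj) UDQ; rewrite !map_mxM map_mx0.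
  by rewrite conjD conjQ.
have f1 (U' : 'M[C]_N) : U' *m D *m Q = 0 -> U' *m P^T *m adjmx U' = 0.
  move=> e'; apply/matrixP => i j; rewrite [RHS]mxE.
  transitivity (\sum_k h (star ((emb A U' *m W) j k) * (emb A U' *m W) i k)); last first.
    by rewrite big1 // => k _; exact: key.
  rewrite mxE (eq_bigr (fun b => \sum_a U' i a * (U' j b)^* * (\sum_k h (w b k * w a k)))); last first.
    move=> b _; rewrite mxE adjmxE mulr_suml; apply: eq_bigr => a _.
    rewrite !mxE (scf_sum l) mulrAC; congr (_ * _); apply: eq_bigr => k _; by rewrite !mxE.
  rewrite exchange_big /= [RHS](eq_bigr (fun k => \sum_a \sum_b U' i a * (U' j b)^* * h (w b k * w a k))).
    rewrite [RHS]exchange_big; apply: eq_bigr => a _; rewrite [RHS]exchange_big; apply: eq_bigr => b _.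
    by rewrite mulr_sumr.
  move=> k _; rewrite !emb_mull star_sum mulr_suml (scf_sum l) exchange_big; apply: eq_bigr => b _.
  rewrite mulr_sumr (scf_sum l); apply: eq_bigr => a _.
  by rewrite starZc -scaleAl -scaleAr !(scfZ l) !mxE wr; ring.
have f2 : U *m P *m adjmx U = 0.
  have := congr1 trmx (f1 _ cU); rewrite trmx0 !trmx_mul !trmxK mulmxA.
  by congr (_ *m _ *m _ = 0); apply/matrixP => i j; rewrite !mxE ?conjCK.
have f3 : U *m D *m adjmx U + U *m D *m adjmx U = 0.
  by rewrite -mulmxDl -mulmxDr -PD mulmxDr mulmxDl f2 f1 // addr0.
have f4 i : (U *m D *m adjmx U) i i = 0.
  apply: (@addxx_inj R C^o); rewrite addr0.
  by have := congr1 (fun M : 'M[C]_N => M i i) f3; rewrite [LHS]mxE [RHS]mxE.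
have f5 i k : dvec 0 k * U i k = 0.
  by apply: mul_diag_adj0 => // j; rewrite dvecE.
apply/matrixP => i k; rewrite [RHS]mxE; have [nk|nk] := boolP (null k); first exact: U0.
by have := f5 i k; rewrite dvecE => /eqP; rewrite mulf_eq0 (negPf nk) => /eqP.
Qed.

(** * Null rows: the kernel of [D Q] and the associated left ideal *)

Definition nullproj : 'M[C]_N := diag_mx (\row_i (null i)%:R).
Local Notation P0 := nullproj.

Let nullD : P0 *m D = 0.
Proof.
apply/matrixP => i j; rewrite mul_diag_mx mxE [X in X * _]mxE [D _ _]mxE dvecE [RHS]mxE.
by case: (eqVneq (P i i) 0) => [->|_]; rewrite ?mul0rn ?mulr0 ?mul0r.
Qed.

Let P0P0 : P0 *m P0 = P0.
Proof.
apply/matrixP => i j; rewrite mul_diag_mx !mxE; case: (_ == 0); by rewrite ?mul1r ?mul0r ?mul0rn.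
Qed.

Let Cm := D *m Q + P0.

(** If [U Cm = 0], multiplying by [(U D)^*] removes [P0] and leaves [U D Q (U D)^* = 0]. Hence
    [U D Q = 0], then [U P0 = 0], and [coker_DQ] applies. *)
Lemma Cm_unit : Cm \in unitmx.
Proof.
rewrite -row_free_unit -kermx_eq0; set U := kermx Cm.
have UC : U *m Cm = 0 by exact: mulmx_ker.
have e1 : U *m D *m Q *m adjmx (U *m D) = 0.
  have := congr1 (fun M => M *m adjmx (U *m D)) UC; rewrite mul0mx mulmxDr mulmxDl mulmxA.
  by rewrite adjmxM adjD -(mulmxA U P0) (mulmxA P0) nullD mul0mx mulmx0 addr0.
have e2 : Q *m adjmx (U *m D) = 0.
  by apply: gram_ker => k; rewrite adjmxK e1 mxE.
have e3 : U *m D *m Q = 0 by rewrite -[LHS]adjmxK adjmxM dQ e2 adjmx0.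
have e4 : U *m P0 = 0 by move: UC; rewrite mulmxDr mulmxA e3 add0r.
apply/eqP/coker_DQ => // a i ni.
have := congr1 (fun M : 'M[C]_N => M a i) e4; rewrite mul_mx_diag !mxE.
move: ni; rewrite !mxE => ->; by rewrite mulr1.
Qed.

(** An identity in [A] itself, not only under [h]. In a null row [i] the relation [W D Q = D Q W]
    has zero right side, so for every linear [g] the non-null part of the row [g(w_ik)] is
    annihilated by [D Q], and [coker_DQ] makes it zero. *)
Lemma null_coef i k : null i -> ~~ null k -> w i k = 0.
Proof.
move=> ni nk; apply: scalar_sep => g hg.
pose U : 'M[C]_N := \matrix_(a, k) (g (w i k) * (~~ null k)%:R).
have UDQ : U *m D *m Q = 0.
  have e j : \sum_k g (w i k) * (D *m Q) k j = 0.
    have := congr1 (fun M : 'M[A]_N => g (M i j)) WDQ; rewrite emb_mull emb_mulr.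
    rewrite [X in _ = g X]big1 => [|k' _]; last first.
      by rewrite mul_diag_mx [X in X *: _]mxE dvecE (eqP ni) mul0r scale0r.
    rewrite (scf0 hg) (scf_sum hg) => e; rewrite -[RHS]e; apply: eq_bigr => k' _.
    by rewrite (scfZ hg) mulrC [W _ _]mxE.
  apply/matrixP => a j; rewrite -mulmxA mxE [RHS]mxE -[RHS](e j); apply: eq_bigr => k' _.
  rewrite [U _ _]mxE; have [nk'|_] := boolP (null k'); last by rewrite mulr1.
  by rewrite mulr0 mul0r mul_diag_mx mxE dvecE (eqP nk') mul0r mulr0.
have U0 : U = 0.
  by apply: coker_DQ => // a k' nk'; rewrite mxE nk' mulr0.
by have /matrixP/(_ i k) := U0; rewrite !mxE; move: nk; rewrite !mxE => ->; rewrite mulr1.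
Qed.

(** Its columns at null indices form the basis of the kernel of [D Q] dual to the null coordinates;
    the other columns vanish. *)
Definition nullvec : 'M[C]_N := invmx Cm *m P0.
Local Notation V := nullvec.

Let CV : Cm *m V = P0.
Proof. by rewrite mulmxA mulmxV ?Cm_unit // mul1mx. Qed.

Let P0V : P0 *m V = P0.
Proof.
have := congr1 (mulmx P0) CV.
by rewrite mulmxA /Cm mulmxDr mulmxA nullD mul0mx add0r P0P0.
Qed.

Let DQV : D *m Q *m V = 0.
Proof. by have := CV; rewrite /Cm mulmxDl P0V => /(canRL (addrK _)); rewrite subrr. Qed.

Lemma nullvec_null i k : null i -> V i k = (i == k)%:R.
Proof.
move=> ni; have := congr1 (fun M : 'M[C]_N => M i k) P0V.
rewrite mul_diag_mx [LHS]mxE [X in X * _]mxE ni mul1r => ->.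
by rewrite mxE [X in X *+ _]mxE ni.
Qed.

Lemma nullvec_real i k : (V i k)^* = V i k.
Proof.
have e : map_mx Num.conj V = V.
  rewrite map_mxM map_invmx map_mxD map_mxM /= conjD conjQ.
  have -> : map_mx Num.conj P0 = P0 by rewrite map_diag_mx; congr diag_mx; apply/rowP => j; rewrite !mxE rmorph_nat.
  by [].
by have /matrixP/(_ i k) := e; rewrite [LHS]mxE.
Qed.

(** [W] preserves the kernel of [D Q] because it commutes with [D Q]; the coordinates of [W V] in
    the basis [V] are [P0 W V], which equals [P0 W P0] by [null_coef]. *)
Lemma coef_nullvec : W *m emb A V = emb A V *m W *m emb A P0.
Proof.
have e1 : emb A Cm *m (W *m emb A V) = emb A P0 *m (W *m emb A V).
  by rewrite embD mulmxDl mulmxA -WDQ -mulmxA -embM DQV emb0 mulmx0 add0r.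
have e2 : W *m emb A V = emb A V *m (W *m emb A V).
  transitivity (emb A (invmx Cm) *m (emb A Cm *m (W *m emb A V))).
    by rewrite (mulmxA (emb A (invmx Cm))) -embM mulVmx ?Cm_unit // emb1 mul1mx.
  by rewrite e1 (mulmxA (emb A (invmx Cm))) -embM.
have e3 : emb A P0 *m W = emb A P0 *m W *m emb A P0.
  apply/matrixP => i j; rewrite emb_mulr (bigD1 j) //= big1 ?addr0; last first.
    by move=> k kj; rewrite mxE (negPf kj) mulr0n scale0r.
  rewrite [P0 j j]mxE eqxx mulr1n [X in X *: _]mxE; have [nj|nj] := boolP (null j); first by rewrite scale1r.
  rewrite scale0r emb_mull (bigD1 i) //= big1 ?addr0; last first.
    by move=> k ki; rewrite mxE eq_sym (negPf ki) mulr0n scale0r.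
  rewrite [P0 i i]mxE eqxx mulr1n [X in X *: _]mxE [W _ _]mxE; have [ni|ni] := boolP (null i); last by rewrite scale0r.
  by rewrite null_coef // scaler0.
have VP : V *m P0 = V by rewrite -mulmxA P0P0.
have e4 : emb A P0 *m emb A V = emb A P0 by rewrite -embM P0V.
rewrite e2 -{1}VP embM -2!mulmxA (mulmxA (emb A P0) W) e3 -!mulmxA e4 !mulmxA.
by rewrite -embM VP.
Qed.


Let VP : V *m P0 = V.
Proof. by rewrite -mulmxA P0P0. Qed.

(** The left ideal generated by the block of [w] with both indices null. It contains the columns of
    [W V] at null indices, and [h] vanishes on it. *)
Definition nullideal (x : A) := exists a : 'I_N -> 'I_N -> A,
  x = \sum_(m | null m) \sum_(k | null k) a m k * w m k.
Local Notation inJ := nullideal.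

Lemma nullideal0 : inJ 0.
Proof.
exists (fun _ _ => 0); rewrite big1 // => m _; rewrite big1 // => k _; exact: mul0r.
Qed.

Lemma nullidealD x y : inJ x -> inJ y -> inJ (x + y).
Proof.
move=> [a ->] [b ->]; exists (fun m k => a m k + b m k).
rewrite -big_split; apply: eq_bigr => m _; rewrite -big_split; apply: eq_bigr => k _.
by rewrite mulrDl.
Qed.

Lemma nullidealM a x : inJ x -> inJ (a * x).
Proof.
move=> [b ->]; exists (fun m k => a * b m k); rewrite mulr_sumr; apply: eq_bigr => m _.
by rewrite mulr_sumr; apply: eq_bigr => k _; rewrite mulrA.
Qed.

Lemma nullidealZ c x : inJ x -> inJ (c *: x).
Proof. by move=> /(nullidealM (c *: (1 : A))); rewrite -scaleAl mul1r. Qed.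

Lemma nullideal_sum (I : Type) (r : seq I) (p : pred I) (F : I -> A) :
  (forall i, p i -> inJ (F i)) -> inJ (\sum_(i <- r | p i) F i).
Proof. by move=> hF; apply: big_ind => //; [exact: nullideal0|exact: nullidealD]. Qed.

Lemma nullideal_gen m k : null m -> null k -> inJ (w m k).
Proof.
move=> nm nk; exists (fun m' k' => ((m' == m) && (k' == k))%:R).
rewrite (bigD1 m) //= [X in _ + X]big1 ?addr0 => [|m' /andP[_ /negPf mm]]; last first.
  by rewrite big1 // => k' _; rewrite mm mul0r.
rewrite (bigD1 k) //= big1 ?addr0 => [|k' /andP[_ /negPf kk]]; last by rewrite kk andbF mul0r.
by rewrite !eqxx mul1r.
Qed.

Lemma nullideal_state a x : inJ x -> h (a * x) = 0.
Proof.
move=> [b ->]; rewrite mulr_sumr (scf_sum l) big1 // => m nm.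
by rewrite mulr_sumr (scf_sum l) big1 // => k _; rewrite mulrA null_row.
Qed.

Lemma nullideal_vec j m : null m -> inJ ((W *m emb A V) j m).
Proof.
move=> nm; rewrite coef_nullvec emb_mulr (bigD1 m) //= big1 ?addr0; last first.
  by move=> k km; rewrite mxE (negPf km) mulr0n scale0r.
rewrite [P0 m m]mxE eqxx mulr1n [X in X *: _]mxE nm scale1r emb_mull.
apply: nullideal_sum => k _; have [nk|nk] := boolP (null k).
  by apply: nullidealZ; rewrite mxE; exact: nullideal_gen.
have -> : V j k = 0.
  rewrite -VP mul_mx_diag mxE [X in _ * X]mxE (negPf nk); exact: mulr0.
by rewrite scale0r; exact: nullideal0.
Qed.

(** Take a generator [w_mn] times [w_jk]. If [j] and [k] are null, [w_jk] is a generator; if only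
    [j] is, it is zero. If neither is, the exchange relation loses its second half by [null_coef],
    and the two factors commute. If only [k] is, [W V] expresses [w_jk] modulo the ideal by entries
    of the preceding kind. *)
Lemma nullideal_coef x j k : inJ x -> inJ (x * w j k).
Proof.
have comm m n j' k' : null m -> null n -> ~~ null j' -> ~~ null k' -> inJ (w m n * w j' k').
  move=> nm nn nj nk; have := coef_exchange univ qT hPsi Psiz m j' n k'.
  have mj : m != j' by apply: contraNneq nj => <-.
  have nk' : n != k' by apply: contraNneq nk => <-.
  rewrite /e2 mj nk' /= (null_coef nm nk) mul0r !mulr0 subrr mulr0 addr0 mul1r => /eqP.
  by rewrite subr_eq0 => /eqP ->; apply: nullidealM; exact: nullideal_gen.
have key m n j' k' : null m -> null n -> inJ (w m n * w j' k').
  move=> nm nn; have [nj|nj] := boolP (null j'); have [nk|nk] := boolP (null k').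
  - by apply: nullidealM; exact: nullideal_gen.
  - by rewrite (null_coef nj nk) mulr0; exact: nullideal0.
  - have e : w j' k' = (W *m emb A V) j' k' - \sum_(i | ~~ null i) V i k' *: w j' i.
      have -> : (W *m emb A V) j' k' = \sum_i V i k' *: w j' i.
        by rewrite emb_mulr; apply: eq_bigr => i _; rewrite [W _ _]mxE.
      rewrite (bigID (fun i => null i)) /= addrK.
      rewrite (bigD1 k') //= nullvec_null // eqxx scale1r big1 ?addr0 //.
      by move=> i /andP[ni /negPf ik]; rewrite nullvec_null // ik scale0r.
    rewrite e mulrBr -scaleN1r mulr_sumr; apply: nullidealD.
      exact/nullidealM/nullideal_vec.
    apply/nullidealZ/nullideal_sum => i ni; rewrite -scaleAr; apply: nullidealZ.
    exact: comm.
  - exact: comm.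
move=> [a ->]; rewrite mulr_suml; apply: nullideal_sum => m nm.
rewrite mulr_suml; apply: nullideal_sum => n nn; rewrite -mulrA; apply: nullidealM.
exact: key.
Qed.

(** * Exclusion of null rows by a reflected Clifford model *)

Section Reflection.
Variable m : 'I_N.
Hypothesis nm : null m.

Let r2 : C := (N%:R)^-1.
Let N0 : N%:R != 0 :> C.
Proof. by rewrite pnatr_eq0 -lt0n; case: (N) m => [[]|]. Qed.

Variables (M : cstarAlgType R) (clif : 'I_N -> M).
Hypotheses (M1 : (1 : M) <> 0) (clif_rel : sphere_rel RealCase Twisted clif).
Hypothesis clif_ac : forall i j,
  acomm (clif i) (clif j) = (2%:R * r2 * (i == j)%:R) *: (1 : M).

Let v j : C := V j m.
Let v_real j : (v j)^* = v j. Proof. exact: nullvec_real. Qed.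
Let n2 : C := \sum_j v j * v j.
Let n2_neq0 : n2 != 0.
Proof.
rewrite /n2 (bigD1 m) //= /v nullvec_null // eqxx mulr1 gt_eqF // ltr_pwDl ?ltr01 //.
by rewrite sumr_ge0 // => j _; rewrite -{2}nullvec_real mulcJ_ge0.
Qed.

Let cc := 2%:R / n2.
Let cc_real : cc^* = cc.
Proof.
have n2r : n2^* = n2 by rewrite /n2 conjc_sum; apply: eq_bigr => j _; rewrite conjcM !v_real.
have n2V : (n2^-1)^* = n2^-1 by rewrite -[in RHS]n2r; exact: (fmorphV Num.conj).
by rewrite /cc conjcM rmorph_nat n2V.
Qed.

Let axis : M := \sum_k v k *: clif k.

Let axis_ac i : acomm axis (clif i) = (2%:R * r2 * v i) *: (1 : M).
Proof.
rewrite /axis acomm_suml (bigD1 i) //= big1 ?addr0 => [|k /negPf ki]; last first.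
  by rewrite acommZl clif_ac ki mulr0 scale0r scaler0.
by rewrite acommZl clif_ac eqxx mulr1 scalerA mulrC.
Qed.

Let axis_sq : acomm axis axis = (2%:R * r2 * n2) *: (1 : M).
Proof.
rewrite {1}/axis acomm_suml mulr_sumr scaler_suml; apply: eq_bigr => k _.
by rewrite acommZl acommC axis_ac scalerA; congr (_ *: _); ring.
Qed.

(** The orthogonal reflection along the real vector [v], with [cc = 2 / |v|^2], applied to the
    Clifford generators; it preserves their anticommutators. *)
Let refl j := clif j - (cc * v j) *: axis.

Let refl_ac i j : acomm (refl i) (refl j) = (2%:R * r2 * (i == j)%:R) *: (1 : M).
Proof.
rewrite /refl acommBl !acommBr !acommZl !acommZr clif_ac axis_ac [acomm (clif i) axis]acommC.
rewrite axis_ac axis_sq !scalerA -!scalerBl.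
by congr (_ *: _); rewrite /cc; field.
Qed.

Let clif_sa j : star (clif j) = clif j.
Proof. by have [/(_ erefl) h1 _ _ _] := (sphere_relP _ _ _).1 clif_rel; rewrite -h1. Qed.

Let refl_sa j : refl j = star (refl j).
Proof.
rewrite /refl starB clif_sa starZc conjcM cc_real v_real; congr (_ - _ *: _).
by rewrite /axis star_sum; apply: eq_bigr => k _; rewrite starZc v_real clif_sa.
Qed.

Let refl_rel : sphere_rel RealCase Twisted refl.
Proof.
apply/sphere_relP; split=> // [s|_ i j s t].
  transitivity (\sum_(i < N) r2 *: (1 : M)).
    apply: eq_bigr => i _; rewrite !(adj_id _ (refl_sa i)).
    apply: (@addxx_inj R); have := refl_ac i i; rewrite /acomm => ->.
    by rewrite eqxx mulr1 mulr_natl -scalerMnl mulr2n.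
  by rewrite sumr_const card_ord scalerMnl -[_ *+ _]mulr_natl divff // scale1r.
rewrite !(adj_id _ (refl_sa _)) /e2 /=; have [->|ij] := eqVneq i j; first by rewrite mul1r.
have := refl_ac i j; rewrite (negPf ij) mulr0 scale0r => /eqP; rewrite addr_eq0 => /eqP ->.
by rewrite expr1 mulN1r.
Qed.

Hypothesis dens : dense (span2 (fun (x : X) (a : A) => Psi x * tprod ten a 1)).

Let word (s : seq ('I_N * 'I_N)) : A := foldr (fun p b => w p.1 p.2 * b) 1 s.

Let hfun a b x := h (a * x * b).
Let hfun_bd a b : bdfun (hfun a b).
Proof.
apply: (bdfun_comp (f := fun x => a * x * b) (positive_bounded ph)).
exact: (bounded_map_comp (bounded_mull a) (bounded_mulr b)).
Qed.

(** Vanishing under [h] when inserted between an arbitrary [a] and a word in the coefficients. Left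
    factors are absorbed by [a] and [phi], right factors [w_jk (x) b] by the word and [phi], so the
    condition survives both multiplications. *)
Let inE (y : ten A (M)) := forall a s (phi : M -> C), bdfun phi ->
  pfun (hfun a (word s)) phi y = 0.

Let inE_tprod x b : inJ x -> inE (tprod ten x b).
Proof.
move=> Jx a s phi bphi; rewrite pfunE //.
suff -> : hfun a (word s) x = 0 by rewrite mul0r.
rewrite /hfun -mulrA nullideal_state //; elim: s x Jx => [|p s ih] x Jx /=; first by rewrite mulr1.
by rewrite mulrA; apply: ih; exact: nullideal_coef.
Qed.

Let inE_lin c x y : inE x -> inE y -> inE (c *: x + y).
Proof.
move=> hx hy a s phi bphi; rewrite (pfun_bounded ten (hfun_bd a (word s)) bphi).1.
by rewrite hx // hy // mulr0 addr0.
Qed.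

Let inE_lim u y : (forall n, inE (u n)) -> seq_lim u y -> inE y.
Proof.
move=> hu uy a s phi bphi; apply: (bdfun_lim0 (pfun_bounded ten (hfun_bd a (word s)) bphi) uy).
by move=> n; exact: hu.
Qed.

Let inE_right y j k b : inE y -> inE (y * tprod ten (w j k) b).
Proof.
move=> hy a s phi bphi.
have b2 : bdfun (fun x => phi (x * b)) by exact: (bdfun_comp bphi (bounded_mulr b)).
rewrite -(hy a ((j, k) :: s) _ b2); move: y {hy}.
apply: (tens_fun_ext (f := fun y => pfun (hfun a (word s)) phi (y * tprod ten (w j k) b))
  (g := pfun (hfun a (word ((j, k) :: s))) (fun x => phi (x * b)))).
- exact: (bdfun_comp (pfun_bounded ten (hfun_bd _ _) bphi) (bounded_mulr _)).
- exact: (pfun_bounded ten (hfun_bd _ _) b2).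
- by move=> x b'; rewrite tprodM !pfunE // /hfun /= !mulrA.
Qed.

Let inE_left y Y' : inE y -> inE (Y' * y).
Proof.
move=> hy a s phi bphi; have bp := pfun_bounded ten (hfun_bd a (word s)) bphi.
apply: (tens_fun_ext (f := fun Y' => pfun (hfun a (word s)) phi (Y' * y)) (g := fun=> 0)).
- exact: (bdfun_comp bp (bounded_mulr _)).
- split; first by move=> c x x'; rewrite mulr0 addr0.
  by exists 0; split=> // x; rewrite cabs0 mul0r.
move=> a' b'.
have b2 : bdfun (fun x => phi (b' * x)) by exact: (bdfun_comp bphi (bounded_mull b')).
rewrite -(hy (a * a') s _ b2); move: y {hy}.
apply: (tens_fun_ext (f := fun y => pfun (hfun a (word s)) phi (tprod ten a' b' * y))
  (g := pfun (hfun (a * a') (word s)) (fun x => phi (b' * x)))).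
- exact: (bdfun_comp bp (bounded_mull _)).
- exact: (pfun_bounded ten (hfun_bd _ _) b2).
- by move=> x b; rewrite tprodM !pfunE // /hfun /= !mulrA.
Qed.

(* Reflecting the generators along the null vector [v] changes [Psi] only modulo
   the left ideal, on which the Haar state vanishes; this contradicts the density
   of [(A (x) 1) Psi(X)]. *)
Lemma null_absurd : False.
Proof.
have [_ /(_ _ _ clif_rel)[f [[hf fz] _]]] := univ.
have [_ /(_ _ _ refl_rel)[f' [[hf' fz'] _]]] := univ.
have [hG eG] := tmapP ten (starhom_id A) hf.
have [hG' eG'] := tmapP ten (starhom_id A) hf'.
set G := tmap id f in hG eG; set G' := tmap id f' in hG' eG'.
have gen i : inE (G (Psi (z i)) - G' (Psi (z i))).
  rewrite Psiz (starhom_sum hG) (starhom_sum hG') -sumrB.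
  rewrite (eq_bigr (fun j => tprod ten ((cc * v j) *: w i j) axis)) => [|j _]; last first.
    rewrite eG eG' fz fz' /refl /tprod -mulrBr -(starhomB (tinr_hom ten _ _)) opprB addrC subrK.
    by rewrite (starhomZ (tinr_hom ten _ _)) (starhomZ (tinl_hom ten _ _)) -scaleAl -scaleAr.
  rewrite -tprod_suml; apply: inE_tprod.
  have -> : \sum_j (cc * v j) *: w i j = cc *: (W *m emb A V) i m.
    by rewrite emb_mulr scaler_sumr; apply: eq_bigr => j _; rewrite scalerA [W _ _]mxE.
  by apply: nullidealZ; exact: nullideal_vec.
have inEB x y : inE x -> inE y -> inE (x + y).
  by move=> hx hy; rewrite -[x]scale1r; exact: inE_lin.
(* The difference propagates along words by [p q - p' q' = (p - p') q + p' (q - q')]. *)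
have all x : inE (G (Psi x) - G' (Psi x)).
  move: x; apply: (@right_word_ind R _ (fun A => @sphere_rel R A N RealCase Twisted) X z univ _
    (fun x => inE (G (Psi x) - G' (Psi x)))).
  - by move=> B0 D0 g w0 hg gI; exact: (sphere_rel_inj hg gI).
  - rewrite (starhom1 hPsi) (starhom1 hG) (starhom1 hG') subrr => a s phi bphi.
    exact: (scf0 (pfun_bounded ten (hfun_bd _ _) bphi).1).
  - move=> c a b ha hb; rewrite (starhomD hPsi) (starhomZ hPsi).
    rewrite (starhomD hG) (starhomZ hG) (starhomD hG') (starhomZ hG') opprD addrACA -scalerBr.
    exact: inE_lin.
  - move=> u a hu ua.
    have l1 := starhom_lim hPsi ua.
    have := seq_limD (starhom_lim hG l1) (seq_limZ (-1) (starhom_lim hG' l1)).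
    rewrite scaleN1r; apply: inE_lim => n /=; rewrite scaleN1r; exact: hu.
  - move=> x i s hx.
    have -> : adj s (z i) = z i.
      have [/(_ erefl) sz _ _ _] := (sphere_relP _ _ _).1 univ.1; exact: adj_id.
    rewrite (starhomM hPsi) (starhomM hG) (starhomM hG').
    have -> : G (Psi x) * G (Psi (z i)) - G' (Psi x) * G' (Psi (z i)) =
        (G (Psi x) - G' (Psi x)) * G (Psi (z i)) + G' (Psi x) * (G (Psi (z i)) - G' (Psi (z i))).
      by rewrite mulrBl mulrBr addrA subrK.
    apply: (inEB _ _); last exact: inE_left.
    rewrite Psiz (starhom_sum hG) mulr_sumr.
    apply: (big_ind inE) => [|y y' hy hy'|j _]; [|exact: inEB|by rewrite eG; exact: inE_right].
    by move=> a t phi bphi; exact: (scf0 (pfun_bounded ten (hfun_bd _ _) bphi).1).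
have axis0 : axis = 0.
  apply: (bdfun_sep ten) => phi bphi.
  have bh := positive_bounded ph.
  have bp := pfun_bounded ten bh bphi.
  have bG := bdfun_comp bp (starhom_bounded hG); have bG' := bdfun_comp bp (starhom_bounded hG').
  (* [G] and [G'] agree on [A (x) 1], so [all] covers the products of [a (x) 1] with [Psi x]; their
     span is dense by the condition on the action. *)
  have e y : pfun h phi (G y) = pfun h phi (G' y).
    apply: (cancel_ext hPsi (tinl_hom ten A X) _ bG bG') => [|a x] /=.
      by move: dens; congr dense; congr span2; apply/funext => x; apply/funext => b; rewrite tprod1l.
    rewrite (starhomM hG) (starhomM hG').
    have el : G (tinl ten X a) = G' (tinl ten X a).
      by rewrite -tprod1l eG eG' (starhom1 hf) (starhom1 hf').
    rewrite el; apply/eqP; rewrite -subr_eq0 -(scfB bp.1) -mulrBr; apply/eqP.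
    have := inE_left (G' (tinl ten X a)) (all x) 1 [::] bphi.
    have -> // : hfun 1 (word [::]) = h by apply/funext => b; rewrite /hfun /= mulr1 mul1r.
  (* At [1 (x) z_m] the two models differ by [cc v_m axis], where [v_m = 1]. *)
  have := e (tprod ten 1 (z m)); rewrite eG eG' !pfunE // sh.2 !mul1r fz fz' /refl.
  move=> /eqP; rewrite (scfB bphi.1) -subr_eq0 opprB addrC subrK (scfZ bphi.1) mulf_eq0.
  rewrite /v nullvec_null // eqxx mulr1 /cc mulf_eq0 invr_eq0 pnatr_eq0 (negPf n2_neq0) /=.
  by move=> /eqP.
have := axis_sq; rewrite axis0 /acomm mulr0 addr0.
rewrite -(scale0r (1 : M)) => /(scalar_eq1 M1)/esym/eqP.
by rewrite !mulf_eq0 invr_eq0 (negPf N0) (negPf n2_neq0) pnatr_eq0.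
Qed.

End Reflection.

(** * The twisted case without null rows *)

Section Positive.
Hypothesis pos : forall i, ~~ null i.

Let Di : 'M[C]_N := diag_mx (\row_i (P i i)^-1).

Let DDi : D *m Di = 1%:M.
Proof.
apply/matrixP => i j; rewrite mul_diag_mx mxE dvecE [Di i j]mxE [X in X *+ _]mxE [RHS]mxE.
by case: (i == j); rewrite ?mulr1n ?mulr0n ?mulr0 // mulfV.
Qed.

Let DiD : Di *m D = 1%:M. Proof. exact: mulmx1C. Qed.

Let Q_unit : Q \in unitmx.
Proof.
have P00 : P0 = 0.
  apply/matrixP => i j; rewrite mxE [X in X *+ _]mxE [RHS]mxE (negPf (pos i)).
  exact: mul0rn.
by have := Cm_unit; rewrite /Cm P00 addr0 unitmx_mul => /andP[].
Qed.

Let Qi := invmx Q.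

Let adjQi : adjmx Qi = Qi.
Proof. by rewrite /adjmx /Qi trmx_inv QT map_invmx conjQ. Qed.

Let QQi : emb A Q *m emb A Qi = 1%:M. Proof. by rewrite -embM mulmxV // emb1. Qed.
Let QiQ : emb A Qi *m emb A Q = 1%:M. Proof. by rewrite -embM mulVmx // emb1. Qed.

Let dWT : dag W^T = W. Proof. by rewrite -dW dagK. Qed.

(** Write [Q = B^* B]. As [W^t Q W = Q], the matrix [B W B^-1] is an isometry, and [q' = B q B^*] is
    the projection complementary to its range. Its trace is zero because [tr(Q W Q^-1 W^t)]
    rearranges into the pairing of [Q^-1] with [W^t Q W = Q]: only scalars and indices are moved,
    and [Q] is symmetric. *)
Lemma coef_invgram : W *m emb A Qi *m W^T = emb A Qi.
Proof.
have [B QB] : exists B, Q = adjmx B *m B.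
  apply: psd_factor dQ _ => V i; rewrite -gramY mxE mxE (scf_sum l) sumr_ge0 // => k _.
  by rewrite !mxE; exact: ph.2.
have uB : B \in unitmx by move: Q_unit; rewrite QB unitmx_mul => /andP[].
pose q := emb A Qi - W *m emb A Qi *m W^T.
have dq : dag q = q.
  have dagB (M1 M2 : 'M[A]_N) : dag (M1 - M2) = dag M1 - dag M2.
    by apply/matrixP => i j; rewrite !mxE starB.
  by rewrite dagB !dagM dWT dW dag_emb -/(adjmx Qi) adjQi mulmxA.
have qQW : q *m emb A Q *m W = 0.
  rewrite !mulmxBl QiQ mul1mx -!mulmxA (mulmxA W^T) hQ QiQ mulmx1 subrr //.
have qQq : q *m emb A Q *m q = q.
  by rewrite {2}/q mulmxBr !mulmxA qQW !mul0mx subr0 -mulmxA QQi mulmx1.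
have trq : \tr (emb A Q *m q) = 0.
  rewrite mulmxBr QQi raddfB /= mxtrace1; apply/eqP; rewrite subr_eq0; apply/eqP.
  transitivity (\sum_a \sum_b Qi a b *: (W^T *m emb A Q *m W) a b).
    rewrite hQ; transitivity (\sum_(a < N) (1 : A)); first by rewrite sumr_const card_ord.
    apply: eq_bigr => a _; have := congr1 (fun M : 'M[A]_N => M a a) QiQ.
    rewrite emb_mull [X in _ = X -> _]mxE eqxx => e; transitivity (true%:R : A) => //.
    rewrite -e; apply: eq_bigr => b _.
    by rewrite !embE -{1}QT [Q^T _ _]mxE.
  rewrite /mxtrace; under [RHS]eq_bigr do rewrite emb_mull.
  transitivity (\sum_a \sum_b \sum_i \sum_j (Qi a b * Q j i) *: (w j a * w i b)).
    apply: eq_bigr => a _; apply: eq_bigr => b _; rewrite mxE scaler_sumr; apply: eq_bigr => i _.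
    rewrite emb_mulr [W _ _]mxE mulr_suml scaler_sumr; apply: eq_bigr => j _.
    by rewrite -scaleAl scalerA [W^T _ _]mxE [W _ _]mxE.
  symmetry; transitivity (\sum_i \sum_j \sum_a \sum_b (Qi a b * Q j i) *: (w j a * w i b)).
    apply: eq_bigr => i _; apply: eq_bigr => j _.
    rewrite [X in _ *: X]mxE scaler_sumr [RHS]exchange_big /=; apply: eq_bigr => b _.
    rewrite emb_mulr [W^T _ _]mxE [W _ _]mxE mulr_suml scaler_sumr; apply: eq_bigr => a _.
    by rewrite -scaleAl scalerA [W _ _]mxE -{1}QT [Q^T _ _]mxE mulrC.
  under eq_bigr do rewrite exchange_big.
  rewrite exchange_big; apply: eq_bigr => a _.
  by under eq_bigr do rewrite exchange_big; rewrite exchange_big.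
pose q' := emb A B *m q *m emb A (adjmx B).
have dq' : dag q' = q'.
  by rewrite /q' !dagM !dag_emb dq -/(adjmx B) -/(adjmx (adjmx B)) adjmxK mulmxA.
have q'q' : q' *m q' = q'.
  rewrite /q' -!mulmxA; congr (_ *m _); rewrite (mulmxA (emb A (adjmx B))) -embM -QB.
  by rewrite (mulmxA (emb A Q)) mulmxA (mulmxA q) qQq.
have trq' : \tr q' = 0.
  rewrite /q' -mulmxA mxtrace_emb -mulmxA -embM -QB -mxtrace_emb //.
have q'0 : \sum_(p : 'I_N * 'I_N) q' p.1 p.2 * star (q' p.1 p.2) = 0.
  rewrite -(pair_big xpredT xpredT (fun i j => q' i j * star (q' i j))) /= -[RHS]trq'.
  apply: eq_bigr => i _; rewrite -{3}q'q' mxE; apply: eq_bigr => j _.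
  have -> // : q' j i = star (q' i j).
  by rewrite -{1}dq' [LHS]mxE [LHS]mxE.
have {}q'0 : q' = 0.
  apply/matrixP => i j; rewrite [RHS]mxE.
  exact: (sum_mul_star_eq0 ten q'0 (i := (i, j)) isT).
have q0 : q = 0.
  have uA : adjmx B \in unitmx by rewrite /adjmx map_unitmx unitmx_tr.
  have : emb A (invmx B) *m q' *m emb A (invmx (adjmx B)) = q.
    rewrite /q' !mulmxA -embM mulVmx // emb1 mul1mx -mulmxA -embM mulmxV // emb1 mulmx1 //.
  by rewrite q'0 mulmx0 mul0mx.
by apply/esym/eqP; rewrite -subr_eq0; apply/eqP.
Qed.

(** From [W D Q = D Q W] and the two invariance identities for [Q] one gets [W D W^t = D] and
    [W^t D^-1 W = D^-1]. Now [tr D = N] by [state_tr], and [h] applied to the second identity gives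
    [tr D^-1 = N]. So the [(D_i - 1)^2 / D_i = D_i + 1/D_i - 2] sum to zero, and [D = 1]. *)
Lemma positive_rows : W *m W^T = 1%:M.
Proof.
have e2 : W *m emb A D *m W^T = emb A D.
  have e : emb A D = emb A (D *m Q) *m emb A Qi by rewrite -embM mulmxK.
  by rewrite {1}e mulmxA WDQ -!mulmxA (mulmxA W) coef_invgram -e.
have e3 : W^T *m emb A Di *m W = emb A Di.
  have e4 : emb A Q *m W = emb A Di *m W *m emb A (D *m Q).
    by rewrite -mulmxA WDQ mulmxA -embM mulmxA DiD mul1mx.
  have e5 : W^T *m emb A Di *m W *m emb A (D *m Q) = emb A Q.
    by rewrite -!mulmxA (mulmxA (emb A Di)) -e4 mulmxA.
  have := congr1 (mulmx^~ (emb A (Qi *m Di))) e5.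
  rewrite -mulmxA -!embM mulmxA mulmxK // DDi emb1 mulmx1 => ->.
  by rewrite mulmxA mulmxV // mul1mx.
have trD : \sum_i P i i = N%:R by rewrite -(state_tr univ hPsi Psiz sh).
have trDi : \sum_i (P i i)^-1 = N%:R.
  transitivity (\sum_i h ((emb A Di) i i)).
    by apply: eq_bigr => i _; rewrite embE (scfZ l) sh.2 mulr1 [Di i i]mxE eqxx mulr1n [RHS]mxE.
  rewrite -e3; transitivity (\sum_k \sum_i (P i i)^-1 * h (w i k * w i k)).
    apply: eq_bigr => k _; rewrite mxE (scf_sum l); apply: eq_bigr => i _.
    rewrite emb_mulr (bigD1 i) //= big1 ?addr0; last first.
      by move=> j ji; rewrite mxE (negPf ji) mulr0n scale0r.
    by rewrite [Di i i]mxE eqxx mulr1n [X in X *: _]mxE -scaleAl (scfZ l) [W^T _ _]mxE ![W _ _]mxE.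
  rewrite exchange_big /=; transitivity (\sum_(i < N) (1 : C)).
    apply: eq_bigr => i _; rewrite -mulr_sumr -(mulVf (pos i)); congr (_ * _).
    by rewrite PE; apply: eq_bigr => k _; rewrite wr.
  by rewrite sumr_const card_ord.
have p1 i : P i i = 1.
  have h0 j : 0 <= (P j j - 1) ^+ 2 / P j j.
    rewrite mulr_ge0 ?invr_ge0 //; apply: real_exprn_even_ge0 => //.
    by rewrite rpredB ?rpred1 // ger0_real.
  have : \sum_j (P j j - 1) ^+ 2 / P j j = 0.
    transitivity (\sum_j (P j j + (P j j)^-1 - 2%:R)).
      apply: eq_bigr => j _; have := pos j; move: (P j j) => x x0; by field.
    by rewrite sumrB big_split /= trD trDi sumr_const card_ord -[_ *+ N]mulr_natr; ring.
  move=> /eqP; rewrite psumr_eq0 // => /allP/(_ i (mem_index_enum _)) /=.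
  by rewrite mulf_eq0 invr_eq0 (negPf (pos i)) orbF expf_eq0 /= subr_eq0 => /eqP.
have D1 : D = 1%:M.
  by apply/matrixP => i j; rewrite mxE dvecE p1 [RHS]mxE.
by move: e2; rewrite D1 emb1 mulmx1.
Qed.

End Positive.

Lemma twisted_rows : dense (span2 (fun (x : X) (a : A) => Psi x * tprod ten a 1)) ->
  W *m W^T = 1%:M.
Proof.
move=> dens; apply: positive_rows => i; apply/negP => ni.
have [F [rF aF]] := clifford_model R i.
apply: (null_absurd ni _ rF aF dens) => /(congr1 (fun M => entry M (true, finset.set0) (true, finset.set0))).
by rewrite entry1 eqxx (scf0 (entry_scalar _ _)) => /eqP; rewrite oner_eq0.
Qed.

End Twisted.

(** * The universal quantum group and its action *)

Section Products.
Variables (R : realType) (ten : spatialTensor R) (N : nat).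
Variables A B : cstarAlgType R.

Definition tcontract (p : 'I_N -> A) (q : 'I_N -> B) : ten A B := \sum_k tprod ten (p k) (q k).

Lemma adj_tcontract s p q :
  adj s (tcontract p q) = tcontract (fun k => adj s (p k)) (fun k => adj s (q k)).
Proof.
by case: s => //; rewrite /= star_sum; apply: eq_bigr => k _; rewrite tprod_star.
Qed.

Lemma tcontractM p q p' q' : tcontract p q * tcontract p' q' =
  \sum_a \sum_b tprod ten (p a * p' b) (q a * q' b).
Proof.
rewrite /tcontract mulr_suml; apply: eq_bigr => a _.
by rewrite mulr_sumr; apply: eq_bigr => b _; rewrite tprodM.
Qed.

Lemma tprod_sgn2 (b c : bool) (x : A) (y : B) :
  tprod ten ((-1) ^+ b * x) ((-1) ^+ c * y) = (-1) ^+ (b (+) c) * tprod ten x y.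
Proof. by rewrite sgn_tprod tprod_sgn mulrA -signr_addb. Qed.

(** The sign [f] of the summation indices occurs once in each leg and cancels. One statement serves
    the comultiplication and the action. *)
Lemma tcontract_comm2 (e e' : bool) (f : 'I_N -> 'I_N -> bool) p q p' q' :
  (forall a b, p a * p' b = (-1) ^+ (e (+) f a b) * (p' b * p a)) ->
  (forall a b, q a * q' b = (-1) ^+ (f a b (+) e') * (q' b * q a)) ->
  tcontract p q * tcontract p' q' = (-1) ^+ (e (+) e') * (tcontract p' q' * tcontract p q).
Proof.
move=> hp hq; rewrite !tcontractM [in RHS]exchange_big mulr_sumr; apply: eq_bigr => a _.
rewrite mulr_sumr; apply: eq_bigr => b _; rewrite hp hq tprod_sgn2.
by rewrite -addbA (addbA (f a b)) addbb addFb.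
Qed.

Lemma tcontract_comm3 (e e' : bool) (f : 'I_N -> 'I_N -> 'I_N -> bool) p q p' q' p'' q'' :
  (forall a b c, p a * p' b * p'' c = (-1) ^+ (e (+) f a b c) * (p'' c * p' b * p a)) ->
  (forall a b c, q a * q' b * q'' c = (-1) ^+ (f a b c (+) e') * (q'' c * q' b * q a)) ->
  tcontract p q * tcontract p' q' * tcontract p'' q'' =
  (-1) ^+ (e (+) e') * (tcontract p'' q'' * tcontract p' q' * tcontract p q).
Proof.
move=> hp hq.
have M3 x y x' y' x'' y'' : tcontract x y * tcontract x' y' * tcontract x'' y'' =
    \sum_a \sum_b \sum_c tprod ten (x a * x' b * x'' c) (y a * y' b * y'' c).
  rewrite tcontractM mulr_suml; apply: eq_bigr => a _; rewrite mulr_suml; apply: eq_bigr => b _.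
  by rewrite mulr_sumr; apply: eq_bigr => c _; rewrite tprodM.
have rv (V : nmodType) (g : 'I_N -> 'I_N -> 'I_N -> V) :
    \sum_l \sum_m \sum_n g l m n = \sum_n \sum_m \sum_l g l m n.
  rewrite exchange_big; under eq_bigr do rewrite exchange_big; rewrite exchange_big.
  by apply: eq_bigr.
rewrite !M3 [in RHS]rv mulr_sumr; apply: eq_bigr => a _.
rewrite mulr_sumr; apply: eq_bigr => b _; rewrite mulr_sumr; apply: eq_bigr => c _.
by rewrite hp hq tprod_sgn2 -addbA (addbA (f a b c)) addbb addFb.
Qed.

Lemma tcontract_sum (I : finType) (p p' : I -> 'I_N -> A) (q q' : 'I_N -> B) :
  (forall a b, \sum_i p i a * p' i b = (a == b)%:R) ->
  \sum_i tcontract (p i) q * tcontract (p' i) q' = \sum_a tprod ten 1 (q a * q' a).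
Proof.
move=> hp; under eq_bigr do rewrite tcontractM.
rewrite exchange_big; apply: eq_bigr => a _; rewrite exchange_big (bigD1 a) //= [X in _ + X]big1 ?addr0.
  by rewrite -tprod_suml hp eqxx.
by move=> b; rewrite eq_sym => /negPf ab; rewrite -tprod_suml hp ab tprod0l.
Qed.

Lemma tcontract_sum' (I : finType) (p p' : 'I_N -> A) (q q' : I -> 'I_N -> B) :
  (forall a b, \sum_i q i a * q' i b = (a == b)%:R) ->
  \sum_i tcontract p (q i) * tcontract p' (q' i) = \sum_a tprod ten (p a * p' a) 1.
Proof.
move=> hp; under eq_bigr do rewrite tcontractM.
rewrite exchange_big; apply: eq_bigr => a _; rewrite exchange_big (bigD1 a) //= [X in _ + X]big1 ?addr0.
  by rewrite -tprod_sumr hp eqxx.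
by move=> b; rewrite eq_sym => /negPf ab; rewrite -tprod_sumr hp ab tprod0r.
Qed.

Variables (K : scalars) (L : liberation).

Lemma qgroup_comm2 (D : cstarAlgType R) (v : 'I_N * 'I_N -> D) s t i j k l :
  comm2 v (fun a b => twisted L && same_line a b) ->
  adj s (v (i, k)) * adj t (v (j, l)) =
  (-1) ^+ (e2 L i j (+) e2 L k l) * (adj t (v (j, l)) * adj s (v (i, k))).
Proof. by move=> h; rewrite h same_lineE. Qed.

Lemma qgroup_comm3 (D : cstarAlgType R) (v : 'I_N * 'I_N -> D) s t r i j k l m n :
  comm3 v (fun a b c => twisted L && mixed_span a b c) ->
  adj s (v (i, l)) * adj t (v (j, m)) * adj r (v (k, n)) =
  (-1) ^+ (e3 L i j k (+) e3 L l m n) * (adj r (v (k, n)) * adj t (v (j, m)) * adj s (v (i, l))).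
Proof. by move=> h; rewrite h mixed_spanE. Qed.

Lemma qgroup_rel_tprod (v : 'I_N * 'I_N -> A) (v' : 'I_N * 'I_N -> B) :
  qgroup_rel K L v -> qgroup_rel K L v' ->
  qgroup_rel K L (fun p => tcontract (fun k => v (p.1, k)) (fun k => v' (k, p.2))).
Proof.
move=> /qgroup_relP[h1 [h2 h2'] h3 h4] /qgroup_relP[g1 [g2 g2'] g3 g4].
apply/qgroup_relP; split.
- move=> hK a; rewrite -[RHS]/(adj true _) adj_tcontract; apply: eq_bigr => k _.
  by rewrite !adj_id //; [exact: g1|exact: h1].
- split=> s k l; under eq_bigr do rewrite !adj_tcontract /=.
    rewrite tcontract_sum //= -tprod_sumr g2; case: eqP => _; [exact: tprod11|exact: tprod0r].
  rewrite tcontract_sum' //= -tprod_suml h2'; case: eqP => _; [exact: tprod11|exact: tprod0l].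
- move=> qL [i k] [j l] s t; rewrite !adj_tcontract same_lineE.
  by apply: (tcontract_comm2 (f := e2 L)) => a b; apply: qgroup_comm2; auto.
- move=> cL [i l] [j m] [k n] s t r; rewrite !adj_tcontract mixed_spanE.
  by apply: (tcontract_comm3 (f := e3 L)) => a b c; apply: qgroup_comm3; auto.
Qed.

Lemma sphere_rel_tprod (v : 'I_N * 'I_N -> A) (z : 'I_N -> B) :
  qgroup_rel K L v -> sphere_rel K L z ->
  sphere_rel K L (fun i => tcontract (fun k => v (i, k)) z).
Proof.
move=> /qgroup_relP[h1 [h2 h2'] h3 h4] /sphere_relP[g1 g2 g3 g4].
apply/sphere_relP; split.
- move=> hK i; rewrite -[RHS]/(adj true _) adj_tcontract; apply: eq_bigr => k _.
  by rewrite !adj_id //; [exact: g1|exact: h1].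
- move=> s; under eq_bigr do rewrite !adj_tcontract.
  by rewrite tcontract_sum // -tprod_sumr g2 tprod11.
- move=> qL i j s t; rewrite !adj_tcontract -[e2 L i j]addbF.
  apply: (tcontract_comm2 (f := e2 L)) => a b; first by apply: qgroup_comm2; auto.
  by rewrite addbF; exact: g3.
- move=> cL i j k s t r; rewrite !adj_tcontract -[e3 L i j k]addbF.
  apply: (tcontract_comm3 (f := e3 L)) => a b c; first by apply: qgroup_comm3; auto.
  by rewrite addbF; exact: g4.
Qed.

(** A product of entries of the identity matrix vanishes unless row and column indices agree, and
    then the row sign cancels the column sign. *)
Lemma qgroup_rel_unit : qgroup_rel K L (fun p : 'I_N * 'I_N => (p.1 == p.2)%:R : A).
Proof.
have adj_nat s (b : bool) : adj s (b%:R : A) = b%:R.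
  by case: s => //=; case: b; rewrite ?star1 ?star0.
apply/qgroup_relP; split.
- by move=> _ a; rewrite -[RHS]/(adj true _) adj_nat.
- split=> s k l /=; under eq_bigr do rewrite !adj_nat.
    by rewrite (bigD1 k) //= eqxx mul1r big1 ?addr0 // => i /negPf ->; rewrite mul0r.
  rewrite (bigD1 k) //= eqxx mul1r big1 ?addr0 ?(eq_sym l) // => i; rewrite eq_sym => /negPf ->.
  by rewrite mul0r.
- move=> qL [i k] [j l] s t; rewrite !adj_nat same_lineE /=.
  case: eqP => [->|_]; last by rewrite mul0r !mulr0.
  case: eqP => [->|_]; last by rewrite mul0r !mulr0.
  by rewrite addbb !mul1r.
- move=> cL [i l] [j m] [k n] s t r; rewrite !adj_nat mixed_spanE /=.
  case: eqP => [->|_]; last by rewrite !(mul0r, mulr0).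
  case: eqP => [->|_]; last by rewrite !(mul0r, mulr0).
  case: eqP => [->|_]; last by rewrite !(mul0r, mulr0).
  by rewrite addbb !mul1r.
Qed.

End Products.

Section Universal.
Variables (R : realType) (I : Type) (rel : forall A : cstarAlgType R, (I -> A) -> Prop).
Local Notation C := R[i].
Variables (A : cstarAlgType R) (v : I -> A).
Hypothesis univ : is_universal rel v.
Hypothesis rel_inj : forall (B D : cstarAlgType R) (f : B -> D) (w : I -> B),
  is_starhom f -> injective f -> rel (f \o w) -> rel w.

Lemma starhom_ext (B : cstarAlgType R) (f g : A -> B) : is_starhom f -> is_starhom g ->
  (forall i, f (v i) = g (v i)) -> forall a, f a = g a.
Proof.
move=> hf hg e; apply: (universal_gen_inj univ rel_inj).
- by rewrite (starhom1 hf) (starhom1 hg).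
- by move=> c a b ea eb; rewrite (starhomD hf) (starhomD hg) (starhomZ hf) (starhomZ hg) ea eb.
- by move=> a b ea eb; rewrite (starhomM hf) (starhomM hg) ea eb.
- by move=> a ea; rewrite (starhom_star hf) (starhom_star hg) ea.
- move=> u a hu ua; apply: (seq_lim_unique (starhom_lim hf ua)).
  by have := starhom_lim hg ua; congr seq_lim; apply/funext => n /=; rewrite hu.
- exact: e.
Qed.

(** It suffices to reach the generators: if [c g] is a sum of products [Phi a * r d] and [c x] is a
    limit of such sums, then so is [c g * c x], because [r d] moves past [c x]. *)
Lemma span_dense (D T : cstarAlgType R) (Phi c : A -> T) (r : D -> T) :
  is_starhom Phi -> is_starhom c -> is_starhom r ->
  (forall a d, c a * r d = r d * c a) ->
  dense (span2 (fun a d => c a * r d)) ->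
  (forall i s, span2 (fun a d => Phi a * r d) (c (adj s (v i)))) ->
  dense (span2 (fun a d => Phi a * r d)).
Proof.
move=> hP hc hr cr dcr gen.
pose S := span2 (fun a d => Phi a * r d).
pose E y := forall e : R, 0 < e -> exists y', S y' /\ nm (y - y') < e.
have SD (k : C) x y : S x -> S y -> S (k *: x + y).
  move=> [s ->] [t ->]; exists ([seq (k *: p.1, p.2) | p <- s] ++ t).
  rewrite big_cat big_map scaler_sumr; congr (_ + _); apply: eq_bigr => p _ /=.
  by rewrite (starhomZ hP) -scaleAl.
have Elin (k : C) x y : E x -> E y -> E (k *: x + y).
  move=> hx hy e e0; have e20 : 0 < e / 2 by rewrite divr_gt0.
  have k0 : 0 < cabs k + 1 by rewrite ltr_wpDl ?cabs_ge0.
  have [x' [Sx hx']] := hx _ (divr_gt0 e20 k0); have [y' [Sy hy']] := hy _ e20.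
  exists (k *: x' + y'); split; first exact: SD.
  rewrite opprD addrACA -scalerBr (le_lt_trans (nmD _ _)) // nmZ [ltRHS]splitr.
  rewrite ltr_leD ?(ltW hy') //; rewrite ltr_pdivlMr // mulrDr mulr1 in hx'.
  by rewrite mulrC (le_lt_trans _ hx') // lerDl nm_ge0.
have SE y : S y -> E y by move=> Sy e e0; exists y; rewrite subrr nm0.
have E0 : E 0 by apply: SE; exists [::]; rewrite big_nil.
have ED x y : E x -> E y -> E (x + y) by move=> hx hy; rewrite -[x]scale1r; exact: Elin.
have Esum (J : Type) (t : seq J) (F : J -> T) : (forall j, E (F j)) -> E (\sum_(j <- t) F j).
  by move=> hF; apply: (big_ind E).
have Emap (f : T -> T) : bounded_map f -> (forall y, S y -> S (f y)) -> forall y, E y -> E (f y).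
  move=> [fl [M [M0 hM]]] fS y hy e e0; have k0 : 0 < M + 1 by rewrite ltr_wpDl.
  have [y' [Sy hy']] := hy _ (divr_gt0 e0 k0); exists (f y'); split; first exact: fS.
  rewrite -(lfB fl) (le_lt_trans (hM _)) //; rewrite ltr_pdivlMr // mulrDr mulr1 in hy'.
  by rewrite mulrC (le_lt_trans _ hy') // lerDl nm_ge0.
have El a y : E y -> E (Phi a * y).
  apply: Emap; first exact: bounded_mull.
  move=> _ [s ->]; exists [seq (a * p.1, p.2) | p <- s]; rewrite big_map mulr_sumr.
  by apply: eq_bigr => p _; rewrite /= (starhomM hP) mulrA.
have Er d y : E y -> E (y * r d).
  apply: (Emap (fun y => y * r d)); first exact: bounded_mulr.
  move=> _ [s ->]; exists [seq (p.1, p.2 * d) | p <- s]; rewrite big_map mulr_suml.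
  by apply: eq_bigr => p _; rewrite /= (starhomM hr) mulrA.
have Ec a : E (c a).
  move: a; apply: (left_word_ind univ rel_inj).
  - apply: SE; exists [:: (1, 1)]; rewrite big_seq1 (starhom1 hP) (starhom1 hr) (starhom1 hc).
    by rewrite mulr1.
  - by move=> k a b ha hb; rewrite (starhomD hc) (starhomZ hc); exact: Elin.
  - move=> u a hu ua e e0; have e20 : 0 < e / 2 by rewrite divr_gt0.
    have [n0 h0] := starhom_lim hc ua e20; have {}h0 := h0 n0 (leqnn _).
    have [y' [Sy hy']] := hu n0 _ e20; exists y'; split=> //.
    rewrite (le_lt_trans (nm_tri (c (u n0)) _ _)) // [ltRHS]splitr ltrD // nmB; exact: h0.
  - move=> a i s ha; rewrite (starhomM hc); have [t ->] := gen i s.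
    rewrite mulr_suml; apply: Esum => p; rewrite -mulrA -cr mulrA.
    by apply: Er; exact: El.
apply/dense_nm => y e e0; have e20 : 0 < e / 2 by rewrite divr_gt0.
have /dense_nm/(_ y _ e20)[y1 [t ->] h1] := dcr.
have Et : E (\sum_(p <- t) c p.1 * r p.2) by apply: Esum => p; apply: Er; exact: Ec.
have [y' [Sy hy']] := Et _ e20; exists y' => //.
by rewrite (le_lt_trans (nm_tri (\sum_(p <- t) c p.1 * r p.2) _ _)) // [ltRHS]splitr ltrD.
Qed.

End Universal.

(** * Counit, comultiplication and action of the universal algebra *)

Section Construction.
Variables (R : realType) (ten : spatialTensor R) (K : scalars) (L : liberation) (N : nat).
Local Notation C := R[i].
Variables (U : cstarAlgType R) (u : 'I_N * 'I_N -> U).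
Hypothesis uU : is_universal (fun A => @qgroup_rel R A N K L) u.

Let u_ext (B : cstarAlgType R) (f g : U -> B) : is_starhom f -> is_starhom g ->
  (forall i j, f (u (i, j)) = g (u (i, j))) -> forall a, f a = g a.
Proof.
move=> hf hg e; apply: (starhom_ext uU _ hf hg) => [B0 D0 f0 w0 h1 h2|[i j]]; last exact: e.
exact: (qgroup_rel_inj h1 h2).
Qed.

Let urel := (qgroup_relP K L u).1 uU.1.

(** Universality with target the 1 by 1 matrices, which are the scalars as a C*-algebra. *)
Lemma counit_exists : exists eps : U -> C,
  is_character eps /\ forall i j, eps (u (i, j)) = (i == j)%:R.
Proof.
have [_ /(_ _ _ (qgroup_rel_unit N (mat R unit) K L))[f [[hf fu] _]]] := uU.
exists (fun a => entry (f a) tt tt); split; last first.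
  by move=> i j; rewrite fu /=; case: eqP => _; [rewrite entry1|rewrite (scf0 (entry_scalar _ _))].
have l := @entry_scalar R unit tt tt.
split; first by move=> c x y; rewrite (starhomD hf) (starhomZ hf) l.
  split=> [|x y]; first by rewrite (starhom1 hf) entry1.
  by rewrite (starhomM hf) entryM (bigD1 tt) //= big1 ?addr0 // => -[].
by move=> x; rewrite (starhom_star hf) entry_star.
Qed.

Lemma comult_exists : exists Delta : U -> ten U U, is_starhom Delta /\
  forall i j, Delta (u (i, j)) = \sum_k tprod ten (u (i, k)) (u (k, j)).
Proof.
have [_ /(_ _ _ (qgroup_rel_tprod ten uU.1 uU.1))[f [[hf fu] _]]] := uU.
by exists f; split=> // i j; rewrite fu.
Qed.

Variables (Delta : U -> ten U U) (eps : U -> C).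
Hypotheses (hD : is_starhom Delta) (he : is_character eps).
Hypothesis Du : forall i j, Delta (u (i, j)) = \sum_k tprod ten (u (i, k)) (u (k, j)).
Hypothesis eu : forall i j, eps (u (i, j)) = (i == j)%:R.

Section OneSided.
Variables (B : cstarAlgType R) (J : Type) (v : J -> B) (rel : forall A : cstarAlgType R, (J -> A) -> Prop).
Hypothesis vU : is_universal rel v.
Hypothesis rel_inj : forall (B D : cstarAlgType R) (f : B -> D) (w : J -> B),
  is_starhom f -> injective f -> rel (f \o w) -> rel w.
Variables (Phi : B -> ten U B) (row : 'I_N -> J -> J) (idx : J -> 'I_N).
Hypothesis hP : is_starhom Phi.
Hypothesis Phiv : forall i j, Phi (v (row i j)) = \sum_k tprod ten (u (i, k)) (v (row k j)).
Hypothesis rowK : forall j, row (idx j) j = j.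

(** [Delta] and the action are treated together: in the first case [J] consists of pairs and [row i]
    replaces the row index, in the second [J] is ['I_N] and [row i j] is [i]. *)
Lemma coaction_coassoc x : tmap id Phi (Phi x) = tassoc (tmap Delta id (Phi x)).
Proof.
have [h1 e1] := tmapP ten (starhom_id U) hP; have [h2 e2] := tmapP ten hD (starhom_id B).
have [h3 e3] := tassocP ten U U B.
apply: (starhom_ext vU rel_inj (starhom_comp hP h1)
  (starhom_comp hP (starhom_comp h2 h3))) => j /=.
rewrite -(rowK j) !Phiv (starhom_sum h1) (starhom_sum h2) (starhom_sum h3).
rewrite (eq_bigr (fun k => \sum_l tprod ten (u (idx j, k)) (tprod ten (u (k, l)) (v (row l j))))).
  rewrite exchange_big; apply: eq_bigr => l _.
  rewrite e2 Du tprod_suml (starhom_sum h3); apply: eq_bigr => k _; by rewrite e3.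
by move=> k _; rewrite e1 Phiv tprod_sumr.
Qed.

Lemma coaction_counit x : tlift (scalar_map B eps) id (Phi x) = x.
Proof.
have [h1 e1] := tlift_epsl ten B he.
apply: (starhom_ext vU rel_inj (starhom_comp hP h1) (starhom_id B)) => j /=.
rewrite -{1}(rowK j) Phiv (starhom_sum h1) (bigD1 (idx j)) //= e1 eu eqxx scale1r rowK.
rewrite big1 ?addr0 // => k; rewrite eq_sym => /negPf kj; by rewrite e1 eu kj scale0r.
Qed.

(** Unitarity of the columns of [u] recovers [1 (x) v_j] as a sum of products of [Phi v] with
    [u^* (x) 1]. *)
Lemma coaction_dense : dense (span2 (fun (x : B) (a : U) => Phi x * tprod ten a 1)).
Proof.
have -> : (fun (x : B) (a : U) => Phi x * tprod ten a 1) = (fun x a => Phi x * tinl ten B a).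
  by apply/funext => x; apply/funext => a; rewrite tprod1l.
apply: (span_dense vU rel_inj hP (tinr_hom ten U B) (tinl_hom ten U B)).
- by move=> b a; rewrite (spatial_comm (tensP ten U B)).
- have := spatial_dense (tensP ten U B).
  move=> /dense_nm h; apply/dense_nm => y e e0; have [_ [s ->] hs] := h y e e0.
  exists (\sum_(p <- s) tinl ten B p.1 * tinr ten U p.2) => //.
  exists [seq (p.2, p.1) | p <- s]; rewrite big_map; apply: eq_bigr => p _ /=.
  by rewrite (spatial_comm (tensP ten U B)).
- move=> j s; have [_ [g2 _] _ _] := urel.
  exists [seq (adj s (v (row i j)), adj (~~ s) (u (i, idx j))) | i <- index_enum 'I_N].
  rewrite big_map /=.
  have e i : Phi (adj s (v (row i j))) * tinl ten B (adj (~~ s) (u (i, idx j))) =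
      \sum_k tprod ten (adj s (u (i, k)) * adj (~~ s) (u (i, idx j))) (adj s (v (row k j))).
    rewrite (starhom_adj _ _ hP) Phiv -[\sum_k _]/(tcontract ten _ _) adj_tcontract mulr_suml.
    by apply: eq_bigr => k _; rewrite -tprod1l tprodM mulr1.
  under eq_bigr do rewrite e.
  rewrite exchange_big (bigD1 (idx j)) //= [X in _ + X]big1 ?addr0.
    by rewrite -tprod_suml g2 eqxx tprod1r rowK.
  by move=> k /negPf kj; rewrite -tprod_suml g2 kj tprod0l.
Qed.

End OneSided.

Lemma comult_cancelr : dense (span2 (fun x a : U => Delta x * tprod ten 1 a)).
Proof.
have -> : (fun x a : U => Delta x * tprod ten 1 a) = (fun x a => Delta x * tinr ten U a).
  by apply/funext => x; apply/funext => a; rewrite tprod1r.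
apply: (span_dense uU _ hD (tinl_hom ten U U) (tinr_hom ten U U)).
- by move=> B0 D0 f0 w0 h1 h2; exact: (qgroup_rel_inj h1 h2).
- by move=> b a; rewrite (spatial_comm (tensP ten U U)).
- exact: (spatial_dense (tensP ten U U)).
- move=> [i j] s; have [_ [_ g2] _ _] := urel.
  exists [seq (adj s (u (i, k)), adj (~~ s) (u (j, k))) | k <- index_enum 'I_N].
  rewrite big_map /=.
  have e k : Delta (adj s (u (i, k))) * tinr ten U (adj (~~ s) (u (j, k))) =
      \sum_l tprod ten (adj s (u (i, l))) (adj s (u (l, k)) * adj (~~ s) (u (j, k))).
    rewrite (starhom_adj _ _ hD) Du -[\sum_k _]/(tcontract ten _ _) adj_tcontract mulr_suml.
    by apply: eq_bigr => l _; rewrite -tprod1r tprodM mulr1.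
  under eq_bigr do rewrite e.
  rewrite exchange_big (bigD1 j) //= [X in _ + X]big1 ?addr0.
    by rewrite -tprod_sumr g2 eqxx tprod1l.
  by move=> l /negPf lj; rewrite -tprod_sumr g2 lj tprod0r.
Qed.

Lemma universal_cqg : is_cqg Delta eps.
Proof.
have inj (B D : cstarAlgType R) (f : B -> D) (w : 'I_N * 'I_N -> B) :
    is_starhom f -> injective f -> qgroup_rel K L (f \o w) -> qgroup_rel K L w.
  by move=> h1 h2; exact: (qgroup_rel_inj h1 h2).
pose row (i : 'I_N) (p : 'I_N * 'I_N) := (i, p.2).
have rowK p : row p.1 p = p by case: p.
have Drow i p : Delta (u (row i p)) = \sum_k tprod ten (u (i, k)) (u (row k p)) by exact: Du.
split=> //.
- exact: (coaction_coassoc uU inj hD Drow rowK).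
- exact: (coaction_counit uU inj hD Drow rowK).
- have [h1 e1] := tlift_epsr ten U he.
  move=> a; apply: (u_ext (starhom_comp hD h1) (starhom_id U)) => i j /=.
  rewrite Du (starhom_sum h1) (bigD1 j) //= e1 eu eqxx scale1r.
  by rewrite big1 ?addr0 // => k /negPf kj; rewrite e1 eu kj scale0r.
- exact: (coaction_dense uU inj hD Drow rowK).
- exact: comult_cancelr.
Qed.

Variables (X : cstarAlgType R) (z : 'I_N -> X).
Hypothesis zU : is_universal (fun A => @sphere_rel R A N K L) z.

Lemma universal_action : exists Phi : X -> ten U X,
  is_action Delta eps Phi /\ forall i, Phi (z i) = \sum_j tprod ten (u (i, j)) (z j).
Proof.
have inj (B D : cstarAlgType R) (f : B -> D) (w : 'I_N -> B) :
    is_starhom f -> injective f -> sphere_rel K L (f \o w) -> sphere_rel K L w.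
  by move=> h1 h2; exact: (sphere_rel_inj h1 h2).
have [_ /(_ _ _ (sphere_rel_tprod ten uU.1 zU.1))[Phi [[hP Pz] _]]] := zU.
exists Phi; split; last by move=> i; rewrite Pz.
pose row (i : 'I_N) (j : 'I_N) := i.
have rowK j : row j j = j by [].
have Prow i j : Phi (z (row i j)) = \sum_k tprod ten (u (i, k)) (z (row k j)) by exact: Pz.
split=> //.
- exact: (coaction_coassoc zU inj hP Prow rowK).
- exact: (coaction_counit zU inj hP Prow rowK).
- exact: (coaction_dense zU inj hP Prow rowK).
Qed.

Variables (A : cstarAlgType R) (DeltaA : A -> ten A A) (epsA : A -> C).
Variables (Psi : X -> ten A X) (w : 'I_N -> 'I_N -> A).
Hypotheses (hA : is_cqg DeltaA epsA) (hPsi : is_action DeltaA epsA Psi).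
Hypothesis Psiz : forall i, Psi (z i) = \sum_j tprod ten (w i j) (z j).

(** The real quadratic spheres are those where the relevant monomials of degree two are dependent,
    so they alone go through the Haar state. *)
Lemma action_biunitary : biunitary w.
Proof.
have hP := action_hom hPsi.
have [hKL|hKL] := boolP ((if K is ComplexCase then true else false) || ~~ quadratic L).
  apply: (coef_biunitary zU hP Psiz).
  by case: (K) hKL => /= hKL; [right|left].
move: hKL; rewrite negb_or negbK => /andP[hK qL].
have eK : K = RealCase by case: (K) hK.
have [h [sh hW hQ]] := coefmx_haar zU hA hPsi Psiz.
move: zU; rewrite eK => zU'; apply: (biunitary_of_rows zU' hP Psiz).
have [eL|eL] : L = Classical \/ L = Twisted by case: (L) qL; [left| | | |right].
  exact: (classical_rows zU' qL hP Psiz sh eL hW hQ).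
move: zU'; rewrite eL => zU''.
exact: (twisted_rows zU'' hP Psiz sh hW hQ (action_dense hPsi)).
Qed.

Lemma universal_morphism : exists f : U -> A, [/\ is_starhom f,
  forall i j, f (u (i, j)) = w i j & forall x, tmap f f (Delta x) = DeltaA (f x)].
Proof.
have rw := coef_relations zU (action_hom hPsi) Psiz action_biunitary.
have [_ /(_ _ _ rw)[f [[hf fu] _]]] := uU.
exists f; split=> //.
have [hm em] := tmapP ten hf hf.
apply: (u_ext (starhom_comp hD hm) (starhom_comp hf (cqg_hom hA))) => i j /=.
rewrite Du (starhom_sum hm) fu /= (coef_comult zU hA hPsi Psiz); apply: eq_bigr => k _.
by rewrite em !fu.
Qed.

End Construction.

Theorem theorem5p7 (R : realType) (ten : spatialTensor R)
    (K : scalars) (L : liberation) (N : nat)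
    (U : cstarAlgType R) (u : 'I_N * 'I_N -> U)
    (X : cstarAlgType R) (z : 'I_N -> X)
    (u_universal : is_universal (fun A => @qgroup_rel R A N K L) u)
    (z_universal : is_universal (fun A => @sphere_rel R A N K L) z) :
  exists (Delta : U -> ten U U) (eps : U -> R[i]),
    [/\ is_cqg Delta eps,
        forall i j, Delta (u (i, j)) = \sum_k tprod ten (u (i, k)) (u (k, j)),
        forall i j, eps (u (i, j)) = (i == j)%:R,
        exists Phi : X -> ten U X,
          is_action Delta eps Phi /\
          forall i, Phi (z i) = \sum_j tprod ten (u (i, j)) (z j) &
        forall (A : cstarAlgType R) (DeltaA : A -> ten A A) (epsA : A -> R[i])
               (Psi : X -> ten A X) (w : 'I_N -> 'I_N -> A),
          is_cqg DeltaA epsA -> is_action DeltaA epsA Psi ->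
          (forall i, Psi (z i) = \sum_j tprod ten (w i j) (z j)) ->
          exists f : U -> A,
            [/\ is_starhom f,
                forall i j, f (u (i, j)) = w i j &
                forall x, tmap f f (Delta x) = DeltaA (f x)]].
Proof.
have [eps [he eu]] := counit_exists u_universal.
have [Delta [hD Du]] := comult_exists ten u_universal.
exists Delta, eps; split=> //.
- exact: (universal_cqg u_universal hD he Du eu).
- exact: (universal_action u_universal hD he Du eu z_universal).
- move=> A DeltaA epsA Psi w hA hPsi Psiz.
  exact: (universal_morphism u_universal hD Du z_universal hA hPsi Psiz).
Qed.
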